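(* Let $k,t\ge 0$ be fixed constants. There is an algorithm that, given a CNF formula $F$, runs in time $O(|F|^3)$ (the constant hidden in the $O$ may depend on $k$ and $t$) and either computes the number of satisfying assignments of $F$ (i.e. the number of $\tau:{\rm var}(F)\to\{0,1\}$ such that $F[\tau]$ has no clauses), or correctly concludes that $\mathrm{sb}_t(F)>k$.
   Context: CNF formulas contain no clause with a complementary pair of literals. For a clause $c$, ${\rm lit}(c)$ and ${\rm var}(c)$ are its sets of literals and variables; ${\rm cla}(F)$, ${\rm var}(F)$ are the clauses and variables of $F$. The size of $F$ is $|F|=|{\rm var}(F)|+\sum_{c\in{\rm cla}(F)}(1+|{\rm lit}(c)|)$. For $X\subseteq{\rm var}(F)$ and a truth assignment $\tau:X\to\{0,1\}$ (extended to literals by $\tau(\neg x)=1-\tau(x)$), $F[\tau]$ is obtained from $F$ by removing every clause containing a literal set to $1$ by $\tau$ and removing the literals set to $0$ from the remaining clauses. The incidence graph ${\rm inc}(F)$ is the bipartite graph on vertex set ${\rm var}(F)\cup{\rm cla}(F)$ in which variable $x$ is adjacent to clause $c$ iff $x\in{\rm var}(c)$. $\mathcal{W}_{\le t}$ is the class of CNF formulas whose incidence graph has treewidth at most $t$. A set $B\subseteq{\rm var}(F)$ is a strong $\mathcal{W}_{\le t}$-backdoor set of $F$ if $F[\tau]\in\mathcal{W}_{\le t}$ for every $\tau:B\to\{0,1\}$. $\mathrm{sb}_t(F)$ denotes the size of a smallest strong $\mathcal{W}_{\le t}$-backdoor set of $F$. *)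

(* Defs.v *)
From HB Require Import structures.
From mathcomp Require Import all_boot all_order.
From mathcomp Require Import finmap.
From mathcomp Require Import boolp.

Set Implicit Arguments.
Unset Strict Implicit.
Unset Printing Implicit Defensive.

Local Open Scope fset_scope.

(** * CNF formulas *)

(* [(x, true)] is the literal x and [(x, false)] its negation. *)
Notation literal := (nat * bool)%type.
Notation clause := {fset literal}.
Notation formula := {fset clause}.

Definition is_cnf (F : formula) : Prop :=
  forall c x, c \in F -> ~ ((x, true) \in c /\ (x, false) \in c).

Definition cvar (c : clause) : {fset nat} := [fset l.1 | l in c].
Definition fvar (F : formula) : {fset nat} := \bigcup_(c <- F) cvar c.

Definition fsize (F : formula) : nat :=
  #|` fvar F| + \sum_(c <- F) (1 + #|` c|).

(* [None] when the variable of [l] is outside the domain of [tau]. *)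
Definition lit_val (X : {fset nat}) (tau : {ffun X -> bool}) (l : literal) :
    option bool :=
  omap (fun x : X => if l.2 then tau x else ~~ tau x) (insub l.1).

Definition satisfied (X : {fset nat}) (tau : {ffun X -> bool}) (c : clause) :
    bool :=
  [exists l : c, lit_val tau (val l) == Some true].

Definition reduce_clause (X : {fset nat}) (tau : {ffun X -> bool})
    (c : clause) : clause :=
  [fset l in c | lit_val tau l != Some false].

Definition reduct (F : formula) (X : {fset nat}) (tau : {ffun X -> bool}) :
    formula :=
  [fset reduce_clause tau c | c in F & ~~ satisfied tau c].

Definition num_models (F : formula) : nat :=
  #|[set tau : {ffun fvar F -> bool} | reduct F tau == fset0]|.

(** * Treewidth *)

Definition is_tree (T : finType) (e : rel T) : Prop :=
  [/\ symmetric e, irreflexive e, 0 < #|T|,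
      forall i j : T, connect e i j
    & forall p : seq T, ucycle e p -> size p < 3].

Record tree_decomposition (V : finType) (g : rel V) (T : finType) (e : rel T)
    (bag : T -> {set V}) : Prop := TreeDecomposition {
  td_tree : is_tree e;
  td_vertex : forall v : V, exists i, v \in bag i;
  td_edge : forall u v : V, g u v -> exists i, (u \in bag i) && (v \in bag i);
  td_connected : forall (v : V) (i j : T), v \in bag i -> v \in bag j ->
    connect [rel a b | [&& e a b, v \in bag a & v \in bag b]] i j
}.

(* The subtraction is truncated: the graph with no vertex has treewidth 0. *)
Definition td_width (V T : finType) (bag : T -> {set V}) : nat :=
  (\max_(i : T) #|bag i|).-1.

Definition has_td_of_width (V : finType) (g : rel V) (w : nat) : Prop :=
  exists (T : finType) (e : rel T) (bag : T -> {set V}),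
    tree_decomposition g e bag /\ td_width bag = w.

Lemma has_td_trivial (V : finType) (g : rel V) : has_td_of_width g #|V|.-1.
Proof.
exists unit, [rel _ _ | false], (fun=> setT); split; last first.
  by rewrite /td_width (big_pred1 tt) ?cardsT // => -[].
split.
- split=> //; first by rewrite card_unit.
  + by move=> [] []; exact: connect0.
  + move=> p /andP [_ /card_uniqP <-].
    by apply: leq_ltn_trans (max_card _) _; rewrite card_unit.
- by move=> v; exists tt; rewrite inE.
- by move=> u v _; exists tt; rewrite !inE.
- by move=> v [] [] _ _; exact: connect0.
Qed.

Lemma has_td_ex (V : finType) (g : rel V) :
  exists w, `[< has_td_of_width g w >].
Proof. by exists #|V|.-1; apply/asboolP; exact: has_td_trivial. Qed.

Definition treewidth (V : finType) (g : rel V) : nat := ex_minn (has_td_ex g).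

Definition inc (F : formula) : rel (fvar F + F)%type :=
  fun u v => match u, v with
    | inl x, inr c | inr c, inl x => val x \in cvar (val c)
    | _, _ => false
    end.

Definition in_W (t : nat) (F : formula) : Prop := treewidth (@inc F) <= t.

(** * Strong backdoor sets *)

Definition strong_backdoor (t : nat) (F : formula) (B : {fset nat}) : Prop :=
  B `<=` fvar F /\ forall tau : {ffun B -> bool}, in_W t (reduct F tau).

Lemma reduct_total (F : formula) (tau : {ffun fvar F -> bool}) c :
  c \in reduct F tau -> c = fset0.
Proof.
case/imfsetP=> /= d; rewrite inE => /andP [dF /existsPn dN] ->.
apply/eqP; rewrite -fsubset0; apply/fsubsetP=> l; rewrite !inE /=.
case/andP=> ld; have := dN [` ld]; rewrite /lit_val.
have lF : l.1 \in fvar F.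
  by apply/bigfcupP; exists d; rewrite ?dF //; apply/imfsetP; exists l.
by rewrite insubT /=; case: (if _ then _ else _).
Qed.

Lemma strong_backdoor_fvar t F : strong_backdoor t F (fvar F).
Proof.
split=> [//|tau]; rewrite /in_W /treewidth; case: ex_minnP => w _ minw.
apply: leq_trans (minw _ (asboolT (has_td_trivial _))) _.
suff : #|{: fvar (reduct F tau) + reduct F tau}| <= 1 by case: #|_| => [|[]].
rewrite card_sum -!cardfE.
have -> : fvar (reduct F tau) = fset0.
  apply/eqP; rewrite -fsubset0; apply/fsubsetP => x /bigfcupP [c].
  rewrite andbT => /reduct_total -> /imfsetP [l /=].
  by rewrite inE.
rewrite cardfs0 add0n -(cardfs1 (fset0 : clause)); apply: fsubset_leq_card.
by apply/fsubsetP=> c /reduct_total ->; rewrite inE.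
Qed.

Lemma strong_backdoor_ex t F :
  exists s, `[< exists2 B, strong_backdoor t F B & #|` B| = s >].
Proof.
exists #|` fvar F|; apply/asboolP; exists (fvar F) => //.
exact: strong_backdoor_fvar.
Qed.

Definition sb (t : nat) (F : formula) : nat := ex_minn (strong_backdoor_ex t F).

(** * Word RAM *)

Variant binop := Add | Sub | Mul | Div.

Definition eval_binop (o : binop) : nat -> nat -> nat :=
  match o with Add => addn | Sub => subn | Mul => muln | Div => divn end.

(* Registers and program positions are named by fixed numbers. *)
Variant instr :=
  | Const (r v : nat)               (* R[r] := v          *)
  | Binop (o : binop) (r a b : nat) (* R[r] := R[a] o R[b] *)
  | Read (r a : nat)                (* R[r] := M[R[a]]    *)
  | Write (a r : nat)               (* M[R[a]] := R[r]    *)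
  | JumpZ (r l : nat)               (* if R[r] = 0 goto l *)
  | Halt.

Definition program := seq instr.

Record config := Config { pc : nat; reg : nat -> nat; mem : nat -> nat }.

Definition upd (f : nat -> nat) (i v : nat) : nat -> nat :=
  fun j => if j == i then v else f j.

(* Falling off the end of the program halts. *)
Definition current (P : program) (s : config) : instr := nth Halt P (pc s).

Definition halted (P : program) (s : config) : Prop := current P s = Halt.

(* A word holds a number smaller than [W]; a value that does not fit blocks the
   machine, as does a step from a halted configuration. *)
Definition step (W : nat) (P : program) (s : config) : option config :=
  let: Config p R M := s in
  let set_reg r v :=
    if v < W then Some (Config p.+1 (upd R r v) M) else None in
  match current P s with
  | Const r v => set_reg r v
  | Binop o r a b => set_reg r (eval_binop o (R a) (R b))
  | Read r a => set_reg r (M (R a))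
  | Write a r => Some (Config p.+1 R (upd M (R a) (R r)))
  | JumpZ r l => Some (Config (if R r == 0 then l else p.+1) R M)
  | Halt => None
  end.

Definition init (input : seq nat) : config :=
  Config 0 (fun=> 0) (nth 0 input).

(* [R[0] = 0] is the answer "no number"; [R[0] = 1] announces the number whose
   [R[1]] binary digits are in memory from address 0, least significant first. *)
Definition output (s : config) (a : option nat) : Prop :=
  match a with
  | None => reg s 0 = 0
  | Some N => [/\ reg s 0 = 1, forall i, i < reg s 1 -> mem s i < 2
                & N = \sum_(i < reg s 1) mem s i * 2 ^ i]
  end.

(* On [input], with words smaller than [W], [P] halts within [T] steps and
   outputs [a]. *)
Definition computes (P : program) (W T : nat) (input : seq nat)
    (a : option nat) : Prop :=
  exists n s, [/\ n <= T,
    iter n (obind (step W P)) (Some (init input)) = Some s,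
    halted P s & output s a].

(** * Formulas as machine inputs *)

(* [L] lists each clause of [F] once and each literal of a clause once, in an
   arbitrary order. *)
Definition listing (F : formula) (L : seq (seq literal)) : bool :=
  all uniq L && perm_eq [seq [fset l in c] | c <- L] (enum_fset F).

Definition encode_literal (l : literal) : nat := l.1.*2 + l.2.

Definition encode (L : seq (seq literal)) : seq nat :=
  size L :: flatten [seq size c :: map encode_literal c | c <- L].

(* Words of O(log(|F| + m)) bits, m the largest variable name: enough to hold
   a variable name or a number polynomial in |F|. *)
Definition word_bound (C : nat) (F : formula) : nat :=
  C * (fsize F + \max_(x <- fvar F) x + 1) ^ C.

(* O(|F|^3); the added 1 matters only for the formula without clauses, the
   only one of size 0. *)
Definition cubic_bound (C : nat) (F : formula) : nat := C * (fsize F ^ 3 + 1).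

(* Main.v *)
(**
  A structure like a tree decomposition of the incidence graph is computed by
  inserting the literal occurrences one at a time: an elimination order of
  bounded width together with a colouring that names the members of each bag
  by a bounded number of colours.  After each insertion the structure is
  rebuilt with bounded width by solving bounded-size monadic second-order
  queries along the old structure (type-table dynamic programming), which cost
  linear time each; a rebuild takes quadratic time and the whole construction
  cubic time.  If a rebuild fails, it leaves a vertex whose surrounding
  component has too many boundary vertices to be separated by a small
  backdoor.  Any strong backdoor of size at most [k] then meets the union of
  boundedly many sets that are again found by queries, so branching on the
  boundedly many variables in that union, with depth at most [k], either
  reaches formulas of bounded width, whose models are counted by the same
  dynamic programming with the numbers written in binary modulo [2 ^ N], or
  shows that no small backdoor exists.
*)
Require Import Defs.
From mathcomp Require Import all_boot all_order finmap boolp zify.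

Set Implicit Arguments.
Unset Strict Implicit.
Unset Printing Implicit Defensive.

(** * A loop language on top of the word RAM *)

(** Candidate backdoors are tested only for two consequences of bounded width: after every
    assignment the boundary of the failing component has a small balanced separator, and every small
    set [X] of variables has a small separator leaving components that touch few of its members.
    Both can be queried, and true backdoors pass. Sets that pass without being backdoors do no harm:
    models are counted only along a structure of bounded width. The point of the test is that
    [2 * w + 2] pairwise disjoint sets that pass would combine to a bounded separator of the
    unreduced graph, which the failed rebuild rules out; hence greedily collected disjoint sets meet
    every hidden backdoor. The width is [w = 2 ^ k * (t + 1)], not [t]: an assignment can make up to
    [2 ^ k] clauses equal, while their cells in the input stay distinct. Running time is controlled
    by a loop language in which every loop has the input length as its bound, so the exponent 3 is a
    nesting depth. Words stay polynomial because each store exceeds the earlier values by at most a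
    constant; the counts themselves are kept as arrays of binary digits. *)

Definition aid := (nat * nat * nat)%type.

Inductive expr :=
 | Num (k : nat)
 | Var (x : nat)
 | Arr (a : aid) (e : expr)
 | In (e : expr)
 | Size
 | Bin (o : binop) (e1 e2 : expr).

(* Every loop runs from 0 to n - 1 where n is the length of the input, so the
 running time of a program is a polynomial read off its nesting depth. *)
Inductive com :=
 | Skip
 | Assign (x : nat) (e : expr)
 | Store (a : aid) (e1 e2 : expr)
 | Out (e1 e2 : expr)
 | Seq (c1 c2 : com)
 | If (e : expr) (c1 c2 : com)
 | Loop (x : nat) (c : com).

Record store := Mk { var : nat -> nat; arr : aid -> nat -> nat; inp : nat -> nat }.

Definition setv s x v := Mk (upd (var s) x v) (arr s) (inp s).
Definition seta s a i v :=
 Mk (var s) (fun b => if b == a then upd (arr s a) i v else arr s b) (inp s).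
Definition seti s i v := Mk (var s) (arr s) (upd (inp s) i v).

(** In the compiled memory the arrays start at address [n]; a read of the input region beyond [n] is
    therefore cut off and gives 0. *)
Fixpoint eval n s e :=
 match e with
 | Num k => k
 | Var x => var s x
 | Arr a e => arr s a (eval n s e)
 | In e => if eval n s e < n then inp s (eval n s e) else 0
 | Size => n
 | Bin o e1 e2 => eval_binop o (eval n s e1) (eval n s e2)
 end.

Fixpoint run n c s :=
 match c with
 | Skip => s
 | Assign x e => setv s x (eval n s e)
 | Store a e1 e2 => seta s a (eval n s e1) (eval n s e2)
 | Out e1 e2 =>
 if eval n s e1 < n then seti s (eval n s e1) (eval n s e2) else s
 | Seq c1 c2 => run n c2 (run n c1 s)
 | If e c1 c2 => if eval n s e != 0 then run n c1 s else run n c2 s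
 | Loop x c => iteri n (fun i s => run n c (setv s x i)) s
 end.

(** * Bounds on time and on stored values, read off the syntax *)

Fixpoint ecost e :=
 match e with
 | Num _ => 1
 | Var _ | Size => 2
 | Arr _ e => ecost e + 6
 | In e => ecost e + 6
 | Bin _ e1 e2 => ecost e1 + ecost e2 + 1
 end.

(** Both branches of a conditional are charged, which keeps the cost a function of [n] alone. *)
Fixpoint cost n c :=
 match c with
 | Skip => 0
 | Assign _ e => ecost e + 2
 | Store _ e1 e2 => ecost e1 + ecost e2 + 6
 | Out e1 e2 => ecost e1 + ecost e2 + 3
 | Seq c1 c2 => cost n c1 + cost n c2
 | If e c1 c2 => ecost e + cost n c1 + cost n c2 + 3
 | Loop _ c => n * (cost n c + 8) + 3
 end.

Fixpoint depth c :=
 match c with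
 | Seq c1 c2 | If _ c1 c2 => maxn (depth c1) (depth c2)
 | Loop _ c => (depth c).+1
 | _ => 0
 end.

(* A tame expression exceeds the largest stored value by at most a constant. *)
Fixpoint tame e :=
 match e with
 | Bin Add e (Num _) | Bin Defs.Sub e _ | Bin Div e _ => tame e
 | Bin _ _ _ => false
 | _ => true
 end.

Fixpoint excess e :=
 match e with
 | Num k => k
 | Bin Add e (Num k) => excess e + k
 | Bin _ e _ => excess e
 | _ => 0
 end.

Fixpoint growth n c :=
 match c with
 | Assign _ e | Store _ _ e | Out _ e => excess e
 | Seq c1 c2 | If _ c1 c2 => growth n c1 + growth n c2
 | Loop _ c => n * growth n c
 | _ => 0
 end.

Fixpoint wf c :=
 match c with
 | Assign _ e | Store _ _ e | Out _ e => tame e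
 | Seq c1 c2 | If _ c1 c2 => wf c1 && wf c2
 | Loop _ c => wf c
 | _ => true
 end.

Fixpoint earrays e : seq aid :=
 match e with
 | Arr a e => a :: earrays e
 | In e => earrays e
 | Bin _ e1 e2 => earrays e1 ++ earrays e2
 | _ => [::]
 end.

Fixpoint arrays c : seq aid :=
 match c with
 | Assign _ e => earrays e
 | Store a e1 e2 => a :: earrays e1 ++ earrays e2
 | Out e1 e2 => earrays e1 ++ earrays e2
 | Seq c1 c2 => arrays c1 ++ arrays c2
 | If e c1 c2 => earrays e ++ arrays c1 ++ arrays c2
 | Loop _ c => arrays c
 | _ => [::]
 end.

Definition bounded V s :=
 [/\ forall x, var s x <= V, forall a i, arr s a i <= V
 & forall i, inp s i <= V].

Lemma boundedW V V' s : V <= V' -> bounded V s -> bounded V' s.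
Proof. by move=> le [bv ba bi]; split=> *; apply: leq_trans le. Qed.

Lemma tame_bound n V s e : bounded V s -> n <= V -> tame e ->
 eval n s e <= V + excess e.
Proof.
move=> [bv ba bi] nV; elim: e => [k|x|a e IH|e IH||o e1 IH1 e2 IH2] /=.
- lia.
- by rewrite addn0.
- by rewrite addn0.
- by rewrite addn0; case: ifP.
- by rewrite addn0.
- case: o => //=; case: e2 IH2 => //=.
 all: try by move=> *; apply: leq_trans (leq_subr _ _) (IH1 _).
 all: try by move=> *; apply: leq_trans (leq_div _ _) (IH1 _).
 by move=> k _ /IH1; lia.
Qed.

Lemma run_loop n x c s (I : nat -> store -> Prop) :
 I 0 s -> (forall i s, i < n -> I i s -> I i.+1 (run n c (setv s x i))) ->
 I n (run n (Loop x c) s).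
Proof.
move=> I0 IS /=.
have H : forall m, m <= n -> I m (iteri m (fun i s => run n c (setv s x i)) s).
 elim=> [//|m IH] lt; rewrite /=; apply: IS => //; apply: IH; exact: ltnW.
exact: H.
Qed.

(** A single store raises the largest value by at most a constant, so polynomially many steps keep
    all stored words polynomial. This is what prevents the machine from blocking on a value that
    does not fit. *)
Lemma run_bounded n V s c : bounded V s -> n <= V -> wf c ->
 bounded (V + growth n c) (run n c s).
Proof.
elim: c s V => [|x e|a e1 e2|e1 e2|c1 IH1 c2 IH2|e c1 IH1 c2 IH2|x c IH] s V bs nV /=.
- by rewrite addn0.
- move=> te; have le := tame_bound bs nV te; have [bv ba bi] := boundedW (leq_addr (excess e) V) bs.
 by split=> //= y; rewrite /upd; case: ifP.
- move=> te; have le := tame_bound bs nV te; have [bv ba bi] := boundedW (leq_addr (excess e2) V) bs.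
 by split=> //= b i; case: ifP => // _; rewrite /upd; case: ifP.
- move=> te; have le := tame_bound bs nV te; have [bv ba bi] := boundedW (leq_addr (excess e2) V) bs.
 by case: ifP => // _; split=> //= i; rewrite /upd; case: ifP.
- case/andP=> w1 w2; rewrite addnA; apply: IH2 => //; last by lia.
 exact: IH1.
- case/andP=> w1 w2; case: ifP => _.
 + by apply: boundedW (IH1 _ _ bs nV w1); lia.
 + by apply: boundedW (IH2 _ _ bs nV w2); lia.
- move=> wc.
 apply: (@run_loop n x c s (fun i s => bounded (V + i * growth n c) s)).
 by rewrite addn0.
 move=> i s' lt bs'; rewrite mulSn addnCA addnC.
 apply: IH => //; last by lia.
 by case: bs' => bv ba bi; split=> //= y; rewrite /upd; case: ifP => // _; lia.
Qed.

(* Bounds every word that occurs while [e] is evaluated with K arrays and all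
 stored values at most V. *)
Fixpoint ewords K V e :=
 match e with
 | Num k => k
 | Var _ | Size => V
 | Arr _ e => ewords K V e * K + ewords K V e + K + K + V
 | In e => ewords K V e + V + 1
 | Bin _ e1 e2 => ewords K V e1 * ewords K V e2 + ewords K V e1 + ewords K V e2
 end.

Fixpoint cwords K V c :=
 match c with
 | Skip => 0
 | Assign _ e => ewords K V e
 | Store _ e1 e2 =>
 ewords K V e1 * K + ewords K V e1 + K + K + V + ewords K V e2
 | Out e1 e2 => ewords K V e1 + ewords K V e2 + V + 1
 | Seq c1 c2 => cwords K V c1 + cwords K V c2
 | If e c1 c2 => ewords K V e + cwords K V c1 + cwords K V c2
 | Loop _ c => cwords K V c + V + 1
 end.

Lemma eval_elim K V n s e : bounded V s -> n <= V -> eval n s e <= ewords K V e.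
Proof.
move=> [bv ba bi] nV; elim: e => [k|x|a e IH|e IH||o e1 IH1 e2 IH2] //=.
- by apply: leq_trans (ba _ _) _; lia.
- by case: ifP => // _; apply: leq_trans (bi _) _; lia.
- case: o => /=.
 + lia.
 + lia.
 + by apply: leq_trans (leq_mul IH1 IH2) _; lia.
 + by apply: leq_trans (leq_div _ _) _; lia.
Qed.

(* Registers 0 and 1 hold the answer and register 2 the input length; the
 variables sit in the even registers from 4 on, temporaries in the odd ones. *)
Definition vr x := x.*2 + 4.
Definition tr d := d.*2 + 5.

(** * Compilation to the word RAM and its correctness *)

Section Compiler.
Variable al : seq aid.
Let K := size al.

(** A read of the input is executed even if its address [v] leaves the input region. The fetched
    word is then multiplied by [1 - (1 - (n - v))], the truth value of [v < n], so expressions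
    compile without jumps. *)
Fixpoint ecomp e d : program :=
 match e with
 | Num k => [:: Const (tr d) k]
 | Var x => [:: Const (tr d) 0; Binop Add (tr d) (vr x) (tr d)]
 | Size => [:: Const (tr d) 0; Binop Add (tr d) 2 (tr d)]
 | Arr a e => ecomp e d ++
 [:: Const (tr d.+1) K; Binop Mul (tr d) (tr d) (tr d.+1);
 Const (tr d.+1) (index a al); Binop Add (tr d) (tr d) (tr d.+1);
 Binop Add (tr d) (tr d) 2; Read (tr d) (tr d)]
 | In e => ecomp e d ++
 [:: Binop Defs.Sub (tr d.+1) 2 (tr d); Read (tr d) (tr d);
 Const (tr d.+2) 1; Binop Defs.Sub (tr d.+1) (tr d.+2) (tr d.+1);
 Binop Defs.Sub (tr d.+1) (tr d.+2) (tr d.+1);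
 Binop Mul (tr d) (tr d) (tr d.+1)]
 | Bin o e1 e2 => ecomp e1 d ++ ecomp e2 d.+1 ++
 [:: Binop o (tr d) (tr d) (tr d.+1)]
 end.

Lemma size_ecomp e d : size (ecomp e d) = ecost e.
Proof.
elim: e d => //= [a e IH d|e IH d|o e1 IH1 e2 IH2 d].
- by rewrite size_cat IH.
- by rewrite size_cat IH.
- by rewrite !size_cat IH1 IH2 addnA.
Qed.

Definition mov d r r' : program :=
 [:: Const (tr d) 0; Binop Add r r' (tr d)].

(** A loop counts in the temporary [tr d], while its body is compiled with temporaries from
    [tr d.+1] on. Assignments of the body to the loop variable thus do not change the number of
    rounds. *)
Fixpoint ccomp p c d : program :=
 match c with
 | Skip => [::]
 | Assign x e => ecomp e d ++ mov d.+1 (vr x) (tr d)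
 | Store a e1 e2 => ecomp e1 d ++ ecomp e2 d.+1 ++
 [:: Const (tr d.+2) K; Binop Mul (tr d) (tr d) (tr d.+2);
 Const (tr d.+2) (index a al); Binop Add (tr d) (tr d) (tr d.+2);
 Binop Add (tr d) (tr d) 2; Write (tr d) (tr d.+1)]
 | Out e1 e2 => ecomp e1 d ++ ecomp e2 d.+1 ++
 [:: Binop Defs.Sub (tr d.+2) 2 (tr d);
 JumpZ (tr d.+2) (p + ecost e1 + ecost e2 + 3);
 Write (tr d) (tr d.+1)]
 | Seq c1 c2 => let p1 := ccomp p c1 d in p1 ++ ccomp (p + size p1) c2 d
 | If e c1 c2 =>
 let q := p + ecost e + 1 in
 let p1 := ccomp q c1 d in
 let q2 := q + size p1 + 2 in
 let p2 := ccomp q2 c2 d in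
 ecomp e d ++ [:: JumpZ (tr d) q2] ++ p1 ++
 [:: Const (tr d) 0; JumpZ (tr d) (q2 + size p2)] ++ p2
 | Loop x c =>
 let b := ccomp (p + 5) c d.+1 in
 [:: Const (tr d) 0; Binop Defs.Sub (tr d.+1) 2 (tr d);
 JumpZ (tr d.+1) (p + 5 + size b + 4)] ++
 mov d.+1 (vr x) (tr d) ++ b ++
 [:: Const (tr d.+1) 1; Binop Add (tr d) (tr d) (tr d.+1);
 Const (tr d.+1) 0; JumpZ (tr d.+1) p.+1]
 end.

Definition code_at (P : program) p l :=
 forall i, i < size l -> nth Halt P (p + i) = nth Halt l i.

Lemma code_at_cat P p l1 l2 : code_at P p (l1 ++ l2) ->
 code_at P p l1 /\ code_at P (p + size l1) l2.
Proof.
move=> H; split=> i lt.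
 by rewrite H ?nth_cat ?lt // size_cat; lia.
by rewrite -addnA H ?nth_cat ?size_cat ?ltn_add2l // ifN ?addKn //; lia.
Qed.

Lemma code_at_cons P p i l : code_at P p (i :: l) ->
 nth Halt P p = i /\ code_at P p.+1 l.
Proof.
move=> H; split; first by have := H 0 isT; rewrite addn0.
by move=> j lt; have := H j.+1 lt; rewrite addnS addSn.
Qed.

Definition steps W P m s s' :=
 iter m (obind (step W P)) (Some s) = Some s'.

Lemma steps_trans W P m1 m2 s1 s2 s3 :
 steps W P m1 s1 s2 -> steps W P m2 s2 s3 -> steps W P (m1 + m2) s1 s3.
Proof. by rewrite /steps addnC iterD => -> ->. Qed.

Lemma steps1 W P s s' : step W P s = Some s' -> steps W P 1 s s'.
Proof. by []. Qed.

Lemma steps_const W P p R M r v : nth Halt P p = Const r v -> v < W ->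
 steps W P 1 (Config p R M) (Config p.+1 (upd R r v) M).
Proof. by move=> H lt; apply: steps1; rewrite /= /current /= H lt. Qed.

Lemma steps_binop W P p R M o r a b : nth Halt P p = Binop o r a b ->
 eval_binop o (R a) (R b) < W ->
 steps W P 1 (Config p R M)
 (Config p.+1 (upd R r (eval_binop o (R a) (R b))) M).
Proof. by move=> H lt; apply: steps1; rewrite /= /current /= H lt. Qed.

Lemma steps_read W P p R M r a : nth Halt P p = Read r a -> M (R a) < W ->
 steps W P 1 (Config p R M) (Config p.+1 (upd R r (M (R a))) M).
Proof. by move=> H lt; apply: steps1; rewrite /= /current /= H lt. Qed.

Lemma steps_write W P p R M a r : nth Halt P p = Write a r ->
 steps W P 1 (Config p R M) (Config p.+1 R (upd M (R a) (R r))).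
Proof. by move=> H; apply: steps1; rewrite /= /current /= H. Qed.

Lemma steps_jump W P p R M r l : nth Halt P p = JumpZ r l ->
 steps W P 1 (Config p R M) (Config (if R r == 0 then l else p.+1) R M).
Proof. by move=> H; apply: steps1; rewrite /= /current /= H. Qed.

(** The arrays are interleaved behind the input: entry [i] of the array with index [j] has address
    [n + i * K + j]. No length has to be fixed in advance. *)
Definition rep n s (R M : nat -> nat) :=
 [/\ R 2 = n, forall x, R (vr x) = var s x,
 forall i, i < n -> M i = inp s i
 & forall a i, a \in al -> M (n + i * K + index a al) = arr s a i].

Definition same_below d (R R' : nat -> nat) :=
 forall r, (forall d', d <= d' -> r <> tr d') -> R' r = R r.

(** By division with remainder by [K], every address beyond the input is an entry of some array. So
    even a stray read fetches a word that fits. *)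
Lemma rep_mem_bound n V s R M : 0 < K -> uniq al -> rep n s R M ->
 bounded V s -> forall i, M i <= V.
Proof.
move=> K0 ual [_ _ Hi Ha] [_ ba bi] i.
case: (ltnP i n) => lt; first by rewrite Hi.
have lK : (i - n) %% K < K by rewrite ltn_mod.
have := Ha (nth (0,0,0) al ((i - n) %% K)) ((i - n) %/ K) (mem_nth _ lK).
rewrite index_uniq // -addnA -divn_eq subnKC // => ->; exact: ba.
Qed.

Lemma rep_same n s R R' M d : rep n s R M -> same_below d R R' -> rep n s R' M.
Proof.
move=> [R2 Rv Hi Ha] H; split=> //.
 by rewrite H // => d' _; rewrite /tr; lia.
by move=> x; rewrite H // => d' _; rewrite /tr /vr; lia.
Qed.

Lemma same_below_upd d d' R R' v : d <= d' -> same_below d R R' ->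
 same_below d R (upd R' (tr d') v).
Proof.
move=> le H r Hr; rewrite /upd; case: eqP => [E|_]; last exact: H.
by case: (Hr _ le).
Qed.

Lemma same_below_trans d d' R R' R'' : d <= d' ->
 same_below d R R' -> same_below d' R' R'' -> same_below d R R''.
Proof.
move=> le H H' r Hr; rewrite H' ?H // => e le' ; apply: Hr; exact: leq_trans le'.
Qed.

Lemma same_below_tr d d' R R' : d' < d -> same_below d R R' ->
 R' (tr d') = R (tr d').
Proof. by move=> lt; apply=> e le; rewrite /tr; lia. Qed.

Lemma tr_eq d d' : (tr d == tr d') = (d == d').
Proof. by rewrite /tr eqn_add2r; apply/eqP/eqP; lia. Qed.

Lemma two_tr d : (2 == tr d) = false.
Proof. by rewrite /tr; lia. Qed.

Lemma vr_tr x d : (vr x == tr d) = false.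
Proof. by rewrite /tr /vr; lia. Qed.

Lemma vr_eq x y : (vr x == vr y) = (x == y).
Proof. by rewrite /vr eqn_add2r; apply/eqP/eqP; lia. Qed.

Hypotheses (K0 : 0 < K) (ual : uniq al).

Section Run.
Variables (n W V : nat) (P : program).
Hypotheses (nV : n <= V) (VW : V < W).

Lemma ecomp_ok s e d p R M :
 code_at P p (ecomp e d) -> rep n s R M -> bounded V s ->
 {subset earrays e <= al} -> ewords K V e < W ->
 exists R', [/\ steps W P (ecost e) (Config p R M) (Config (p + ecost e) R' M),
 R' (tr d) = eval n s e & same_below d R R'].
Proof.
have trS d' : (tr d' == tr d'.+1) = false by rewrite tr_eq; lia.
have trS' d' : (tr d'.+1 == tr d') = false by rewrite tr_eq; lia.
have trSS d' : (tr d' == tr d'.+2) = false by rewrite tr_eq; lia.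
elim: e d p R => [k|x|a e IH|e IH||o e1 IH1 e2 IH2] d p R.
- move=> /code_at_cons [c1 _] rp bs _ /= lt.
 exists (upd R (tr d) k); split; first by rewrite addn1; exact: steps_const.
 + by rewrite /upd eqxx.
 + exact: same_below_upd.
- move=> /code_at_cons [c1 /code_at_cons [c2 _]] rp bs _ /= lt.
 exists (upd (upd R (tr d) 0) (tr d) (var s x)); split.
 + rewrite addn2; apply: (@steps_trans W P 1 1).
 by apply: (@steps_const W P _ _ _ _ _ c1); lia.
 have [_ Rv _ _] := rp; have := @steps_binop W P _ (upd R (tr d) 0) M _ _ _ _ c2.
 rewrite /= /upd eqxx vr_tr addn0 Rv.
 by apply; case: bs => bv _ _; apply: leq_ltn_trans (bv x) _.
 + by rewrite /upd eqxx.
 + by do 2!apply: same_below_upd => //.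
- rewrite /= => /code_at_cat [ce]; rewrite size_ecomp.
 move=> /code_at_cons [c1 /code_at_cons [c2 /code_at_cons [c3]]].
 move=> /code_at_cons [c4 /code_at_cons [c5 /code_at_cons [c6 _]]].
 move=> rp bs sub lt.
 have aal : a \in al by apply: sub; rewrite inE eqxx.
 have lidx : index a al < K by rewrite index_mem.
 have [] := IH d p R ce rp bs _ _; first by move=> b be; apply: sub; rewrite inE be orbT.
 by lia.
 move=> R1 [st E1 S1].
 set v := eval n s e in E1 *.
 have lv : v <= ewords K V e by apply: eval_elim.
 have [R2 _ _ Ha] := rep_same rp S1.
 have lvK : v * K <= ewords K V e * K by apply: leq_mul.
 set R3 := upd R1 (tr d.+1) K.
 set R4 := upd R3 (tr d) (v * K).
 set R5 := upd R4 (tr d.+1) (index a al).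
 set R6 := upd R5 (tr d) (v * K + index a al).
 set R7 := upd R6 (tr d) (v * K + index a al + n).
 exists (upd R7 (tr d) (arr s a v)); split; last 1 first.
 + by rewrite /R7 /R6 /R5 /R4 /R3; do 6!apply: same_below_upd => //.
 + rewrite (_ : p + (ecost e + 6) = (p + ecost e).+1.+1.+1.+1.+1.+1); last by lia.
 apply: steps_trans st _; rewrite (_ : 6 = 1 + (1 + (1 + (1 + (1 + 1))))) //.
 apply: steps_trans (@steps_const W P _ _ _ _ _ c1 _) _; first by lia.
 rewrite -/R3.
 apply: (@steps_trans _ _ _ _ _ (Config (p + ecost e).+2 R4 M)).
 have := @steps_binop W P _ R3 M _ _ _ _ c2.
 have -> : R3 (tr d) = v by rewrite /R3 /upd trS.
 have -> : R3 (tr d.+1) = K by rewrite /R3 /upd eqxx.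
 by apply => /=; lia.
 apply: steps_trans (@steps_const W P _ _ _ _ _ c3 _) _; first by lia.
 rewrite -/R5.
 apply: (@steps_trans _ _ _ _ _ (Config (p + ecost e).+4 R6 M)).
 have := @steps_binop W P _ R5 M _ _ _ _ c4.
 have -> : R5 (tr d) = v * K by rewrite /R5 /R4 /upd trS eqxx.
 have -> : R5 (tr d.+1) = index a al by rewrite /R5 /upd eqxx.
 by apply => /=; lia.
 apply: (@steps_trans _ _ _ _ _ (Config (p + ecost e).+4.+1 R7 M)).
 have := @steps_binop W P _ R6 M _ _ _ _ c5.
 have -> : R6 (tr d) = v * K + index a al by rewrite /R6 /upd eqxx.
 have -> : R6 2 = n by rewrite /R6 /R5 /R4 /R3 /upd !two_tr.
 by apply => /=; lia.
 have := @steps_read W P _ R7 M _ _ c6.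
 have -> : R7 (tr d) = n + v * K + index a al by rewrite /R7 /upd eqxx; lia.
 rewrite Ha //; apply.
 by case: bs => _ ba _; apply: leq_ltn_trans (ba _ _) _.
 + by rewrite /upd eqxx.
- rewrite /= => /code_at_cat [ce]; rewrite size_ecomp.
 move=> /code_at_cons [c1 /code_at_cons [c2 /code_at_cons [c3]]].
 move=> /code_at_cons [c4 /code_at_cons [c5 /code_at_cons [c6 _]]].
 move=> rp bs sub lt.
 have [|R1 [st E1 S1]] := IH d p R ce rp bs sub; first by lia.
 set v := eval n s e in E1 *.
 have lv : v <= ewords K V e by apply: eval_elim.
 have rp1 := rep_same rp S1; have [R2 _ Hi Ha] := rp1.
 have lM : M v <= V by apply: rep_mem_bound rp bs _.
 set R3 := upd R1 (tr d.+1) (n - v).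
 set R4 := upd R3 (tr d) (M v).
 set R5 := upd R4 (tr d.+2) 1.
 set R6 := upd R5 (tr d.+1) (1 - (n - v)).
 set R7 := upd R6 (tr d.+1) (1 - (1 - (n - v))).
 exists (upd R7 (tr d) (M v * (1 - (1 - (n - v))))); split; last 1 first.
 + by rewrite /R7 /R6 /R5 /R4 /R3; do 6!(apply: same_below_upd; first by lia).
 + rewrite (_ : p + (ecost e + 6) = (p + ecost e).+1.+1.+1.+1.+1.+1); last by lia.
 apply: steps_trans st _; rewrite (_ : 6 = 1 + (1 + (1 + (1 + (1 + 1))))) //.
 apply: (@steps_trans _ _ _ _ _ (Config (p + ecost e).+1 R3 M)).
 have := @steps_binop W P _ R1 M _ _ _ _ c1.
 by rewrite R2 E1 /=; apply; lia.
 apply: (@steps_trans _ _ _ _ _ (Config (p + ecost e).+2 R4 M)).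
 have := @steps_read W P _ R3 M _ _ c2.
 have -> : R3 (tr d) = v by rewrite /R3 /upd trS.
 by apply; lia.
 apply: steps_trans (@steps_const W P _ _ _ _ _ c3 _) _; first by lia.
 rewrite -/R5.
 apply: (@steps_trans _ _ _ _ _ (Config (p + ecost e).+4 R6 M)).
 have := @steps_binop W P _ R5 M _ _ _ _ c4.
 have -> : R5 (tr d.+2) = 1 by rewrite /R5 /upd eqxx.
 have -> : R5 (tr d.+1) = n - v by rewrite /R5 /R4 /R3 /upd trS trS' eqxx.
 by apply => /=; lia.
 apply: (@steps_trans _ _ _ _ _ (Config (p + ecost e).+4.+1 R7 M)).
 have := @steps_binop W P _ R6 M _ _ _ _ c5.
 have -> : R6 (tr d.+2) = 1 by rewrite /R6 /R5 /upd trS' eqxx.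
 have -> : R6 (tr d.+1) = 1 - (n - v) by rewrite /R6 /upd eqxx.
 by apply => /=; lia.
 have := @steps_binop W P _ R7 M _ _ _ _ c6.
 have -> : R7 (tr d) = M v by rewrite /R7 /R6 /R5 /R4 /upd trS trSS eqxx.
 have -> : R7 (tr d.+1) = 1 - (1 - (n - v)) by rewrite /R7 /upd eqxx.
 apply => /=.
 have h : M v * (1 - (1 - (n - v))) <= M v * 1 by apply: leq_mul => //; lia.
 by lia.
 + rewrite /upd eqxx; case: ltnP => lt'.
 by rewrite Hi // (_ : 1 - (1 - (n - v)) = 1) ?muln1 //; lia.
 by rewrite (_ : 1 - (1 - (n - v)) = 0) ?muln0 //; lia.
- move=> /code_at_cons [c1 /code_at_cons [c2 _]] rp bs _ /= lt.
 exists (upd (upd R (tr d) 0) (tr d) n); split.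
 + rewrite addn2; apply: (@steps_trans W P 1 1).
 by apply: (@steps_const W P _ _ _ _ _ c1); lia.
 have [R2 _ _ _] := rp; have := @steps_binop W P _ (upd R (tr d) 0) M _ _ _ _ c2.
 by rewrite /= /upd eqxx two_tr addn0 R2; apply; lia.
 + by rewrite /upd eqxx.
 + by do 2!apply: same_below_upd => //.
- rewrite /= => /code_at_cat [ce1 /code_at_cat [ce2]]; rewrite !size_ecomp.
 move=> /code_at_cons [c1 _] rp bs sub lt; rewrite size_ecomp in ce2.
 have [||R1 [st1 E1 S1]] := IH1 d p R ce1 rp bs.
 by move=> b be; apply: sub; rewrite mem_cat be.
 by lia.
 have rp1 := rep_same rp S1.
 have [||R2 [st2 E2 S2]] := IH2 d.+1 _ R1 ce2 rp1 bs.
 by move=> b be; apply: sub; rewrite mem_cat be orbT.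
 by lia.
 exists (upd R2 (tr d) (eval_binop o (eval n s e1) (eval n s e2))); split.
 + apply: steps_trans (steps_trans st1 st2) _.
 rewrite (_ : p + (ecost e1 + ecost e2 + 1) = (p + ecost e1 + ecost e2).+1);
 last by lia.
 have := @steps_binop W P _ R2 M _ _ _ _ c1.
 rewrite E2 (same_below_tr _ S2) ?E1 //; apply.
 have l1 := @eval_elim K V n s e1 bs nV; have l2 := @eval_elim K V n s e2 bs nV.
 move: lt; set q := _ * _ => lt.
 have lq : eval n s e1 * eval n s e2 <= q by apply: leq_mul.
 case: o {c1} => /=.
 * lia.
 * lia.
 * lia.
 * by apply: leq_ltn_trans (leq_div _ _) _; lia.
 + by rewrite /upd eqxx.
 + apply: same_below_upd => //; apply: same_below_trans S1 S2; exact: leqnSn.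
Qed.

Lemma rep_setv s R M x d d' R' : d <= d' -> same_below d R R' -> rep n s R M ->
 forall v, rep n (setv s x v) (upd (upd R' (tr d') 0) (vr x) v) M.
Proof.
move=> le S rp v; have [R2 Rv Hi Ha] := rep_same rp (same_below_upd 0 le S).
split=> //=; first by rewrite /upd (_ : 2 == vr x = false) // /vr; lia.
by move=> y; rewrite /upd vr_eq; case: ifP => // _; rewrite vr_tr -Rv /upd vr_tr.
Qed.

Lemma mov_ok s R M x d d' v p R' : code_at P p (mov d' (vr x) (tr d)) ->
 d < d' -> same_below d R R' -> R' (tr d) = v -> v < W -> rep n s R M ->
 exists R'', [/\ steps W P 2 (Config p R' M) (Config (p + 2) R'' M),
 rep n (setv s x v) R'' M & forall r, r <> vr x -> r <> tr d' -> R'' r = R' r].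
Proof.
move=> /code_at_cons [c1 /code_at_cons [c2 _]] lt S E vW rp.
exists (upd (upd R' (tr d') 0) (vr x) v); split.
- rewrite addn2; apply: (@steps_trans W P 1 1).
 by apply: (@steps_const W P _ _ _ _ _ c1); lia.
 have := @steps_binop W P _ (upd R' (tr d') 0) M _ _ _ _ c2.
 have -> : upd R' (tr d') 0 (tr d) = v by rewrite /upd tr_eq E; case: eqP => //; lia.
 have -> : upd R' (tr d') 0 (tr d') = 0 by rewrite /upd eqxx.
 by rewrite /= addn0; apply.
- exact: (rep_setv _ (ltnW lt) S rp).
- by move=> r /eqP/negbTE n1 /eqP/negbTE n2; rewrite /upd n1 n2.
Qed.

Lemma addr_inj i j a b : a \in al -> b \in al ->
 (n + i * K + index a al == n + j * K + index b al) = (i == j) && (a == b).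
Proof.
move=> aa ba; have la : index a al < K by rewrite index_mem.
have lb : index b al < K by rewrite index_mem.
apply/eqP/andP => [E|[/eqP -> /eqP ->] //].
have E' : i * K + index a al = j * K + index b al by lia.
have Eij : i = j.
 have := congr1 (divn^~ K) E'.
 by rewrite !divnMDl // (divn_small la) (divn_small lb) !addn0.
split; first exact/eqP.
have Ei : index a al = index b al by lia.
by rewrite -(nth_index a aa) -[X in _ == X](nth_index a ba) Ei.
Qed.

Lemma rep_seta s R M a i v : a \in al -> rep n s R M ->
 rep n (seta s a i v) R (upd M (n + i * K + index a al) v).
Proof.
move=> aa [R2 Rv Hi Ha]; split=> //=.
 by move=> j lt; rewrite /upd Hi //; case: eqP => //; lia.
move=> b j bb; rewrite /upd addr_inj // andbC.
by case: eqP => [->|_] /=; rewrite Ha //; case: ifP.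
Qed.

Lemma rep_seti s R M i v : i < n -> rep n s R M ->
 rep n (seti s i v) R (upd M i v).
Proof.
move=> lt [R2 Rv Hi Ha]; split=> //=.
 by move=> j ltj; rewrite /upd Hi.
by move=> b j bb; rewrite /upd Ha //; case: eqP => //; lia.
Qed.

Lemma bounded_setv U s x v : bounded U s -> v <= U -> bounded U (setv s x v).
Proof. by case=> bv ba bi le; split=> //= y; rewrite /upd; case: ifP. Qed.

(** Two bounds are needed for the induction: [U] bounds the current store and moves along with the
    execution, while [V] and the word size stay fixed. Each subcommand starts from [U] plus the
    growth so far. *)
Lemma ccomp_ok c s U d p R M :
 code_at P p (ccomp p c d) -> rep n s R M -> bounded U s -> n <= U ->
 U + growth n c <= V -> wf c -> {subset arrays c <= al} -> cwords K V c < W ->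
 exists m R' M', [/\ m <= cost n c,
 steps W P m (Config p R M) (Config (p + size (ccomp p c d)) R' M'),
 rep n (run n c s) R' M' & forall d', d' < d -> R' (tr d') = R (tr d')].
Proof.
have trS d' : (tr d' == tr d'.+1) = false by rewrite tr_eq; lia.
have trS' d' : (tr d'.+1 == tr d') = false by rewrite tr_eq; lia.
have trSS d' : (tr d' == tr d'.+2) = false by rewrite tr_eq; lia.
elim: c s U d p R M =>
 [|x e|a e1 e2|e1 e2|c1 IH1 c2 IH2|e c1 IH1 c2 IH2|x c IH] s U d p R M /=.
- by exists 0, R, M; rewrite addn0.
- rewrite size_cat size_ecomp => /code_at_cat [ce cm] rp bs nU UV te sub lt.
 rewrite size_ecomp in cm; have bV : bounded V s by apply: boundedW bs; lia.
 have [//|R1 [st E S]] := ecomp_ok ce rp bV sub.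
 have vW : eval n s e < W.
 by apply: leq_ltn_trans lt; apply: eval_elim => //; lia.
 have [//|R2 [st2 rp2 S2]] := mov_ok cm _ S E vW rp.
 exists (ecost e + 2), R2, M; split=> //.
 by rewrite addnA; apply: steps_trans st st2.
 move=> d' ltd; rewrite S2; first exact: same_below_tr ltd S.
 by apply/eqP; rewrite eq_sym vr_tr.
 by apply/eqP; rewrite tr_eq; lia.
- rewrite !size_cat !size_ecomp => /code_at_cat [ce1 /code_at_cat [ce2]].
 rewrite !size_ecomp in ce2 *; rewrite /= => cc rp bs nU UV te sub lt.
 have bV : bounded V s by apply: boundedW bs; lia.
 have aal : a \in al by apply: sub; rewrite inE eqxx.
 have lidx : index a al < K by rewrite index_mem.
 have [||R1 [st1 E1 S1]] := ecomp_ok ce1 rp bV.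
 by move=> b be; apply: sub; rewrite inE mem_cat be orbT.
 by lia.
 have rp1 := rep_same rp S1.
 have [||R2 [st2 E2 S2]] := ecomp_ok ce2 rp1 bV.
 by move=> b be; apply: sub; rewrite inE mem_cat be !orbT.
 by lia.
 have E1' : R2 (tr d) = eval n s e1 by rewrite (same_below_tr _ S2).
 set v := eval n s e1 in E1' *; set u := eval n s e2 in E2 *.
 have S12 : same_below d R R2 by apply: same_below_trans S1 S2; lia.
 have rp2 := rep_same rp S12; have [R22 _ _ _] := rp2.
 have lv : v <= ewords K V e1 by apply: eval_elim.
 have lvK : v * K <= ewords K V e1 * K by apply: leq_mul.
 move: cc => /code_at_cons [c1 /code_at_cons [c2 /code_at_cons [c3]]].
 move=> /code_at_cons [c4 /code_at_cons [c5 /code_at_cons [c6 _]]].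
 set q := p + ecost e1 + ecost e2 in c1 c2 c3 c4 c5 c6.
 set R3 := upd R2 (tr d.+2) K.
 set R4 := upd R3 (tr d) (v * K).
 set R5 := upd R4 (tr d.+2) (index a al).
 set R6 := upd R5 (tr d) (v * K + index a al).
 set R7 := upd R6 (tr d) (v * K + index a al + n).
 have S7 : same_below d R R7.
 by rewrite /R7 /R6 /R5 /R4 /R3; do 5!(apply: same_below_upd; first by lia).
 exists (ecost e1 + ecost e2 + 6), R7, (upd M (n + v * K + index a al) u).
 split=> //; last 2 first.
 + apply: rep_seta => //; exact: rep_same S7.
 + by move=> d' ltd; exact: same_below_tr S7.
 rewrite (_ : p + (ecost e1 + (ecost e2 + 6)) = q.+1.+1.+1.+1.+1.+1);
 last by rewrite /q; lia.
 apply: steps_trans (steps_trans st1 st2) _.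
 rewrite (_ : 6 = 1 + (1 + (1 + (1 + (1 + 1))))) //.
 apply: steps_trans (@steps_const W P _ _ _ _ _ c1 _) _; first by lia.
 rewrite -/R3.
 apply: (@steps_trans _ _ _ _ _ (Config q.+2 R4 M)).
 have := @steps_binop W P _ R3 M _ _ _ _ c2.
 have -> : R3 (tr d) = v by rewrite /R3 /upd trSS.
 have -> : R3 (tr d.+2) = K by rewrite /R3 /upd eqxx.
 by apply => /=; lia.
 apply: steps_trans (@steps_const W P _ _ _ _ _ c3 _) _; first by lia.
 rewrite -/R5.
 apply: (@steps_trans _ _ _ _ _ (Config q.+4 R6 M)).
 have := @steps_binop W P _ R5 M _ _ _ _ c4.
 have -> : R5 (tr d) = v * K by rewrite /R5 /R4 /upd trSS eqxx.
 have -> : R5 (tr d.+2) = index a al by rewrite /R5 /upd eqxx.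
 by apply => /=; lia.
 apply: (@steps_trans _ _ _ _ _ (Config q.+4.+1 R7 M)).
 have := @steps_binop W P _ R6 M _ _ _ _ c5.
 have -> : R6 (tr d) = v * K + index a al by rewrite /R6 /upd eqxx.
 have -> : R6 2 = n by rewrite /R6 /R5 /R4 /R3 /upd !two_tr.
 by apply => /=; lia.
 have := @steps_write W P _ R7 M _ _ c6.
 have -> : R7 (tr d) = n + v * K + index a al by rewrite /R7 /upd eqxx; lia.
 by have -> : R7 (tr d.+1) = u
 by rewrite /R7 /R6 /R5 /R4 /R3 /upd !trS' trS.
- rewrite !size_cat !size_ecomp => /code_at_cat [ce1 /code_at_cat [ce2]].
 rewrite !size_ecomp in ce2 *; rewrite /= => cc rp bs nU UV te sub lt.
 have bV : bounded V s by apply: boundedW bs; lia.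
 have [||R1 [st1 E1 S1]] := ecomp_ok ce1 rp bV.
 by move=> b be; apply: sub; rewrite mem_cat be.
 by lia.
 have rp1 := rep_same rp S1.
 have [||R2 [st2 E2 S2]] := ecomp_ok ce2 rp1 bV.
 by move=> b be; apply: sub; rewrite mem_cat be !orbT.
 by lia.
 have E1' : R2 (tr d) = eval n s e1 by rewrite (same_below_tr _ S2).
 set v := eval n s e1 in E1' *; set u := eval n s e2 in E2 *.
 have S12 : same_below d R R2 by apply: same_below_trans S1 S2; lia.
 have rp2 := rep_same rp S12; have [R22 _ _ _] := rp2.
 move: cc => /code_at_cons [c1 /code_at_cons [c2 /code_at_cons [c3 _]]].
 set q := p + ecost e1 + ecost e2 in c1 c2 c3.
 set R3 := upd R2 (tr d.+2) (n - v).
 have S3 : same_below d R R3 by rewrite /R3; apply: same_below_upd => //; lia.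
 have rp3 := rep_same rp S3.
 have stA : steps W P (ecost e1 + ecost e2 + 2) (Config p R M)
 (Config (if n - v == 0 then q + 3 else q.+2) R3 M).
 apply: steps_trans (steps_trans st1 st2) _; rewrite (_ : 2 = 1 + 1) //.
 apply: (@steps_trans _ _ _ _ _ (Config q.+1 R3 M)).
 have := @steps_binop W P _ R2 M _ _ _ _ c1.
 by rewrite R22 E1'; apply => /=; lia.
 have := @steps_jump W P _ R3 M _ _ c2.
 by have -> : R3 (tr d.+2) = n - v by rewrite /R3 /upd eqxx.
 rewrite (_ : p + (ecost e1 + (ecost e2 + 3)) = q + 3); last by rewrite /q; lia.
 case: ltnP => lv; last first.
 exists (ecost e1 + ecost e2 + 2), R3, M; split=> //; first by lia.
 by move: stA; rewrite (_ : n - v == 0) //; lia.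
 by move=> d' ltd; exact: same_below_tr S3.
 exists (ecost e1 + ecost e2 + 2 + 1), R3, (upd M v u); split=> //; first by lia.
 + apply: steps_trans stA _; rewrite (_ : (n - v == 0) = false) //; last by lia.
 have := @steps_write W P _ R3 M _ _ c3.
 have -> : R3 (tr d) = v by rewrite /R3 /upd trSS.
 have -> : R3 (tr d.+1) = u by rewrite /R3 /upd trS.
 by rewrite (_ : q.+3 = q + 3) //; lia.
 + exact: rep_seti.
 + by move=> d' ltd; exact: same_below_tr S3.
- rewrite size_cat => /code_at_cat [cc1 cc2] rp bs nU UV /andP [w1 w2] sub lt.
 have [|//|||m1 [R1 [M1 [l1 st1 rp1 S1]]]] := IH1 s U d p R M cc1 rp bs nU.
 by lia.
 by move=> b be; apply: sub; rewrite mem_cat be.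
 by lia.
 have b1 := run_bounded bs nU w1.
 have [||//|||m2 [R2 [M2 [l2 st2 rp2 S2]]]] := IH2 _ _ d _ R1 M1 cc2 rp1 b1.
 by lia.
 by lia.
 by move=> b be; apply: sub; rewrite mem_cat be orbT.
 by lia.
 exists (m1 + m2), R2, M2; split=> //; first by lia.
 by rewrite addnA; apply: steps_trans st1 st2.
 by move=> d' ltd; rewrite S2 // S1.
- set q := p + ecost e + 1; set p1 := ccomp q c1 d; set q2 := q + size p1 + 2.
 set p2 := ccomp q2 c2 d.
 rewrite size_cat /= size_cat /= size_ecomp.
 move=> /code_at_cat [ce]; rewrite size_ecomp => /code_at_cons [cj].
 move=> /code_at_cat [cc1] /code_at_cons [cz /code_at_cons [cj2 cc2]].
 move=> rp bs nU UV /andP [w1 w2] sub lt.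
 have bV : bounded V s by apply: boundedW bs; lia.
 have [||R1 [st E S]] := ecomp_ok ce rp bV.
 by move=> b be; apply: sub; rewrite mem_cat be.
 by lia.
 have rp1 := rep_same rp S.
 have stA : steps W P (ecost e + 1) (Config p R M)
 (Config (if eval n s e == 0 then q2 else q) R1 M).
 apply: steps_trans st _; have := @steps_jump W P _ R1 M _ _ cj.
 by rewrite E (_ : q = (p + ecost e).+1) // /q; lia.
 rewrite (_ : (p + ecost e).+1 = q) in cc1 cz cj2 cc2; last by rewrite /q; lia.
 rewrite (_ : (q + size p1).+2 = q2) in cc2; last by rewrite /q2; lia.
 have -> : p + (ecost e + (size p1 + (size p2).+2).+1) = q2 + size p2.
 by rewrite /q2 /q; lia.
 case: ifP stA => ev stA /=.
 have [||//|||m2 [R2 [M2 [l2 st2 rp2 S2]]]] := IH2 s U d q2 R1 M cc2 rp1 bs.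
 by [].
 by lia.
 by move=> b be; apply: sub; rewrite !mem_cat be !orbT.
 by lia.
 exists (ecost e + 1 + m2), R2, M2; split=> //; first by lia.
 exact: steps_trans stA st2.
 by move=> d' ltd; rewrite S2 //; exact: same_below_tr S.
 have [||//|||m2 [R2 [M2 [l2 st2 rp2 S2]]]] := IH1 s U d q R1 M cc1 rp1 bs.
 by [].
 by lia.
 by move=> b be; apply: sub; rewrite !mem_cat be !orbT.
 by lia.
 have S0 : same_below d R2 (upd R2 (tr d) 0) by apply: same_below_upd.
 exists (ecost e + 1 + m2 + 2), (upd R2 (tr d) 0), M2; split=> //; first by lia.
 + apply: steps_trans (steps_trans stA st2) _.
 rewrite (_ : 2 = 1 + 1) //.
 apply: steps_trans (@steps_const W P _ _ _ _ _ cz _) _; first by lia.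
 have := @steps_jump W P _ (upd R2 (tr d) 0) M2 _ _ cj2.
 by have -> : upd R2 (tr d) 0 (tr d) = 0 by rewrite /upd eqxx.
 + exact: rep_same S0.
 + move=> d' ltd; rewrite (same_below_tr ltd S0) S2 //; exact: same_below_tr S.
- set b := ccomp (p + 5) c d.+1.
 move=> /code_at_cons [c1 /code_at_cons [c2 /code_at_cons [c3]]].
 move=> /(@code_at_cat _ _ (mov _ _ _)) [cm] /code_at_cat [cb].
 rewrite (_ : p.+3 + size (mov d.+1 (vr x) (tr d)) = p + 5); last by rewrite /=; lia.
 rewrite (_ : p.+3 + size (mov d.+1 (vr x) (tr d)) = p + 5) in cb; last by rewrite /=; lia.
 move=> /code_at_cons [c4 /code_at_cons [c5 /code_at_cons [c6 /code_at_cons [c7 _]]]].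
 move=> rp bs nU UV wc sub lt.
 rewrite /= size_cat /=.
 set F := fun i s => run n c (setv s x i).
 (* The invariant holds at [p.+1], the loop test; the initialisation of the counter at [p] is
    executed once and accounts for the leading 1. *)
 have inv i : i <= n -> exists m R1 M1, [/\ m <= 1 + i * (cost n c + 8),
 steps W P m (Config p R M) (Config p.+1 R1 M1), rep n (iteri i F s) R1 M1,
 R1 (tr d) = i /\ bounded (U + i * growth n c) (iteri i F s)
 & forall d', d' < d -> R1 (tr d') = R (tr d')].
 elim: i => [|i IHi] li.
 exists 1, (upd R (tr d) 0), M.
 have S0 : same_below d R (upd R (tr d) 0) by apply: same_below_upd.
 split=> //.
 + by apply: (@steps_const W P _ _ _ _ _ c1); lia.
 + exact: rep_same S0.
 + by rewrite /upd eqxx addn0.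
 + by move=> d' ltd; exact: same_below_tr S0.
 have [m [R1 [M1 [lm st rp1 [Ei bi] S1]]]] := IHi (ltnW li).
 have lgi : i.+1 * growth n c <= n * growth n c by apply: leq_mul.
 rewrite mulSn in lgi.
 set s1 := iteri i F s in rp1 bi *.
 set R2 := upd R1 (tr d.+1) (n - i).
 have S2 : same_below d.+1 R1 R2 by apply: same_below_upd.
 have R12 : R1 2 = n by case: rp1.
 have st2 : steps W P 2 (Config p.+1 R1 M1) (Config p.+3 R2 M1).
 rewrite (_ : 2 = 1 + 1) //.
 apply: (@steps_trans _ _ _ _ _ (Config p.+2 R2 M1)).
 have := @steps_binop W P _ R1 M1 _ _ _ _ c2.
 by rewrite R12 Ei; apply => /=; lia.
 have := @steps_jump W P _ R2 M1 _ _ c3.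
 have -> : R2 (tr d.+1) = n - i by rewrite /R2 /upd eqxx.
 by rewrite ifF //; lia.
 have E2 : R2 (tr d) = i by rewrite /R2 /upd trS.
 have S2' : same_below d R1 R2 by apply: same_below_upd.
 have iW : i < W by lia.
 have [//|R3 [st3 rp3 S3]] := mov_ok cm _ S2' E2 iW rp1.
 rewrite (_ : p.+3 + 2 = p + 5) in st3; last by lia.
 have bi' : bounded (U + i * growth n c) (setv s1 x i).
 by apply: bounded_setv => //; lia.
 have [||//|//||m4 [R4 [M4 [l4 st4 rp4 S4]]]] :=
 IH (setv s1 x i) _ d.+1 (p + 5) R3 M1 cb rp3 bi'.
 by lia.
 by lia.
 by lia.
 set R5 := upd R4 (tr d.+1) 1.
 set R6 := upd R5 (tr d) i.+1.
 set R7 := upd R6 (tr d.+1) 0.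
 have E4 : R4 (tr d) = i.
 rewrite S4 // S3 //; first by apply/eqP; rewrite eq_sym vr_tr.
 by apply/eqP; rewrite trS.
 have S7 : same_below d R4 R7.
 by rewrite /R7 /R6 /R5; do 3!(apply: same_below_upd; first by lia).
 exists (m + 2 + 2 + m4 + 4), R7, M4; split.
 + by rewrite mulSn; lia.
 + apply: steps_trans (steps_trans (steps_trans (steps_trans st st2) st3) st4) _.
 rewrite (_ : 4 = 1 + (1 + (1 + 1))) //.
 apply: steps_trans (@steps_const W P _ _ _ _ _ c4 _) _; first by lia.
 rewrite -/R5.
 apply: (@steps_trans _ _ _ _ _ (Config (p + 5 + size b).+2 R6 M4)).
 have := @steps_binop W P _ R5 M4 _ _ _ _ c5.
 have -> : R5 (tr d) = i by rewrite /R5 /upd trS.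
 have -> : R5 (tr d.+1) = 1 by rewrite /R5 /upd eqxx.
 by rewrite /= addn1; apply; lia.
 apply: steps_trans (@steps_const W P _ _ _ _ _ c6 _) _; first by lia.
 rewrite -/R7.
 have := @steps_jump W P _ R7 M4 _ _ c7.
 by have -> : R7 (tr d.+1) = 0 by rewrite /R7 /upd eqxx.
 + exact: rep_same S7.
 + split; first by rewrite /R7 /R6 /upd trS eqxx.
 rewrite mulSn addnCA addnC; apply: run_bounded => //; lia.
 + move=> d' ltd; rewrite (same_below_tr ltd S7) S4; last by lia.
 rewrite S3; first by rewrite (same_below_tr ltd S2') S1.
 by apply/eqP; rewrite eq_sym vr_tr.
 by apply/eqP; rewrite tr_eq; lia.
 have [m [R1 [M1 [lm st rp1 [Ei bi] S1]]]] := inv n (leqnn n).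
 set R2 := upd R1 (tr d.+1) 0.
 have S2 : same_below d R1 R2 by apply: same_below_upd.
 have R12 : R1 2 = n by case: rp1.
 exists (m + 2), R2, M1; split; first by lia.
 + apply: steps_trans st _; rewrite (_ : 2 = 1 + 1) //.
 apply: (@steps_trans _ _ _ _ _ (Config p.+2 R2 M1)).
 have := @steps_binop W P _ R1 M1 _ _ _ _ c2.
 by rewrite R12 Ei /= subnn; apply; lia.
 have := @steps_jump W P _ R2 M1 _ _ c3.
 have -> : R2 (tr d.+1) = 0 by rewrite /R2 /upd eqxx.
 by rewrite eqxx (_ : p + (size b + 4).+1.+4 = p + 5 + size b + 4) //; lia.
 + exact: rep_same S2.
 + by move=> d' ltd; rewrite (same_below_tr ltd S2) S1.
Qed.

End Run.
End Compiler.

(** * Polynomial bounds on cost, growth and words *)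

Lemma leq_mul_exp a b x i j k : a <= b -> x <= k -> i <= j -> 0 < k ->
 a * x ^ i <= b * k ^ j.
Proof.
move=> ab xk ij k0; apply: leq_mul => //.
by apply: leq_trans (leq_pexp2l k0 ij); case: i ij => // i _; rewrite leq_exp2r.
Qed.

Lemma cost_poly c : exists k, forall n, cost n c <= k * n.+1 ^ depth c.
Proof.
elim: c => [|x e|a e1 e2|e1 e2|c1 [k1 H1] c2 [k2 H2]|e c1 [k1 H1] c2 [k2 H2]|x c [k H]] /=.
- by exists 0.
- by exists (ecost e + 2) => n; rewrite muln1.
- by exists (ecost e1 + ecost e2 + 6) => n; rewrite muln1.
- by exists (ecost e1 + ecost e2 + 3) => n; rewrite muln1.
- exists (k1 + k2) => n; rewrite mulnDl; apply: leq_add.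
 by apply: leq_trans (H1 n) _; apply: leq_mul_exp => //; rewrite leq_maxl.
 by apply: leq_trans (H2 n) _; apply: leq_mul_exp => //; rewrite leq_maxr.
- exists (ecost e + k1 + k2 + 3) => n.
 have p0 : 0 < n.+1 ^ maxn (depth c1) (depth c2) by rewrite expn_gt0.
 rewrite !mulnDl.
 have := leq_trans (H1 n) (leq_mul_exp (leqnn k1) (leqnn n.+1) (leq_maxl _ (depth c2)) isT).
 have := leq_trans (H2 n) (leq_mul_exp (leqnn k2) (leqnn n.+1) (leq_maxr (depth c1) _) isT).
 by have := leq_pmulr (ecost e) p0; have := leq_pmulr 3 p0; lia.
- exists (k + 11) => n; rewrite expnS mulnCA.
 have p0 : 0 < n.+1 ^ depth c by rewrite expn_gt0.
 have h : cost n c + 8 <= (k + 8) * n.+1 ^ depth c.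
 by have := H n; rewrite mulnDl; have := leq_pmulr 8 p0; lia.
 have h2 := leq_mul (leqnn n) h.
 have e : (k + 11) * n.+1 ^ depth c = (k + 8) * n.+1 ^ depth c + 3 * n.+1 ^ depth c.
 by rewrite -mulnDl -addnA.
 by rewrite e mulSn mulnDr; have := leq_pmulr 3 p0; lia.
Qed.

Lemma growth_poly c : exists k, forall n, growth n c <= k * n.+1 ^ depth c.
Proof.
elim: c => [|x e|a e1 e2|e1 e2|c1 [k1 H1] c2 [k2 H2]|e c1 [k1 H1] c2 [k2 H2]|x c [k H]] /=.
- by exists 0.
- by exists (excess e) => n; rewrite muln1.
- by exists (excess e2) => n; rewrite muln1.
- by exists (excess e2) => n; rewrite muln1.
- exists (k1 + k2) => n; rewrite mulnDl; apply: leq_add.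
 by apply: leq_trans (H1 n) _; apply: leq_mul_exp => //; rewrite leq_maxl.
 by apply: leq_trans (H2 n) _; apply: leq_mul_exp => //; rewrite leq_maxr.
- exists (k1 + k2) => n; rewrite mulnDl; apply: leq_add.
 by apply: leq_trans (H1 n) _; apply: leq_mul_exp => //; rewrite leq_maxl.
 by apply: leq_trans (H2 n) _; apply: leq_mul_exp => //; rewrite leq_maxr.
- exists k => n; rewrite expnS mulnCA.
 by apply: leq_mul; [exact: leqnSn|exact: H].
Qed.

Lemma leq_pow2 k X : 1 < X -> k <= X ^ k.
Proof. by move=> X1; apply: ltnW; apply: ltn_expl. Qed.

Lemma addn_pow X a b i j : 1 < X -> a <= X ^ i -> b <= X ^ j ->
 a + b <= X ^ (i + j).+1.
Proof.
move=> X1 Ha Hb; rewrite expnS expnD.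
have p1 : 0 < X ^ i by rewrite expn_gt0; lia.
have p2 : 0 < X ^ j by rewrite expn_gt0; lia.
have h1 : a <= X ^ i * X ^ j by apply: leq_trans Ha _; apply: leq_pmulr.
have h2 : b <= X ^ i * X ^ j by apply: leq_trans Hb _; apply: leq_pmull.
by apply: leq_trans (leq_mul X1 (leqnn _)); lia.
Qed.

Lemma muln_pow X a b i j : a <= X ^ i -> b <= X ^ j -> a * b <= X ^ (i + j).
Proof. by move=> Ha Hb; rewrite expnD; apply: leq_mul. Qed.

Definition poly_bounded (f : nat -> nat) :=
 exists d, forall V, f V <= V.+2 ^ d.

Lemma poly_const k : poly_bounded (fun=> k).
Proof. by exists k => V; apply: leq_pow2. Qed.
Lemma poly_id : poly_bounded id.
Proof. by exists 1 => V; rewrite expn1; lia. Qed.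
Lemma poly_add f g : poly_bounded f -> poly_bounded g ->
 poly_bounded (fun V => f V + g V).
Proof. by move=> [i Hf] [j Hg]; exists (i + j).+1 => V; apply: addn_pow. Qed.
Lemma poly_mul f g : poly_bounded f -> poly_bounded g ->
 poly_bounded (fun V => f V * g V).
Proof. by move=> [i Hf] [j Hg]; exists (i + j) => V; apply: muln_pow. Qed.

Lemma ewords_poly K e : poly_bounded (fun V => ewords K V e).
Proof.
elim: e => [k|x|a e IH|e IH||o e1 IH1 e2 IH2] /=; try exact: poly_const;
 try exact: poly_id.
- do 4?[apply: poly_add]; try exact: poly_const; try exact: poly_id => //.
 by apply: poly_mul => //; exact: poly_const.
 by [].
- do 2?[apply: poly_add]; try exact: poly_const; try exact: poly_id => //.
 by [].
- by do 2?[apply: poly_add] => //; apply: poly_mul.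
Qed.

Lemma cwords_poly K c : poly_bounded (fun V => cwords K V c).
Proof.
have HC := poly_const; have HI := poly_id; have HE := ewords_poly K.
elim: c => [|x e|a e1 e2|e1 e2|c1 H1 c2 H2|e c1 H1 c2 H2|x c H] /=;
 do ?[apply: poly_add] => //; by apply: poly_mul.
Qed.

(** * Whole RAM programs from loop programs *)

Definition loop_output n s (a : option nat) :=
 match a with
 | None => var s 0 = 0
 | Some N => [/\ var s 0 = 1, var s 1 <= n,
 forall i, i < var s 1 -> inp s i < 2
 & N = \sum_(i < var s 1) inp s i * 2 ^ i]
 end.

Definition init_store input :=
 Mk (fun=> 0) (fun _ _ => 0) (nth 0 input).

(** The machine is not told the length of its input. The prologue hops from clause header to clause
    header, adding [size c + 1] to register 2 until the clause count in register 5 is used up.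
    Registers 9 and 11 hold the constants 1 and 0, the latter for the unconditional jump back. *)
Definition prologue : program :=
 [:: Const 9 1; Const 11 0; Const 2 1; Read 5 11;
 JumpZ 5 10; Read 7 2; Binop Add 2 2 7; Binop Add 2 2 9;
 Binop Defs.Sub 5 5 9; JumpZ 11 4].

Definition epilogue : program :=
 [:: Const 5 0; Binop Add 0 4 5; Binop Add 1 6 5].

Lemma size_encode L :
 size (encode L) = 1 + \sum_(c <- L) (1 + size c).
Proof.
rewrite /encode /= add1n; congr _.+1.
elim: L => [|c L IH] /=; first by rewrite big_nil.
by rewrite big_cons size_cat /= size_map IH; lia.
Qed.

Lemma nth_encode L1 c L2 :
 nth 0 (encode (L1 ++ c :: L2)) (size (encode L1)) = size c.
Proof.
by rewrite /encode /= map_cat flatten_cat nth_cat ltnn subnn.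
Qed.

Lemma prologue_ok P W L : code_at P 0 prologue -> size (encode L) < W -> 1 < W ->
 (forall v, v \in encode L -> v < W) ->
 exists m R, [/\ m <= 5 + 6 * size (encode L),
 steps W P m (init (encode L)) (Config 10 R (nth 0 (encode L))),
 R 2 = size (encode L) & forall x, R (vr x) = 0].
Proof.
move=> /code_at_cons [c0 /code_at_cons [c1 /code_at_cons [c2 /code_at_cons [c3]]]].
move=> /code_at_cons [c4 /code_at_cons [c5 /code_at_cons [c6 /code_at_cons [c7]]]].
move=> /code_at_cons [c8 /code_at_cons [c9 _]] lW W1 valW.
set M := nth 0 (encode L).
have inv : forall L2 L1 R, L = L1 ++ L2 -> R 2 = size (encode L1) ->
 R 5 = size L2 -> R 9 = 1 -> R 11 = 0 -> (forall x, R (vr x) = 0) ->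
 exists m R', [/\ m <= 1 + 6 * size L2,
 steps W P m (Config 4 R M) (Config 10 R' M),
 R' 2 = size (encode L) & forall x, R' (vr x) = 0].
 elim=> [|c L2 IH] L1 R EL R2 R5 R9 R11 Rv.
 exists 1, R; split=> //; last by rewrite EL cats0.
 by have := @steps_jump W P _ R M _ _ c4; rewrite R5.
 have Mp : M (size (encode L1)) = size c by rewrite /M EL nth_encode.
 have Esz : size (encode (rcons L1 c)) = size (encode L1) + size c + 1.
 by rewrite !size_encode -cats1 big_cat big_seq1 /=; lia.
 have le1 : size (encode (rcons L1 c)) <= size (encode L).
 by rewrite EL -cat_rcons !size_encode big_cat /=; lia.
 have le2 : (size L2).+1 <= size (encode L).
 rewrite EL size_encode big_cat big_cons /=.
 have : size L2 <= \sum_(j <- L2) (1 + size j).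
 by elim: (L2) => //= d l IHl; rewrite big_cons; lia.
 by lia.
 pose R1 := upd R 7 (size c).
 pose R2' := upd R1 2 (size (encode L1) + size c).
 pose R3 := upd R2' 2 (size (encode L1) + size c + 1).
 pose R4 := upd R3 5 (size L2).
 have [||||||m [R' [lm st E Rv']]] := IH (rcons L1 c) R4.
 - by rewrite cat_rcons.
 - by rewrite Esz.
 - by [].
 - by rewrite /R4 /R3 /R2' /R1 /upd /=.
 - by rewrite /R4 /R3 /R2' /R1 /upd /=.
 - move=> x; rewrite /R4 /R3 /R2' /R1 /upd.
 by do 4!(rewrite ifF; last by rewrite /vr; lia).
 exists (6 + m), R'; split=> //; first by rewrite /=; lia.
 apply: steps_trans st; rewrite (_ : 6 = 1 + (1 + (1 + (1 + (1 + 1))))) //.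
 apply: (@steps_trans _ _ _ _ _ (Config 5 R M)).
 by have := @steps_jump W P _ R M _ _ c4; rewrite R5.
 apply: (@steps_trans _ _ _ _ _ (Config 6 R1 M)).
 by have := @steps_read W P _ R M _ _ c5; rewrite R2 Mp; apply; lia.
 apply: (@steps_trans _ _ _ _ _ (Config 7 R2' M)).
 have := @steps_binop W P _ R1 M _ _ _ _ c6.
 have -> : R1 2 = size (encode L1) by rewrite /R1 /upd.
 have -> : R1 7 = size c by [].
 by apply; rewrite /eval_binop; lia.
 apply: (@steps_trans _ _ _ _ _ (Config 8 R3 M)).
 have := @steps_binop W P _ R2' M _ _ _ _ c7.
 have -> : R2' 2 = size (encode L1) + size c by [].
 have -> : R2' 9 = 1 by rewrite /R2' /R1 /upd.
 by apply; rewrite /eval_binop; lia.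
 apply: (@steps_trans _ _ _ _ _ (Config 9 R4 M)).
 have := @steps_binop W P _ R3 M _ _ _ _ c8.
 have -> : R3 5 = (size L2).+1 by rewrite /R3 /R2' /R1 /upd /= R5.
 have -> : R3 9 = 1 by rewrite /R3 /R2' /R1 /upd.
 by rewrite /= subn1; apply => /=; lia.
 have := @steps_jump W P _ R4 M _ _ c9.
 by have -> : R4 11 = 0 by rewrite /R4 /R3 /R2' /R1 /upd.
pose R0 : nat -> nat := fun=> 0.
pose R1 := upd R0 9 1.
pose R2 := upd R1 11 0.
pose R3 := upd R2 2 1.
pose R4 := upd R3 5 (size L).
have [||||||m [R [lm st E Rv]]] := inv L [::] R4; rewrite ?/R4 //.
 move=> x; rewrite /R4 /R3 /R2 /R1 /upd.
 by do 4!(rewrite ifF; last by rewrite /vr; lia).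
exists (4 + m), R; split=> //.
 have : size L < size (encode L).
 rewrite size_encode; elim: (L) => [|c l IHl]; first by rewrite big_nil.
 by rewrite big_cons /=; lia.
 by lia.
apply: steps_trans st; rewrite (_ : 4 = 1 + (1 + (1 + 1))) //.
apply: steps_trans (@steps_const W P _ _ _ _ _ c0 _) _ => //.
apply: steps_trans (@steps_const W P _ _ _ _ _ c1 _) _ => //; first by lia.
apply: steps_trans (@steps_const W P _ _ _ _ _ c2 _) _ => //.
have := @steps_read W P _ R3 M _ _ c3.
have -> : M (R3 11) = size L by [].
by apply; apply: valW; rewrite inE eqxx.
Qed.

(** [X] bounds the length of the input as well as its words, since variable names may be far larger
    than the length. The time depends on the length alone, the word size on [X]. *)
Lemma loop_computes c : wf c -> depth c <= 3 ->
 exists P C, forall L X, (forall v, v \in encode L -> v <= X) ->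
 size (encode L) <= X -> forall a,
 loop_output (size (encode L))
 (run (size (encode L)) c (init_store (encode L))) a ->
 computes P (C * X.+1 ^ C) (C * size (encode L) ^ 3) (encode L) a.
Proof.
(* The dummy entry makes the number of arrays positive, as the interleaved layout requires. *)
move=> wc dc; pose al := undup ((0, 0, 0) :: arrays c).
have K0 : 0 < size al by rewrite /al -has_predT; apply/hasP; exists (0,0,0); rewrite ?mem_undup ?inE.
have ual : uniq al by apply: undup_uniq.
have sal : {subset arrays c <= al} by move=> b bc; rewrite mem_undup inE bc orbT.
have [k1 Hk1] := cost_poly c; have [k2 Hk2] := growth_poly c.
have [d Hd] := cwords_poly (size al) c.
pose P := prologue ++ ccomp al 10 c 0 ++ epilogue.
(* Stored values satisfy [V.+2 <= (k2 + 3) * X.+1 ^ 3], and all words are at most [V.+2 ^ d]; the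
   summand 4 leaves room for strictness and for the small constants of the prologue. *)
pose C1 := (k2 + 3) ^ d.+1 + 4.
pose C := maxn (C1 + 3 * d.+1) (14 + k1 * 8).
exists P, C => L X valX nX a out; set n := size _ in nX out *.
have n0 : 0 < n by rewrite /n.
pose V := X + growth n c.
have V2 : V.+2 <= (k2 + 3) * X.+1 ^ 3.
 have h := Hk2 n; have h3 : n.+1 ^ depth c <= X.+1 ^ 3.
 apply: leq_trans (_ : X.+1 ^ depth c <= _); last by rewrite leq_pexp2l.
 by case: (depth c) => // e; rewrite leq_exp2r.
 have h4 := leq_mul (leqnn k2) h3.
 have h5 : X.+1 <= X.+1 ^ 3 by rewrite -{1}(expn1 X.+1) leq_pexp2l.
 by rewrite mulnDl /V; move: h h3 h4 h5; set a3 := X.+1 ^ 3; lia.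
pose W := C * X.+1 ^ C.
have Wbig : ((k2 + 3) * X.+1 ^ 3) ^ d.+1 + 4 <= W.
 rewrite expnMn -expnM.
 apply: leq_trans (_ : C1 * X.+1 ^ (3 * d.+1) <= _).
 rewrite /C1 mulnDl leq_add2l -[X in X <= _]muln1 leq_mul //.
 by rewrite expn_gt0.
 apply: leq_mul_exp => //; rewrite /C leq_max; apply/orP; left; lia.
have pV : V.+2 ^ d.+1 <= ((k2 + 3) * X.+1 ^ 3) ^ d.+1 by rewrite leq_exp2r.
have VW : V < W.
 apply: leq_trans Wbig; rewrite -addn1; apply: leq_add => //.
 apply: leq_trans pV; rewrite expnS -{1}(muln1 V) leq_mul //; first by lia.
 by rewrite expn_gt0.
have wW : cwords (size al) V c < W.
 apply: leq_trans Wbig; rewrite -addn1; apply: leq_add => //.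
 apply: leq_trans (Hd V) _; apply: leq_trans pV; exact: leq_pexp2l.
have cP0 : code_at P 0 prologue.
 by move=> i lt; rewrite /P nth_cat lt.
have cP1 : code_at P 10 (ccomp al 10 c 0).
 by move=> i lt; rewrite -[LHS]/(nth Halt (ccomp al 10 c 0 ++ epilogue) i) nth_cat lt.
have cP2 : code_at P (10 + size (ccomp al 10 c 0)) epilogue.
 move=> i lt; rewrite -addnA -[LHS]/(nth Halt (ccomp al 10 c 0 ++ epilogue) _).
 by rewrite nth_cat ifF ?addKn //; lia.
have [|||m1 [R1 [l1 st1 E1 Rv1]]] := @prologue_ok P W L cP0.
- by rewrite -/n /V in VW *; lia.
- by lia.
- by move=> v /valX; rewrite /V in VW; lia.
have rp1 : rep al n (init_store (encode L)) R1 (nth 0 (encode L)).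
 split=> //= b i bal; rewrite nth_default // -/n; lia.
have b1 : bounded X (init_store (encode L)).
 split=> //= i; case: (ltnP i n) => lt; last by rewrite nth_default.
 by apply: valX; rewrite mem_nth.
have nV : n <= V by rewrite /V; lia.
have gV : X + growth n c <= V by [].
have [m2 [R2 [M2 [l2 st2 rp2 _]]]] :=
 ccomp_ok K0 ual nV VW cP1 rp1 b1 nX gV wc sal wW.
have [R22 Rv2 Hi2 _] := rp2.
have b2 : bounded V (run n c (init_store (encode L))) by apply: run_bounded.
move: cP2 => /code_at_cons [c0 /code_at_cons [c1 /code_at_cons [c2 _]]].
set q := 10 + _ in c0 c1 c2 st2.
set s := run _ _ _ in out rp2 Rv2 Hi2 b2 *.
have [bv _ _] := b2.
pose R3 := upd R2 5 0.
pose R4 := upd R3 0 (var s 0).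
pose R5 := upd R4 1 (var s 1).
exists (m1 + m2 + 3), (Config q.+3 R5 M2); split.
- have h := Hk1 n; have h3 : n.+1 ^ depth c <= 8 * n ^ 3.
 apply: leq_trans (_ : n.+1 ^ 3 <= _); first by rewrite leq_pexp2l.
 by rewrite (_ : 8 = 2 ^ 3) // -expnMn leq_exp2r //; lia.
 have h4 := leq_mul (leqnn k1) h3.
 have h5 : n <= n ^ 3 by rewrite -{1}(expn1 n) leq_pexp2l.
 apply: leq_trans (_ : (14 + k1 * 8) * n ^ 3 <= _); last first.
 by apply: leq_mul => //; rewrite /C leq_maxr.
 by rewrite -/n in l1; rewrite mulnDl -mulnA; lia.
- apply: steps_trans (steps_trans st1 st2) _; rewrite (_ : 3 = 1 + (1 + 1)) //.
 apply: steps_trans (@steps_const W P _ _ _ _ _ c0 _) _; first by lia.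
 apply: (@steps_trans _ _ _ _ _ (Config q.+2 R4 M2)).
 have := @steps_binop W P _ R3 M2 _ _ _ _ c1.
 have -> : R3 4 = var s 0 by rewrite -Rv2.
 have -> : R3 5 = 0 by [].
 by rewrite /= addn0; apply; apply: leq_ltn_trans VW.
 have := @steps_binop W P _ R4 M2 _ _ _ _ c2.
 have -> : R4 6 = var s 1 by rewrite -Rv2.
 have -> : R4 5 = 0 by [].
 by rewrite /= addn0; apply; apply: leq_ltn_trans VW.
- by rewrite /halted /current /= nth_default // /P !size_cat /= /q; lia.
- case: a out => [N|] //= [v0 v1 dig EN]; rewrite /R5 /R4 /upd /=; split=> //.
 + by move=> i lt; rewrite Hi2 ?dig //; lia.
 + by rewrite EN; apply: eq_bigr => i _; rewrite Hi2 //; have := ltn_ord i; lia.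
Qed.

(** * Elimination orders *)

Lemma connect_inv (T : finType) (e e' : rel T) (P : T -> Prop) x y :
 connect e x y -> P x -> (forall a b, P a -> e a b -> P b /\ e' a b) ->
 connect e' x y /\ P y.
Proof.
move=> /connectP [p pth ->] Px H; elim: p x Px pth => [|b p IH] x Px /=.
 by move=> _; split.
case/andP=> exb pth; have [Pb e'xb] := H _ _ Px exb.
by have [c Pl] := IH b Pb pth; split=> //; apply: connect_trans (connect1 e'xb) c.
Qed.

Lemma connect_cross (T : finType) (e : rel T) (P : pred T) x y :
 connect e x y -> P x -> ~~ P y -> exists a b, [/\ e a b, P a & ~~ P b].
Proof.
move=> c Px nPy; case: (pselect (exists a b, [/\ e a b, P a & ~~ P b])) => // H.
have [|_ Py] := connect_inv (e' := e) (P := fun z => P z) c Px; last by rewrite Py in nPy.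
move=> a b Pa eab; split=> //; case: (boolP (P b)) => // nPb.
by case: H; exists a, b.
Qed.

(** * Components, fill-in neighbours and separators *)

Section Comp.
Variables (V : finType) (g : rel V).

Definition within (A : {set V}) : rel V :=
 [rel a b | [&& g a b, a \in A & b \in A]].

Definition component A x := [set y | connect (within A) x y].

Lemma compxx (A : {set V}) x : x \in component A x.
Proof. by rewrite inE connect0. Qed.

Lemma comp_sub (A : {set V}) x : x \in A -> component A x \subset A.
Proof.
move=> xA; apply/subsetP=> y; rewrite inE => c.
have [||_ //] := @connect_inv _ _ (within A) (fun z => z \in A) _ _ c => //.
by move=> a b aA eab; split=> //; case/and3P: eab.
Qed.

Lemma comp_step (A : {set V}) x a b : a \in component A x -> g a b -> a \in A -> b \in A ->
 b \in component A x.
Proof.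
rewrite !inE => c gab aA bA; apply: connect_trans c (connect1 _).
exact/and3P.
Qed.

Lemma comp_ind (A : {set V}) x (P : V -> Prop) : P x ->
 (forall a b, P a -> a \in A -> b \in A -> g a b -> P b) ->
 forall y, y \in component A x -> P y.
Proof.
move=> Px H y; rewrite inE => c.
have [||_ //] := @connect_inv _ _ (within A) P _ _ c => //.
by move=> a b Pa eab; split=> //; case/and3P: eab => gab aA bA; apply: H gab.
Qed.

Lemma comp_mono (A A' : {set V}) x : A \subset A' -> component A x \subset component A' x.
Proof.
move=> sub; apply/subsetP=> y; rewrite !inE; apply: connect_sub => a b.
case/and3P=> gab aA bA; apply: connect1; apply/and3P.
by rewrite !(subsetP sub).
Qed.

Hypothesis gsym : symmetric g.

Lemma comp_sym (A : {set V}) x y : (y \in component A x) = (x \in component A y).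
Proof.
rewrite !inE; apply: sym_connect_sym => a b; rewrite /within /= gsym.
by rewrite [X in _ && X]andbC.
Qed.

Lemma comp_eq (A : {set V}) x y : y \in component A x -> component A y = component A x.
Proof.
move=> yx; have xy : x \in component A y by rewrite comp_sym.
apply/setP=> z; rewrite inE in yx; rewrite inE in xy; rewrite !inE.
by apply/idP/idP; apply: connect_trans.
Qed.

Lemma comp_self (A : {set V}) x : x \in A -> component (component A x) x = component A x.
Proof.
move=> xA; apply/eqP; rewrite eqEsubset comp_mono ?comp_sub // andTb.
suff H y : y \in component A x ->
 y \in component (component A x) x /\ y \in component A x.
 by apply/subsetP => y /H [].
move: y; apply: comp_ind; first by rewrite !compxx.
move=> a b [ac ac'] aA bA gab.
have bc : b \in component A x := comp_step ac' gab aA bA.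
by split=> //; apply: comp_step gab _ _.
Qed.

Section Order.
Variable r : V -> nat.

Definition earlier v := [set x | r x <= r v].
(** The fill-in neighbours of [v]: the later vertices that become adjacent to [v] once the earlier
    ones are eliminated, described by reachability instead of a sequence of graphs. *)
Definition elim_nbrs v :=
 [set u | (r v < r u) && [exists x in component (earlier v) v, g x u]].

Variable w : nat.
Hypotheses (rinj : injective r) (rw : forall v, #|elim_nbrs v| <= w).

Lemma low_self v : v \in earlier v.
Proof. by rewrite inE. Qed.

Lemma comp_low v a b : a \in component (earlier v) v -> g a b ->
 (b \in component (earlier v) v) || (b \in elim_nbrs v).
Proof.
move=> av gab; case: (leqP (r b) (r v)) => lt.
 rewrite (comp_step av gab) ?inE //.
 by have := subsetP (comp_sub (low_self v)) _ av; rewrite inE.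
by rewrite orbC inE lt; apply/orP; left; apply/existsP; exists a; rewrite av.
Qed.

Lemma comp_top (A : {set V}) x : x \in A -> exists2 v, v \in component A x &
 component A x \subset component (earlier v) v.
Proof.
move=> xA; have [v vC vmax] := arg_maxnP r (compxx A x).
exists v => //; rewrite -(comp_eq vC).
have vA : v \in A by apply: (subsetP (comp_sub xA)).
rewrite -comp_self //; apply: comp_mono; apply/subsetP=> y.
by rewrite (comp_eq vC) => yC; rewrite inE; apply: vmax.
Qed.

(** Take the earliest [v] whose component among the earlier vertices holds more than half of [W],
    and remove [v] with its fill-in neighbours. A remaining component inside has an earlier latest
    vertex, so it is light by minimality of [v]; one outside misses more than half of [W]. *)
Lemma balanced_separator (W : {set V}) : exists2 Z : {set V}, #|Z| <= w.+1 &
 forall x, x \notin Z -> #|W :&: component (~: Z) x|.*2 <= #|W|.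
Proof.
pose heavy v := #|W| < #|W :&: component (earlier v) v|.*2.
case: (pickP heavy) => [v0 hv0|nh]; last first.
 exists set0; first by rewrite cards0.
 move=> x _; have [|v _ sub] := @comp_top (~: set0) x; first by rewrite !inE.
 have := nh v; rewrite /heavy; have := subset_leq_card (setIS W sub); lia.
have [v hv vmin] := arg_minnP r hv0.
have vR : v \notin elim_nbrs v by rewrite inE ltnn.
exists (v |: elim_nbrs v); first by rewrite cardsU1 vR; have := rw v; lia.
move=> x xZ; set Z := v |: _ in xZ *; set D := component (earlier v) v.
have xA : x \in ~: Z by rewrite inE.
have nR u : u \in ~: Z -> (u \in elim_nbrs v) = false.
 by rewrite in_setC in_setU1 negb_or => /andP [_ /negbTE].
have CD y z : z \in component (~: Z) y -> y \in D -> z \in D.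
 move=> zC yD; apply: (comp_ind (P := fun z => z \in D)) zC => // a b aD _ bZ gab.
 by have := comp_low aD gab; rewrite nR ?orbF.
case: (boolP (x \in D)) => xD.
 have [v' v'C sub] := comp_top xA.
 have v'v : v' != v.
 by have := subsetP (comp_sub xA) _ v'C; rewrite !inE negb_or => /andP [].
 have v'D := CD _ _ v'C xD.
 have le : r v' <= r v.
 by have := subsetP (comp_sub (low_self v)) _ v'D; rewrite inE.
 have lt : r v' < r v by rewrite ltn_neqAle le andbT (inj_eq rinj).
 have : ~~ heavy v' by apply: contraTN lt => /vmin; rewrite -leqNgt.
 by rewrite /heavy; have := subset_leq_card (setIS W sub); lia.
have dis : (W :&: component (~: Z) x) :&: (W :&: D) = set0.
 apply/setP => y; rewrite !in_setI in_set0; apply/negbTE/negP.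
 case/andP=> /andP [_ yC] /andP [_ yD]; case/negP: xD.
 by rewrite comp_sym in yC; apply: CD yC yD.
have : #|(W :&: component (~: Z) x) :|: (W :&: D)| <= #|W|.
 by apply: subset_leq_card; rewrite subUset !subsetIl.
by move: hv; rewrite cardsU dis cards0 subn0 /heavy -/D; lia.
Qed.

Lemma card_bigcup_le (I : finType) (A : {pred I}) (F : I -> {set V}) m :
 (forall i, i \in A -> #|F i| <= m) -> #|\bigcup_(i in A) F i| <= #|A| * m.
Proof.
move=> H; rewrite -sum_nat_const.
elim/big_ind2: _ => [||i iA]; first by rewrite cards0.
 move=> S1 n1 S2 n2 h1 h2; apply: leq_trans (leq_add h1 h2).
 by rewrite cardsU leq_subr.
exact: H.
Qed.

(** Remove the fill-in neighbours of all members of [X]. Let [v] be the latest vertex of a remaining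
    component and [x] a member of [X] touching it. If [x] came before [v], the component would lie
    in the earlier component of [x], because leaving that crosses a removed vertex; then [v] would
    not come after [x]. So [x] is a fill-in neighbour of [v]. *)
Lemma touch_separator (X : {set V}) : exists2 Z : {set V}, #|Z| <= w * #|X| &
 forall y, y \notin X :|: Z ->
 #|[set x in X | [exists z in component (~: (X :|: Z)) y, g z x]]| <= w.
Proof.
exists (\bigcup_(x in X) elim_nbrs x).
 by rewrite mulnC; apply: card_bigcup_le => x _.
move=> y yN; set Z := \bigcup_(x in X) _ in yN *; set A := ~: _.
have yA : y \in A by rewrite inE.
have [v vC sub] := comp_top yA.
apply: leq_trans (rw v); apply: subset_leq_card; apply/subsetP => x.
rewrite inE => /andP [xX /existsP [z /andP [zC gzx]]].
have vA := subsetP (comp_sub yA) _ vC; have zA := subsetP (comp_sub yA) _ zC.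
case: (ltnP (r v) (r x)) => lt.
 by rewrite inE lt; apply/existsP; exists z; rewrite gzx (subsetP sub).
have nZ u : u \in A -> u \notin elim_nbrs x.
 rewrite !inE negb_or => /andP [_ uZ]; apply: contra uZ => uR.
 by apply/bigcupP; exists x => //; rewrite inE.
have zD : z \in component (earlier x) x.
 have := comp_low (compxx _ x); rewrite gsym in gzx => /(_ _ gzx).
 by rewrite (negbTE (nZ z zA)) orbF.
have vzC : v \in component A z by rewrite (comp_eq zC).
have vD : v \in component (earlier x) x.
 apply: (comp_ind (P := fun u => u \in component (earlier x) x)) vzC => // a b aD aA bA gab.
 by have := comp_low aD gab; rewrite (negbTE (nZ b bA)) orbF.
have := subsetP (comp_sub (low_self x)) _ vD; rewrite inE => le.
have E : x = v by apply: rinj; apply/eqP; rewrite eqn_leq lt le.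
by move: vA; rewrite -E !inE xX.
Qed.

End Order.
End Comp.

(** * From tree decompositions to elimination orders *)

Section TreeToOrder.
Variables (V T : finType) (g : rel V) (e : rel T) (bag : T -> {set V}) (w : nat).
Hypotheses (etree : is_tree e)
 (bedge : forall u v, g u v -> exists i, (u \in bag i) && (v \in bag i))
 (bconn : forall v i j, v \in bag i -> v \in bag j ->
 connect [rel a b | [&& e a b, v \in bag a & v \in bag b]] i j)
 (bsize : forall i, #|bag i| <= w.+1).

Let esym : symmetric e. Proof. by case: etree. Qed.
Let eirr : irreflexive e. Proof. by case: etree. Qed.

Lemma tree_root : exists r0 : T, true.
Proof. by case: etree => _ _ /card_gt0P [i _] _ _; exists i. Qed.

Let r0 := xchoose tree_root.

Definition avoid i := [rel a b | [&& e a b, a != i & b != i]].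

(** With the tree rooted at [r0], these are the nodes outside the subtree at [i]: those reached from
    the root without passing through [i]. For the root the set is empty. *)
Definition outside i : {set T} :=
 [set j | [&& i != r0, j != i & connect (avoid i) r0 j]].

Lemma outside_step i a b : a \in outside i -> e a b -> b != i -> b \in outside i.
Proof.
rewrite !inE => /and3P [-> ai c] eab bi; rewrite bi /=.
by apply: connect_trans c (connect1 _); rewrite /= eab ai.
Qed.

Lemma outside_sub i j : j \notin outside i -> j != i -> outside i \subset outside j.
Proof.
move=> jO ji; apply/subsetP => a aO.
have ir0 : i != r0 by move: aO; rewrite inE => /and3P [].
have r0O : r0 \in outside i by rewrite inE ir0 eq_sym ir0 connect0.
have jr0 : j != r0 by apply: contraNneq jO => ->.
have nj b : b \in outside i -> b != j by move=> bO; apply: contraNneq jO => <-.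
rewrite inE jr0 nj //=.
have c : connect (avoid i) r0 a by move: aO; rewrite inE => /and3P [].
have [||//] := @connect_inv _ _ (avoid j) (fun z => z \in outside i) _ _ c => //.
move=> x y xO /and3P [exy xi yi]; have yO := outside_step xO exy yi.
by split=> //=; rewrite exy !nj.
Qed.

Lemma outside_total i j : i != j -> (i \in outside j) || (j \in outside i).
Proof.
move=> ij; case: (eqVneq i r0) => [E|ir0].
 by rewrite E in ij *; rewrite [r0 \in _]inE ij eq_sym ij connect0.
case: (eqVneq j r0) => [E|jr0].
 by rewrite !inE E ir0 eq_sym ir0 connect0 orbT.
have c : connect e r0 i by case: etree.
case/connectP: c => p pth li.
have : forall p x, x != i -> x != j -> connect (avoid i) r0 x ->
 connect (avoid j) r0 x -> path e x p -> i = last x p ->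
 (i \in outside j) || (j \in outside i).
 elim=> [|b q IH] x xi xj ci cj /=; first by move=> _ E; rewrite E eqxx in xi.
 case/andP=> exb pthq lq.
 case: (eqVneq b i) => [E|bi].
 apply/orP; left; rewrite inE jr0 ij /=; apply: connect_trans cj (connect1 _).
 by rewrite /= -E exb xj E.
 case: (eqVneq b j) => [E|bj].
 apply/orP; right; rewrite inE ir0 eq_sym ij /=.
 by apply: connect_trans ci (connect1 _); rewrite /= -E exb xi E eq_sym.
 apply: IH lq => //.
 by apply: connect_trans ci (connect1 _); rewrite /= exb xi bi.
 by apply: connect_trans cj (connect1 _); rewrite /= exb xj bj.
by move/(_ p r0); apply; rewrite ?connect0 // eq_sym.
Qed.

(** Otherwise [i] has a neighbour [p], different from [b], on a path from the root that avoids [b].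
    Both [p] and [b] are reached from the root avoiding [i], so a path between them closes with [i]
    to a cycle of length at least 3. *)
Lemma outside_parent i b : b \in outside i -> e i b -> i \notin outside b.
Proof.
move=> bO eib; apply/negP => iO.
move: (bO); rewrite inE => /and3P [ir0 bi cb].
move: (iO); rewrite inE => /and3P [br0 ib ci].
have [p [epi pi pb cp]] : exists p, [/\ e p i, p != i, p != b & connect (avoid i) r0 p].
 case/connectP: ci => q pth lq.
 have : forall q x, x != i -> x != b -> connect (avoid i) r0 x ->
 path (avoid b) x q -> i = last x q ->
 exists p, [/\ e p i, p != i, p != b & connect (avoid i) r0 p].
 elim=> [|y s IH] x xi xb cx /=; first by move=> _ E; rewrite E eqxx in xi.
 case/andP=> /and3P [exy _ yb] pths ls.
 case: (eqVneq y i) => [E|yi]; first by exists x; split; rewrite // -E.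
 by apply: IH ls => //; apply: connect_trans cx (connect1 _); rewrite /= exy xi.
 by move/(_ q r0); apply; rewrite ?connect0 // eq_sym.
have asym : connect_sym (avoid i).
 by apply: sym_connect_sym => x y /=; rewrite esym [X in _ && X]andbC.
have cpb : connect (avoid i) p b by rewrite asym in cp; apply: connect_trans cp cb.
case/connectP: cpb => q0 pth0 lb0.
case: (shortenP pth0) lb0 => q pth uq _ lb.
have qi : all (fun x => x != i) (p :: q).
 elim: q p pi pth {uq lb pth0 epi pb cp} => [|y s IH] p pi /=; first by rewrite pi.
 by case/andP=> /and3P [_ _ yi] pth; rewrite pi; apply: IH.
have pthe : path e p q.
 by apply: sub_path pth => x y /and3P [].
have sz : size (i :: p :: q) < 3.
 case: etree => _ _ _ _; apply; apply/andP; split.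
 by rewrite /= rcons_path pthe -lb esym epi esym eib.
 rewrite cons_uniq uq andbT; apply/negP => iq.
 by have := allP qi _ iq; rewrite eqxx.
case: q lb sz {pth uq qi pthe} => // E _.
by rewrite /= in E; rewrite E eqxx in pb.
Qed.

(** The size of the subtree at [i], which grows towards the root. *)
Definition depth_ i := #|~: outside i|.

Lemma depth_lt i j : j \notin outside i -> j != i -> depth_ j < depth_ i.
Proof.
move=> jO ji; apply: proper_card; rewrite properE.
rewrite setCS outside_sub //=; apply/subsetPn; exists i.
 by rewrite !inE eqxx andbF.
have := outside_total ji; rewrite (negbTE jO) /=.
by rewrite in_setC negbK.
Qed.

(** The nodes of [v] form a connected part of the tree, so this is the subtree size at the topmost
    of them. *)
Let dv v := \max_(i | v \in bag i) depth_ i.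

Lemma dv_ge v i : v \in bag i -> depth_ i <= dv v.
Proof. by move=> vi; rewrite /dv (bigD1 i) //= leq_maxl. Qed.

Lemma dv_top v i : v \in bag i -> exists2 j, v \in bag j & dv v = depth_ j.
Proof.
move=> vi; have c0 : 0 < #|[pred i | v \in bag i]| by apply/card_gt0P; exists i.
by have [j vj E] := eq_bigmax_cond depth_ c0; exists j => //; rewrite /dv E.
Qed.

(** The node [i] is the only gate between its subtree and the rest, and the nodes that hold [x] are
    connected; the step out of the subtree goes from [i] to a node with a larger subtree. *)
Lemma bag_cross x i j j' : x \in bag j -> x \in bag j' ->
 j \notin outside i -> j' \in outside i ->
 x \in bag i /\ exists2 b, x \in bag b & depth_ i < depth_ b.
Proof.
move=> xj xj' jO jO'.
have [|a [b [/and3P [eab xa xb] aO bO]]] :=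
 @connect_cross _ _ (fun z => z \notin outside i) _ _ (bconn xj xj') jO.
 by rewrite negbK.
rewrite negbK in bO.
have Ea : a = i.
 apply/eqP; case: (eqVneq a i) => // ai; case/negP: aO.
 by apply: (outside_step bO); rewrite // esym.
subst a; split=> //; exists b => //.
apply: depth_lt; first exact: outside_parent.
by apply: contraTneq eab => ->; rewrite eirr.
Qed.

(** Order the vertices by the subtree size at their topmost node, ties broken by rank. Whatever [v]
    reaches through earlier vertices stays in the subtree at the top node of [v], and a later vertex
    touching it must occur in that top bag; without [v] the bag has at most [w] members. A vertex in
    no bag has no edges, hence no fill-in neighbours. *)
Lemma tree_elim_order : exists2 r : V -> nat, injective r &
 forall v, #|elim_nbrs g r v| <= w.
Proof.
pose r v := dv v * #|V| + enum_rank v.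
have rle a b : r a <= r b -> dv a <= dv b.
 rewrite /r; move: (ltn_ord (enum_rank b)).
 set N := #|V|; set ra := nat_of_ord _; set rb := nat_of_ord _.
 move=> lb le; rewrite leqNgt; apply/negP => lt.
 by have := leq_mul lt (leqnn N); rewrite mulSn; lia.
exists r.
 move=> a b E; have Ed : dv a = dv b.
 by apply/eqP; rewrite eqn_leq; apply/andP; split; apply: rle; rewrite E.
 apply: enum_rank_inj; apply: val_inj; move: E; rewrite /r Ed /=; lia.
move=> v; case: (pickP (fun i => v \in bag i)) => [i0 vi0|nb]; last first.
 rewrite (_ : elim_nbrs g r v = set0) ?cards0 //; apply/setP => u.
 rewrite !inE; apply/negbTE/negP => /andP [_ /existsP [x /andP [xv gxu]]].
 have E : x = v.
 apply: (comp_ind (P := fun z => z = v)) xv => // a b -> _ _ gvb.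
 by have [i /andP []] := bedge gvb; rewrite nb.
 by have [i /andP []] := bedge gxu; rewrite E nb.
have [i vi Ei] := dv_top vi0.
apply: leq_trans (_ : #|bag i :\ v| <= _); last first.
 by have := cardsD1 v (bag i); rewrite vi; have := bsize i; lia.
apply: subset_leq_card; apply/subsetP => u.
have iO : i \notin outside i by rewrite inE eqxx andbF.
have inside x j : x \in bag j -> j \notin outside i -> dv x <= depth_ i ->
 forall j', x \in bag j' -> j' \notin outside i.
 move=> xj jO le j' xj'; apply/negP => jO'.
 have [_ [b xb lt]] := bag_cross xj xj' jO jO'.
 by have := dv_ge xb; lia.
have allin x : x \in component g (earlier r v) v -> forall j, x \in bag j -> j \notin outside i.
 apply: (comp_ind (P := fun x => forall j, x \in bag j -> j \notin outside i)).
 by apply: (inside _ i) => //; rewrite Ei.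
 move=> a b Pa _ bl gab; have [j /andP [aj bj]] := bedge gab.
 apply: (inside _ j) => //; first exact: Pa.
 by rewrite -Ei; apply: rle; rewrite inE in bl.
rewrite inE => /andP [lt /existsP [x /andP [xv gxu]]].
have [j /andP [xj uj]] := bedge gxu; have jO := allin _ xv _ xj.
rewrite !inE; apply/andP; split; first by apply: contraTneq lt => ->; rewrite ltnn.
apply/negPn/negP => ui.
have [j0 uj0 Ej0] := dv_top uj.
have j0O : j0 \notin outside i.
 by apply/negP => j0O; have [ui' _] := bag_cross uj uj0 jO j0O; rewrite ui' in ui.
have j0i : j0 != i by apply: contraNneq ui => <-.
by have := rle _ _ (ltnW lt); rewrite Ei Ej0 leqNgt depth_lt.
Qed.

End TreeToOrder.

(** * Disjoint backdoors *)

Section Backdoors.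
Variables (V : finType) (g : rel V) (isv : pred V) (sgn : V -> V -> bool).
Hypotheses (gsym : symmetric g) (gbip : forall u v, g u v -> isv u -> ~~ isv v).

(** [tau] is the set of the variables of [B] set to true, and [sgn b c] says that [b] occurs
    positively in [c]. So [B] goes, together with the clauses satisfied by the assignment. *)
Definition killed (B tau : {set V}) : {set V} :=
 B :|: [set c | [exists b in B, g b c && (sgn b c == (b \in tau))]].

Definition touched (X K : {set V}) := [set x in X | [exists z in K, g z x]].

Definition separates (W Z A : {set V}) :=
 forall x, x \in A :\: Z -> #|W :&: component g (A :\: Z) x|.*2 <= #|W|.

Definition shatters w (X Z A : {set V}) :=
 forall x, x \in A :\: (X :|: Z) ->
 #|touched (X :&: A) (component g (A :\: (X :|: Z)) x)| <= w.

(** The two traces of bounded width that the argument with disjoint backdoors needs. They only ask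
    for separators of bounded size, so they can be written as a fixed formula. *)
Definition backdoor_like w x0 (W B : {set V}) :=
 forall tau : {set V}, tau \subset B ->
 (exists2 Z : {set V}, #|Z| <= w.+1 & separates W Z (~: killed B tau)) /\
 (forall X : {set V}, #|X| <= x0 -> X \subset isv ->
 exists2 Z : {set V}, #|Z| <= w * x0 & shatters w X Z (~: killed B tau)).

Lemma touchedS (X K K' : {set V}) : K \subset K' -> touched X K \subset touched X K'.
Proof.
move=> sub; apply/subsetP => x; rewrite !inE => /andP [-> /existsP [z /andP [zK gzx]]].
by apply/existsP; exists z; rewrite gzx (subsetP sub).
Qed.

Lemma touchedU (X K K' : {set V}) : touched X (K :|: K') = touched X K :|: touched X K'.
Proof.
apply/eqP; rewrite eqEsubset; apply/andP; split; last first.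
 by rewrite subUset; apply/andP; split; apply: touchedS; rewrite ?subsetUl ?subsetUr.
apply/subsetP => x; rewrite !inE => /andP [-> /existsP [z /andP [zK gzx]]].
move: zK; rewrite inE => /orP [zK|zK]; apply/orP; [left|right];
 by apply/existsP; exists z; rewrite zK.
Qed.

Lemma component_sub (Q A : {set V}) x : x \in Q -> Q \subset A ->
 (forall y, y \in Q -> y \in component g Q x) -> Q \subset component g A x.
Proof.
move=> xQ QA conn; apply/subsetP => y /conn; exact: (subsetP (@comp_mono V g Q A x QA)).
Qed.

Section Disjoint.
Variables (w k : nat) (W : {set V}).
(** [M] exceeds [2 * w], which bounds what a part touches after one growth step, and [M - 1] exceeds
    [w] even for [w = 0]. *)
Let M := w.*2.+2.
Variable B : 'I_M -> {set V}.
Hypotheses (Bv : forall j, B j \subset isv) (Bk : forall j, #|B j| <= k)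
 (Bdis : forall i j, i != j -> [disjoint B i & B j])
 (Bback : forall j, backdoor_like w (M * k) W (B j)).

Let wM : w < M. Proof. by rewrite /M; lia. Qed.
Let w2M : w.*2 < M. Proof. by rewrite /M; lia. Qed.

Let wM1 : w < M.-1. Proof. by rewrite /M; lia. Qed.

Let X := \bigcup_(j in 'I_M) B j.

Lemma card_union_backdoors : #|X| <= M * k.
Proof.
apply: leq_trans (card_bigcup_le (m := k) _) _ => //.
by rewrite card_ord.
Qed.

Lemma union_backdoors_vars : X \subset isv.
Proof. by apply/bigcupsP => j _. Qed.

(** Pigeonhole: the [M] sets are disjoint, so if each were touched, at least [M] variables would
    be. *)
Lemma untouched_backdoor (K : {set V}) : #|touched X K| < M ->
 exists j, touched (B j) K = set0.
Proof.
move=> lt; case: (pickP (fun j => touched (B j) K == set0)) => [j /eqP|ne]; first by exists j.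
have ex j : exists x, x \in touched (B j) K.
 by apply/set0Pn; rewrite ne.
have [f Hf] := fin_all_exists ex.
have finj : injective f.
 move=> i j E; apply/eqP/negPn/negP => /Bdis /pred0P /(_ (f i)) /=.
 by have := Hf j; have := Hf i; rewrite -E !inE => /andP [-> _] /andP [-> _].
have : #|f @: 'I_M| <= #|touched X K|.
 apply: subset_leq_card; apply/subsetP => _ /imsetP [j _ ->].
 have := Hf j; rewrite !inE => /andP [fB ->]; rewrite andbT.
 by apply/bigcupP; exists j.
by rewrite card_imset // card_ord leqNgt lt.
Qed.

Lemma untouched_alive j (K : {set V}) : [disjoint K & X] ->
 touched (B j) K = set0 -> K \subset ~: killed (B j) set0.
Proof.
move=> dis tch; apply/subsetP => z zK; rewrite !inE negb_or; apply/andP; split.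
 apply/negP => zB; move/pred0P: dis => /(_ z) /=; rewrite zK /=.
 by move/negbT/bigcupP; apply; exists j.
apply/negP => /existsP [b /and3P [bB gbz _]].
have : b \in touched (B j) K.
 by rewrite inE bB; apply/existsP; exists z; rewrite zK gsym.
by rewrite tch inE.
Qed.

(** [Z] collects all [B j] and the separators for all their assignments. A remaining component [K]
    that touches no variable of some [B j] survives the all-false assignment of it and is balanced
    by its separator. Otherwise [K] touches at least [M] variables; a connected part grown inside
    [K] one vertex at a time passes a moment when it touches more than [w] but at most [2 * w]
    variables. It then misses some [B j], survives its assignment and contradicts shattering. *)
Lemma disjoint_backdoors_separator :
 exists2 Z : {set V}, #|Z| <= M * k + M * (2 ^ k * (w.+1 + w * (M * k))) &
 separates W Z setT.
Proof.
have exZ (p : 'I_M * {set V}) : exists ZZ : {set V} * {set V},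
 p.2 \subset B p.1 -> [/\ #|ZZ.1| <= w.+1, separates W ZZ.1 (~: killed (B p.1) p.2),
 #|ZZ.2| <= w * (M * k) & shatters w X ZZ.2 (~: killed (B p.1) p.2)].
 case: (boolP (p.2 \subset B p.1)) => sub; last by exists (set0, set0).
 have [[Z1 c1 s1] /(_ X card_union_backdoors union_backdoors_vars) [Z2 c2 s2]] :=
 Bback sub.
 by exists (Z1, Z2).
have [f Hf] := fin_all_exists exZ.
pose Zj j := \bigcup_(tau in powerset (B j)) ((f (j, tau)).1 :|: (f (j, tau)).2).
pose Z := X :|: \bigcup_(j in 'I_M) Zj j.
have ZX : X \subset Z by apply: subsetUl.
have Zf j (tau : {set V}) : tau \subset B j -> (f (j, tau)).1 :|: (f (j, tau)).2 \subset Z.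
 move=> sub; apply: subset_trans (subsetUr _ _).
 apply: subset_trans (bigcup_sup j _) => //.
 by apply: (bigcup_sup tau); rewrite powersetE.
exists Z.
 rewrite cardsU; apply: leq_trans (leq_subr _ _) _.
 apply: leq_add; first exact: card_union_backdoors.
 apply: leq_trans (card_bigcup_le (m := 2 ^ k * (w.+1 + w * (M * k))) _) _;
 last by rewrite card_ord.
 move=> j _; apply: leq_trans (_ : #|powerset (B j)| * (w.+1 + w * (M * k)) <= _).
 apply: card_bigcup_le => tau; rewrite powersetE => sub.
 have [c1 _ c2 _] := Hf (j, tau) sub; rewrite cardsU.
 by apply: leq_trans (leq_subr _ _) (leq_add c1 c2).
 by rewrite leq_mul2r card_powerset leq_exp2l // Bk orbT.
move=> x; set A := setT :\: Z => xA; set K := component g A x.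
have KA : K \subset A by apply: comp_sub.
have KnZ z : z \in K -> ~ z \in Z.
 by move/(subsetP KA); rewrite in_setD => /andP [/negP].
have KX : [disjoint K & X].
 by apply/pred0P => z /=; apply/negbTE/negP => /andP [/KnZ zZ /(subsetP ZX)].
have Kself := comp_self g xA; rewrite -/K in Kself.
have [[j tj]|nt] := pselect (exists j, touched (B j) K = set0).
 have [_ sp _ _] := Hf (j, set0) (sub0set _); rewrite /= in sp.
 set Z1 := (f (j, set0)).1 in sp.
 have KZ : K \subset ~: killed (B j) set0 :\: Z1.
 rewrite subsetD untouched_alive //=; apply/pred0P => z /=.
 apply/negbTE/negP => /andP [/KnZ zZ zZ1]; apply: zZ.
 by apply: (subsetP (Zf j _ (sub0set _))); rewrite inE zZ1.
 have xK : x \in K by apply: compxx.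
 apply: leq_trans (sp x (subsetP KZ _ xK)).
 rewrite leq_double; apply: subset_leq_card; apply: setIS.
 by apply: component_sub => //; rewrite Kself.
(* A connected part of K touching more than w variables of X but missing some
 B j would survive every assignment of B j, which (b) forbids. *)
have small j (tau Q : {set V}) x' : tau \subset B j -> x' \in Q -> Q \subset K ->
 (forall y, y \in Q -> y \in component g Q x') ->
 Q \subset ~: killed (B j) tau -> #|touched (X :\: B j) Q| <= w.
 move=> sub xQ QK conn Qal; have [_ _ _ sh] := Hf (j, tau) sub; rewrite /= in sh.
 set Z2 := (f (j, tau)).2 in sh.
 have QZ : Q \subset ~: killed (B j) tau :\: (X :|: Z2).
 rewrite subsetD Qal /=; apply/pred0P => z /=.
 apply/negbTE/negP => /andP [/(subsetP QK) /KnZ zZ].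
 rewrite in_setU => /orP [zX|zZ2]; apply: zZ.
 exact: (subsetP ZX).
 by apply: (subsetP (Zf j _ sub)); rewrite inE zZ2 orbT.
 apply: leq_trans (sh x' (subsetP QZ _ xQ)); apply: subset_leq_card.
 apply/subsetP => y; rewrite !inE -andbA => /andP [yB /andP [yX /existsP [z /andP [zQ gzy]]]].
 rewrite yX negb_or yB /=; apply/andP; split.
 apply/existsPn => b; rewrite negb_and -implybE; apply/implyP => bB.
 apply/negP => /andP [gby _]; have := gbip gby (subsetP (Bv j) _ bB).
 by apply/negP; rewrite negbK; exact: (subsetP union_backdoors_vars _ yX).
 by apply/existsP; exists z; rewrite gzy andbT; apply: (subsetP (component_sub xQ QZ conn)).
(* A single vertex survives a suitable assignment of every [B j]: all its literals are made false.
   If it touches every [B j], it still touches [M - 1 > w] variables outside [B j0]. *)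
have single z : z \in K -> #|touched X [set z]| <= w.
 move=> zK.
 have conn y : y \in [set z] -> y \in component g [set z] z.
 by rewrite inE => /eqP ->; apply: compxx.
 have zQ : [set z] \subset K by rewrite sub1set.
 have alive j : exists2 tau : {set V}, tau \subset B j & [set z] \subset ~: killed (B j) tau.
 exists [set b in B j | ~~ sgn b z].
 by apply/subsetP => b; rewrite inE => /andP [].
 rewrite sub1set !inE negb_or; apply/andP; split.
 apply/negP => zB; move/pred0P: KX => /(_ z) /=; rewrite zK /=.
 by move/negbT/bigcupP; apply; exists j.
 apply/existsPn => b; rewrite !inE; case: (boolP (b \in B j)) => //= _.
 by case: (sgn b z); rewrite /= ?andbF.
 rewrite leqNgt; apply/negP => big.
 have [[j tj]|nt'] := pselect (exists j, touched (B j) [set z] = set0).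
 have [tau sub al] := alive j.
 have := small j tau [set z] z sub (set11 z) zQ conn al; apply/negP; rewrite -ltnNge.
 apply: leq_trans big _; apply: subset_leq_card; apply/subsetP => y yt.
 move: (yt); rewrite !inE => /andP [-> ->]; rewrite !andbT; apply/negP => yB.
 have : y \in touched (B j) [set z].
 by move: yt; rewrite !inE yB => /andP [_ ->].
 by rewrite tj inE.
 have j0 : 'I_M by exists 0.
 have [tau sub al] := alive j0.
 have := small j0 tau [set z] z sub (set11 z) zQ conn al; apply/negP; rewrite -ltnNge.
 have ex j : exists y, (j != j0) ==> (y \in touched (B j) [set z]).
 have := nt'; case: (eqVneq j j0) => [_ _|_ H]; first by exists z.
 have /set0Pn [y yt] : touched (B j) [set z] != set0.
 by apply/eqP => E; apply: H; exists j.
 by exists y; rewrite yt.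
 have [h Hh] := fin_all_exists ex.
 have hin j : j \in [set~ j0] -> h j \in touched (B j) [set z].
 by rewrite in_setC1 => jj; have := Hh j; rewrite jj.
 have hinj : {in [set~ j0] &, injective h}.
 move=> i j /hin hi /hin hj E; apply/eqP/negPn/negP => /Bdis /pred0P /(_ (h i)) /=.
 by move: hi hj; rewrite -E !inE => /andP [-> _] /andP [-> _].
 have : #|h @: [set~ j0]| <= #|touched (X :\: B j0) [set z]|.
 apply: subset_leq_card; apply/subsetP => _ /imsetP [j jj ->].
 have := hin j jj; rewrite !inE => /andP [hB ->]; rewrite andbT.
 rewrite inE in jj; rewrite inE in jj.
 have -> : h j \in X by apply/bigcupP; exists j.
 rewrite andbT; apply/negP => hB0; move/Bdis/pred0P: jj => /(_ (h j)) /=.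
 by rewrite hB hB0.
 by rewrite card_in_imset // cardsC1 card_ord; apply: leq_trans wM1.
pose conn (Q : {set V}) := [forall y in Q, forall z in Q, z \in component g Q y].
pose good (Q : {set V}) := [&& Q \subset K, conn Q & #|touched X Q| <= w].
have xK : x \in K by apply: compxx.
have g1 : good [set x].
 rewrite /good sub1set xK single //= andbT; apply/forall_inP => y; rewrite inE => /eqP ->.
 by apply/forall_inP => z; rewrite inE => /eqP ->; apply: compxx.
have x1 : (x \in [set x]) && good [set x] by rewrite set11.
(* Instead of a growth process, a largest connected part touching at most [w] variables is chosen;
   one more vertex of [K] then pushes it above [w]. *)
have [Q /andP [xQ gQ] Qmax] := @arg_maxnP _ [set x] (fun Q => (x \in Q) && good Q) (fun Q => #|Q|) x1.
have /and3P [QK /forall_inP Qc Qt] := gQ.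
have [EQ|nEQ] := eqVneq Q K.
 by case: nt; apply: untouched_backdoor; rewrite -EQ; apply: leq_ltn_trans Qt wM.
have [q qK qQ] : exists2 q, q \in K & q \notin Q.
 by apply/subsetPn; apply: contraNN nEQ => KQ; rewrite eqEsubset QK.
have qxK : connect (within g A) x q by rewrite inE in qK.
have [a [b [/and3P [gab aA bA] aQ bQ]]] := connect_cross (P := fun z => z \in Q) qxK xQ qQ.
have bK : b \in K by apply: comp_step gab aA bA; apply: (subsetP QK).
set Q' := Q :|: [set b].
have xQ' : x \in Q' by rewrite inE xQ.
have Q'K : Q' \subset K by rewrite subUset QK sub1set.
have mono y z : z \in component g Q y -> z \in component g Q' y.
 by apply: (subsetP (@comp_mono V g Q Q' y (subsetUl _ _))).
have aQ' : a \in Q' by rewrite inE aQ.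
have bQ' : b \in Q' by rewrite !inE eqxx orbT.
have toa y : y \in Q' -> y \in component g Q' a.
 rewrite !inE => /orP [yQ|/eqP ->]; first by rewrite -inE; apply: mono; apply: (forall_inP (Qc a aQ)).
 by apply: connect1; apply/and3P.
have Qc' y z : y \in Q' -> z \in Q' -> z \in component g Q' y.
 by move=> yQ zQ; rewrite (comp_eq gsym (toa y yQ)); apply: toa.
have Qt' : w < #|touched X Q'|.
 rewrite ltnNge; apply/negP => le.
 have g' : (x \in Q') && good Q'.
 rewrite xQ' /good Q'K le andbT; apply/forall_inP => y yQ.
 by apply/forall_inP => z; apply: Qc'.
 have : #|Q'| <= #|Q| := Qmax _ g'.
 by rewrite /Q' setUC cardsU1 bQ add1n ltnn.
have Qt2 : #|touched X Q'| <= w.*2.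
 rewrite touchedU cardsU; apply: leq_trans (leq_subr _ _) _.
 by rewrite -addnn leq_add ?single.
have [j tj] := untouched_backdoor (leq_ltn_trans Qt2 w2M).
have Q'X : [disjoint Q' & X] by apply: disjointWl Q'K KX.
have := small j set0 Q' x (sub0set _) xQ' Q'K (fun y => Qc' x y xQ')
 (untouched_alive Q'X tj).
move=> le; exfalso; move: le; apply/negP; rewrite -ltnNge.
apply: leq_trans Qt' _; apply: subset_leq_card; apply/subsetP => y yt.
move: (yt); rewrite !inE => /andP [-> ->]; rewrite !andbT; apply/negP => yB.
have : y \in touched (B j) Q' by move: yt; rewrite !inE yB => /andP [_ ->].
by rewrite tj inE.
Qed.

End Disjoint.
End Backdoors.

(** * Elimination structures and finite algebras *)

(* Vertices are eliminated in the order [eord]; [eadj v j] is the sign of the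
 edge from v to the later vertex of colour j in its bag, 0 if there is none. *)
Record estr (V : finType) := EStr {
 eord : seq V; ecol : V -> nat; epar : V -> option V; eadj : V -> nat -> nat }.

(** The operations that assemble a graph of bounded width: the empty part, the union of two parts,
    an edge with a sign between two colours, and forgetting a colour while the label of its vertex
    is read. *)
Record alg (L : Type) := Alg {
 ast : finType; aunit : ast; ajoin : ast -> ast -> ast;
 aedge : nat -> nat -> nat -> ast -> ast;
 aforget : nat -> L -> ast -> ast }.

Lemma disjoint_setU (T : finType) (A B C : {set T}) :
 [disjoint A :|: B & C] = [disjoint A & C] && [disjoint B & C].
Proof. by rewrite -!setI_eq0 setIUl setU_eq0. Qed.

(** * Runs of an algebra along an elimination structure *)

Section Structure.
Variables (c : nat) (V : finType) (S : estr V).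

Section Run.
Variables (L : Type) (A : alg L).

Definition aedges v (a : ast A) : ast A :=
 foldl (fun a j => if eadj S v j != 0 then aedge (ecol S v) j (eadj S v j) a else a)
 a (iota 0 c).

(** The accumulator of [v] is complete when [v] is reached; its edges are added, its colour is
    forgotten, and the result joins the accumulator of its parent, that of [None] for a root. *)
Definition estep (m : V -> L) (acc : option V -> ast A) v :=
 fun o => if o == epar S v
 then ajoin (acc o) (aforget (ecol S v) (m v) (aedges v (acc (Some v))))
 else acc o.

Definition accs m s := foldl (estep m) (fun=> aunit A) s.

Definition erun m := accs m (eord S) None.

Lemma accs_rcons m s v : accs m (rcons s v) = estep m (accs m s) v.
Proof. by rewrite /accs foldl_rcons. Qed.

End Run.

(** The same recursion, computing the set of vertices that an accumulator has absorbed. *)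
Definition dstep (D : option V -> {set V}) v :=
 fun o => if o == epar S v then D o :|: (v |: D (Some v)) else D o.

Definition dsc s := foldl dstep (fun=> set0) s.

Lemma dsc_rcons s v : dsc (rcons s v) = dstep (dsc s) v.
Proof. by rewrite /dsc foldl_rcons. Qed.

(** An accumulator reads only the labels of absorbed vertices, so labels can be chosen independently
    on disjoint accumulators. *)
Lemma accs_local L (A : alg L) (m m' : V -> L) s o :
 {in dsc s o, m =1 m'} -> accs A m s o = accs A m' s o.
Proof.
elim/last_ind: s o => [//|s v IH] o.
rewrite dsc_rcons !accs_rcons /dstep /estep; case: eqP => // _ H.
- rewrite (IH o); last by move=> x xo; apply: H; rewrite inE xo.
 rewrite (IH (Some v)); last by move=> x xo; apply: H; rewrite !inE xo !orbT.
 by rewrite H // !inE eqxx orbT.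
- exact: IH.
Qed.

Definition open (s : seq V) (o : option V) := if o is Some v then v \notin s else true.

Definition ordered :=
 [/\ uniq (eord S), forall v, v \in eord S &
 forall v p, epar S v = Some p -> index v (eord S) < index p (eord S)].

Hypothesis ord : ordered.

Lemma open_parent s v s' : eord S = s ++ v :: s' -> open (rcons s v) (epar S v).
Proof.
case: ord => uo ao par E; case Ep : (epar S v) => [p|] //=.
apply/negP => pin; have := par _ _ Ep.
rewrite E -cat_rcons !index_cat pin mem_rcons inE eqxx /=.
have us : uniq (rcons s v) by move: uo; rewrite E -cat_rcons cat_uniq => /andP [].
have := index_mem p (rcons s v); rewrite pin size_rcons => lt.
have -> : index v (rcons s v) = size s.
 rewrite -cats1 index_cat; move: us; rewrite rcons_uniq => /andP [/negbTE -> _].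
 by rewrite /= eqxx addn0.
by rewrite ltnNge -ltnS lt.
Qed.

Lemma next_notin s v s' : eord S = s ++ v :: s' -> v \notin s.
Proof.
by case: ord => uo _ _ E; move: uo; rewrite E -cat_rcons cat_uniq rcons_uniq => /andP [/andP []].
Qed.

Lemma openW s v o : open (rcons s v) o -> open s o.
Proof. by case: o => //= p; rewrite mem_rcons inE negb_or => /andP []. Qed.

Lemma dsc_inv s s' : eord S = s ++ s' ->
 [/\ forall o, {subset dsc s o <= s},
 forall o o', open s o -> open s o' -> o != o' -> [disjoint dsc s o & dsc s o'] &
 forall x, x \in s -> exists2 o, open s o & x \in dsc s o].
Proof.
elim/last_ind: s s' => [|s v IH] s' E.
 split=> //; first by move=> o x; rewrite inE.
 by move=> o o' _ _ _; rewrite -setI_eq0 setI0.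
rewrite cat_rcons in E; have [sub dis ex] := IH _ E.
have vs := next_notin E; have op := open_parent E.
have ov : open s (Some v) by [].
have vD o : v \notin dsc s o by apply: contra vs; apply: sub.
rewrite dsc_rcons /dstep; split.
- move=> o x; rewrite mem_rcons inE; case: ifP => _; last by move/sub => ->; rewrite orbT.
 by rewrite !inE => /or3P [/sub ->|->|/sub ->]; rewrite ?orbT.
- have main o : open (rcons s v) o -> o != epar S v ->
 [disjoint dsc s o & dsc s (epar S v) :|: (v |: dsc s (Some v))].
 move=> oo ne; rewrite disjoint_sym !disjoint_setU disjoints1 vD /=.
 rewrite !dis ?(openW op) ?(openW oo) // 1?eq_sym //.
 by apply: contraTneq oo => -> /=; rewrite mem_rcons inE eqxx.
 move=> o o' oo oo' ne; case: (eqVneq o (epar S v)) => [Eo|no].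
 rewrite ifN -?Eo 1?eq_sym // disjoint_sym Eo; apply: main => //.
 by rewrite -Eo eq_sym.
 case: (eqVneq o' (epar S v)) => [Eo'|no']; first by rewrite Eo'; apply: main.
 by apply: dis; rewrite ?(openW oo) ?(openW oo').
- move=> x; rewrite mem_rcons inE => /orP [/eqP ->|xs].
 by exists (epar S v) => //; rewrite eqxx !inE eqxx orbT.
 have [o oo xo] := ex x xs.
 case: (eqVneq o (Some v)) => [Eo|no].
 by exists (epar S v) => //; rewrite eqxx !inE -Eo xo !orbT.
 exists o; last by case: ifP => // _; rewrite inE xo.
 case: o oo xo no => //= p ps _ no; rewrite mem_rcons inE negb_or ps andbT.
 by apply: contraNneq no => ->.
Qed.

Lemma dsc_all : dsc (eord S) None = [set: V].
Proof.
have [_ _ ex] := dsc_inv (esym (cats0 (eord S))); case: ord => _ ao _.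
apply/setP => x; have [[p|] //= po xo] := ex x (ao x); last by rewrite xo inE.
by rewrite ao in po.
Qed.

Lemma dsc_join s v s' : eord S = s ++ v :: s' ->
 [/\ [disjoint dsc s (epar S v) & v |: dsc s (Some v)], v \notin dsc s (Some v)
 & v \notin dsc s (epar S v)].
Proof.
move=> E; have [sub dis _] := dsc_inv E; have vs := next_notin E.
have op := open_parent E.
have vD o : v \notin dsc s o by apply: contra vs; apply: sub.
rewrite !vD disjoint_sym disjoint_setU disjoints1 vD /=; split=> //; apply: dis => //.
 exact: openW op.
by case: (epar S v) op => //= p; rewrite mem_rcons inE negb_or => /andP [pv _]; apply: contraNneq pv => -[->].
Qed.

(* The marks of a second track, read off a set of states (a powerset algebra). *)
Definition palg (L M : finType) (A : alg (M * L)) : alg L :=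
 @Alg L {set ast A} [set aunit A]
 (fun X Y => [set ajoin a b | a in X, b in Y])
 (fun i j s X => [set aedge i j s a | a in X])
 (fun i l X => [set aforget i (x, l) a | x in M, a in X]).

Lemma aedges_palg (L M : finType) (A : alg (M * L)) v (X : {set ast A}) :
 @aedges L (palg A) v X = [set aedges v a | a in X].
Proof.
rewrite /aedges; elim: (iota 0 c) X => [|j l IH] X /=.
 by rewrite imset_id.
rewrite IH; case: ifP => _ //; apply/setP => a; apply/imsetP/imsetP.
 by case=> _ /imsetP [b bX ->] ->; exists b.
by case=> b bX ->; exists (aedge (ecol S v) j (eadj S v j) b) => //; apply: imset_f.
Qed.

(** Guessing marks commutes with the run because the joined parts are disjoint: choices [U] and [U']
    for the two parts and [x] for [v] glue to one function. *)
Lemma accs_palg (L M : finType) (x0 : M) (A : alg (M * L)) (m : V -> L) s s' o :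
 eord S = s ++ s' -> open s o ->
 accs (palg A) m s o =
 [set accs A (fun v => (U v, m v)) s o | U : {ffun V -> M}].
Proof.
elim/last_ind: s s' o => [|s v IH] s' o E oo.
 apply/setP => a; rewrite inE; apply/eqP/imsetP => [->|[] //].
 by exists [ffun=> x0].
rewrite cat_rcons in E; have [dis vD vP] := dsc_join E.
rewrite accs_rcons /estep; case: eqP => [Eo|ne]; last first.
 rewrite (IH _ _ E (openW oo)); apply: eq_imset => U.
 by rewrite accs_rcons /estep ifN //; apply/eqP.
rewrite Eo (IH _ _ E (openW (open_parent E))) (IH _ (Some v) E (next_notin E)).
rewrite aedges_palg; apply/setP => a; apply/imset2P/imsetP.
 case=> _ _ /imsetP [U _ ->] /imset2P [x _ _ /imsetP [_ /imsetP [U' _ ->] ->] ->] ->.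
 exists [ffun y => if y \in dsc s (epar S v) then U y else if y == v then x else U' y] => //.
 rewrite accs_rcons /estep eqxx !ffunE (negbTE vP) eqxx.
 congr ajoin; last congr (aforget _ _ (aedges _ _)).
 by apply: accs_local => y yD; rewrite ffunE yD.
 apply: accs_local => y yD; rewrite ffunE ifF; last first.
 apply/negbTE/negP => yD'; move/pred0P: dis => /(_ y) /=.
 by rewrite yD' !inE yD orbT.
 by rewrite ifN //; apply: contraNneq vD => Ey; move: yD; rewrite Ey.
case=> U _ ->; rewrite accs_rcons /estep eqxx.
pose b := accs A (fun v => (U v, m v)) s (Some v).
exists (accs A (fun v => (U v, m v)) s (epar S v))
 (aforget (ecol S v) (U v, m v) (aedges v b)) => //.
 by apply/imsetP; exists U.
apply/imset2P; exists (U v) (aedges v b) => //; apply/imsetP; exists b => //.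
by apply/imsetP; exists U.
Qed.

Lemma erun_palg (L M : finType) (x0 : M) (A : alg (M * L)) (m : V -> L) :
 erun (palg A) m = [set erun A (fun v => (U v, m v)) | U : {ffun V -> M}].
Proof. exact: (accs_palg x0 _ _ (esym (cats0 _))). Qed.

End Structure.

(** * Recognizability of monadic second-order properties *)

(** The atoms are conditions on all edges and upper bounds on cardinalities. They take arbitrary
    predicates of the membership bits, so Boolean set terms need no syntax; [Rel] replaces the
    environment by Boolean combinations of its sets. *)
Inductive fml :=
 | AllE (p : seq bool -> nat -> seq bool -> bool)
 | CardP (p : seq bool -> bool) (q : nat)
 | And (f1 f2 : fml)
 | Not (f : fml)
 | Ex (f : fml)
 | Rel (hs : seq (seq bool -> bool)) (f : fml).

Definition bits (V : Type) (env : seq (V -> bool)) v := [seq P v | P <- env].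

Fixpoint sat (V : finType) (g : V -> V -> nat) (env : seq (V -> bool)) f : Prop :=
 match f with
 | AllE p => forall u v, g u v != 0 -> p (bits env u) (g u v) (bits env v)
 | CardP p q => #|[set v | p (bits env v)]| <= q
 | And f1 f2 => sat g env f1 /\ sat g env f2
 | Not f => ~ sat g env f
 | Ex f => exists U : V -> bool, sat g (U :: env) f
 | Rel hs f => sat g [seq (fun v => h (bits env v)) | h <- hs] f
 end.

(** Bags as in an elimination order with fill-in: of two members the later lies in the bag of the
    earlier, so members have distinct colours, and the parent is the earliest member. A colour thus
    names at most one vertex of a bag, and [eadj] can list edges by colour. *)
Definition valid c (V : finType) (g : V -> V -> nat) (S : estr V) :=
 exists bag : V -> {set V}, let pos v := index v (eord S) in
 [/\ ordered S,
 (forall v, ecol S v < c) /\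
 (forall v x, x \in bag v -> pos v < pos x /\ ecol S x != ecol S v),
 (forall v x y, x \in bag v -> y \in bag v -> pos x < pos y -> y \in bag x) /\
 (forall v x, g v x != 0 -> pos v < pos x -> x \in bag v),
 (forall v x, x \in bag v -> eadj S v (ecol S x) = g v x) /\
 (forall v j, (forall x, x \in bag v -> ecol S x != j) -> eadj S v j = 0)
 & forall v, match epar S v with
 | Some p => p \in bag v /\ forall x, x \in bag v -> pos p <= pos x
 | None => bag v = set0 end].

Definition recog c r f :=
 exists (A : alg (r.-tuple bool)) (acc : pred (ast A)),
 forall (V : finType) (g : V -> V -> nat) (S : estr V) (env : r.-tuple (V -> bool)),
 (forall u v, g u v = g v u) -> (forall v, g v v = 0) -> valid c g S ->
 sat g env f <-> acc (erun c S A (fun v => [tuple of bits env v])).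

Lemma recog_not c r f : recog c r f -> recog c r (Not f).
Proof.
move=> [A [acc H]]; exists A, (fun a => ~~ acc a) => V g S env gs gi vS /=.
by rewrite (H V g S env gs gi vS); split=> /negP.
Qed.

Definition prodalg L (A B : alg L) : alg L :=
 @Alg L (ast A * ast B)%type (aunit A, aunit B)
 (fun x y => (ajoin x.1 y.1, ajoin x.2 y.2))
 (fun i j s x => (aedge i j s x.1, aedge i j s x.2))
 (fun i l x => (aforget i l x.1, aforget i l x.2)).

Lemma accs_prod c V (S : estr V) L (A B : alg L) m s o :
 accs c S (prodalg A B) m s o = (accs c S A m s o, accs c S B m s o).
Proof.
have Ee v (a : ast A) (b : ast B) :
 @aedges c _ S _ (prodalg A B) v (a, b) = (aedges c S v a, aedges c S v b).
 by rewrite /aedges; elim: (iota 0 c) a b => //= j l IH a b; case: ifP => _; rewrite IH.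
elim/last_ind: s o => // s v IH o; rewrite !accs_rcons /estep !IH.
by case: ifP => // _; rewrite Ee.
Qed.

Lemma recog_and c r f1 f2 : recog c r f1 -> recog c r f2 -> recog c r (And f1 f2).
Proof.
move=> [A [a1 H1]] [B [a2 H2]].
exists (prodalg A B), (fun x => a1 x.1 && a2 x.2) => V g S env gs gi vS /=.
rewrite /erun accs_prod (H1 V g S env gs gi vS) (H2 V g S env gs gi vS).
by split=> [[h1 h2]|/andP []]; first apply/andP.
Qed.

Definition consalg r (A : alg (r.+1.-tuple bool)) : alg (bool * r.-tuple bool) :=
 @Alg _ (ast A) (aunit A) (@ajoin _ A) (@aedge _ A)
 (fun i (l : bool * r.-tuple bool) => aforget i [tuple of l.1 :: l.2]).

Lemma accs_cons c V (S : estr V) r (A : alg (r.+1.-tuple bool))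
 (m : V -> bool * r.-tuple bool) s o :
 accs c S (consalg A) m s o = accs c S A (fun v => [tuple of (m v).1 :: (m v).2]) s o.
Proof.
by elim/last_ind: s o => // s v IH o; rewrite !accs_rcons /estep !IH.
Qed.

Lemma recog_ex c r f : recog c r.+1 f -> recog c r (Ex f).
Proof.
move=> [A [acc H]]; exists (palg (consalg A)), (fun X : {set ast A} => [exists a in X, acc a]).
move=> V g S env gs gi vS /=; have [_ [ord _ _ _ _]] := vS.
rewrite (erun_palg c ord true); split.
 case=> U sU; apply/existsP.
 have := (H V g S [tuple of U :: env] gs gi vS).1 sU => ac.
 exists (erun c S (consalg A) (fun v => (finfun U v, [tuple of bits env v]))).
 apply/andP; split; first by apply/imsetP; exists (finfun U).
 rewrite /erun accs_cons; move: ac; congr (is_true (acc _)).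
 rewrite /erun; apply: accs_local => v _; apply: val_inj => /=.
 by rewrite ffunE.
case/existsP=> _ /andP [/imsetP [U _ ->] ac]; exists U.
apply/(H V g S [tuple of (U : V -> bool) :: env] gs gi vS).
move: ac; rewrite /erun accs_cons; congr (is_true (acc _)).
by apply: accs_local => v _; apply: val_inj.
Qed.

Definition relalg r (hs : seq (seq bool -> bool)) (A : alg ((size hs).-tuple bool)) :
 alg (r.-tuple bool) :=
 @Alg (r.-tuple bool) (ast A) (aunit A) (@ajoin _ A) (@aedge _ A)
 (fun i (l : r.-tuple bool) => aforget i (map_tuple (fun h => h (l : seq bool)) (in_tuple hs))).

Lemma accs_rel c V (S : estr V) r hs A (m : V -> r.-tuple bool) s o :
 accs c S (@relalg r hs A) m s o =
 accs c S A (fun v => map_tuple (fun h => h (m v : seq bool)) (in_tuple hs)) s o.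
Proof.
by elim/last_ind: s o => // s v IH o; rewrite !accs_rcons /estep !IH.
Qed.

Lemma recog_rel c r hs f : recog c (size hs) f -> recog c r (Rel hs f).
Proof.
move=> [A [acc H]]; exists (relalg r A), acc => V g S env gs gi vS /=.
pose env' := map_tuple (fun h v => h (bits env v)) (in_tuple hs).
rewrite (_ : [seq _ | h <- hs] = env') // (H V g S env' gs gi vS) /erun accs_rel.
suff -> : accs c S A (fun v => [tuple of bits env' v]) (eord S) None =
 accs c S A (fun v => map_tuple (fun h => h ([tuple of bits env v] : seq bool))
 (in_tuple hs)) (eord S) None by [].
apply: accs_local => v _; apply: val_inj => /=.
by rewrite /bits -map_comp.
Qed.

(** Cardinalities are counted up to the cap [q.+1], which stands for all values above [q]. *)
Definition cardalg r (p : seq bool -> bool) q : alg (r.-tuple bool) :=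
 @Alg (r.-tuple bool) 'I_q.+2 ord0 (fun a b => inord (minn (a + b) q.+1)) (fun _ _ _ a => a)
 (fun _ (l : r.-tuple bool) a => inord (minn (a + p l) q.+1)).

Lemma minn_cap a b d q :
 minn (minn a q + minn (minn b q + d) q) q = minn (a + (d + b)) q.
Proof. by lia. Qed.

Lemma accs_card c V (S : estr V) r p q (m : V -> r.-tuple bool) s s' o : ordered S ->
 eord S = s ++ s' -> open s o ->
 accs c S (cardalg r p q) m s o = minn #|[set v in dsc S s o | p (m v)]| q.+1 :> nat.
Proof.
move=> ord; have Ee v a : aedges c S v (a : ast (cardalg r p q)) = a.
 by rewrite /aedges; elim: (iota 0 c) a => //= j l IH a; case: ifP => _; rewrite IH.
elim/last_ind: s s' o => [|s v IH] s' o E oo.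
 rewrite /= (_ : [set _ in _ | _] = set0) ?cards0 //.
 by apply/setP => x; rewrite !inE.
rewrite cat_rcons in E; have [dis vD vP] := dsc_join ord E.
rewrite accs_rcons dsc_rcons /estep /dstep; case: eqP => [->|ne]; last by apply: IH E (openW oo).
rewrite Ee /=.
set x := accs _ _ _ _ _ (epar S v); set y := accs _ _ _ _ _ (Some v).
have Ex' : x = minn #|[set u in dsc S s (epar S v) | p (m u)]| q.+1 :> nat.
 exact: (IH _ _ E (openW (open_parent ord E))).
have Ey : y = minn #|[set u in dsc S s (Some v) | p (m u)]| q.+1 :> nat.
 exact: (IH _ (Some v) E (next_notin ord E)).
have -> : [set u in dsc S s (epar S v) :|: (v |: dsc S s (Some v)) | p (m u)] =
 [set u in dsc S s (epar S v) | p (m u)] :|: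
 ([set u in [set v] | p (m u)] :|: [set u in dsc S s (Some v) | p (m u)]).
 by apply/setP => u; rewrite !inE !andb_orl.
have c1 : #|[set u in [set v] | p (m u)]| = p (m v).
 case pv : (p (m v)); last first.
 by rewrite (_ : [set _ in _ | _] = set0) ?cards0 //; apply/setP => u; rewrite !inE; apply/negbTE/negP => /andP [/eqP ->]; rewrite pv.
 rewrite (_ : [set _ in _ | _] = [set v]) ?cards1 //; apply/setP => u; rewrite !inE.
 by case: eqP => // ->; rewrite pv.
rewrite cardsU disjoint_setI0; last first.
 apply: disjointWl (_ : _ \subset dsc S s (epar S v)) _.
 by apply/subsetP => u; rewrite inE => /andP [].
 apply: disjointWr dis; apply/subsetP => u; rewrite !inE => /orP [/andP [-> _] //|/andP [-> _]].
 by rewrite orbT.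
rewrite cards0 subn0 cardsU disjoint_setI0; last first.
 apply/pred0P => u /=; rewrite !inE; apply/negbTE/negP => /andP [/andP [/eqP -> _] /andP [vD' _]].
 by rewrite vD' in vD.
rewrite cards0 subn0 c1 inordK; last by rewrite ltnS geq_minr.
rewrite inordK; last by rewrite ltnS geq_minr.
by rewrite Ex' Ey minn_cap.
Qed.

Lemma recog_card c r p q : recog c r (CardP p q).
Proof.
exists (cardalg r p q), (fun a : 'I_q.+2 => a <= q) => V g S env gs gi vS /=.
have [_ [ord _ _ _ _]] := vS.
rewrite /erun (accs_card _ _ _ _ ord (esym (cats0 _))) // dsc_all //.
rewrite (_ : [set v in [set: V] | p [tuple of bits env v]] = [set v | p (bits env v)]).
 by rewrite geq_min ltnn orbF.
by apply/setP => v; rewrite !inE.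
Qed.

Section AllEdges.
Variables (c r : nat) (p : seq bool -> nat -> seq bool -> bool).

Let bnd := {ffun 'I_c.+1 -> r.-tuple bool}.

Definition edgeok (x : r.-tuple bool) s (y : r.-tuple bool) := p x s y && p y s x.

(** A state says for which assignments of labels to colours all edges read so far are accepted.
    Forgetting a colour substitutes the label of its vertex, which is known only then. *)
Definition edgealg : alg (r.-tuple bool) :=
 @Alg _ {ffun bnd -> bool} [ffun=> true] (fun a b => [ffun f => a f && b f])
 (fun i j s a => [ffun f : bnd => a f && edgeok (f (inord i)) s (f (inord j))])
 (fun i l a => [ffun f : bnd => a [ffun k => if k == inord i then l else f k]]).

Variables (V : finType) (g : V -> V -> nat) (S : estr V) (m : V -> r.-tuple bool).
Hypotheses (gsym : forall u v, g u v = g v u).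
Variable bag : V -> {set V}.
Let pos v := index v (eord S).
Hypotheses (ord : ordered S) (col : forall v, ecol S v < c)
 (bpos : forall v x, x \in bag v -> pos v < pos x /\ ecol S x != ecol S v)
 (bclq : forall v x y, x \in bag v -> y \in bag v -> pos x < pos y -> y \in bag x)
 (bedge : forall v x, g v x != 0 -> pos v < pos x -> x \in bag v)
 (adj1 : forall v x, x \in bag v -> eadj S v (ecol S x) = g v x)
 (adj0 : forall v j, (forall x, x \in bag v -> ecol S x != j) -> eadj S v j = 0)
 (par : forall v, match epar S v with
 | Some q => q \in bag v /\ forall x, x \in bag v -> pos q <= pos x
 | None => bag v = set0 end).

Lemma pos_inj u v : pos u = pos v -> u = v.
Proof.
case: ord => _ ao _ E; rewrite -(nth_index u (ao u)) -(nth_index u (ao v)).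
by rewrite -/(pos u) E.
Qed.

Lemma aedges_edge v (a : ast edgealg) f :
 aedges c S v a f = a f && [forall j : 'I_c, (eadj S v j != 0) ==>
 edgeok (f (inord (ecol S v))) (eadj S v j) (f (inord j))].
Proof.
have -> : [forall j : 'I_c, (eadj S v j != 0) ==>
 edgeok (f (inord (ecol S v))) (eadj S v j) (f (inord j))] =
 all (fun j => (eadj S v j != 0) ==>
 edgeok (f (inord (ecol S v))) (eadj S v j) (f (inord j))) (iota 0 c).
 apply/forallP/allP => [H j|H j]; last by apply: H; rewrite mem_iota add0n ltn_ord.
 by rewrite mem_iota add0n => /= lt; apply: (H (Ordinal lt)).
rewrite /aedges; elim: (iota 0 c) a => [|j l IH] a /=; first by rewrite andbT.
by rewrite IH; case: ifP => _ //; rewrite ffunE andbA.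
Qed.

Definition consistent (f : bnd) o :=
 if o is Some v then f (inord (ecol S v)) = m v /\
 forall x, x \in bag v -> f (inord (ecol S x)) = m x
 else True.

Definition up_ok x := [forall y, (g x y != 0) && (pos x < pos y) ==> edgeok (m x) (g x y) (m y)].

(** Consistency is required only on the open vertex and its bag, because every edge of an absorbed
    vertex leads to another absorbed vertex or into that set. *)
Lemma accs_edge s s' o f : eord S = s ++ s' -> consistent f o ->
 accs c S edgealg m s o f = [forall x in dsc S s o, up_ok x].
Proof.
elim/last_ind: s s' o f => [|s v IH] s' o f E cf.
 by rewrite ffunE; apply/esym/forall_inP => x; rewrite inE.
rewrite cat_rcons in E.
rewrite accs_rcons dsc_rcons /estep /dstep; case: eqP => [Eo|ne]; last exact: IH E cf.
rewrite /= !ffunE aedges_edge (IH _ o f E cf).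
set f' := [ffun k => _].
have inordE i j : i < c -> j < c -> ((inord i : 'I_c.+1) == inord j) = (i == j).
 by move=> li lj; rewrite -val_eqE /= !inordK // ltnS ltnW.
have f'v : f' (inord (ecol S v)) = m v by rewrite ffunE eqxx.
(* The bag of [v] without its parent lies in the bag of the parent, where [f] is already
   consistent. *)
have f'x x : x \in bag v -> f' (inord (ecol S x)) = m x.
 move=> xv; have [lt /negbTE ne] := bpos xv; rewrite ffunE inordE // ne.
 move: (par v) cf; rewrite Eo; case: (epar S v) => [q [qv qmin] [fq fb]|E0]; last first.
 by rewrite E0 inE in xv.
 case: (eqVneq x q) => [->|nxq] //; apply: fb; apply: (bclq qv xv).
 by have := qmin x xv; rewrite leq_eqVlt => /orP [/eqP /pos_inj E'|//]; rewrite E' eqxx in nxq.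
rewrite (IH _ (Some v) f' E); last by split.
have -> : [forall j : 'I_c, (eadj S v j != 0) ==>
 edgeok (f' (inord (ecol S v))) (eadj S v j) (f' (inord j))] = up_ok v.
 rewrite f'v; apply/forallP/forallP => [H y|H j]; apply/implyP.
 case/andP=> gvy lt; have yv := bedge gvy lt.
 have := H (Ordinal (col y)); rewrite /= adj1 // gvy /=; by rewrite f'x.
 case: (pselect (exists2 x, x \in bag v & ecol S x = j)) => [[x xv Ex]|nx].
 rewrite -Ex adj1 // f'x // => gvx; have := H x.
 by rewrite gvx (bpos xv).1.
 rewrite adj0 // => x xv; apply/eqP => Ex; apply: nx; by exists x.
apply/andP/forall_inP.
 move=> [/forall_inP H1 /andP [/forall_inP H2 H3]] x; rewrite !inE.
 by case/or3P => [/H1|/eqP ->|/H2].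
move=> H; split; first by apply/forall_inP => x xD; apply: H; rewrite inE xD.
apply/andP; split; last by apply: H; rewrite !inE eqxx orbT.
by apply/forall_inP => x xD; apply: H; rewrite !inE xD !orbT.
Qed.

Lemma erun_edge f : (forall v, g v v = 0) ->
 erun c S edgealg m f <-> forall u v, g u v != 0 -> p (m u) (g u v) (m v).
Proof.
move=> gi; rewrite /erun (@accs_edge _ [::]) ?cats0 // dsc_all //; split.
 move=> /forall_inP H u v guv; case: (ltngtP (pos u) (pos v)) => [lt|lt|/pos_inj E].
 - by have := H u (in_setT _) => /forallP /(_ v); rewrite guv lt => /andP [].
 - have := H v (in_setT _) => /forallP /(_ u); rewrite gsym guv lt => /andP [_].
 by rewrite gsym.
 - by rewrite E gi in guv.
move=> H; apply/forall_inP => x _; apply/forallP => y; apply/implyP => /andP [gxy _].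
by rewrite /edgeok H //= gsym H // gsym.
Qed.

End AllEdges.

Lemma recog_edge c r p : recog c r (AllE p).
Proof.
exists (edgealg c r p),
 (fun a : {ffun {ffun 'I_c.+1 -> r.-tuple bool} -> bool} =>
 a [ffun=> [tuple of nseq r false]]).
move=> V g S env gs gi [bag [ord [h1 h2] [h3 h4] [h5 h6] h7]].
by rewrite (erun_edge p _ gs ord h1 h2 h3 h4 h5 h6 h7 _ gi).
Qed.

Theorem fml_recog c f r : recog c r f.
Proof.
elim: f r => [p|p q|f1 IH1 f2 IH2|f IH|f IH|hs f IH] r.
- exact: recog_edge.
- exact: recog_card.
- exact: recog_and.
- exact: recog_not.
- exact: recog_ex.
- exact: recog_rel.
Qed.

(** * Formulas for components, neighbourhoods and balance *)

Definition bp := seq bool -> bool.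
(** Bits are listed newest quantifier first, so [bit] is a de Bruijn index and [up] the shift under
    a quantifier. *)
Definition bit i : bp := fun b => nth false b i.
Definition up (P : bp) : bp := fun b => P (behead b).

Definition SubF (X Y : bp) := CardP (fun b => X b && ~~ Y b) 0.
Definition ClosedF (X A : bp) :=
 AllE (fun bu _ bv => [&& X bu, A bu & A bv] ==> X bv).
Definition AllF f := Not (Ex (Not f)).
Definition ImpF f1 f2 := Not (And f1 (Not f2)).
Definition OneF (X : bp) := And (CardP X 1) (Not (CardP X 0)).
(** Reachability by second-order quantification: the component is the least set that contains [x]
    and is closed under the edges inside [A]. *)
Definition CompF (x U A : bp) :=
 And (And (SubF x U) (SubF U A)) (And (ClosedF U A)
 (AllF (ImpF (And (SubF (up x) (bit 0)) (ClosedF (bit 0) (up A)))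
 (SubF (up U) (bit 0))))).
(** Comparing two cardinalities is not an atom. Since [#|W|] is at most [J] in all uses, each
    threshold [j] up to [J] is tested; the case [j = #|W|] gives the claim. *)
Definition HalfF J (C W : bp) :=
 foldr (fun j f => And (ImpF (CardP W j) (CardP (fun b => W b && C b) j./2)) f)
 (CardP (fun=> false) 0) (iota 0 J.+1).
(* [bit 1] is the singleton {x} and [bit 0] its component. *)
Definition AllCompF (A : bp) f :=
 AllF (ImpF (And (OneF (bit 0)) (SubF (bit 0) (up A)))
 (AllF (ImpF (CompF (bit 1) (bit 0) (up (up A))) f))).
Definition BalF J (W A : bp) := AllCompF A (HalfF J (bit 0) (up (up W))).
(** The atom on edges is universal, so the existence of a neighbour in [U] is said for each
    singleton of [Wn] as: not all edges avoid going from it into [U]. *)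
Definition NbrF (d U Wn : bp) :=
 And (SubF Wn d) (And (AllE (fun bu _ bv => U bu && d bv ==> Wn bv))
 (AllF (ImpF (And (OneF (bit 0)) (SubF (bit 0) (up Wn)))
 (Not (AllE (fun bu _ bv => ~~ (bit 0 bu && up U bv))))))).

Section Semantics.
Variables (V : finType) (g : V -> V -> nat).
Hypothesis gsym : forall u v, g u v = g v u.

Definition chi (U : {set V}) : V -> bool := fun v => v \in U.

Definition gr : rel V := fun u v => g u v != 0.

Lemma gr_sym : symmetric gr.
Proof. by move=> u v; rewrite /gr gsym. Qed.

Definition setb env (P : bp) : {set V} := [set v | P (bits env v)].

Lemma setb_up U env P : setb (U :: env) (up P) = setb env P.
Proof. by apply/setP => v; rewrite !inE. Qed.

Lemma setb_0 U env : setb (U :: env) (bit 0) = [set v | U v].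
Proof. by apply/setP => v; rewrite !inE. Qed.

Lemma sat_and env f1 f2 : sat g env (And f1 f2) <-> sat g env f1 /\ sat g env f2.
Proof. by []. Qed.

Lemma sat_not env f : sat g env (Not f) <-> ~ sat g env f.
Proof. by []. Qed.

Lemma sat_alle env p : sat g env (AllE p) <->
 forall u v, g u v != 0 -> p (bits env u) (g u v) (bits env v).
Proof. by []. Qed.

Lemma sat_sub env X Y : sat g env (SubF X Y) <-> setb env X \subset setb env Y.
Proof.
rewrite /= leqn0 cards_eq0; split.
 move=> /eqP E; apply/subsetP => v; rewrite !inE => Xv.
 by move/setP: E => /(_ v); rewrite !inE Xv => /negbFE.
move/subsetP => H; apply/eqP/setP => v; rewrite !inE; apply/negbTE/negP.
by case/andP=> Xv; have := H v; rewrite !inE => /(_ Xv) ->.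
Qed.

Lemma sat_all env f : sat g env (AllF f) <-> forall U : {set V}, sat g (chi U :: env) f.
Proof.
rewrite /=; split.
 by move=> H U; apply: contrapT => H'; apply: H; exists (chi U).
move=> H [U HU]; apply: HU.
rewrite (_ : U = chi [set v | U v]); first exact: H.
by apply/funext => v; rewrite /chi inE.
Qed.

Lemma sat_ex env f : sat g env (Ex f) <-> exists U : {set V}, sat g (chi U :: env) f.
Proof.
rewrite /=; split; last by case=> U HU; exists (chi U).
case=> U HU; exists [set v | U v].
rewrite (_ : chi [set v | U v] = U) //.
by apply/funext => v; rewrite /chi inE.
Qed.

Lemma setb_mem (U : {set V}) env : setb (chi U :: env) (bit 0) = U.
Proof. by rewrite setb_0; apply/setP => v; rewrite /chi inE. Qed.

Lemma sat_imp env f1 f2 : sat g env (ImpF f1 f2) <-> (sat g env f1 -> sat g env f2).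
Proof.
rewrite /=; split; first by move=> H h1; apply: contrapT => h2; apply: H.
by move=> H [h1 h2]; apply: h2; apply: H.
Qed.

Lemma sat_card env P q : sat g env (CardP P q) <-> #|setb env P| <= q.
Proof. by []. Qed.

Lemma sat_one env X : sat g env (OneF X) <-> exists x, setb env X = [set x].
Proof.
rewrite /= -/(setb env X) leqn0 cards_eq0; split.
 case=> le /negP ne; apply/cards1P; rewrite eqn_leq le lt0n cards_eq0 //.
by case=> x ->; rewrite cards1; split=> //; apply/negP; rewrite -cards_eq0 cards1.
Qed.

Lemma sat_closed env X A : sat g env (ClosedF X A) <->
 forall a b, a \in setb env X -> a \in setb env A -> b \in setb env A -> gr a b ->
 b \in setb env X.
Proof.
rewrite /=; split=> H a b.
 by rewrite !inE => Xa Aa Ab gab; have := H a b gab; rewrite Xa Aa Ab.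
move=> gab; apply/implyP => /and3P [Xa Aa Ab].
by have := H a b; rewrite !inE; apply.
Qed.

Opaque sat.

Lemma sat_comp env x U A x0 : setb env x = [set x0] -> x0 \in setb env A ->
 sat g env (CompF x U A) <-> setb env U = component gr (setb env A) x0.
Proof.
move=> Ex xA; rewrite /CompF; split.
 move/sat_and => [/sat_and [/sat_sub s1 /sat_sub s2] /sat_and [/sat_closed cl /sat_all mn]].
 rewrite Ex sub1set in s1; apply/eqP; rewrite eqEsubset; apply/andP; split.
 have /sat_imp h := mn (component gr (setb env A) x0).
 suff /h/sat_sub : sat g (chi (component gr (setb env A) x0) :: env)
 (And (SubF (up x) (bit 0)) (ClosedF (bit 0) (up A))).
 by rewrite setb_up setb_mem.
 apply/sat_and; split.
 by apply/sat_sub; rewrite setb_up setb_mem Ex sub1set compxx.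
 apply/sat_closed => a b; rewrite setb_up setb_mem => ac aA bA gab.
 exact: comp_step gab aA bA.
 apply/subsetP => y; apply: (comp_ind (P := fun y => y \in setb env U)) => // a b aU aA bA gab.
move=> EU; apply/sat_and; split; apply/sat_and; split; first (by apply/sat_sub; rewrite Ex EU sub1set compxx).
- by apply/sat_sub; rewrite EU comp_sub.
- by apply/sat_closed => a b; rewrite EU => ac aA bA gab; exact: comp_step gab aA bA.
- apply/sat_all => Y; apply/sat_imp => /sat_and [/sat_sub s1 /sat_closed cl].
 apply/sat_sub; move: s1 cl; rewrite !setb_up !setb_mem Ex EU sub1set => xY cl.
 apply/subsetP => y; apply: (comp_ind (P := fun y => y \in Y)) => // a b aY aA bA gab.
Qed.

Lemma sat_half env J C W : #|setb env W| <= J -> sat g env (HalfF J C W) <->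
 #|setb env W :&: setb env C|.*2 <= #|setb env W|.
Proof.
move=> leJ.
have E : setb env (fun b => W b && C b) = setb env W :&: setb env C.
 by apply/setP => v; rewrite !inE.
have all_iff s : sat g env (foldr (fun j f => And (ImpF (CardP W j)
 (CardP (fun b => W b && C b) j./2)) f) (CardP (fun=> false) 0) s) <->
 forall j, j \in s -> #|setb env W| <= j -> #|setb env W :&: setb env C| <= j./2.
 elim: s => [|j s IH].
 split=> // _; apply/sat_card; rewrite leqn0 cards_eq0; apply/eqP/setP => v.
 by rewrite !inE.
 rewrite [foldr _ _ _]/=; split.
 move/sat_and => [/sat_imp h1 /IH h2] i; rewrite inE => /orP [/eqP -> le|/h2 //].
 by have := h1 le => /sat_card; rewrite E.
 move=> H; apply/sat_and; split; last by apply/IH => i is_; apply: H; rewrite inE is_ orbT.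
 by apply/sat_imp => /sat_card le; apply/sat_card; rewrite E; apply: H; rewrite ?inE ?eqxx.
rewrite /HalfF all_iff; split=> H.
 have := H #|setb env W|; rewrite mem_iota add0n ltnS leJ => /(_ isT (leqnn _)).
 by rewrite -leq_double; move=> h; apply: leq_trans h _; rewrite -[X in _ <= X]odd_double_half leq_addl.
move=> j _ le; rewrite -(doubleK #|_ :&: _|); apply: half_leq; exact: leq_trans le.
Qed.

Lemma sat_allcomp env A f (Q : {set V} -> Prop) :
 (forall x0 C, sat g (chi C :: chi [set x0] :: env) f <-> Q C) ->
 sat g env (AllCompF A f) <->
 forall x, x \in setb env A -> Q (component gr (setb env A) x).
Proof.
move=> fQ; rewrite /AllCompF sat_all.
have E1 x C : setb (chi C :: chi [set x] :: env) (bit 1) = [set x].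
 by apply/setP => v; rewrite !inE /bit /= /chi inE.
split.
 move=> H x xA; have /sat_imp h := H [set x].
 have /h/sat_all/(_ (component gr (setb env A) x))/sat_imp h' :
 sat g (chi [set x] :: env) (And (OneF (bit 0)) (SubF (bit 0) (up A))).
 apply/sat_and; split; first by apply/sat_one; exists x; rewrite setb_mem.
 by apply/sat_sub; rewrite setb_mem setb_up sub1set.
 have xA2 : x \in setb (chi (component gr (setb env A) x) :: chi [set x] :: env) (up (up A)).
 by rewrite !setb_up.
 apply/(fQ x); apply: h'; apply/(sat_comp _ (E1 _ _) xA2).
 by rewrite !setb_up setb_mem.
move=> H X; apply/sat_imp => /sat_and [/sat_one [x]]; rewrite setb_mem => -> /sat_sub.
rewrite setb_mem setb_up sub1set => xA.
apply/sat_all => C; apply/sat_imp.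
have xA2 : x \in setb (chi C :: chi [set x] :: env) (up (up A)) by rewrite !setb_up.
move/(sat_comp _ (E1 _ _) xA2); rewrite !setb_up setb_mem => EC.
by apply/(fQ x); rewrite EC; exact: H.
Qed.

Lemma sat_bal env J W A : #|setb env W| <= J ->
 sat g env (BalF J W A) <->
 forall x, x \in setb env A ->
 #|setb env W :&: component gr (setb env A) x|.*2 <= #|setb env W|.
Proof.
move=> leJ; apply: (@sat_allcomp _ _ _ (fun C => #|setb env W :&: C|.*2 <= #|setb env W|)).
by move=> x0 C; rewrite sat_half !setb_up // setb_mem.
Qed.

Lemma sat_nbr env d U Wn : sat g env (NbrF d U Wn) <->
 setb env Wn = touched gr (setb env d) (setb env U).
Proof.
rewrite /NbrF; split.
 move/sat_and => [/sat_sub s1 /sat_and [/sat_alle h2 /sat_all h3]]; apply/eqP; rewrite eqEsubset; apply/andP; split.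
 apply/subsetP => x xW; rewrite inE (subsetP s1) //=.
 have /sat_imp h := h3 [set x].
 apply/existsP; apply: contrapT => nex.
 have /h/sat_not : sat g (chi [set x] :: env) (And (OneF (bit 0)) (SubF (bit 0) (up Wn))).
 apply/sat_and; split; first by apply/sat_one; exists x; rewrite setb_mem.
 by apply/sat_sub; rewrite setb_mem setb_up sub1set.
 apply; apply/sat_alle => u v guv; apply/negP => /andP [bu bv]; apply: nex.
 exists v; move: bu; rewrite /bit /= /chi inE => /eqP Eu.
 by apply/andP; split; [rewrite inE|rewrite gr_sym -Eu].
 apply/subsetP => x; rewrite inE => /andP [xd /existsP [z /andP [zU gzx]]].
 by have := h2 z x gzx; rewrite !inE in xd zU *; rewrite xd zU.
move=> EW; apply/sat_and; split; last (apply/sat_and; split).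
- by apply/sat_sub; rewrite EW; apply/subsetP => x; rewrite inE => /andP [].
- apply/sat_alle => u v guv; apply/implyP => /andP [Uu dv].
 have : v \in setb env Wn.
 by rewrite EW !inE dv; apply/existsP; exists u; rewrite inE Uu.
 by rewrite inE.
- apply/sat_all => X; apply/sat_imp => /sat_and [/sat_one [x]]; rewrite setb_mem => -> /sat_sub.
 rewrite setb_mem setb_up sub1set EW inE => /andP [_ /existsP [z /andP [zU gzx]]].
 rewrite gr_sym in gzx; apply/sat_not => /sat_alle /(_ x z gzx); rewrite /bit /= /chi inE eqxx.
 by rewrite inE in zU; rewrite /up /= zU.
Qed.

End Semantics.

(* Sets D, {u}, Wn, Zn: Wn is the neighbourhood of the component U of u outside
 D, and Zn with some vertices of Wn is a balanced separator of Wn + u. *)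
Definition SplitF T J :=
 Ex (And (CompF (bit 2) (bit 0) (fun b => ~~ bit 1 b))
 (And (SubF (bit 4) (bit 0))
 (And (NbrF (bit 1) (bit 0) (bit 3))
 (Ex (And (SubF (bit 0) (bit 4))
 (And (CardP (fun b => bit 5 b || bit 0 b) T.+1)
 (BalF J (fun b => bit 4 b || bit 3 b)
 (fun b => (bit 1 b || bit 4 b) && ~~ (bit 5 b || bit 0 b))))))))).

(* Sets M, free variables, clauses: M is a satisfying assignment. *)
Definition ModelF :=
 And (SubF (bit 0) (bit 1))
 (AllF (ImpF (And (OneF (bit 0)) (SubF (bit 0) (bit 3)))
 (Not (AllE (fun bu s bv => ~~ (bit 0 bu && ((s == 2) == bit 1 bv))))))).

Definition KillF (Kl t b : bp) :=
 And (SubF b Kl) (And (AllE (fun bu s bv => b bu && ((s == 2) == t bu) ==> Kl bv))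
 (AllF (ImpF (And (OneF (bit 0)) (SubF (bit 0) (fun l => up Kl l && ~~ up b l)))
 (Not (AllE (fun bu s bv => ~~ [&& bit 0 bu, up b bv & (s == 2) == up t bv])))))).

(** The touched set is bounded by guessing a cover of at most [w] vertices, without describing the
    set itself. *)
Definition ShatterF w (X Z Kl : bp) :=
 AllCompF (fun b => ~~ Kl b && ~~ (X b || Z b))
 (Ex (And (CardP (bit 0) w)
 (AllE (fun bu _ bv =>
 [&& bit 1 bu, up (up (up X)) bv & ~~ up (up (up Kl)) bv] ==> bit 0 bv)))).

(* Sets B, D, {u}, allowed variables, all variables. *)
Definition BackdoorF w x0 J :=
 And (SubF (bit 0) (bit 3))
 (Ex (And (CompF (bit 3) (bit 0) (fun b => ~~ bit 2 b))
 (Ex (And (NbrF (bit 3) (bit 1) (bit 0))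
 (AllF (ImpF (SubF (bit 0) (bit 3))
 (Ex (And (KillF (bit 0) (bit 1) (bit 4))
 (And (Ex (And (CardP (bit 0) w.+1)
 (BalF J (fun b => bit 3 b || bit 7 b) (fun b => ~~ bit 1 b && ~~ bit 0 b))))
 (AllF (ImpF (And (CardP (bit 0) x0) (SubF (bit 0) (bit 9)))
 (Ex (And (CardP (bit 0) (w * x0)) (ShatterF w (bit 1) (bit 0) (bit 2))))))))))))))).

Section QuerySemantics.
Variables (V : finType) (g : V -> V -> nat).
Hypothesis gsym : forall u v, g u v = g v u.
Notation G := (gr g).

Opaque sat.

Ltac sb := apply/setP => v; rewrite !inE /bit /bits /= /chi ?inE.

Lemma sat_split T J (D Wn Zn : {set V}) u : u \notin D -> #|u |: Wn| <= J ->
 sat g [:: chi D; chi [set u]; chi Wn; chi Zn] (SplitF T J) <->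
 let U := component G (~: D) u in
 [/\ Wn = touched G D U, Zn \subset U & exists2 Zw : {set V}, Zw \subset Wn &
 #|Zn :|: Zw| <= T.+1 /\ separates G (u |: Wn) (Zn :|: Zw) (U :|: Wn)].
Proof.
move=> uD leJ; rewrite /SplitF; set env := [:: _; _; _; _].
have E2 U : setb (chi U :: env) (bit 2) = [set u] by sb.
have E1 U : setb (chi U :: env) (fun b => ~~ bit 1 b) = ~: D by sb.
have uA U : u \in setb (chi U :: env) (fun b => ~~ bit 1 b) by rewrite E1 inE.
have F1 Zw U : setb (chi Zw :: chi U :: env) (fun b => bit 5 b || bit 0 b) = Zn :|: Zw by sb.
have F2 Zw U : setb (chi Zw :: chi U :: env) (fun b => bit 4 b || bit 3 b) = u |: Wn.
 by sb; rewrite orbC.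
have F3 Zw U : setb (chi Zw :: chi U :: env) (fun b =>
 (bit 1 b || bit 4 b) && ~~ (bit 5 b || bit 0 b)) = (U :|: Wn) :\: (Zn :|: Zw).
 by sb; rewrite andbC.
have F4 Zw U : setb (chi Zw :: chi U :: env) (bit 4) = Wn by sb.
have F5 U : setb (chi U :: env) (bit 4) = Zn by sb.
have F6 U : setb (chi U :: env) (bit 1) = D by sb.
have F7 U : setb (chi U :: env) (bit 3) = Wn by sb.
have leJ' Zw U : #|setb (chi Zw :: chi U :: env) (fun b => bit 4 b || bit 3 b)| <= J.
 by rewrite F2.
split.
 move/sat_ex => [U /sat_and [/(sat_comp g _ (E2 U) (uA U))]].
 rewrite setb_mem E1 => EU /sat_and [/sat_sub]; rewrite F5 setb_mem => sZ.
 move=> /sat_and [/(sat_nbr gsym)]; rewrite F7 F6 setb_mem => EW.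
 move=> /sat_ex [Zw /sat_and [/sat_sub]]; rewrite setb_mem F4 => sZw.
 move=> /sat_and [/sat_card]; rewrite F1 => cZ /(sat_bal g _ (leJ' _ _)).
 rewrite F2 F3 => sp; rewrite -EU; split=> //; exists Zw => //.
set U := component G _ _ => -[EW sZ [Zw sZw [cZ sp]]].
apply/sat_ex; exists U; apply/sat_and; split.
 by apply/(sat_comp g _ (E2 U) (uA U)); rewrite setb_mem E1.
apply/sat_and; split; first by apply/sat_sub; rewrite F5 setb_mem.
apply/sat_and; split; first by apply/(sat_nbr gsym); rewrite F7 F6 setb_mem.
apply/sat_ex; exists Zw; apply/sat_and; split; first by apply/sat_sub; rewrite setb_mem F4.
apply/sat_and; split; first by apply/sat_card; rewrite F1.
by apply/(sat_bal g _ (leJ' _ _)); rewrite F2 F3.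
Qed.

Lemma sat_model (M Fr Cl : {set V}) :
 sat g [:: chi M; chi Fr; chi Cl] ModelF <->
 M \subset Fr /\ forall cl, cl \in Cl -> exists x, G cl x /\ ((g cl x == 2) = (x \in M)).
Proof.
rewrite /ModelF; set env := [:: _; _; _].
have E0 : setb env (bit 0) = M by sb.
have E1 : setb env (bit 1) = Fr by sb.
have E3 X : setb (chi X :: env) (bit 3) = Cl by sb.
rewrite sat_and sat_sub E0 E1; split=> -[sM H]; split=> //.
 move=> cl clC; apply: contrapT => nex; move/sat_all: H => /(_ [set cl]) /sat_imp.
 have h : sat g (chi [set cl] :: env) (And (OneF (bit 0)) (SubF (bit 0) (bit 3))).
 apply/sat_and; split; first by apply/sat_one; exists cl; rewrite setb_mem.
 by apply/sat_sub; rewrite setb_mem E3 sub1set.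
 move=> /(_ h) /sat_not; apply; apply/sat_alle => a b gab; apply/negP.
 rewrite /bit /bits /= /chi inE => /andP [/eqP Ea /eqP Eb]; apply: nex.
 by exists b; rewrite -Ea.
apply/sat_all => X; apply/sat_imp => /sat_and [/sat_one [cl]].
rewrite setb_mem => -> /sat_sub; rewrite setb_mem E3 sub1set => /H [x [gx Ex]].
apply/sat_not => /sat_alle /(_ cl x gx).
by rewrite /bit /bits /= /chi inE eqxx Ex eqxx.
Qed.

Definition sg u v := g u v == 2.

Lemma sat_kill env Kl t b : sat g env (KillF Kl t b) <->
 setb env Kl = killed G sg (setb env b) (setb env t).
Proof.
rewrite /KillF sat_and sat_and sat_sub sat_alle sat_all; split.
 case=> s1 [s2 s3]; apply/eqP; rewrite eqEsubset; apply/andP; split.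
 apply/subsetP => c cK; rewrite !inE; case: (boolP (b (bits env c))) => //= cb.
 apply/existsP; apply: contrapT => nex; move: (s3 [set c]) => /sat_imp.
 have h : sat g (chi [set c] :: env)
 (And (OneF (bit 0)) (SubF (bit 0) (fun l => up Kl l && ~~ up b l))).
 apply/sat_and; split; first by apply/sat_one; exists c; rewrite setb_mem.
 apply/sat_sub; rewrite setb_mem sub1set inE /up /=.
 by move: cK; rewrite inE => ->; rewrite cb.
 move=> /(_ h) /sat_not; apply; apply/sat_alle => x y gxy; apply/negP.
 rewrite /bit /up /= /chi inE => /and3P [/eqP Ex by_ sy]; apply: nex.
 by exists y; rewrite !inE by_ /= gr_sym // /sg gsym -Ex /gr gxy.
 apply/subsetP => c; rewrite !inE => /orP [bc|].
 by have := subsetP s1 c; rewrite !inE; apply.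
 case/existsP=> x; rewrite !inE => /and3P [bx gxc sx].
 by have := s2 x c gxc; rewrite bx sx.
move=> EK; split; first by rewrite EK subsetUl.
split.
 move=> x y gxy; apply/implyP => /andP [bx sx].
 have : y \in setb env Kl.
 by rewrite EK !inE; apply/orP; right; apply/existsP; exists x; rewrite !inE bx /gr gxy.
 by rewrite inE.
move=> X; apply/sat_imp => /sat_and [/sat_one [c]]; rewrite setb_mem => -> /sat_sub.
rewrite setb_mem sub1set inE /up /= => /andP [Kc bc].
apply/sat_not => /sat_alle H.
have : c \in setb env Kl by rewrite inE.
rewrite EK !inE (negbTE bc) /= => /existsP [x]; rewrite !inE => /and3P [bx gxc sx].
move: (gxc); rewrite gr_sym // => gcx; have := H c x gcx.
rewrite /bit /up /= /chi inE eqxx bx /=.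
by move: sx; rewrite /sg gsym => ->.
Qed.

Lemma sat_shatter env w X Z Kl : sat g env (ShatterF w X Z Kl) <->
 shatters G w (setb env X) (setb env Z) (~: setb env Kl).
Proof.
rewrite /ShatterF.
have EA : setb env (fun b => ~~ Kl b && ~~ (X b || Z b)) =
 ~: setb env Kl :\: (setb env X :|: setb env Z).
 by apply/setP => v; rewrite !inE andbC.
rewrite (@sat_allcomp _ g _ _ _ (fun C =>
 #|touched G (setb env X :&: ~: setb env Kl) C| <= w)); first by rewrite EA.
move=> x0 C; split.
 move/sat_ex => [Tt /sat_and [/sat_card]]; rewrite setb_mem => cT /sat_alle H.
 apply: leq_trans (subset_leq_card _) cT; apply/subsetP => y.
 rewrite !inE => /andP [/andP [Xy Ky] /existsP [z /andP [zC gzy]]].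
 have := H z y gzy; rewrite /bit /up /= /chi zC /= => /implyP; apply.
 by rewrite Xy.
move=> le; apply/sat_ex; exists (touched G (setb env X :&: ~: setb env Kl) C).
apply/sat_and; split; first by apply/sat_card; rewrite setb_mem.
apply/sat_alle => a b gab; rewrite /bit /up /= /chi; apply/implyP => /and3P [aC Xb Kb].
by rewrite !inE Xb Kb /=; apply/existsP; exists a; rewrite aC.
Qed.

Lemma sat_backdoor w x0 J (B D Al Iv : {set V}) u : u \notin D ->
 let W := u |: touched G D (component G (~: D) u) in #|W| <= J ->
 sat g [:: chi B; chi D; chi [set u]; chi Al; chi Iv] (BackdoorF w x0 J) <->
 B \subset Al /\ backdoor_like G (fun v => v \in Iv) sg w x0 W B.
Proof.
move=> uD W leJ; rewrite /BackdoorF; set env := [:: _; _; _; _; _].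
have E0 : setb env (bit 0) = B by sb.
have E3 : setb env (bit 3) = Al by sb.
rewrite sat_and sat_sub E0 E3; set U := component G _ u in W leJ *.
pose Wd := touched G D U.
have E2 X : setb (chi X :: env) (bit 3) = [set u] by sb.
have E1 X : setb (chi X :: env) (fun b => ~~ bit 2 b) = ~: D by sb.
have uA X : u \in setb (chi X :: env) (fun b => ~~ bit 2 b) by rewrite E1 inE.
have F1 Y X : setb (chi Y :: chi X :: env) (bit 3) = D by sb.
have F2 Y X : setb (chi Y :: chi X :: env) (bit 1) = X by sb.
have F3 t Y X : setb (chi t :: chi Y :: chi X :: env) (bit 3) = B by sb.
have F4 K t Y X : setb (chi K :: chi t :: chi Y :: chi X :: env) (bit 4) = B by sb.
have F5 K t Y X : setb (chi K :: chi t :: chi Y :: chi X :: env) (bit 1) = t by sb.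
have G1 Z K t X : setb (chi Z :: chi K :: chi t :: chi Wd :: chi X :: env)
 (fun b => bit 3 b || bit 7 b) = W by sb; rewrite orbC.
have G2 Z K t Y X : setb (chi Z :: chi K :: chi t :: chi Y :: chi X :: env)
 (fun b => ~~ bit 1 b && ~~ bit 0 b) = ~: K :\: Z by sb; rewrite andbC.
have G3 X' K t Y X : setb (chi X' :: chi K :: chi t :: chi Y :: chi X :: env) (bit 9) = Iv by sb.
have G4 Z X' K t Y X :
 setb (chi Z :: chi X' :: chi K :: chi t :: chi Y :: chi X :: env) (bit 1) = X' by sb.
have G5 Z X' K t Y X :
 setb (chi Z :: chi X' :: chi K :: chi t :: chi Y :: chi X :: env) (bit 2) = K by sb.
have leJ' Z K t X : #|setb (chi Z :: chi K :: chi t :: chi Wd :: chi X :: env)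
 (fun b => bit 3 b || bit 7 b)| <= J by rewrite G1.
split=> -[sB H]; split=> //.
 move: H => /sat_ex [U' /sat_and [/(sat_comp g _ (E2 U') (uA U'))]].
 rewrite setb_mem E1 => -> /sat_ex [Wd' /sat_and [/(sat_nbr gsym)]].
 rewrite setb_mem F1 F2 => -> /sat_all H tau sub.
 have /sat_imp h := H tau.
 have /h /sat_ex [K /sat_and [/sat_kill]] : sat g [:: chi tau, chi Wd, chi U & env] (SubF (bit 0) (bit 3)).
 by apply/sat_sub; rewrite setb_mem F3.
 rewrite setb_mem F4 F5 => -> /sat_and [/sat_ex [Z /sat_and [/sat_card]]].
 rewrite setb_mem => cZ /(sat_bal g _ (leJ' _ _ _ _)); rewrite G1 G2 => sp /sat_all h2.
 split; first by exists Z.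
 move=> X cX sX; have /sat_imp h3 := h2 X.
 have /h3 /sat_ex [Z2 /sat_and [/sat_card]] : sat g
 [:: chi X, chi (killed G sg B tau), chi tau, chi Wd, chi U & env]
 (And (CardP (bit 0) x0) (SubF (bit 0) (bit 9))).
 apply/sat_and; split; first by apply/sat_card; rewrite setb_mem.
 by apply/sat_sub; rewrite setb_mem G3; apply/subsetP => v /(subsetP sX).
 rewrite setb_mem => cZ2 /sat_shatter; rewrite G4 G5 setb_mem => sh.
 by exists Z2.
apply/sat_ex; exists U; apply/sat_and; split.
 by apply/(sat_comp g _ (E2 U) (uA U)); rewrite setb_mem E1.
apply/sat_ex; exists Wd; apply/sat_and; split.
 by apply/(sat_nbr gsym); rewrite setb_mem F1 F2.
apply/sat_all => tau; apply/sat_imp => /sat_sub; rewrite setb_mem F3 => sub.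
have [[Z cZ sp] h2] := H tau sub.
apply/sat_ex; exists (killed G sg B tau); apply/sat_and; split.
 by apply/sat_kill; rewrite setb_mem F4 F5.
apply/sat_and; split.
 apply/sat_ex; exists Z; apply/sat_and; split; first by apply/sat_card; rewrite setb_mem.
 by apply/(sat_bal g _ (leJ' _ _ _ _)); rewrite G1 G2.
apply/sat_all => X; apply/sat_imp => /sat_and [/sat_card]; rewrite setb_mem => cX /sat_sub.
rewrite setb_mem G3 => sX; have [|Z2 cZ2 sh] := h2 X cX.
 by apply/subsetP => v /(subsetP sX).
apply/sat_ex; exists Z2; apply/sat_and; split; first by apply/sat_card; rewrite setb_mem.
by apply/sat_shatter; rewrite G4 G5 setb_mem.
Qed.

End QuerySemantics.

(** * Elimination orders and separators *)

Lemma elim_nbrs_sub (V : finType) (g g' : rel V) r v : subrel g' g ->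
 elim_nbrs g' r v \subset elim_nbrs g r v.
Proof.
move=> sub; apply/subsetP => u; rewrite !inE => /andP [-> /= /existsP [x /andP [xc xu]]].
apply/existsP; exists x; rewrite sub // andbT; move: xc; rewrite !inE.
by apply: connect_sub => a b /= /and3P [ab ha hb]; apply: connect1; apply/and3P; split=> //; exact: sub.
Qed.

(** Both separator lemmas are applied to [within g A], where the killed vertices are isolated;
    outside [Z] its components are those of [A :\: Z]. *)
Lemma order_backdoor_like (V : finType) (g : rel V) isv sgn w x0 (W B : {set V}) :
 symmetric g ->
 (forall tau : {set V}, tau \subset B -> exists2 r : V -> nat, injective r &
 forall v, #|elim_nbrs (within g (~: killed g sgn B tau)) r v| <= w) ->
 backdoor_like g isv sgn w x0 W B.
Proof.
move=> gsym H tau tB; have [r rinj rw] := H tau tB.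
set A := ~: killed g sgn B tau in rw *; move: A rw => A rw; pose h := within g A.
have hsym : symmetric h by move=> a b; rewrite /h /within /= gsym; congr andb; rewrite andbC.
have hE (Z : {set V}) x : component g (A :\: Z) x = component h (~: Z) x.
 apply/setP => y; rewrite !inE; apply: eq_connect => a b; rewrite /h /within /= !inE.
 by case: (g a b); case: (a \in Z); case: (a \in A); case: (b \in Z); case: (b \in A).
split.
 have [Z Zs Zb] := balanced_separator hsym rinj rw W.
 exists Z => // x; rewrite inE => /andP [xZ _]; rewrite hE; exact: Zb.
move=> X Xs _; have [Z Zs Zb] := touch_separator hsym rinj rw X.
exists Z => [|x]; first by apply: leq_trans Zs _; rewrite leq_mul2l Xs orbT.
move=> xA.
apply: leq_trans (Zb x _); last by move: xA; rewrite inE => /andP [].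
apply/subset_leq_card/subsetP => y hy.
have /andP [/setIP [yX yA] /existsP [z /andP [zc zy]]] :
 (y \in X :&: A) && [exists z in component g (A :\: (X :|: Z)) x, g z y].
 by move: hy; rewrite /touched in_set.
have zA : z \in A by have := subsetP (comp_sub g xA) z zc; rewrite in_setD => /andP [].
have hzy : h z y by rewrite /h /within /= zy zA yA.
by rewrite in_set yX; apply/existsP; exists z; rewrite -hE zc hzy.
Qed.

Lemma index_after (T : eqType) (P1 : seq T) v P2 : uniq (P1 ++ v :: P2) ->
 let P := P1 ++ v :: P2 in
 [/\ index v P = size P1, forall x, x \in P -> (x \in P2) = (size P1 < index x P)
 & forall x, x \in P2 -> index x P = (size P1).+1 + index x P2].
Proof.
rewrite cat_uniq /= negb_or => /and4P [u1 /andP [v1 h] v2 u2]; split.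
- by rewrite index_cat (negbTE v1) /= eqxx addn0.
- move=> x; rewrite mem_cat inE index_cat; case: ifP => [x1 _|x1 /=].
 have -> : (x \in P2) = false by apply/negP => x2; case/hasP: h; exists x.
 by symmetry; apply/negbTE; rewrite -leqNgt ltnW // index_mem.
 case/orP=> [/eqP ->|x2]; first by rewrite eqxx addn0 ltnn (negbTE v2).
 case: eqP => [E|_]; first by rewrite E x2 in v2.
 by rewrite x2 addnS ltnS leq_addr.
- move=> x x2; rewrite index_cat ifN; last by apply/negP => x1; case/hasP: h; exists x.
 by rewrite /= ifN ?addnS //; apply: contraNneq v2 => ->.
Qed.

Section Preorder.
Variables (V : finType) (c : nat).

(** Validity without the adjacency table. Order, colours and bags are settled first, and the table
    is refilled afterwards for a graph with more edges. *)
Definition prevalid c (g : V -> V -> nat) (S : estr V) :=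
 exists bag : V -> {set V}, let pos v := index v (eord S) in
 [/\ ordered S,
 (forall v, ecol S v < c) /\
 (forall v x, x \in bag v -> pos v < pos x /\ ecol S x != ecol S v),
 (forall v x y, x \in bag v -> y \in bag v -> pos x < pos y -> y \in bag x) /\
 (forall v x, g v x != 0 -> pos v < pos x -> x \in bag v)
 & forall v, match epar S v with
 | Some p => p \in bag v /\ forall x, x \in bag v -> pos p <= pos x
 | None => bag v = set0 end].

Definition adjspec (g : V -> V -> nat) (S : estr V) :=
 let pos v := index v (eord S) in forall v j,
 (eadj S v j = 0 /\ forall x, pos v < pos x -> g v x != 0 -> ecol S x != j) \/
 (exists x, [/\ pos v < pos x, g v x != 0, ecol S x = j & eadj S v j = g v x]).

Lemma pos_eq (S : estr V) u v : ordered S -> index u (eord S) = index v (eord S) -> u = v.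
Proof.
by case=> _ all _ E; rewrite -(nth_index u (all u)) E nth_index.
Qed.

(** Two members of a bag with the same colour coincide, since the later would lie in the bag of the
    earlier. So an entry found under the colour of [x] belongs to [x]. *)
Lemma prevalid_valid (g : V -> V -> nat) S : prevalid c g S -> adjspec g S -> valid c g S.
Proof.
move=> [bag [ord [h1 h2] [h3 h4] h5]] adj; exists bag; split=> //.
split=> [v x xb|v j nj].
 case: (adj v (ecol S x)) => [[-> no]|[y [py gy cy ->]]].
 case: (eqVneq (g v x) 0) => // ne; have [px _] := h2 _ _ xb.
 by have := no x px ne; rewrite eqxx.
 have yb := h4 _ _ gy py; case: (ltngtP (index x (eord S)) (index y (eord S))) => lt.
 - by have [_] := h2 _ _ (h3 _ _ _ xb yb lt); rewrite cy eqxx.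
 - by have [_] := h2 _ _ (h3 _ _ _ yb xb lt); rewrite cy eqxx.
 - by rewrite (pos_eq ord lt).
case: (adj v j) => [[]//|[y [py gy cy _]]].
by have := nj y (h4 _ _ gy py); rewrite cy eqxx.
Qed.

(* A vertex that comes last may be joined to everything, at the cost of one colour. *)
Definition cone p (S : estr V) adj := EStr (eord S)
 (fun v => if v == p then c else ecol S v)
 (fun v => if v == p then None else if epar S v is Some q then Some q else Some p) adj.

(** Putting the last vertex [p] into every other bag keeps all conditions for any choice of edges at
    [p], so those edges can be inserted all at once. The former roots become children of [p]. *)
Lemma prevalid_cone (g g' : V -> V -> nat) S p adj : prevalid c g S ->
 (forall v, index v (eord S) <= index p (eord S)) ->
 (forall u v, u != p -> v != p -> g' u v = g u v) -> prevalid c.+1 g' (cone p S adj).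
Proof.
move=> [bag [ord [h1 h2] [h3 h4] h5]] top gE.
have lt v : v != p -> index v (eord S) < index p (eord S).
 by move=> vp; rewrite ltn_neqAle top andbT; apply: contra vp => /eqP /(pos_eq ord) ->.
exists (fun v => if v == p then set0 else p |: bag v); rewrite /cone; split=> /=.
- case: (ord) => u a par; split; [exact: u|exact: a|].
 move=> v q /=; case: (eqVneq v p) => [_|vp]; first by [].
 by case E : (epar S v) => [q'|] [<-]; [exact: (par v q' E)|exact: lt].
- split=> [v|v x]; first by case: ifP => // _; exact: leqW (h1 v).
 case: (eqVneq v p) => [_|vp] /=; first by rewrite inE.
 rewrite !inE; case: (eqVneq x p) => [-> _|xp] /=; last exact: h2.
 by split; [exact: lt|rewrite neq_ltn h1 orbT].
- split=> [v x y|v x].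
 case: (eqVneq v p) => [_|vp] /=; first by rewrite !inE.
 rewrite !inE; case: (eqVneq x p) => [->|xp] /=; first by move=> _ _; rewrite ltnNge top.
 rewrite !inE; case: (eqVneq y p) => [//|yp] /=; exact: h3.
 case: (eqVneq v p) => [->|vp] /=; first by move=> _; rewrite ltnNge top.
 move=> gvx pv; rewrite !inE; case: (eqVneq x p) => [//|xp] /=; apply: h4 => //; by rewrite -gE.
move=> v; case: (eqVneq v p) => [_|vp]; first by [].
have := h5 v; case: (epar S v) => [q [qb qm]|->] /=.
 split; first by rewrite !inE qb orbT.
 by move=> x; rewrite !inE => /orP [/eqP ->|/qm //]; exact: top.
by split; [rewrite !inE eqxx|move=> x; rewrite !inE orbF => /eqP ->].
Qed.

(** * Placing vertices from the end of the order backwards *)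

Section Rebuild.
Variables (g : V -> V -> nat).
Hypothesis gsym : forall u v, g u v = g v u.
Notation G := (gr g).

Definition nbrs (D : {set V}) v := touched G D (component G (~: D) v).

(* [v] was placed when exactly the vertices of [P] were. *)
Definition placed_ok (col : V -> nat) (par : V -> option V) v (P : seq V) :=
 let N := nbrs [set x in P] v in
 [/\ col v < c, forall x, x \in N -> col x != col v
 & match par v with
 | Some p => p \in N /\ forall x, x \in N -> index p P <= index x P
 | None => N = set0 end].

Definition placed (col : V -> nat) (par : V -> option V) (P : seq V) :=
 uniq P /\ forall P1 v P2, P = P1 ++ v :: P2 -> placed_ok col par v P2.

Lemma placed_cons col par col' par' v P : placed col par P -> v \notin P ->
 (forall x, x != v -> col' x = col x /\ par' x = par x) -> placed_ok col' par' v P ->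
 placed col' par' (v :: P).
Proof.
move=> [uP H] vP E new; split=> [|[|y P1] w P2 /= [E1 E2]]; first by rewrite /= vP.
 by rewrite -E1 -E2.
have [h1 h2 h3] := H _ _ _ E2.
have nv x : x \in P -> x != v by move=> xP; apply: contraNneq vP => <-.
have wP : w \in P by rewrite E2 mem_cat inE eqxx orbT.
have sN x : x \in nbrs [set x in P2] w -> x != v.
 by rewrite !inE => /andP [xP _]; apply: nv; rewrite E2 mem_cat inE xP !orbT.
have [cw pw] := E w (nv _ wP); split; rewrite ?cw ?pw //.
by move=> x xN; have [-> _] := E x (sN x xN); exact: h2.
Qed.

(** The order lists the vertex placed last first, so the vertices after [v] are those placed before
    it. The neighbourhood of [v] at its placement is therefore its fill-in neighbourhood in the
    finished order. *)
Lemma placed_prevalid col par P adj : placed col par P -> (forall v, v \in P) ->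
 prevalid c g (EStr P col par adj).
Proof.
move=> [uP H] all; pose pos v := index v P.
pose aft v := drop (pos v).+1 P.
have dec v : P = take (pos v) P ++ v :: aft v.
 have E : drop (pos v) P = v :: aft v by rewrite (drop_nth v) ?index_mem // nth_index.
 by rewrite -E cat_take_drop.
have ia v := @index_after V (take (pos v) P) v (aft v).
have aftP v x : (x \in aft v) = (pos v < pos x).
 by have := ia v; rewrite -dec => /(_ uP) [e1 e2 _]; rewrite e2 // -e1.
have lowE v : earlier pos v = ~: [set x in aft v] by apply/setP => x; rewrite !inE aftP -leqNgt.
pose bag v := nbrs [set x in aft v] v.
have bagP v x : x \in bag v -> pos v < pos x /\ exists2 z, z \in component G (earlier pos v) v & G z x.
 rewrite !inE aftP -lowE => /andP [-> /existsP [z /andP [h1 h2]]]; by split=> //; exists z.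
have bagI v x z : pos v < pos x -> z \in component G (earlier pos v) v -> G z x -> x \in bag v.
 by move=> lt zc zx; rewrite !inE aftP lt -lowE; apply/existsP; exists z; rewrite zc.
have Gsym : symmetric G by exact: gr_sym.
have ok v := H _ _ _ (dec v).
have ord : ordered (EStr P col par adj).
 split=> //= v p E; have [_ _] := ok v; rewrite E => -[pb _]; by have [] := bagP _ _ pb.
exists bag; split=> //=.
- split=> [v|v x xb]; first by have [] := ok v.
 by have [_ h _] := ok v; split; [have [] := bagP _ _ xb|exact: h].
- split=> [v x y /bagP [lx [a ac ax]] /bagP [ly [b bc bby]] lxy|v x gvx lt]; last first.
 by apply: bagI lt _ gvx; exact: compxx.
 have sl : earlier pos v \subset earlier pos x.
 by apply/subsetP => z; rewrite !inE => le; apply: leq_trans le (ltnW lx).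
 have av := subsetP (comp_sub G (_ : v \in earlier pos v)) _ ac.
 have vv : v \in earlier pos v by rewrite inE.
 have xv : x \in component G (earlier pos x) v.
 apply: (@comp_step _ _ _ v a) ax _ _; last by rewrite inE.
 exact: (subsetP (comp_mono G v sl)).
 by apply: (subsetP sl); apply: av.
 apply: bagI lxy _ bby; rewrite (comp_eq Gsym xv).
 exact: (subsetP (comp_mono G v sl)).
move=> v; have [_ _] := ok v; case: (par v) => [p [pb pm]|//].
split=> // x xb; have lt y : y \in aft v -> pos y = (pos v).+1 + index y (aft v).
 by move=> ya; have := ia v; rewrite -dec => /(_ uP) [e1 _ e3]; rewrite /pos e3 // -e1.
have ina y : y \in bag v -> y \in aft v by move/bagP => [l _]; rewrite aftP.
change (pos p <= pos x); rewrite (lt p) ?ina // (lt x) ?ina // leq_add2l; exact: pm.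
Qed.

Lemma nbrs_grow (D D' : {set V}) v : D \subset D' -> v \notin D' ->
 #|nbrs D' v| <= #|nbrs D v| + #|D' :\: D|.
Proof.
move=> sD vD; apply: leq_trans (leq_card_setU _ _); apply/subset_leq_card/subsetP => x.
rewrite !inE => /andP [xD /existsP [z /andP [zc zx]]]; rewrite xD andbT orbC.
case: (boolP (x \in D)) => //= xd; apply/existsP; exists z; rewrite zx andbT.
by apply: (subsetP (comp_mono G v _)) zc; rewrite setCS.
Qed.

Section Split.
Variables (D : {set V}) (u : V) (s T : nat).
Hypotheses (uD : u \notin D) (nb : forall v, v \notin D -> #|nbrs D v| <= s).
Let U := component G (~: D) u.
Let W := touched G D U.

(** After placing [u] and the separator, a part of the split component is bounded by [u], the
    separator and at most half of [u |: W]: in all [1 + (T + 1) + (s + 1) / 2], which is at most [s]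
    once [s] is at least [2 * T + 5]. Other components gain no boundary. *)
Lemma split_step (Zn Zw : {set V}) : Zn \subset U -> Zw \subset W ->
 #|Zn :|: Zw| <= T.+1 -> separates G (u |: W) (Zn :|: Zw) (U :|: W) -> 2 * T + 5 <= s ->
 forall v, v \notin D :|: (u |: Zn) -> #|nbrs (D :|: (u |: Zn)) v| <= s.
Proof.
move=> ZU ZW Zs sep sT v; set D' := D :|: _ => vD'.
have vD : v \notin D by apply: contra vD'; rewrite inE => ->.
have Gsym : symmetric G by exact: gr_sym.
have sub : ~: D' \subset ~: D by rewrite setCS subsetUl.
have uU : u \in U := compxx _ _ _.
case: (boolP (v \in U)) => vU; last first.
 apply: leq_trans (nb vD); apply/subset_leq_card/subsetP => x.
 rewrite inE => /andP [xD' /existsP [z /andP [zc zx]]].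
 have zc' := subsetP (comp_mono G v sub) z zc.
 have zD : z \in ~: D by apply: (subsetP (comp_sub G (_ : v \in ~: D))) zc'; rewrite inE.
 suff xD : x \in D by rewrite inE xD; apply/existsP; exists z; rewrite zc'.
 apply: contraNT vU => xD; have xU : x \in U.
 by move: xD'; rewrite !inE (negbTE xD) /= => /orP [/eqP ->|/(subsetP ZU)]; rewrite ?inE.
 have xc : x \in component G (~: D) v by apply: comp_step zc' zx zD _; rewrite inE.
 rewrite /U -(comp_eq Gsym xU) (comp_eq Gsym xc); exact: compxx.
pose K := component G (~: D') v.
have KU : K \subset U.
 rewrite /U -(comp_eq Gsym vU); exact: comp_mono.
have KD' : K \subset ~: D' by apply: comp_sub; rewrite inE.
pose A := (U :|: W) :\: (Zn :|: Zw).
have WD : W \subset D by apply/subsetP => x; rewrite inE => /andP [].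
have inA x : x \in K -> x \in A.
 move=> xK; have xU := subsetP KU _ xK; have := subsetP KD' _ xK.
 rewrite !inE !negb_or => /and3P [xD _ xZ]; rewrite xZ.
 have -> : x \notin Zw by apply: contra xD => /(subsetP ZW)/(subsetP WD).
 by move: xU; rewrite inE => ->.
have KA x : x \in K -> x \in component G A v.
 move=> xK; have : x \in component G K v by rewrite comp_self // inE.
 by apply: (subsetP (comp_mono G v _)); apply/subsetP => y /inA.
have vA : v \in A by apply: inA; exact: compxx.
have sub2 : nbrs D' v \subset u |: ((Zn :|: Zw) :|: ((u |: W) :&: component G A v)).
 apply/subsetP => x; rewrite inE => /andP [xD' /existsP [z /andP [zc zx]]].
 case: (boolP (x \in D)) => xD; last first.
 by move: xD'; rewrite !inE (negbTE xD) /= => /orP [->|->]; rewrite ?orbT.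
 have xW : x \in W.
 by rewrite inE xD; apply/existsP; exists z; rewrite zx andbT; exact: (subsetP KU).
 case: (boolP (x \in Zn :|: Zw)) => xZ; first by rewrite !inE in xZ *; rewrite xZ !orbT.
 have xA : x \in A by rewrite inE xZ inE xW orbT.
 have xc : x \in component G A v by apply: comp_step (KA _ zc) zx (inA _ zc) xA.
 apply/setUP; right; apply/setUP; right; apply/setIP; split=> //.
 by apply/setUP; right.
apply: leq_trans (subset_leq_card sub2) _.
have := sep v vA; rewrite -/A => h.
have c1 := leq_card_setU [set u] ((Zn :|: Zw) :|: ((u |: W) :&: component G A v)).
have c2 := leq_card_setU (Zn :|: Zw) ((u |: W) :&: component G A v).
have c3 := leq_card_setU [set u] W; rewrite cards1 in c1 c3.
have Ws : #|W| <= s := nb uD.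
have h1 : #|(u |: W) :&: component G A v|.*2 <= s.+1.
 by apply: (leq_trans h); apply: (leq_trans c3); rewrite add1n ltnS.
apply: (leq_trans c1); apply: (@leq_trans (1 + (T.+1 + #|(u |: W) :&: component G A v|))).
 by rewrite leq_add2l; apply: (leq_trans c2); rewrite leq_add2r.
by move: h1; move: #|(u |: W) :&: component G A v| => a; clear -sT; lia.
Qed.

(** Nothing of [u |: W] remains. With this separator, which always exists, the split query can serve
    merely to list the boundary of [u]. *)
Lemma split_trivial : separates G (u |: W) ([set u] :|: W) (U :|: W).
Proof.
move=> x xA; rewrite (_ : _ :&: _ = set0) ?cards0 //; apply/setP => y; rewrite [RHS]inE.
apply/negP; rewrite inE => /andP [y1 /(subsetP (comp_sub G xA))].
by rewrite inE y1.
Qed.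

Lemma split_of_separator (Z : {set V}) : #|Z| <= T.+1 -> separates G (u |: W) Z setT ->
 exists Zn Zw : {set V}, [/\ Zn \subset U, Zw \subset W, #|Zn :|: Zw| <= T.+1
 & separates G (u |: W) (Zn :|: Zw) (U :|: W)].
Proof.
move=> Zs sep; exists (Z :&: U), (Z :&: W); rewrite !subsetIr; split=> //.
 by apply: leq_trans Zs; apply: subset_leq_card; rewrite subUset !subsetIl.
rewrite -setIUr; set A := U :|: W => x xA.
have E : A :\: (Z :&: A) \subset setT :\: Z.
 by apply/subsetP => y; rewrite !inE negb_and andb_orl andbT => /orP [/andP []|] //; case/andP=> /negP.
apply: leq_trans (sep x (subsetP E x xA)); rewrite leq_double; apply: subset_leq_card.
by apply: setIS; apply: comp_mono.
Qed.

End Split.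
End Rebuild.
End Preorder.

(** * Hitting the hidden backdoor *)

Section Hitting.
Variables (V : finType) (g : rel V) (isv : pred V) (sgn : V -> V -> bool).
Hypotheses (gsym : symmetric g) (gbip : forall u v, g u v -> isv u -> ~~ isv v).
Variables (w k : nat) (W : {set V}).
Let M := w.*2.+2.
Let good (B : {set V}) := [/\ B \subset isv, #|B| <= k & backdoor_like g isv sgn w (M * k) W B].

(** The second alternative is stable under further rounds, so the search can run for a fixed number
    of rounds even after it has stopped finding sets. *)
Definition collected m (S : {set V}) :=
 (exists Bs : seq {set V}, [/\ size Bs = m, pairwise (fun A B : {set V} => [disjoint A & B]) Bs
 & forall B, B \in Bs -> good B /\ B \subset S]) \/
 (exists2 S0 : {set V}, S0 \subset S & forall B, good B -> ~~ [disjoint B & S0]).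

Lemma collected0 : collected 0 set0.
Proof. by left; exists [::]. Qed.

Lemma collected_found m (S B : {set V}) : collected m S -> good B -> [disjoint B & S] ->
 collected m.+1 (S :|: B).
Proof.
move=> [[Bs [sz pw H]]|[S0 sS H]] gB dB; last first.
 by right; exists S0 => //; apply: subset_trans sS (subsetUl _ _).
left; exists (B :: Bs); split; [by rewrite /= sz| |].
 rewrite /= pw andbT; apply/allP => A /H [_ sA]; exact: disjointWr sA dB.
move=> A; rewrite inE => /orP [/eqP ->|/H [gA sA]]; split=> //; first exact: subsetUr.
exact: subset_trans sA (subsetUl _ _).
Qed.

Lemma collected_none m (S : {set V}) : (forall B, good B -> ~~ [disjoint B & S]) -> collected m.+1 S.
Proof. by move=> H; right; exists S. Qed.

(** [M] disjoint good sets would yield a balanced separator of size at most [T], which is excluded;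
    so at some round no good set disjoint from the collected ones was left. *)
Lemma collected_all (S : {set V}) T : collected M S ->
 M * k + M * (2 ^ k * (w.+1 + w * (M * k))) <= T ->
 (forall Z : {set V}, #|Z| <= T -> ~ separates g W Z setT) ->
 forall B, good B -> ~~ [disjoint B & S].
Proof.
move=> [[Bs [sz pw H]]|[S0 sS H]] TM no; last first.
 by move=> B /H; apply: contra => d; exact: disjointWr sS d.
have inB (j : 'I_M) : nth set0 Bs j \in Bs by rewrite mem_nth // sz.
have [||||Z Zs sep] := @disjoint_backdoors_separator V g isv sgn gsym gbip w k W
 (fun j : 'I_M => nth set0 Bs j).
- by move=> j; have [[]] := H _ (inB j).
- by move=> j; have [[]] := H _ (inB j).
- move=> i j ne; move/(pairwiseP set0): pw => pw.
 case: (ltngtP i j) => lt; last by move/val_inj: lt => E; rewrite E eqxx in ne.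
 by apply: pw; rewrite ?inE ?sz.
 by rewrite disjoint_sym; apply: pw; rewrite ?inE ?sz.
- by move=> j; have [[]] := H _ (inB j).
by case: (no Z _ sep); apply: leq_trans Zs TM.
Qed.

End Hitting.

(** * Programming in the loop language *)

Definition seqs := foldr Seq Skip.
(** With truncated subtraction, both differences vanish only for equal arguments; tests yield
    nonzero for true. *)
Definition EqE e1 e2 :=
 Bin Defs.Sub (Num 1) (Bin Add (Bin Defs.Sub e1 e2) (Bin Defs.Sub e2 e1)).
Definition LtE e1 e2 := Bin Defs.Sub e2 e1.
Definition AndE e1 e2 := Bin Mul e1 e2.
Definition AddE e k := Bin Add e (Num k).

Fixpoint switch e k (f : nat -> com) :=
 if k is k'.+1 then If (EqE e (Num k')) (f k') (switch e k' f) else Skip.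

Lemma eval_eq n s e1 e2 : (eval n s (EqE e1 e2) != 0) = (eval n s e1 == eval n s e2).
Proof. by rewrite /=; apply/idP/idP; lia. Qed.

Lemma eval_lt n s e1 e2 : (eval n s (LtE e1 e2) != 0) = (eval n s e1 < eval n s e2).
Proof. by rewrite /=; lia. Qed.

Lemma eval_and n s e1 e2 :
 (eval n s (AndE e1 e2) != 0) = (eval n s e1 != 0) && (eval n s e2 != 0).
Proof. by rewrite /= muln_eq0 negb_or. Qed.

Lemma run_if n e c1 c2 s :
 run n (If e c1 c2) s = if eval n s e != 0 then run n c1 s else run n c2 s.
Proof. by []. Qed.

Lemma run_seq n c1 c2 s : run n (Seq c1 c2) s = run n c2 (run n c1 s).
Proof. by []. Qed.

Lemma iota_rcons r : iota 0 r.+1 = rcons (iota 0 r) r.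
Proof. by rewrite -{1}addn1 iotaD cats1. Qed.

Lemma run_seqs_cons n c l s : run n (seqs (c :: l)) s = run n (seqs l) (run n c s).
Proof. by []. Qed.

Lemma run_seqs_cat n l1 l2 s :
 run n (seqs (l1 ++ l2)) s = run n (seqs l2) (run n (seqs l1) s).
Proof. by elim: l1 s => //= c l IH s; rewrite IH. Qed.

Lemma run_seqs_rcons n l c s : run n (seqs (rcons l c)) s = run n c (run n (seqs l) s).
Proof. by rewrite -cats1 run_seqs_cat. Qed.

Lemma run_switch n e k f s : eval n s e < k ->
 run n (switch e k f) s = run n (f (eval n s e)) s.
Proof.
elim: k => // k IH lt.
rewrite -[LHS]/(if eval n s (EqE e (Num k)) != 0 then run n (f k) s
 else run n (switch e k f) s) eval_eq -[eval n s (Num k)]/k.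
by case: eqP => [->|ne] //; apply: IH; lia.
Qed.

(* [ok d X Y c]: well formed, nesting depth at most d, assigns only variables of
 X and arrays of Y, and leaves the input region alone. *)
Fixpoint frame (X : pred nat) (Y : pred aid) c :=
 match c with
 | Skip => true
 | Assign x _ => X x
 | Store a _ _ => Y a
 | Out _ _ => false
 | Seq c1 c2 | If _ c1 c2 => frame X Y c1 && frame X Y c2
 | Loop x c => X x && frame X Y c
 end.

Definition ok d X Y c := [&& wf c, depth c <= d & frame X Y c].

Lemma frameP n X Y c s : frame X Y c ->
 [/\ forall x, ~~ X x -> var (run n c s) x = var s x,
 forall a, ~~ Y a -> arr (run n c s) a = arr s a & inp (run n c s) = inp s].
Proof.
elim: c s => [|x e|a e1 e2|e1 e2|c1 IH1 c2 IH2|e c1 IH1 c2 IH2|x c IH] s //=.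
- by move=> Xx; split=> // y; rewrite /upd; case: eqP => // -> /negP.
- by move=> Ya; split=> // b; case: eqP => // -> /negP.
- case/andP=> f1 f2; have [v1 a1 i1] := IH1 s f1.
 have [v2 a2 i2] := IH2 (run n c1 s) f2.
 by split=> [x nx|a na|]; rewrite ?v2 ?v1 ?a2 ?a1 ?i2.
- by case/andP=> f1 f2; case: ifP => _; [apply: IH1|apply: IH2].
- case/andP=> Xx fc.
 apply: (@run_loop n x c s (fun _ s1 =>
 [/\ forall y, ~~ X y -> var s1 y = var s y,
 forall a, ~~ Y a -> arr s1 a = arr s a & inp s1 = inp s])) => // m s1 _ [v1 a1 i1].
 have [v2 a2 i2] := IH (setv s1 x m) fc.
 split=> [y ny|a na|].
 + by rewrite v2 //= /upd -v1 //; case: eqP => // E; rewrite E Xx in ny.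
 + by rewrite a2 //= a1.
 + by rewrite i2.
Qed.

Lemma ok_var n d (X : pred nat) Y c s x : ok d X Y c -> ~~ X x -> var (run n c s) x = var s x.
Proof. by case/and3P=> _ _ /(frameP n s) [H _ _]; apply: H. Qed.
Lemma ok_arr n d X (Y : pred aid) c s a : ok d X Y c -> ~~ Y a -> arr (run n c s) a = arr s a.
Proof. by case/and3P=> _ _ /(frameP n s) [_ H _]; apply: H. Qed.
Lemma frame_sub (X X' : pred nat) (Y Y' : pred aid) c : subpred X X' -> subpred Y Y' ->
 frame X Y c -> frame X' Y' c.
Proof.
move=> sX sY; elim: c => //= [x _|a _ _|c1 IH1 c2 IH2|_ c1 IH1 c2 IH2|x c IH].
- exact: sX.
- exact: sY.
- by case/andP=> /IH1 -> /IH2 ->.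
- by case/andP=> /IH1 -> /IH2 ->.
- by case/andP=> /sX -> /IH ->.
Qed.

Lemma ok_sub d d' (X X' : pred nat) (Y Y' : pred aid) c : d <= d' -> subpred X X' ->
 subpred Y Y' -> ok d X Y c -> ok d' X' Y' c.
Proof.
move=> dd sX sY /and3P [w dc f]; apply/and3P; split=> //; first exact: leq_trans dd.
exact: frame_sub f.
Qed.

Lemma ok_seq d X Y c1 c2 : ok d X Y c1 -> ok d X Y c2 -> ok d X Y (Seq c1 c2).
Proof.
by move=> /and3P [w1 d1 f1] /and3P [w2 d2 f2]; rewrite /ok /= w1 w2 f1 f2 geq_max d1 d2.
Qed.
Lemma ok_if d X Y e c1 c2 : ok d X Y c1 -> ok d X Y c2 -> ok d X Y (If e c1 c2).
Proof.
by move=> /and3P [w1 d1 f1] /and3P [w2 d2 f2]; rewrite /ok /= w1 w2 f1 f2 geq_max d1 d2.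
Qed.
Lemma ok_loop d (X : pred nat) Y x c : X x -> ok d X Y c -> ok d.+1 X Y (Loop x c).
Proof. by move=> Xx /and3P [w1 d1 f1]; rewrite /ok /= w1 ltnS d1 Xx f1. Qed.
Lemma ok_skip d X Y : ok d X Y Skip.
Proof. by []. Qed.
Lemma ok_seqs d X Y l : foldr (fun c P => ok d X Y c /\ P) True l -> ok d X Y (seqs l).
Proof. by elim: l => //= c l IH [oc ol]; apply: ok_seq => //; apply: IH. Qed.
Lemma ok_seqs_map d X Y (T : Type) (f : T -> com) l :
 (forall x, ok d X Y (f x)) -> ok d X Y (seqs (map f l)).
Proof. by move=> H; elim: l => //= x l IH; apply: ok_seq. Qed.
Lemma ok_switch d X Y e k f : (forall i, i < k -> ok d X Y (f i)) ->
 ok d X Y (switch e k f).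
Proof.
elim: k => //= k IH H; apply: ok_if; first exact: H.
by apply: IH => i lt; apply: H; exact: ltnW.
Qed.

(** * Families of markings *)

Notation marking V q := {ffun V -> 'I_q.+1}.

Section Families.
Variables (V : finType) (q : nat).

(** Markings vanish outside [D], so markings with disjoint domains can be superposed, and families
    multiply. *)
Definition fam (D : {set V}) (P : pred (marking V q)) : {set (marking V q)} :=
 [set m : marking V q | [forall v, (v \notin D) ==> (m v == ord0)] && P m].

Definition merge (m m' : marking V q) : marking V q :=
 [ffun v => if m v != ord0 then m v else m' v].

Definition fmul (M M' : {set (marking V q)}) := [set merge m m' | m in M, m' in M'].

Definition local T (D : {set V}) (f : marking V q -> T) :=
 forall m m' : marking V q, {in D, m =1 m'} -> f m = f m'.

Lemma famP (D : {set V}) (P : pred (marking V q)) (m : marking V q) :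
 reflect ((forall v, v \notin D -> m v = ord0) /\ P m) (m \in fam D P).
Proof.
rewrite inE; apply: (iffP andP) => [[/forallP H Pm]|[H Pm]]; split=> //.
 by move=> v vD; have := H v; rewrite vD => /eqP.
by apply/forallP => v; apply/implyP => /H ->.
Qed.

Lemma eq_fam (D : {set V}) (P P' : pred (marking V q)) : P =1 P' -> fam D P = fam D P'.
Proof. by move=> E; apply/setP => m; rewrite !inE E. Qed.

Lemma fam_mul (D1 D2 : {set V}) (P1 P2 : pred (marking V q)) : [disjoint D1 & D2] ->
 local D1 P1 -> local D2 P2 ->
 fmul (fam D1 P1) (fam D2 P2) = fam (D1 :|: D2) (fun m => P1 m && P2 m).
Proof.
move=> dis l1 l2; apply/setP => m; apply/imset2P/famP.
 case=> m1 m2 /famP [z1 p1] /famP [z2 p2] ->; split.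
 by move=> v; rewrite inE negb_or ffunE => /andP [v1 v2]; rewrite z1 // eqxx z2.
 rewrite -(l1 m1) ?p1 /=; last first.
 move=> v v1; rewrite ffunE; case: eqP => // E; rewrite E z2 //.
 by move/pred0P: dis => /(_ v) /=; rewrite v1 /= => ->.
 rewrite -(l2 m2) ?p2 // => v v2; rewrite ffunE z1 ?eqxx //.
 by move/pred0P: dis => /(_ v) /=; rewrite v2 andbT => ->.
case=> z /andP [p1 p2].
exists [ffun v => if v \in D1 then m v else ord0] [ffun v => if v \in D2 then m v else ord0].
- apply/famP; split; first by move=> v vD; rewrite ffunE (negbTE vD).
 by rewrite (l1 _ m) // => v vD; rewrite ffunE vD.
- apply/famP; split; first by move=> v vD; rewrite ffunE (negbTE vD).
 by rewrite (l2 _ m) // => v vD; rewrite ffunE vD.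
- apply/ffunP => v; rewrite !ffunE; case: (boolP (v \in D1)) => v1 /=.
 case: eqP => // E; case: ifP => // v2.
 case: ifP => // v2; apply: z; by rewrite inE negb_or v1 v2.
Qed.

Definition delta v k : marking V q := [ffun u => if u == v then inord k else ord0].

End Families.

(** * The dynamic programming engine *)

(* Nodes 0 and 1 are temporaries, node 2 holds the marks of the current vertex,
 node 3 is the root and node [v + 4] belongs to vertex v. *)
Definition vTop := 6.
Definition vI := 7.
Definition vV := 8.
Definition vN := 9.
Definition vP := 10.
Definition vT1 := 11.
Definition vT2 := 12.
Definition vMk := 13.
Definition vRt := 14.
Definition aORD : aid := (0, 0, 0).
Definition aCOL : aid := (0, 1, 0).
Definition aPAR : aid := (0, 2, 0).
Definition aLAB : aid := (0, 8, 0).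
Definition aADJ j : aid := (3, j, 0).

Definition engine_vars : pred nat := fun x => 7 <= x <= 14.

Section Engine.
Variables (dv q Q c nlab : nat).
Variables (vzero : nat -> nat -> com) (vmark : nat -> com)
 (vaddmul : nat -> nat -> nat -> nat -> nat -> nat -> com).
Variables (Xv : pred nat) (Yv : pred aid).
Variables (tunit : nat) (tjoin : nat -> nat -> nat)
 (tedge : nat -> nat -> nat -> nat -> nat) (tforget : nat -> nat -> nat -> nat -> nat)
 (tacc : pred nat).

(** A bilinear map on state vectors given by its table: state [d] of [xd] becomes the sum, over the
    triples [(d, a, b)], of the products of state [a] of [xa] and state [b] of [xb]. *)
Definition lincomb xd xa xb (l : seq (nat * nat * nat)) :=
 Seq (seqs [seq vzero xd a | a <- iota 0 Q])
 (seqs [seq vaddmul xd t.1.1 xa t.1.2 xb t.2 | t <- l]).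

Definition tab1 (f : nat -> nat) := [seq (f a, a, 0) | a <- iota 0 Q].
Definition tab2 (f : nat -> nat -> nat) r :=
 [seq (f t.1 t.2, t.1, t.2) | t <- [seq (a, b) | a <- iota 0 Q, b <- iota 0 r]].
Definition copy xd xa := lincomb xd xa vMk (tab1 id).

(** Source and destination of a product must be different nodes, so the result is formed in node 1
    and copied back. *)
Definition eng_edge i j s := Seq (lincomb vT2 vN vMk (tab1 (tedge i j s))) (copy vN vT2).

Definition eng_marks := seqs [seq vmark k | k <- iota 0 q.+1].
Definition eng_edges := switch (Arr aCOL (Var vV)) c (fun i =>
 seqs [seq switch (Arr (aADJ j) (Var vV)) 3
 (fun s => if s == 0 then Skip else eng_edge i j s) | j <- iota 0 c]).
Definition eng_forget := switch (Arr aCOL (Var vV)) c (fun i =>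
 switch (Arr aLAB (Var vV)) nlab (fun l =>
 lincomb vT1 vN vMk (tab2 (fun a k => tforget i l k a) q.+1))).
Definition eng_join := lincomb vT2 vP vT1 (tab2 tjoin Q).

Definition eng_vertex :=
 seqs [:: Assign vN (AddE (Var vV) 4); Assign vP (Arr aPAR (Var vV));
 eng_marks; eng_edges; eng_forget; eng_join; copy vP vT2].

Definition eng_init x := lincomb x vMk vMk [:: (tunit, 0, 0)].

Definition eng_loop1 := Loop vI (If (LtE (Var vI) (Var vTop))
 (Seq (Assign vN (AddE (Var vI) 4)) (eng_init vN)) Skip).
Definition eng_loop2 := Loop vI (If (LtE (Var vI) (Var vTop))
 (Seq (Assign vV (Arr aORD (Var vI))) eng_vertex) Skip).
Definition eng_final :=
 lincomb vT1 vRt vMk [seq (0, a, 0) | a <- [seq a <- iota 0 Q | tacc a]].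

Definition engine :=
 seqs [:: Assign vT1 (Num 0); Assign vT2 (Num 1); Assign vMk (Num 2);
 Assign vRt (Num 3); Assign vV (Num 0); vmark 0; eng_init vRt;
 eng_loop1; eng_loop2; eng_final].

Hypotheses (ok_zero : forall x a, ok dv Xv Yv (vzero x a))
 (ok_mark : forall k, ok dv Xv Yv (vmark k))
 (ok_addmul : forall xd d xa a xb b, ok dv Xv Yv (vaddmul xd d xa a xb b)).

Lemma ok_lincomb xd xa xb l : ok dv Xv Yv (lincomb xd xa xb l).
Proof.
by apply: ok_seq; apply: ok_seqs_map => *; [apply: ok_zero|apply: ok_addmul].
Qed.

Let Xe : pred nat := fun x => Xv x || engine_vars x.

Lemma ok_v com : ok dv Xv Yv com -> ok dv Xe Yv com.
Proof. by apply: ok_sub => // x Xx; rewrite /Xe Xx. Qed.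

Lemma ok_assign (d : nat) (X : pred nat) Y x e : X x -> tame e -> ok d X Y (Assign x e).
Proof. by move=> Xx te; rewrite /ok /= te Xx. Qed.

Lemma ok_eng_vertex : ok dv Xe Yv eng_vertex.
Proof.
have L xd xa xb l : ok dv Xe Yv (lincomb xd xa xb l) by apply: ok_v; apply: ok_lincomb.
apply: ok_seqs; split; [|split; [|split; [|split; [|split; [|split; [exact: L|split; [exact: L|by []]]]]]]].
- by apply: ok_assign; rewrite // /Xe orbT.
- by apply: ok_assign; rewrite // /Xe orbT.
- by apply: ok_seqs_map => k; apply: ok_v; exact: ok_mark.
- apply: ok_switch => i _; apply: ok_seqs_map => j; apply: ok_switch => s _.
 by case: eqP => // _; apply: ok_seq; exact: L.
- by apply: ok_switch => i _; apply: ok_switch => l _; exact: L.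
Qed.

Lemma ok_engine : ok dv.+1 Xe Yv engine.
Proof.
have L xd xa xb l : ok dv.+1 Xe Yv (lincomb xd xa xb l).
 by apply: (@ok_sub dv) (ok_v (ok_lincomb _ _ _ _)).
have A x e : engine_vars x -> tame e -> ok dv.+1 Xe Yv (Assign x e).
 by move=> Xx te; apply: ok_assign => //; rewrite /Xe Xx orbT.
apply: ok_seqs; do 5!(split; first exact: A).
split; [|split; [exact: L|split; [|split; [|split => //; exact: L]]]].
- by apply: (@ok_sub dv) (ok_v (ok_mark _)).
- apply: ok_loop; first by rewrite /Xe orbT.
 apply: ok_if => //; apply: ok_seq; last by apply: ok_v; apply: ok_lincomb.
 by apply: ok_assign => //; rewrite /Xe orbT.
- apply: ok_loop; first by rewrite /Xe orbT.
 apply: ok_if => //; apply: ok_seq; last exact: ok_eng_vertex.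
 by apply: ok_assign => //; rewrite /Xe orbT.
Qed.

Variables (n : nat) (V : finType) (vid : V -> nat).
(** [VALs s nd a M] means that state [a] of node [nd] represents the family [M]. One engine thus
    serves two readings: some member of the family, or its cardinality. *)
Variable VALs : store -> nat -> nat -> {set (marking V q)} -> Prop.
Hypotheses (vid_inj : injective vid)
 (Xv_eng : forall x, x <= 14 -> ~~ Xv x)
 (VAL_ext : forall s s' nd a M, (forall b, Yv b -> arr s b = arr s' b) ->
 VALs s nd a M -> VALs s' nd a M)
 (zeroP : forall x a s, ~~ Xv x -> VALs (run n (vzero x a) s) (var s x) a set0)
 (zeroN : forall x a s nd b M, VALs s nd b M -> ~ (nd = var s x /\ b = a) -> ~~ Xv x ->
 VALs (run n (vzero x a) s) nd b M)
 (markP : forall k s v, k <= q -> k = 0 \/ var s vV = vid v ->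
 VALs (run n (vmark k) s) (var s vMk) k [set delta q v k])
 (markN : forall k s nd b M, VALs s nd b M -> ~ (nd = var s vMk /\ b = k) ->
 VALs (run n (vmark k) s) nd b M)
 (addmulP : forall xd d xa a xb b s M0 (D1 D2 : {set V}) P1 P2,
 [disjoint D1 & D2] -> local D1 P1 -> local D2 P2 ->
 VALs s (var s xd) d M0 -> VALs s (var s xa) a (fam D1 P1) ->
 VALs s (var s xb) b (fam D2 P2) -> var s xd <> var s xa -> var s xd <> var s xb ->
 [disjoint M0 & fmul (fam D1 P1) (fam D2 P2)] -> ~~ Xv xd -> ~~ Xv xa -> ~~ Xv xb ->
 VALs (run n (vaddmul xd d xa a xb b) s) (var s xd) d
 (M0 :|: fmul (fam D1 P1) (fam D2 P2)))
 (addmulN : forall xd d xa a xb b s nd e M, VALs s nd e M ->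
 ~ (nd = var s xd /\ e = d) -> ~~ Xv xd -> VALs (run n (vaddmul xd d xa a xb b) s) nd e M).

(* [vec s nd k D f]: the states below k of node nd hold the markings of D sorted
 by their value under f. *)
Definition vec s nd k (D : {set V}) (f : marking V q -> nat) :=
 [/\ local D f, forall m, f m < k
 & forall a, a < k -> VALs s nd a (fam D (fun m => f m == a))].

Lemma vec_ext s s' nd k D f : (forall b, Yv b -> arr s b = arr s' b) ->
 vec s nd k D f -> vec s' nd k D f.
Proof. by move=> E [l b H]; split=> // a lt; apply: VAL_ext (H a lt). Qed.

Lemma vec_eq s nd k D f f' : f =1 f' -> vec s nd k D f -> vec s nd k D f'.
Proof.
move=> E [l b H]; split=> [m m' mm|m|a lt]; rewrite -?E //; first exact: l.
by rewrite -(@eq_fam _ _ _ (fun m => f m == a)) // => [|m]; [apply: H|rewrite E].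
Qed.

(** A pair of source states occurs in at most one triple, so the added products are pairwise
    disjoint; this is what lets cardinalities be added. *)
Lemma lincombP s xd xa xb l k1 k2 D1 D2 f1 f2 :
 vec s (var s xa) k1 D1 f1 -> vec s (var s xb) k2 D2 f2 -> [disjoint D1 & D2] ->
 var s xd <> var s xa -> var s xd <> var s xb -> ~~ Xv xd -> ~~ Xv xa -> ~~ Xv xb ->
 uniq l -> (forall t t', t \in l -> t' \in l -> t.1.2 = t'.1.2 -> t.2 = t'.2 -> t = t') ->
 (forall t, t \in l -> t.1.2 < k1 /\ t.2 < k2) ->
 let s' := run n (lincomb xd xa xb l) s in
 (forall d, d < Q -> VALs s' (var s xd) d
 (fam (D1 :|: D2) (fun m => (d, f1 m, f2 m) \in l))) /\
 (forall nd b M, VALs s nd b M -> nd <> var s xd -> VALs s' nd b M).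
Proof.
move=> [l1 b1 v1] [l2 b2 v2] dis da db Xd Xa Xb ul inj bnd s'.
have zz : forall r, let s1 := run n (seqs [seq vzero xd a | a <- iota 0 r]) s in
 [/\ forall a, a < r -> VALs s1 (var s xd) a set0,
 forall nd b M, VALs s nd b M -> nd <> var s xd -> VALs s1 nd b M
 & forall x, ~~ Xv x -> var s1 x = var s x].
 elim=> [|r [h1 h2 h3]]; first by split.
 rewrite -addn1 iotaD map_cat run_seqs_cat /= add0n.
 set s1 := run n (seqs _) s in h1 h2 h3 *; have E : var s1 xd = var s xd by apply: h3.
 split=> [a|nd b M vM ne|x nx]; last by rewrite (ok_var n s1 (ok_zero _ _)) ?h3.
 rewrite addn1 ltnS leq_eqVlt => /orP [/eqP ->|lt]; first by rewrite -E; apply: zeroP.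
 by apply: zeroN (h1 a lt) _ Xd => -[_ Ea]; rewrite Ea ltnn in lt.
 by apply: zeroN (h2 _ _ _ vM ne) _ Xd => -[En _]; apply: ne; rewrite -E.
have [z1 z2 z3] := zz Q; rewrite /s' /lincomb [run _ _ _]/=.
set s1 := run n (seqs _) s in z1 z2 z3 *.
have main : forall l0 l', l = l0 ++ l' ->
 let s2 := run n (seqs [seq vaddmul xd t.1.1 xa t.1.2 xb t.2 | t <- l0]) s1 in
 [/\ forall d, d < Q -> VALs s2 (var s xd) d
 (fam (D1 :|: D2) (fun m => (d, f1 m, f2 m) \in l0)),
 forall nd b M, VALs s nd b M -> nd <> var s xd -> VALs s2 nd b M
 & forall x, ~~ Xv x -> var s2 x = var s x].
 elim/last_ind=> [|l0 t IH] l' E.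
 split=> // d lt /=; rewrite (_ : fam _ _ = set0); first exact: z1.
 by apply/setP => m; rewrite !inE andbF.
 rewrite cat_rcons in E; have [h1 h2 h3] := IH _ E.
 rewrite map_rcons run_seqs_rcons; set s2 := run n (seqs _) s1 in h1 h2 h3 *.
 have Ed : var s2 xd = var s xd by apply: h3.
 have Ea : var s2 xa = var s xa by apply: h3.
 have Eb : var s2 xb = var s xb by apply: h3.
 have tl : t \in l by rewrite E mem_cat inE eqxx orbT.
 have [lt1 lt2] := bnd t tl.
 have tn : t \notin l0.
 by move: ul; rewrite E -cat_rcons cat_uniq rcons_uniq => /andP [/andP []].
 have la1 : local D1 (fun m => f1 m == t.1.2) by move=> m m' /l1 ->.
 have la2 : local D2 (fun m => f2 m == t.2) by move=> m m' /l2 ->.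
 have Em := fam_mul dis la1 la2.
 split=> [d ltd|nd b M vM ne|x nx]; last by rewrite (ok_var n s2 (ok_addmul _ _ _ _ _ _)) ?h3.
 case: (eqVneq d t.1.1) => [Edt|ned]; last first.
 rewrite (@eq_fam _ _ _ _ (fun m => (d, f1 m, f2 m) \in l0)).
 by apply: addmulN (h1 d ltd) _ Xd => -[_ E']; rewrite E' eqxx in ned.
 move=> m; rewrite mem_rcons inE; case: eqP => // E'.
 by rewrite -E' /= eqxx in ned.
 rewrite (_ : fam _ _ = fam (D1 :|: D2) (fun m => (d, f1 m, f2 m) \in l0) :|:
 fmul (fam D1 (fun m => f1 m == t.1.2)) (fam D2 (fun m => f2 m == t.2))).
 rewrite -Ed Edt; apply: addmulP => //; rewrite ?Ed ?Ea ?Eb //.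
 - by apply: h1; rewrite -Edt.
 - by apply: h2; [apply: v1|move=> E'; apply: da].
 - by apply: h2; [apply: v2|move=> E'; apply: db].
 - rewrite Em; apply/pred0P => m /=; apply/negbTE/negP.
 case/andP=> /famP [_ ml0] /famP [_ /andP [/eqP e1 /eqP e2]].
 have ml : (t.1.1, f1 m, f2 m) \in l by rewrite E mem_cat ml0.
 by move: tn; rewrite -(inj _ _ ml tl) ?ml0.
 rewrite Em; apply/setP => m; rewrite !inE -andb_orr; congr andb.
 rewrite mem_rcons inE orbC; congr orb; rewrite Edt.
 by case: (t) => -[t1 t2] t3 /=; rewrite !xpair_eqE eqxx.
 by apply: addmulN (h2 _ _ _ vM ne) _ Xd => -[En _]; apply: ne; rewrite -Ed.
have [h1 h2 h3] := main l [::] (esym (cats0 l)).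
by split.
Qed.

(** Mark 0 at any vertex is the zero marking, neutral for [merge]. State 0 of the node of marks
    therefore serves as the unit in operations with one argument. *)
Lemma vec_one s : (exists v : V, VALs s (var s vMk) 0 [set delta q v 0]) ->
 vec s (var s vMk) 1 set0 (fun=> 0).
Proof.
case=> v H; split=> // -[|a] // _.
rewrite (_ : fam _ _ = [set delta q v 0]) //; apply/setP => m; rewrite [in RHS]inE.
apply/famP/eqP => [[z _]|->].
 apply/ffunP => u; rewrite ffunE z ?inE //; case: eqP => // _.
 by apply: val_inj; rewrite /= inordK.
split=> // u _; rewrite ffunE; case: eqP => // _.
by apply: val_inj; rewrite /= inordK.
Qed.

Lemma vec_mark s v : (forall k, k <= q -> VALs s (var s vMk) k [set delta q v k]) ->
 vec s (var s vMk) q.+1 [set v] (fun m => m v).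
Proof.
move=> H; split=> [m m' mm|m|k lt].
- by rewrite mm ?inE.
- exact: ltn_ord.
rewrite (_ : fam _ _ = [set delta q v k]); first exact: H.
apply/setP => m; rewrite [in RHS]inE; apply/famP/eqP => [[z /eqP E]|->].
 apply/ffunP => u; rewrite ffunE; case: (eqVneq u v) => [->|uv].
 by apply: val_inj; rewrite /= inordK.
 by rewrite z ?inE.
split; first by move=> u; rewrite inE ffunE => /negbTE ->.
by rewrite ffunE eqxx inordK.
Qed.

Definition keeps nd s s' :=
 [/\ forall nd' b M, VALs s nd' b M -> nd' <> nd -> VALs s' nd' b M,
 forall x, ~~ Xv x -> var s' x = var s x & forall a, ~~ Yv a -> arr s' a = arr s a].

Lemma vec_keeps nd s s' nd' k D f : keeps nd s s' -> nd' <> nd ->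
 vec s nd' k D f -> vec s' nd' k D f.
Proof. by move=> [H _ _] ne [l b v]; split=> // a lt; apply: H => //; apply: v. Qed.

Lemma keeps_lincomb s xd xa xb l nd :
 nd = var s xd ->
 (forall nd' b M, VALs s nd' b M -> nd' <> var s xd ->
 VALs (run n (lincomb xd xa xb l) s) nd' b M) ->
 keeps nd s (run n (lincomb xd xa xb l) s).
Proof.
move=> -> H; split=> // [x nx|a na].
 by rewrite (ok_var n s (ok_lincomb _ _ _ _)).
by rewrite (ok_arr n s (ok_lincomb _ _ _ _)).
Qed.

Lemma lin1P s xd xa f D f1 :
 vec s (var s xa) Q D f1 -> (exists v : V, VALs s (var s vMk) 0 [set delta q v 0]) ->
 var s xd <> var s xa -> var s xd <> var s vMk -> ~~ Xv xd -> ~~ Xv xa ->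
 (forall a, a < Q -> f a < Q) ->
 let s' := run n (lincomb xd xa vMk (tab1 f)) s in
 vec s' (var s xd) Q D (fun m => f (f1 m)) /\ keeps (var s xd) s s'.
Proof.
move=> v1 one da db Xd Xa fQ s'; have v2 := vec_one one.
have dis : [disjoint D & (set0 : {set V})] by rewrite -setI_eq0 setI0.
have [|||h1 h2] := @lincombP s xd xa vMk (tab1 f) _ _ _ _ _ _ v1 v2 dis da db Xd Xa (@Xv_eng vMk isT).
- by rewrite map_inj_uniq ?iota_uniq // => a b [].
- by move=> t t' /mapP [a _ ->] /mapP [b _ ->] /= ->.
- by move=> t /mapP [a]; rewrite mem_iota add0n => /andP [_ lt] ->.
split; last exact: keeps_lincomb.
case: v1 => l1 b1 _; split=> [m m' mm|m|d lt]; first by rewrite (l1 _ _ mm).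
 exact: fQ.
have := h1 d lt; rewrite setU0 (@eq_fam _ _ _ _ (fun m => f (f1 m) == d)) // => m.
apply/mapP/eqP => [[a _ [-> ->]] //|<-].
by exists (f1 m) => //; rewrite mem_iota add0n b1.
Qed.

Lemma lin2P s xd xa xb f D1 D2 f1 f2 r :
 vec s (var s xa) Q D1 f1 -> vec s (var s xb) r D2 f2 -> [disjoint D1 & D2] ->
 var s xd <> var s xa -> var s xd <> var s xb -> ~~ Xv xd -> ~~ Xv xa -> ~~ Xv xb ->
 (forall a b, a < Q -> b < r -> f a b < Q) ->
 let s' := run n (lincomb xd xa xb (tab2 f r)) s in
 vec s' (var s xd) Q (D1 :|: D2) (fun m => f (f1 m) (f2 m)) /\ keeps (var s xd) s s'.
Proof.
move=> v1 v2 dis da db Xd Xa Xb fQ s'.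
have memt t : t \in tab2 f r -> exists a b, [/\ a < Q, b < r & t = (f a b, a, b)].
 case/mapP=> -[a b] /allpairsP [[a' b'] /= [ia ib [-> ->]]] ->.
 by move: ia ib; rewrite !mem_iota !add0n => /andP [_ la] /andP [_ lb]; exists a', b'.
have [|||h1 h2] := @lincombP s xd xa xb (tab2 f r) _ _ _ _ _ _ v1 v2 dis da db Xd Xa Xb.
- rewrite map_inj_uniq; last by move=> [a b] [a' b'] /= [_ -> ->].
 by rewrite allpairs_uniq ?iota_uniq // => -[a b] [a' b'] _ _ /= [-> ->].
- move=> t t' /memt [a [b [_ _ ->]]] /memt [a' [b' [_ _ ->]]] /= -> -> //.
- by move=> t /memt [a [b [la lb ->]]].
split; last exact: keeps_lincomb.
case: v1 v2 => l1 b1 _ [l2 b2 _]; split=> [m m' mm|m|d lt].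
- rewrite (l1 m m') ?(l2 m m') // => v vD; apply: mm; rewrite inE vD ?orbT //.
- exact: fQ.
have := h1 d lt; rewrite (@eq_fam _ _ _ _ (fun m => f (f1 m) (f2 m) == d)) // => m.
apply/mapP/eqP => [[[a b] _ [-> -> ->]] //|<-].
exists (f1 m, f2 m) => //; apply/allpairsP; exists (f1 m, f2 m).
by rewrite !mem_iota !add0n b1 b2.
Qed.

Lemma keeps_trans nd nd' s s1 s2 : keeps nd s s1 -> keeps nd' s1 s2 ->
 [/\ forall o b M, VALs s o b M -> o <> nd -> o <> nd' -> VALs s2 o b M,
 forall x, ~~ Xv x -> var s2 x = var s x & forall a, ~~ Yv a -> arr s2 a = arr s a].
Proof.
move=> [a1 b1 c1] [a2 b2 c2]; split=> [o b M v n1 n2|x nx|a na].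
- by apply: a2 => //; apply: a1.
- by rewrite b2 ?b1.
- by rewrite c2 ?c1.
Qed.

(* An operation through the temporary node 1, written back to its source. *)
Lemma copyP s x D f1 :
 vec s (var s vT2) Q D f1 -> (exists v : V, VALs s (var s vMk) 0 [set delta q v 0]) ->
 var s x <> var s vT2 -> var s x <> var s vMk -> ~~ Xv x ->
 let s' := run n (copy x vT2) s in
 vec s' (var s x) Q D f1 /\ keeps (var s x) s s'.
Proof.
move=> v1 one d1 d2 Xx; have [//|//|//|//|//|h1 h2] := @lin1P s x vT2 id D f1 v1 one.
 exact: Xv_eng.
by split.
Qed.

Variables (L : Type) (A : alg L) (letter : nat -> nat -> L) (S : estr V) (lab : V -> nat).
Variables (enc : ast A -> nat) (dec : nat -> ast A).
Hypotheses (encQ : forall a, enc a < Q) (encK : forall a, dec (enc a) = a)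
 (decK : forall a, a < Q -> enc (dec a) = a)
 (tunitE : tunit = enc (aunit A))
 (tjoinE : forall a b, tjoin a b = enc (ajoin (dec a) (dec b)))
 (tedgeE : forall i j s a, tedge i j s a = enc (aedge i j s (dec a)))
 (tforgetE : forall i l k a, tforget i l k a = enc (aforget i (letter l k) (dec a))).

Let lm (m : marking V q) v := letter (lab v) (m v).
Definition node o := if o is Some v then vid v + 4 else 3.

Definition es_rep s :=
 [/\ var s vTop = size (eord S) /\ size (eord S) <= n,
 forall i v0, i < size (eord S) -> arr s aORD i = vid (nth v0 (eord S) i),
 forall v, vid v < size (eord S) /\ arr s aCOL (vid v) = ecol S v,
 forall v, arr s aPAR (vid v) = node (epar S v) /\
 arr s aLAB (vid v) = lab v
 & forall v j, j < c -> arr s (aADJ j) (vid v) = eadj S v j].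

Hypotheses (ordS : ordered S) (colS : forall v, ecol S v < c)
 (adjS : forall v j, eadj S v j < 3) (labS : forall v, lab v < nlab)
 (Yv_es : forall a, Yv a -> [/\ a != aORD, a != aCOL, a != aPAR, a != aLAB
 & forall j, a != aADJ j]).

Lemma es_rep_ext s s' : var s' vTop = var s vTop ->
 (forall a, ~~ Yv a -> arr s' a = arr s a) -> es_rep s -> es_rep s'.
Proof.
move=> Et Ea [h1 h2 h3 h4 h5].
have nY a : a \in [:: aORD; aCOL; aPAR; aLAB] -> ~~ Yv a.
 by move=> ain; apply/negP => /Yv_es [a1 a2 a3 a4 _]; move: ain; rewrite !inE (negbTE a1) (negbTE a2) (negbTE a3) (negbTE a4).
have nJ j : ~~ Yv (aADJ j) by apply/negP => /Yv_es [_ _ _ _ /(_ j)]; rewrite eqxx.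
split=> [|i v0 lt|v|v|v j lt].
- by rewrite Et.
- by rewrite Ea ?nY //; apply: h2.
- by rewrite Ea ?nY //; apply: h3.
- by rewrite !Ea ?nY //; apply: h4.
- by rewrite Ea ?nJ //; apply: h5.
Qed.

Definition einv x s :=
 [/\ [/\ var s vT1 = 0, var s vT2 = 1, var s vMk = 2 & var s vRt = 3], es_rep s,
 exists v : V, VALs s 2 0 [set delta q v 0]
 & forall o, open (take x (eord S)) o ->
 vec s (node o) Q (dsc S (take x (eord S)) o)
 (fun m => enc (accs c S A (lm m) (take x (eord S)) o))].

Lemma node_inj : injective node.
Proof.
move=> [u|] [v|] //= E; try by exfalso; lia.
by congr Some; apply: vid_inj; lia.
Qed.

Lemma node_ge o : 3 <= node o.
Proof. by case: o => //= v; lia. Qed.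

Lemma engine_vertexP x s v : einv x s -> x < size (eord S) ->
 nth v (eord S) x = v -> var s vV = vid v -> einv x.+1 (run n eng_vertex s).
Proof.
move=> [[T1 T2 Mk Rt] rp one vecs] lt Ev Evv.
set p := take x (eord S) in vecs.
have Eo : eord S = p ++ v :: drop x.+1 (eord S).
 by rewrite -{1}(cat_take_drop x (eord S)) (drop_nth v) // Ev.
have Ep : take x.+1 (eord S) = rcons p v by rewrite (take_nth v) // Ev.
have [dis vD vP'] := dsc_join ordS Eo.
have nv := next_notin ordS Eo; have op := open_parent ordS Eo.
pose s1 := run n (Assign vP (Arr aPAR (Var vV))) (run n (Assign vN (AddE (Var vV) 4)) s).
change (einv x.+1 (run n (copy vP vT2) (run n eng_join (run n eng_forget
 (run n eng_edges (run n eng_marks s1)))))).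
have V1 y : y != vN -> y != vP -> var s1 y = var s y.
 by move=> h1 h2; rewrite /s1 /= /upd (negbTE h1) (negbTE h2).
have A1 : arr s1 = arr s by [].
have N1 : var s1 vN = node (Some v) by rewrite /s1 /= /upd /= Evv.
have P1 : var s1 vP = node (epar S v).
 by rewrite /s1 /= /upd /= Evv; case: rp => _ _ _ /(_ v) [].
have rp1 : es_rep s1 by apply: es_rep_ext rp.
have X8 y : y <= 14 -> ~~ Xv y := @Xv_eng y.
have marks r : r <= q.+1 -> let s2 := run n (seqs [seq vmark k | k <- iota 0 r]) s1 in
 [/\ forall k, k < r -> VALs s2 2 k [set delta q v k],
 forall nd b M, VALs s1 nd b M -> nd <> 2 -> VALs s2 nd b M,
 forall y, ~~ Xv y -> var s2 y = var s1 y & forall a, ~~ Yv a -> arr s2 a = arr s1 a].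
 elim: r => [|r IH] lr; first by split.
 have [h1 h2 h3 h4] := IH (ltnW lr).
 rewrite -addn1 iotaD map_cat run_seqs_cat /= add0n.
 set s2 := run n (seqs _) s1 in h1 h2 h3 h4 *.
 have M2 : var s2 vMk = 2 by rewrite h3 ?X8 // V1.
 split=> [k|nd b M vM ne|y ny|a na].
 - rewrite addn1 ltnS leq_eqVlt => /orP [/eqP ->|ltk].
 by rewrite -M2; apply: markP => //; right; rewrite h3 ?X8 // V1.
 by apply: markN (h1 k ltk) _ => -[_ E]; rewrite E ltnn in ltk.
 - by apply: markN (h2 _ _ _ vM ne) _ => -[E _]; apply: ne; rewrite E.
 - by rewrite (ok_var n s2 (ok_mark _)) ?h3.
 - by rewrite (ok_arr n s2 (ok_mark _)) ?h4.
have [m1 m2 m3 m4] := marks q.+1 (leqnn _).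
rewrite -/eng_marks in m1 m2 m3 m4; set s2 := run n eng_marks s1 in m1 m2 m3 m4 *.
have one2 : exists v : V, VALs s2 2 0 [set delta q v 0] by exists v; apply: m1.
pose ed (l : seq nat) (a : ast A) := foldl (fun a j =>
 if eadj S v j != 0 then aedge (ecol S v) j (eadj S v j) a else a) a l.
pose f0 (m : marking V q) := accs c S A (lm m) p (Some v).
have rp2 : es_rep s2 by apply: es_rep_ext rp1; rewrite ?m3 ?X8.
have Ecol t : es_rep t -> var t vV = vid v -> eval n t (Arr aCOL (Var vV)) = ecol S v.
 by move=> [_ _ /(_ v) [_ h] _ _] /= ->.
have vv2 : var s2 vV = vid v by rewrite m3 ?X8 // V1.
rewrite {1}/eng_edges run_switch Ecol //; cbv beta.
have base2 : [/\ var s2 vT1 = 0, var s2 vT2 = 1, var s2 vMk = 2 & var s2 vRt = 3].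
 by rewrite !m3 ?X8 // !V1.
have edges l : {subset l <= iota 0 c} -> forall t f, es_rep t -> var t vV = vid v ->
 [/\ var t vT1 = 0, var t vT2 = 1, var t vMk = 2 & var t vRt = 3] ->
 var t vN = node (Some v) -> (forall k, k <= q -> VALs t 2 k [set delta q v k]) ->
 vec t (node (Some v)) Q (dsc S p (Some v)) (fun m => enc (f m)) ->
 let t' := run n (seqs [seq switch (Arr (aADJ j) (Var vV)) 3
 (fun s => if s == 0 then Skip else eng_edge (ecol S v) j s) | j <- l]) t in
 [/\ vec t' (node (Some v)) Q (dsc S p (Some v)) (fun m => enc (ed l (f m))),
 forall nd b M, VALs t nd b M -> nd <> 1 -> nd <> node (Some v) -> VALs t' nd b M,
 forall y, ~~ Xv y -> var t' y = var t y & forall a, ~~ Yv a -> arr t' a = arr t a].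
 elim: l => [|j l IH] sub t f rt vt [b1 b2 b3 b4] Nt ones vt0; first by split.
 have jc : j < c by have := sub j; rewrite inE eqxx mem_iota add0n; apply.
 have sub' : {subset l <= iota 0 c} by move=> i il; apply: sub; rewrite inE il orbT.
 rewrite map_cons run_seqs_cons.
 have Eadj : eval n t (Arr (aADJ j) (Var vV)) = eadj S v j.
 by case: rt => _ _ _ _ /(_ v j jc) h; rewrite /= vt.
 rewrite run_switch Eadj ?adjS //.
 case: eqP => [E0|ne0].
 have [h1 h2 h3 h4] := IH sub' t f rt vt (And4 b1 b2 b3 b4) Nt ones vt0.
 by split=> //=; rewrite E0 /=.
 have onet : exists v : V, VALs t (var t vMk) 0 [set delta q v 0].
 by exists v; rewrite b3; apply: ones.
 have vt1 : vec t (var t vN) Q (dsc S p (Some v)) (fun m => enc (f m)) by rewrite Nt.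
 have nn : 3 <= node (Some v) := node_ge _.
 have [|||||k1 k2] := @lin1P t vT2 vN (tedge (ecol S v) j (eadj S v j)) _ _ vt1 onet.
 - by rewrite b2 Nt; lia.
 - by rewrite b2 b3.
 - exact: X8.
 - exact: X8.
 - by move=> a _; rewrite tedgeE.
 rewrite /eng_edge [run n (Seq _ _) t]/=.
 set t1 := run n (lincomb _ _ _ _) t in k1 k2 *.
 have [q1 q2 q3] := k2; rewrite b2 in k1 k2 q1.
 have E2 : var t1 vT2 = 1 by rewrite q2 ?X8.
 have E3 : var t1 vMk = 2 by rewrite q2 ?X8.
 have EN : var t1 vN = node (Some v) by rewrite q2 ?X8.
 have k1' : vec t1 (var t1 vT2) Q (dsc S p (Some v))
 (fun m => tedge (ecol S v) j (eadj S v j) (enc (f m))) by rewrite E2.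
 have one1 : exists v : V, VALs t1 (var t1 vMk) 0 [set delta q v 0].
 by exists v; rewrite E3; apply: q1; [apply: ones|].
 have [|||c1 c2] := @copyP t1 vN _ _ k1' one1.
 - by rewrite EN E2; lia.
 - by rewrite EN E3; lia.
 - exact: X8.
 set t2 := run n (copy vN vT2) t1 in c1 c2 *; rewrite EN in c1 c2.
 have [w1 w2 w3] := keeps_trans k2 c2.
 have c1' : vec t2 (node (Some v)) Q (dsc S p (Some v))
 (fun m => enc (aedge (ecol S v) j (eadj S v j) (f m))).
 by apply: vec_eq c1 => m; rewrite tedgeE encK.
 have [|||||h1 h2 h3 h4] := IH sub' t2 (fun m => aedge (ecol S v) j (eadj S v j) (f m)) _ _ _ _ _ c1'.
 - by apply: es_rep_ext rt; rewrite ?w2 ?X8.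
 - by rewrite w2 ?X8.
 - by rewrite !w2 ?X8.
 - by rewrite w2 ?X8.
 - by move=> k lk; apply: w1; [apply: ones| |lia].
 split.
 - by move/eqP: ne0 => ne0; rewrite /= ne0 in h1 *.
 - by move=> nd b M vM n1 n2; apply: h2 => //; apply: w1.
 - by move=> y ny; rewrite h3 ?w2.
 - by move=> a na; rewrite h4 ?w3.
have nn : 3 <= node (Some v) := node_ge _.
have nnp : 3 <= node (epar S v) := node_ge _.
have npv : node (epar S v) <> node (Some v).
 move/node_inj => E; move: op; rewrite E /= mem_rcons inE eqxx //.
have vec2 : vec s2 (node (Some v)) Q (dsc S p (Some v)) (fun m => enc (f0 m)).
 have [l b h] := vecs (Some v) nv; split=> // a la; apply: m2; last by lia.
 by apply: VAL_ext (h a la).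
have N2 : var s2 vN = node (Some v) by rewrite m3 ?X8.
have P2 : var s2 vP = node (epar S v) by rewrite m3 ?X8.
have [//|e1 e2 e3 e4] := edges (iota 0 c) _ s2 f0 rp2 vv2 base2 N2 m1 vec2.
set s3 := run n (seqs _) s2 in e1 e2 e3 e4 *.
have rp3 : es_rep s3 by apply: es_rep_ext rp2; rewrite ?e3 ?X8.
have vv3 : var s3 vV = vid v by rewrite e3 ?X8.
have E3 : [/\ var s3 vT1 = 0, var s3 vT2 = 1, var s3 vMk = 2 & var s3 vRt = 3].
 by rewrite !e3 ?X8.
have [T13 T23 Mk3 Rt3] := E3.
have Ec3 := Ecol s3 rp3 vv3.
have El3 : eval n s3 (Arr aLAB (Var vV)) = lab v.
 by rewrite /= vv3; case: rp3 => _ _ _ /(_ v) [_ ->] _.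
rewrite {1}/eng_forget (@run_switch n (Arr aCOL (Var vV)) c _ s3) Ec3 //; cbv beta.
rewrite (@run_switch n (Arr aLAB (Var vV)) nlab _ s3) El3 //; cbv beta.
have vN3 : vec s3 (var s3 vN) Q (dsc S p (Some v)) (fun m => enc (ed (iota 0 c) (f0 m))).
 by rewrite e3 ?X8 // N2.
have vM3 : vec s3 (var s3 vMk) q.+1 [set v] (fun m => m v).
 apply: vec_mark => k lk; rewrite Mk3; apply: e2 => //; last by lia.
 exact: m1.
have dv1 : [disjoint dsc S p (Some v) & [set v]].
 by rewrite disjoint_sym disjoints1.
have [||||||g1 g2] := @lin2P s3 vT1 vN vMk (fun a k => tforget (ecol S v) (lab v) k a)
 _ _ _ _ _ vN3 vM3 dv1.
- by rewrite T13 e3 ?X8 // N2; lia.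
- by rewrite T13 Mk3.
- exact: X8.
- exact: X8.
- exact: X8.
- by move=> a b _ _; rewrite tforgetE.
set s4 := run n (lincomb vT1 _ _ _) s3 in g1 g2 *.
have [g2a g2b g2c] := g2; rewrite T13 in g1 g2 g2a.
have P4 : var s4 vP = node (epar S v) by rewrite g2b ?X8 // e3 ?X8.
have T14 : var s4 vT1 = 0 by rewrite g2b ?X8.
have T24 : var s4 vT2 = 1 by rewrite g2b ?X8.
have Mk4 : var s4 vMk = 2 by rewrite g2b ?X8.
have oth nd b M : VALs s nd b M -> nd <> 0 -> nd <> 1 -> nd <> 2 ->
 nd <> node (Some v) -> VALs s4 nd b M.
 move=> vM n0 n1 n2 n3; apply: g2a => //; apply: e2 => //; apply: m2 => //.
 exact: VAL_ext vM.
have vP4 : vec s4 (var s4 vP) Q (dsc S p (epar S v))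
 (fun m => enc (accs c S A (lm m) p (epar S v))).
 have [l b h] := vecs _ (openW op); rewrite P4; split=> // a la.
 by apply: oth (h a la) _ _ _ _; lia.
have g1' : vec s4 (var s4 vT1) Q (v |: dsc S p (Some v)) (fun m =>
 enc (aforget (ecol S v) (lm m v) (aedges c S v (f0 m)))).
 rewrite T14 setUC; apply: vec_eq g1 => m; by rewrite tforgetE encK.
have [||||||j1 j2] := @lin2P s4 vT2 vP vT1 tjoin _ _ _ _ _ vP4 g1' dis.
- by rewrite T24 P4; lia.
- by rewrite T24 T14.
- exact: X8.
- exact: X8.
- exact: X8.
- by move=> a b _ _; rewrite tjoinE.
rewrite -/eng_join in j1 j2; set s5 := run n eng_join s4 in j1 j2 *.
have [j2a j2b j2c] := j2; rewrite T24 in j1 j2 j2a.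
have one4 : exists v : V, VALs s4 2 0 [set delta q v 0].
 by exists v; apply: g2a => //; apply: e2; [apply: m1| |lia].
have one5 : exists v : V, VALs s5 (var s5 vMk) 0 [set delta q v 0].
 by case: one4 => v' h; exists v'; rewrite j2b ?X8 // Mk4; apply: j2a.
have T25 : var s5 vT2 = 1 by rewrite j2b ?X8.
have P5 : var s5 vP = node (epar S v) by rewrite j2b ?X8.
have Mk5 : var s5 vMk = 2 by rewrite j2b ?X8.
rewrite -[in X in vec _ X]T25 in j1.
have [|||k1 k2] := @copyP s5 vP _ _ j1 one5.
- by rewrite T25 P5; lia.
- by rewrite Mk5 P5; lia.
- exact: X8.
rewrite P5 in k1 k2; set s6 := run n (copy vP vT2) s5 in k1 k2 *.
have [k2a k2b k2c] := k2.
have var6 y : y <= 14 -> y != vN -> y != vP -> var s6 y = var s y.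
 by move=> ly y1 y2; rewrite k2b ?X8 // j2b ?X8 // g2b ?X8 // e3 ?X8 // m3 ?X8 // V1.
split.
- by rewrite !var6.
- apply: es_rep_ext rp; first by rewrite var6.
 by move=> a na; rewrite k2c // j2c // g2c // e4 // m4.
- case: one4 => v' h; exists v'; apply: k2a; last by lia.
 exact: j2a.
move=> o oo; rewrite Ep in oo *; rewrite dsc_rcons /dstep.
case: (eqVneq o (epar S v)) => [->|no].
 apply: vec_eq k1 => m; rewrite tjoinE !encK accs_rcons /estep eqxx.
 by [].
have [l b h] := vecs o (openW oo).
have nov : node o <> node (Some v).
 by move/node_inj => E; move: oo; rewrite E /= mem_rcons inE eqxx.
have nop : node o <> node (epar S v) by move/node_inj => E; rewrite E eqxx in no.
have no3 := node_ge o.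
have vo : vec s6 (node o) Q (dsc S p o) (fun m => enc (accs c S A (lm m) p o)).
 split=> // a la; apply: k2a => //; apply: j2a; last by lia.
 by apply: oth (h a la) _ _ _ _; lia.
by apply: vec_eq vo => m; rewrite accs_rcons /estep (negbTE no).
Qed.

Lemma engine_initP s x : (exists v : V, VALs s 2 0 [set delta q v 0]) ->
 var s vMk = 2 -> ~~ Xv x -> 3 <= var s x -> Q > 0 ->
 let s' := run n (eng_init x) s in
 vec s' (var s x) Q set0 (fun=> tunit) /\ keeps (var s x) s s'.
Proof.
move=> one Mk Xx ge Q0 s'.
have v1 : vec s (var s vMk) 1 set0 (fun=> 0) by apply: vec_one; rewrite Mk.
have dis : [disjoint (set0 : {set V}) & (set0 : {set V})] by rewrite -setI_eq0 setI0.
have X8 : ~~ Xv vMk by apply: Xv_eng.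
have ne : var s x <> var s vMk by rewrite Mk; lia.
have [|||h1 h2] := @lincombP s x vMk vMk [:: (tunit, 0, 0)] _ _ _ _ _ _ v1 v1 dis ne ne Xx X8 X8.
- by [].
- by move=> t t'; rewrite !inE => /eqP -> /eqP ->.
- by move=> t; rewrite inE => /eqP ->.
split; last exact: keeps_lincomb.
split=> // [_|d lt]; first by rewrite tunitE.
have := h1 d lt; rewrite setU0 (@eq_fam _ _ _ _ (fun=> tunit == d)) // => m.
by rewrite inE !xpair_eqE eqxx !andbT eq_sym.
Qed.

Theorem engineP s : es_rep s -> 0 < #|V| ->
 VALs (run n engine s) 0 0 [set m | tacc (enc (erun c S A (lm m)))].
Proof.
move=> rp /card_gt0P [v0 _].
have X8 y : y <= 14 -> ~~ Xv y := @Xv_eng y.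
have Q0 : 0 < Q by have := encQ (aunit A); lia.
pose s1 := run n (seqs [:: Assign vT1 (Num 0); Assign vT2 (Num 1); Assign vMk (Num 2);
 Assign vRt (Num 3); Assign vV (Num 0)]) s.
change (VALs (run n eng_final (run n eng_loop2 (run n eng_loop1 (run n (eng_init vRt)
 (run n (vmark 0) s1))))) 0 0 [set m | tacc (enc (erun c S A (lm m)))]).
have E1 : [/\ var s1 vT1 = 0, var s1 vT2 = 1, var s1 vMk = 2 & var s1 vRt = 3] by [].
have rp1 : es_rep s1 by apply: es_rep_ext rp.
set s2 := run n (vmark 0) s1.
have one2 : exists v : V, VALs s2 2 0 [set delta q v 0].
 by exists v0; apply: (markP (k := 0)) => //; left.
have V2 y : y <= 14 -> var s2 y = var s1 y by move=> ly; rewrite (ok_var n s1 (ok_mark _)) ?X8.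
have E2 : [/\ var s2 vT1 = 0, var s2 vT2 = 1, var s2 vMk = 2 & var s2 vRt = 3] by rewrite !V2.
have rp2 : es_rep s2.
 apply: es_rep_ext rp1; first by rewrite V2.
 by move=> a na; rewrite (ok_arr n s1 (ok_mark _)).
have [T12 T22 Mk2 Rt2] := E2.
have [||i1 i2] := @engine_initP s2 vRt one2 Mk2 (X8 vRt isT); rewrite ?Rt2 //.
rewrite Rt2 in i1 i2; set s3 := run n (eng_init vRt) s2 in i1 i2 *.
have [i2a i2b i2c] := i2.
have [Et szn] : var s vTop = size (eord S) /\ size (eord S) <= n by case: rp.
pose I0 x t := [/\ [/\ var t vT1 = 0, var t vT2 = 1, var t vMk = 2 & var t vRt = 3], es_rep t,
 exists v : V, VALs t 2 0 [set delta q v 0], vec t 3 Q set0 (fun=> tunit)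
 & forall v, vid v < x -> vec t (vid v + 4) Q set0 (fun=> tunit)].
set s4 := run n eng_loop1 s3.
have I4 : I0 n s4.
 apply: run_loop.
 split=> //.
 - by rewrite !i2b ?X8.
 - by apply: es_rep_ext rp2; rewrite ?i2b ?X8.
 - by case: one2 => v h; exists v; apply: i2a.
 move=> i t lti [[t1 t2 t3 t4] rt ot vt vs].
 rewrite run_if eval_lt -[eval _ _ (Var vI)]/(upd (var t) vI i vI)
 -[eval _ _ (Var vTop)]/(upd (var t) vI i vTop).
 have -> : upd (var t) vI i vI = i by rewrite /upd eqxx.
 have -> : upd (var t) vI i vTop = size (eord S) by rewrite /upd /=; case: rt => -[-> _].
 set t' := setv t vI i.
 have rt' : es_rep t' by apply: es_rep_ext rt.
 case: ltnP => lt; last first.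
 rewrite -[run n Skip t']/t'; split=> //.
 - by case: ot => v h; exists v; apply: VAL_ext h.
 - by apply: vec_ext vt.
 move=> v lv; apply: vec_ext (vs v _) => //.
 by case: rt => _ _ /(_ v) [h _] _ _; lia.
 set u := setv t' vN (i + 4).
 have Nu : var u vN = i + 4 by rewrite /u /= /upd eqxx.
 have [||||a1 a2] := @engine_initP u vN _ _ (X8 vN isT).
 - by case: ot => v h; exists v; apply: VAL_ext h.
 - by [].
 - by rewrite Nu; lia.
 - by [].
 rewrite Nu in a1 a2.
 rewrite -[run n (Seq _ _) t']/(run n (eng_init vN) u).
 set w := run n (eng_init vN) u in a1 a2 *.
 have [a2a a2b a2c] := a2.
 split.
 - by rewrite !a2b ?X8.
 - by apply: es_rep_ext rt; rewrite ?a2b ?X8 // => a na; rewrite a2c.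
 - by case: ot => v h; exists v; apply: a2a; [apply: VAL_ext h|lia].
 - by apply: vec_keeps a2 _ _; [lia|apply: vec_ext vt].
 - move=> v lv; case: (eqVneq (vid v) i) => [->|ne] //.
 have lv' : vid v < i by rewrite ltn_neqAle ne -ltnS.
 apply: vec_keeps a2 _ _; last by apply: vec_ext (vs v lv').
 by move/eqP: ne; lia.
have [b4 rp4 one4 vr4 vv4] := I4.
have J0 : einv 0 s4.
 split=> // o _; rewrite take0 /= /dsc /accs /=.
 case: o => [v|] /=; rewrite -tunitE //; apply: vv4.
 by case: rp => _ _ /(_ v) [h _] _ _; lia.
set s5 := run n eng_loop2 s4.
have J5 : einv n s5.
 apply: run_loop => // i t lti Ji.
 rewrite run_if eval_lt -[eval _ _ (Var vI)]/(upd (var t) vI i vI)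
 -[eval _ _ (Var vTop)]/(upd (var t) vI i vTop).
 have [[t1 t2 t3 t4] rt ot vs] := Ji.
 have -> : upd (var t) vI i vI = i by rewrite /upd eqxx.
 have -> : upd (var t) vI i vTop = size (eord S) by rewrite /upd /=; case: rt => -[-> _].
 set t' := setv t vI i.
 have Ji' : einv i t'.
 split; [by []|by apply: es_rep_ext rt| |].
 by case: ot => v h; exists v; apply: VAL_ext h.
 by move=> o oo; apply: vec_ext (vs o oo).
 case: ltnP => lt; last first.
 move: Ji'; rewrite /einv !take_oversize //; lia.
 pose v := nth v0 (eord S) i.
 set u := setv t' vV (arr t aORD i).
 have Eu : arr t aORD i = vid v by case: rt => _ h _ _ _; apply: h.
 have Ju : einv i u.
 have [[w1 w2 w3 w4] rw ow vw] := Ji'; split; [by []|by apply: es_rep_ext rw| |].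
 by case: ow => v' h; exists v'; apply: VAL_ext h.
 by move=> o oo; apply: vec_ext (vw o oo).
 rewrite -[run n (Seq _ _) t']/(run n eng_vertex u).
 apply: (@engine_vertexP i u v) => //; first by rewrite (set_nth_default v0).
have [[T15 T25 Mk5 Rt5] rp5 one5 vec5] := J5.
have := vec5 None isT; rewrite take_oversize // dsc_all //= => vr.
have vr' : vec s5 (var s5 vRt) Q [set: V] (fun m => enc (accs c S A (lm m) (eord S) None)).
 by rewrite Rt5.
have v1 : vec s5 (var s5 vMk) 1 set0 (fun=> 0) by apply: vec_one; rewrite Mk5.
have dis : [disjoint [set: V] & (set0 : {set V})] by rewrite -setI_eq0 setI0.
rewrite /eng_final; set l := [seq (0, a, 0) | a <- _].
have [||||||||h1 _] := @lincombP s5 vT1 vRt vMk l _ _ _ _ _ _ vr' v1 dis; try exact: X8.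
- by rewrite T15 Rt5.
- by rewrite T15 Mk5.
- by rewrite map_inj_uniq ?filter_uniq ?iota_uniq // => a b [].
- by move=> t t' /mapP [a _ ->] /mapP [b _ ->] /= ->.
- by move=> t /mapP [a]; rewrite mem_filter mem_iota add0n => /andP [_ /andP [_ la]] ->.
have := h1 0 Q0; rewrite T15 setU0 (_ : fam _ _ = [set m | tacc (enc (erun c S A (lm m)))]) //.
apply/setP => m; rewrite [in RHS]inE; apply/famP/idP.
 by case=> _ /mapP [a]; rewrite mem_filter => /andP [ta _] [->].
move=> ta; split; first by move=> v; rewrite inE.
apply/mapP; exists (enc (erun c S A (lm m))) => //.
by rewrite mem_filter ta mem_iota add0n encQ.
Qed.

End Engine.

(** * Witnesses and counts *)

Section Witness.
Variable q : nat.
(** [aF a] tells whether the family of state [a] is nonempty; [aC a i] holds one more than the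
    vertex with mark [i.+1], and 0 if no vertex has it. *)
Definition aF a : aid := (1, a, 0).
Definition aC a i : aid := (1, a, i.+1).

Definition wzero x a := Store (aF a) (Var x) (Num 0).
Definition wmark k := Seq (Store (aF k) (Var vMk) (Num 1))
 (seqs [seq Store (aC k i) (Var vMk) (if i.+1 == k then AddE (Var vV) 1 else Num 0)
 | i <- iota 0 q]).
Definition wcell xd d xa a xb b i :=
 If (Arr (aC a i) (Var xa)) (Store (aC d i) (Var xd) (Arr (aC a i) (Var xa)))
 (Store (aC d i) (Var xd) (Arr (aC b i) (Var xb))).
Definition waddmul xd d xa a xb b :=
 If (AndE (Arr (aF a) (Var xa)) (Arr (aF b) (Var xb)))
 (If (Arr (aF d) (Var xd)) Skip
 (Seq (Store (aF d) (Var xd) (Num 1))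
 (seqs [seq wcell xd d xa a xb b i | i <- iota 0 q]))) Skip.

Definition Yw : pred aid := fun b => b.1.1 == 1.

Lemma ok_wzero x a : ok 0 xpred0 Yw (wzero x a).
Proof. by []. Qed.
Lemma ok_wmark k : ok 0 xpred0 Yw (wmark k).
Proof. by apply: ok_seq => //; apply: ok_seqs_map => i; case: eqP. Qed.
Lemma ok_waddmul xd d xa a xb b : ok 0 xpred0 Yw (waddmul xd d xa a xb b).
Proof.
apply: ok_if => //; apply: ok_if => //; apply: ok_seq => //.
by apply: ok_seqs_map.
Qed.

Variables (n : nat) (V : finType) (vid : V -> nat).

(** If several vertices carry the same mark, the cell records only one of them. Uniqueness of marks
    is imposed later through the formula. *)
Definition wit s nd a (m : marking V q) :=
 forall i, i < q -> (arr s (aC a i) nd = 0 /\ forall v, m v != i.+1 :> nat) \/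
 exists2 v, arr s (aC a i) nd = (vid v).+1 & m v = i.+1 :> nat.

Definition wval s nd a (M : {set marking V q}) :=
 if arr s (aF a) nd == 0 then M = set0 else exists2 m, m \in M & wit s nd a m.

Lemma wval_same s s' nd a M : (forall i, arr s' (1, a, i) nd = arr s (1, a, i) nd) ->
 wval s nd a M -> wval s' nd a M.
Proof.
move=> E; rewrite /wval E; case: ifP => // _ [m mM w]; exists m => // i lt.
by have := w i lt; rewrite E.
Qed.

Lemma wval_ext s s' nd a M : (forall b, Yw b -> arr s b = arr s' b) ->
 wval s nd a M -> wval s' nd a M.
Proof. by move=> E; apply: wval_same => i; rewrite E. Qed.

Lemma wzeroP x a s : wval (run n (wzero x a) s) (var s x) a set0.
Proof. by rewrite /wval /= eqxx /upd eqxx. Qed.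

Lemma wzeroN x a s nd b M : wval s nd b M -> ~ (nd = var s x /\ b = a) ->
 wval (run n (wzero x a) s) nd b M.
Proof.
move=> H ne; apply: wval_same H => i; rewrite /=; case: eqP => // -[Eb Ei].
by rewrite /upd; case: eqP => [E|_]; [case: ne|rewrite Eb Ei].
Qed.

Definition slotset s d nd (f : nat -> nat) r s' :=
 [/\ var s' = var s, forall i, i < r -> arr s' (aC d i) nd = f i
 & forall b k, ~ (exists2 i, i < r & b = aC d i /\ k = nd) -> arr s' b k = arr s b k].

Lemma slotset_step s d nd f r s' v : slotset s d nd f r s' -> v = f r ->
 slotset s d nd f r.+1 (seta s' (aC d r) nd v).
Proof.
move=> [h1 h2 h3] ->; split=> //= [i|b k ne].
 rewrite ltnS leq_eqVlt => /orP [/eqP ->|lt]; first by rewrite eqxx /upd eqxx.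
 case: eqP => [[E]|_]; first by rewrite E ltnn in lt.
 exact: h2.
case: eqP => [E|_]; last by apply: h3 => -[i lt [E1 E2]]; apply: ne; exists i => //; lia.
rewrite /upd; case: eqP => [Ek|nk]; first by case: ne; exists r => //; lia.
rewrite E; apply: h3 => -[i lt [E1 E2]]; exact: nk.
Qed.

Lemma wmarkP k s v : k <= q -> k = 0 \/ var s vV = vid v ->
 wval (run n (wmark k) s) (var s vMk) k [set delta q v k].
Proof.
move=> kq Hv; set s1 := run n (Store (aF k) (Var vMk) (Num 1)) s.
have main r : slotset s1 k (var s vMk) (fun i => if i.+1 == k then (vid v).+1 else 0) r
 (run n (seqs [seq Store (aC k i) (Var vMk)
 (if i.+1 == k then AddE (Var vV) 1 else Num 0) | i <- iota 0 r]) s1).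
 elim: r => [|r IH]; first by split.
 rewrite iota_rcons map_rcons run_seqs_rcons.
 set s2 := run n (seqs _) s1 in IH *; have [h1 _ _] := IH.
 rewrite [run n (Store _ _ _) s2]/= h1; apply: slotset_step IH _.
 case: eqP => // E /=; rewrite h1 /= addn1; case: Hv => [k0|->] //.
 by rewrite k0 in E.
have [h1 h2 h3] := main q; rewrite /wmark [run n _ s]/=.
rewrite -/s1; set s2 := run n (seqs _) s1 in h1 h2 h3 *.
have Ef : arr s2 (aF k) (var s vMk) = 1.
 rewrite h3; last by case=> i _ [].
 by rewrite /s1 /= eqxx /upd eqxx.
rewrite /wval Ef /=; exists (delta q v k); first by rewrite inE.
move=> i lt; rewrite h2 //; case: eqP => E.
 by right; exists v => //; rewrite ffunE eqxx inordK -E.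
left; split=> // u; rewrite ffunE; case: (u == v) => //.
by rewrite inordK // eq_sym; apply/eqP.
Qed.

Lemma wmarkN k s nd b M : wval s nd b M -> ~ (nd = var s vMk /\ b = k) ->
 wval (run n (wmark k) s) nd b M.
Proof.
move=> H ne; set s1 := run n (Store (aF k) (Var vMk) (Num 1)) s.
have main r : slotset s1 k (var s vMk) (fun i => if i.+1 == k then (var s vV + 1) else 0) r
 (run n (seqs [seq Store (aC k i) (Var vMk)
 (if i.+1 == k then AddE (Var vV) 1 else Num 0) | i <- iota 0 r]) s1).
 elim: r => [|r IH]; first by split.
 rewrite iota_rcons map_rcons run_seqs_rcons.
 set s2 := run n (seqs _) s1 in IH *; have [h1 _ _] := IH.
 by rewrite [run n (Store _ _ _) s2]/= h1; apply: slotset_step IH _; case: eqP => //= _; rewrite h1.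
have [h1 h2 h3] := main q; rewrite /wmark [run n _ s]/= -/s1.
apply: wval_same H => i; rewrite h3; last first.
 by case=> j _ [[Ea _] En]; apply: ne.
rewrite /s1 /=; case: eqP => // -[Eb Ei].
by rewrite /upd; case: eqP => [E|_]; [case: ne|rewrite Eb Ei].
Qed.

Lemma waddmul_cells xd d xa a xb b s r : var s xd <> var s xa -> var s xd <> var s xb ->
 slotset s d (var s xd) (fun i => if arr s (aC a i) (var s xa) != 0
 then arr s (aC a i) (var s xa) else arr s (aC b i) (var s xb)) r
 (run n (seqs [seq wcell xd d xa a xb b i | i <- iota 0 r]) s).
Proof.
move=> na nb; elim: r => [|r IH]; first by split.
rewrite -addn1 iotaD map_cat run_seqs_cat /= add0n addn1.
set s2 := run n (seqs _) s in IH *; have [h1 _ h3] := IH.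
have Ea : arr s2 (aC a r) (var s xa) = arr s (aC a r) (var s xa).
 by apply: h3 => -[i _ [_ E]]; apply: na.
have Eb : arr s2 (aC b r) (var s xb) = arr s (aC b r) (var s xb).
 by apply: h3 => -[i _ [_ E]]; apply: nb.
by rewrite !h1 Ea Eb; case: ifP => E; apply: slotset_step IH _; rewrite E.
Qed.

Lemma waddmulP xd d xa a xb b s M0 (D1 D2 : {set V}) P1 P2 :
 [disjoint D1 & D2] -> local D1 P1 -> local D2 P2 ->
 wval s (var s xd) d M0 -> wval s (var s xa) a (fam D1 P1) ->
 wval s (var s xb) b (fam D2 P2) -> var s xd <> var s xa -> var s xd <> var s xb ->
 [disjoint M0 & fmul (fam D1 P1) (fam D2 P2)] ->
 wval (run n (waddmul xd d xa a xb b) s) (var s xd) d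
 (M0 :|: fmul (fam D1 P1) (fam D2 P2)).
Proof.
move=> dis l1 l2 v0 v1 v2 na nb _; rewrite /waddmul run_if eval_and /=.
case: ifP => [/andP [fa fb]|fab]; last first.
 suff E : fmul (fam D1 P1) (fam D2 P2) = set0 by rewrite E setU0.
 move: v1 v2 fab; rewrite /wval; case: eqP => /= [_ -> _ _|_ _].
 by apply/setP => m; rewrite inE; apply/imset2P => -[m1 m2]; rewrite inE.
 case: eqP => //= _ -> _; apply/setP => m; rewrite inE; apply/imset2P => -[m1 m2 _].
 by rewrite inE.
case: ifP => fd.
 by move: v0; rewrite /wval (negbTE fd) => -[m mM w]; exists m => //; rewrite inE mM.
set s1 := seta s (aF d) (var s xd) 1.
have [h1 h2 h3] := @waddmul_cells xd d xa a xb b s1 q na nb.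
set s2 := run n (seqs _) s1 in h1 h2 h3 *.
have Ef : arr s2 (aF d) (var s xd) = 1.
 by rewrite h3; [rewrite /s1 /= eqxx /upd eqxx|case=> i _ []].
move: v1 v2; rewrite /wval (negbTE fa) (negbTE fb) Ef /=.
move=> [m1 M1 w1] [m2 M2 w2]; exists (merge m1 m2).
 by rewrite inE; apply/orP; right; apply/imset2P; exists m1 m2.
have [z1 _] := famP _ _ _ M1; have [z2 _] := famP _ _ _ M2.
move=> i lt; rewrite h2 //.
have Ea : arr s1 (aC a i) (var s1 xa) = arr s (aC a i) (var s xa).
 by rewrite /s1 /=; case: eqP.
have Eb : arr s1 (aC b i) (var s1 xb) = arr s (aC b i) (var s xb).
 by rewrite /s1 /=; case: eqP.
rewrite Ea Eb; case: (w1 i lt) => [[-> no1]|[v -> E1]] /=; last first.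
 by right; exists v => //; rewrite ffunE -val_eqE /= E1.
case: (w2 i lt) => [[-> no2]|[v -> E2]].
 by left; split=> // v; rewrite ffunE; case: ifP.
right; exists v => //; rewrite ffunE; case: eqP => //= /eqP nz.
have v1 : v \in D1 by apply: contraNT nz => /z1 ->.
have v2 : v \in D2 by apply: contraTT isT => /z2 E; rewrite E in E2.
by move/pred0P: dis => /(_ v) /=; rewrite v1 v2.
Qed.

Lemma waddmulN xd d xa a xb b s nd e M : wval s nd e M ->
 ~ (nd = var s xd /\ e = d) -> wval (run n (waddmul xd d xa a xb b) s) nd e M.
Proof.
move=> H ne; apply: wval_same H => i.
have cells l t : var t = var s ->
 arr (run n (seqs [seq wcell xd d xa a xb b i | i <- l]) t) (1, e, i) nd = arr t (1, e, i) nd.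
 elim: l t => //= j l IH t Et; rewrite /wcell.
 by case: ifP => _; rewrite IH //= ?Et; case: eqP => // -[Eb Ei];
 rewrite /upd; case: eqP => [E|_]; try (by case: ne); rewrite Eb Ei.
rewrite /waddmul run_if; case: ifP => // _; rewrite run_if; case: ifP => // _.
rewrite run_seq cells //=; case: eqP => // -[Eb Ei].
by rewrite /upd; case: eqP => [E|_]; [case: ne|rewrite Eb Ei].
Qed.

End Witness.

(** * Binary arithmetic modulo a power of two *)

Section Counts.
Definition vB1 := 15.
Definition vB2 := 16.
Definition vCar := 17.
Definition vSum := 18.
Definition aB a : aid := (2, a, 0).

(** Each number occupies [n] consecutive entries of an array, one binary digit per entry, the block
    number being the node. *)
Definition dig x i := Bin Add (Bin Mul (Var x) Size) i.
Definition bzero (a : aid) x := Loop vB1 (Store a (dig x (Var vB1)) (Num 0)).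
Definition bone (a : aid) x := Seq (bzero a x) (Store a (dig x (Num 0)) (Num 1)).
Definition bdigit (d : aid) xd (b : aid) xb :=
 seqs [:: Assign vSum (Var vCar);
 If (Arr d (dig xd (Var vB2))) (Assign vSum (AddE (Var vSum) 1)) Skip;
 If (Arr b (dig xb (Bin Defs.Sub (Var vB2) (Var vB1)))) (Assign vSum (AddE (Var vSum) 1)) Skip;
 switch (Var vSum) 4 (fun r => Seq (Store d (dig xd (Var vB2)) (Num (odd r)))
 (Assign vCar (Num r./2)))].
Definition bshift d xd b xb :=
 Seq (Assign vCar (Num 0))
 (Loop vB2 (If (LtE (Var vB2) (Var vB1)) Skip (bdigit d xd b xb))).
(** School multiplication added to a third number, quadratic in the number of digits. Inside the
    linear loop over the vertices it makes counting cubic. *)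
Definition baddmul (d : aid) xd (a : aid) xa (b : aid) xb :=
 Loop vB1 (If (Arr a (dig xa (Var vB1))) (bshift d xd b xb) Skip).

Definition Xb : pred nat := fun x => 15 <= x <= 18.

Lemma ok_bzero (Y : pred aid) a x : Y a -> ok 2 Xb Y (bzero a x).
Proof. by move=> Ya; rewrite /ok /= Ya. Qed.
Lemma ok_bone (Y : pred aid) a x : Y a -> ok 2 Xb Y (bone a x).
Proof. by move=> Ya; rewrite /ok /= Ya. Qed.
Lemma ok_baddmul (Y : pred aid) d xd a xa b xb : Y d -> ok 2 Xb Y (baddmul d xd a xa b xb).
Proof. by move=> Yd; rewrite /ok /= Yd. Qed.

Variable n : nat.

Definition bits2 s (a : aid) nd := forall i, i < n -> arr s a (nd * n + i) < 2.
Definition low s (a : aid) nd k := \sum_(i < k) arr s a (nd * n + i) * 2 ^ i.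

Lemma low_ext s s' a nd k : (forall i, i < k -> arr s' a (nd * n + i) = arr s a (nd * n + i)) ->
 low s' a nd k = low s a nd k.
Proof. by move=> E; apply: eq_bigr => i _; rewrite E. Qed.

Lemma lowS s a nd k : low s a nd k.+1 = low s a nd k + arr s a (nd * n + k) * 2 ^ k.
Proof. by rewrite /low big_ord_recr. Qed.

Lemma addr_ne nd nd' i i' : i < n -> i' < n -> nd * n + i = nd' * n + i' -> nd = nd' /\ i = i'.
Proof.
move=> li li' E; have n0 : 0 < n by lia.
have := congr1 (divn^~ n) E; rewrite !divnMDl // !divn_small // !addn0 => Ed.
by split=> //; move: E; rewrite Ed; lia.
Qed.

Lemma bzeroP a x s : ~~ Xb x -> let s' := run n (bzero a x) s in
 [/\ forall i, i < n -> arr s' a (var s x * n + i) = 0,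
 forall b k, ~ (b = a /\ exists2 i, i < n & k = var s x * n + i) -> arr s' b k = arr s b k
 & forall y, y != vB1 -> var s' y = var s y].
Proof.
move=> lx.
apply: (@run_loop n vB1 _ s (fun i t =>
 [/\ forall j, j < i -> arr t a (var s x * n + j) = 0,
 forall b k, ~ (b = a /\ exists2 i, i < n & k = var s x * n + i) -> arr t b k = arr s b k
 & forall y, y != vB1 -> var t y = var s y])) => // i t lt [h1 h2 h3].
have Ex : upd (var t) vB1 i x = var s x.
 by rewrite /upd ifN ?h3 //; apply/eqP; rewrite /vB1 => E; rewrite E in lx.
split=> /= [j|b k ne|y ny].
- rewrite eqxx Ex [upd _ _ _ vB1]/upd eqxx ltnS leq_eqVlt => /orP [/eqP ->|lj].
 by rewrite /upd eqxx.
 by rewrite /upd; case: eqP => // _; apply: h1.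
- case: eqP => [Eb|nb]; last exact: h2.
 rewrite Ex [upd _ _ _ vB1]/upd eqxx /upd; case: eqP => [Ek|_]; last by rewrite -Eb; exact: h2.
 by case: ne; split=> //; exists i.
- by rewrite /upd (negbTE ny) h3.
Qed.

Lemma bdigitP d xd b xb s i k : ~~ Xb xd -> ~~ Xb xb -> var s xd <> var s xb ->
 var s vB1 = i -> var s vB2 = k -> i <= k -> k < n ->
 arr s d (var s xd * n + k) < 2 -> arr s b (var s xb * n + (k - i)) < 2 -> var s vCar < 2 ->
 let t := var s vCar + arr s d (var s xd * n + k) + arr s b (var s xb * n + (k - i)) in
 let s' := run n (bdigit d xd b xb) s in
 [/\ var s' vCar = t./2,
 arr s' d (var s xd * n + k) = odd t,
 forall a e, ~ (a = d /\ e = var s xd * n + k) -> arr s' a e = arr s a e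
 & forall y, y != vCar -> y != vSum -> var s' y = var s y].
Proof.
move=> lxd lxb ne E1 E2 ik kn h1 h2 h3 t s'.
have nx x y : ~~ Xb x -> Xb y -> (x == y) = false by move=> hx hy; apply/eqP => E; rewrite E hy in hx.
pose s1 := setv s vSum (var s vCar).
pose s2 := run n (If (Arr d (dig xd (Var vB2))) (Assign vSum (AddE (Var vSum) 1)) Skip) s1.
pose s3 := run n (If (Arr b (dig xb (Bin Defs.Sub (Var vB2) (Var vB1))))
 (Assign vSum (AddE (Var vSum) 1)) Skip) s2.
have V2 : [/\ var s2 vSum = var s vCar + arr s d (var s xd * n + k), arr s2 = arr s
 & forall y, y != vSum -> var s2 y = var s y].
 have C1 : eval n s1 (Arr d (dig xd (Var vB2))) = arr s d (var s xd * n + k).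
 by rewrite /= /upd (nx xd vSum) // E2.
 rewrite /s2 run_if C1.
 case: eqP => [E|E].
 split=> [||y ny] //; first by rewrite /= /upd eqxx E addn0.
 by rewrite /= /upd (negbTE ny).
 split=> [||y ny] //; last by rewrite /= /upd (negbTE ny).
 by rewrite /= /upd !eqxx; move: h1 E; case: (arr _ _ _) => [|[|]] // _ _; rewrite addn1.
have [v2 a2 o2] := V2.
have V3 : [/\ var s3 vSum = t, arr s3 = arr s & forall y, y != vSum -> var s3 y = var s y].
 have C2 : eval n s2 (Arr b (dig xb (Bin Defs.Sub (Var vB2) (Var vB1)))) =
 arr s b (var s xb * n + (k - i)).
 by rewrite /= a2 !o2 ?(nx xb vSum) // E1 E2.
 rewrite /s3 run_if C2.
 case: eqP => [E|E]; first by split=> //; rewrite /= v2 /t E addn0.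
 split=> [||y ny] //; last by rewrite /= /upd (negbTE ny) o2.
 rewrite /= /upd eqxx v2 /t; move: h2 E; case: (arr s b _) => [|[|]] // _ _.
have [v3 a3 o3] := V3.
have Es : s' = run n (switch (Var vSum) 4 (fun r => Seq (Store d (dig xd (Var vB2)) (Num (odd r)))
 (Assign vCar (Num r./2)))) s3 by [].
have t4 : t < 4 by rewrite /t; lia.
rewrite Es run_switch /= v3 //= !o3 ?(nx xd vSum) //= E2 a3.
split.
- by rewrite /= /upd eqxx.
- by rewrite /= eqxx /upd eqxx.
- move=> a e nae /=; case: eqP => [Ea|//]; rewrite /upd; case: eqP => [Ee|_]; last by rewrite Ea.
 by case: nae.
- by move=> y y1 y2; rewrite /= /upd (negbTE y1) o3.
Qed.

Lemma bshiftP d xd b xb s i : ~~ Xb xd -> ~~ Xb xb -> var s xd <> var s xb ->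
 var s vB1 = i -> i < n -> bits2 s d (var s xd) -> bits2 s b (var s xb) ->
 let s' := run n (bshift d xd b xb) s in
 [/\ bits2 s' d (var s xd),
 low s' d (var s xd) n = low s d (var s xd) n + 2 ^ i * low s b (var s xb) n %[mod 2 ^ n],
 forall a e, ~ (a = d /\ exists2 j, j < n & e = var s xd * n + j) -> arr s' a e = arr s a e
 & forall y, y != vB2 -> y != vCar -> y != vSum -> var s' y = var s y].
Proof.
move=> lxd lxb ne E1 lin dd db; rewrite /bshift [run n _ s]/=.
set s0 := setv s vCar 0.
(* The sum of the digits below [k], with the carry as digit [k]. Truncated subtraction makes the
   shifted summand empty for [k <= i], where the carry is still 0. *)
pose I k t := [/\ [/\ forall j, j < n -> arr t d (var s xd * n + j) < 2, var t vCar < 2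
 & k <= i -> var t vCar = 0],
 low t d (var s xd) k + var t vCar * 2 ^ k =
 low s d (var s xd) k + 2 ^ i * low s b (var s xb) (k - i),
 forall j, k <= j -> j < n -> arr t d (var s xd * n + j) = arr s d (var s xd * n + j),
 forall a e, ~ (a = d /\ exists2 j, j < n & e = var s xd * n + j) -> arr t a e = arr s a e
 & forall y, y != vB2 -> y != vCar -> y != vSum -> var t y = var s y].
have nx x y : ~~ Xb x -> Xb y -> x != y by move=> hx hy; apply/eqP => E; rewrite E hy in hx.
have [[J1 J2 _] J3 _ J4 J5] : I n (run n (Loop vB2 (If (LtE (Var vB2) (Var vB1)) Skip
 (bdigit d xd b xb))) s0).
 apply: run_loop.
 split; [| |by []|by []|].
 - by split=> [j jn||_]; [apply: dd|rewrite /= /upd eqxx|rewrite /= /upd eqxx].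
 - have -> : 0 - i = 0 by lia.
 by rewrite /low !big_ord0 muln0 /= /upd eqxx.
 - by move=> y _ ny _; rewrite /= /upd (negbTE ny).
 move=> k t lk [[h1 h2 h3] h4 h5 h6 h7].
 rewrite run_if eval_lt; set u := setv t vB2 k.
 have uB2 : var u vB2 = k by rewrite /u /= /upd eqxx.
 have uv y : y != vB2 -> var u y = var t y by move=> ny; rewrite /u /= /upd (negbTE ny).
 have uB1 : var u vB1 = i by rewrite uv // h7.
 have ud : var u xd = var s xd by rewrite uv ?nx // h7 ?nx.
 have ub : var u xb = var s xb by rewrite uv ?nx // h7 ?nx.
 rewrite [eval _ _ (Var vB2)]uB2 [eval _ _ (Var vB1)]uB1; case: ltnP => ki.
 have c0 : var t vCar = 0 by apply: h3; lia.
 rewrite -[run n Skip u]/u; split.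
 - by split=> // _; rewrite uv.
 - rewrite uv // c0 mul0n addn0 in h4 *; rewrite !lowS.
 rewrite (_ : k.+1 - i = k - i); last by lia.
 rewrite [arr u d _]h5 //; move: h4; rewrite -[low u _ _ k]/(low t d (var s xd) k).
 by set x1 := low t _ _ _; set x2 := low s d _ _; set x3 := 2 ^ i * _; set x4 := _ * 2 ^ k; lia.
 - by move=> j kj jn; apply: h5 => //; lia.
 - exact: h6.
 - by move=> y y1 y2 y3; rewrite uv ?h7.
 have eb j : j < n -> arr u b (var s xb * n + j) = arr s b (var s xb * n + j).
 by move=> jn; apply: h6 => -[_ [j' jn' E]]; case: (addr_ne jn jn' E) => E' _; apply: ne.
 have jlt : k - i < n by lia.
 have a1 : arr u d (var u xd * n + k) < 2 by rewrite ud; apply: h1.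
 have a2 : arr u b (var u xb * n + (k - i)) < 2 by rewrite ub eb //; apply: db.
 have a3 : var u vCar < 2 by rewrite uv.
 have ne' : var u xd <> var u xb by rewrite ud ub.
 have [b1 b2 b3 b4] := bdigitP lxd lxb ne' uB1 uB2 ki lk a1 a2 a3.
 set u' := run n (bdigit d xd b xb) u in b1 b2 b3 b4 *; set tt := _ + _ in b1 b2.
 rewrite ud in b2 b3.
 split.
 - split=> [j jn||le]; last by exfalso; lia.
 case: (eqVneq j k) => [->|njk]; first by rewrite b2; case: (odd _).
 by rewrite b3; [apply: h1|case=> _ /addnI E; rewrite E eqxx in njk].
 by rewrite b1 /tt; lia.
 - rewrite !lowS b2 b1.
 rewrite (@low_ext t u'); last first.
 by move=> j jk; rewrite b3 // => -[_ /addnI E]; rewrite E ltnn in jk.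
 have Ett : (odd tt : nat) + 2 * tt./2 = tt by rewrite mul2n odd_double_half.
 have Etk : tt = var t vCar + arr s d (var s xd * n + k) + arr s b (var s xb * n + (k - i)).
 by rewrite /tt uv // ub eb // ud [arr u d _]h5.
 rewrite (_ : k.+1 - i = (k - i).+1); last by lia.
 rewrite lowS expnS mulnA [_./2 * 2]mulnC -addnA -mulnDl Ett Etk !mulnDl.
 have Ep : 2 ^ k = 2 ^ i * 2 ^ (k - i) by rewrite -expnD subnKC.
 rewrite mulnDr [2 ^ i * (_ * _)]mulnCA -Ep.
 by move: h4; set x1 := low t _ _ _; set x2 := low s d _ _; set x3 := 2 ^ i * _;
 set x4 := _ * 2 ^ k; set x5 := _ * 2 ^ k; set x6 := _ * 2 ^ k; lia.
 - by move=> j kj jn; rewrite b3 ?h5 //; [lia|case=> _ /addnI E; lia].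
 - move=> a e nae; rewrite b3; first exact: h6.
 by case=> Ea Ee; apply: nae; split=> //; exists k.
 - by move=> y y1 y2 y3; rewrite b4 // uv // h7.
split=> //.
(* The top [i] digits of the second number are shifted out and contribute a multiple of [2 ^ n]. *)
have Eb : low s b (var s xb) n = low s b (var s xb) (n - i) +
 2 ^ (n - i) * \sum_(j < i) arr s b (var s xb * n + (n - i + j)) * 2 ^ j.
 rewrite /low; have -> : n = n - i + i by lia.
 rewrite big_split_ord /= addnK; congr addn; rewrite big_distrr /=.
 by apply: eq_bigr => j _; rewrite expnD mulnCA.
rewrite Eb mulnDr addnA -J3 mulnA -expnD subnKC; last exact: ltnW.
by rewrite [2 ^ n * _]mulnC -addnA -mulnDl -modnDmr modnMl addn0.
Qed.

Lemma baddmulP d xd a xa b xb s : ~~ Xb xd -> ~~ Xb xa -> ~~ Xb xb ->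
 var s xd <> var s xa -> var s xd <> var s xb ->
 bits2 s d (var s xd) -> bits2 s a (var s xa) -> bits2 s b (var s xb) ->
 let s' := run n (baddmul d xd a xa b xb) s in
 [/\ bits2 s' d (var s xd),
 low s' d (var s xd) n =
 low s d (var s xd) n + low s a (var s xa) n * low s b (var s xb) n %[mod 2 ^ n]
 & forall c e, ~ (c = d /\ exists2 j, j < n & e = var s xd * n + j) -> arr s' c e = arr s c e].
Proof.
move=> lxd lxa lxb na nb dd da db.
have nx x y : ~~ Xb x -> Xb y -> x != y by move=> hx hy; apply/eqP => E; rewrite E hy in hx.
pose I i t := [/\ bits2 t d (var s xd),
 low t d (var s xd) n = low s d (var s xd) n + low s a (var s xa) i * low s b (var s xb) n
 %[mod 2 ^ n],
 forall c e, ~ (c = d /\ exists2 j, j < n & e = var s xd * n + j) -> arr t c e = arr s c e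
 & forall y, ~~ Xb y -> var t y = var s y].
have [] : I n (run n (baddmul d xd a xa b xb) s) => //.
apply: run_loop; first by split=> //; rewrite /low !big_ord0 mul0n addn0.
move=> i t lt [h1 h2 h3 h4]; rewrite run_if; set u := setv t vB1 i.
have uv y : ~~ Xb y -> var u y = var s y.
 by move=> ly; rewrite /u /= /upd (negbTE (nx y vB1 ly isT)) h4.
have frz c x j : ~~ Xb x -> var s xd <> var s x -> j < n ->
 arr u c (var s x * n + j) = arr s c (var s x * n + j).
 move=> lx ne jn; apply: h3 => -[_ [j' jn' E]].
 by case: (addr_ne jn jn' E) => E' _; apply: ne.
have Ea : eval n u (Arr a (dig xa (Var vB1))) = arr s a (var s xa * n + i).
 by rewrite -[eval _ _ _]/(arr u a (var u xa * n + var u vB1)) uv // {2}/u /= /upd eqxx frz.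
rewrite Ea /I lowS; have := da i lt; case: (arr s a _) => [|[|//]] _ /=.
 by rewrite mul0n addn0; split=> // y ly; rewrite uv.
have bd : bits2 u d (var u xd) by rewrite uv.
have bb : bits2 u b (var u xb) by rewrite uv // => j jn; rewrite frz //; apply: db.
have ne : var u xd <> var u xb by rewrite !uv.
have uB : var u vB1 = i by rewrite /u /= /upd eqxx.
have [g1 g2 g3 g4] := bshiftP lxd lxb ne uB lt bd bb.
rewrite !uv // in g1 g2 g3; split=> //.
- rewrite g2 -modnDml h2 modnDml mul1n mulnDl addnA.
 by congr ((_ + 2 ^ i * _) %% _); apply: low_ext => j jn; rewrite frz.
- by move=> c e nce; rewrite g3 // h3.
- by move=> y ly; rewrite g4 ?uv // nx.
Qed.

Lemma baddmulN d xd a xa b xb s c e : ~~ Xb xd ->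
 ~ (c = d /\ exists2 j, j < n & e = var s xd * n + j) ->
 arr (run n (baddmul d xd a xa b xb) s) c e = arr s c e.
Proof.
move=> lxd ne.
have nx x y : ~~ Xb x -> Xb y -> (x == y) = false by move=> hx hy; apply/eqP => E; rewrite E hy in hx.
have [_ ->] : (forall y, ~~ Xb y -> var (run n (baddmul d xd a xa b xb) s) y = var s y) /\
 arr (run n (baddmul d xd a xa b xb) s) c e = arr s c e; last by [].
apply: (@run_loop n vB1 _ s (fun _ t => (forall y, ~~ Xb y -> var t y = var s y) /\
 arr t c e = arr s c e)) => // i t lt [h1 h2].
rewrite run_if; case: ifP => _; last by split=> // y ly; rewrite /= /upd nx // h1.
rewrite /bshift run_seq.
apply: (@run_loop n vB2 _ _ (fun _ t => (forall y, ~~ Xb y -> var t y = var s y) /\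
 arr t c e = arr s c e)) => [|k w lk [w1 w2]].
 by split=> // y ly; rewrite /= /upd !nx // h1.
rewrite run_if; case: ifP => _; first by split=> // y ly; rewrite /= /upd nx // w1.
set u := setv w vB2 k.
have ob : ok 0 Xb (pred1 d) (bdigit d xd b xb) by rewrite /ok /= eqxx.
split=> [y ly|].
 by rewrite (ok_var n u ob) /= /upd ?nx ?w1.
pose s3 := run n (seqs [:: Assign vSum (Var vCar);
 If (Arr d (dig xd (Var vB2))) (Assign vSum (AddE (Var vSum) 1)) Skip;
 If (Arr b (dig xb (Bin Defs.Sub (Var vB2) (Var vB1)))) (Assign vSum (AddE (Var vSum) 1)) Skip]) u.
have o3 : ok 0 (pred1 vSum) xpred0 (seqs [:: Assign vSum (Var vCar);
 If (Arr d (dig xd (Var vB2))) (Assign vSum (AddE (Var vSum) 1)) Skip;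
 If (Arr b (dig xb (Bin Defs.Sub (Var vB2) (Var vB1)))) (Assign vSum (AddE (Var vSum) 1)) Skip]) by [].
rewrite -[run n (bdigit d xd b xb) u]/(run n (switch (Var vSum) 4 (fun r =>
 Seq (Store d (dig xd (Var vB2)) (Num (odd r))) (Assign vCar (Num r./2)))) s3).
have a3 : arr s3 = arr u by apply/funext => x; apply: (ok_arr n u o3).
have v3 y : y != vSum -> var s3 y = var u y by move=> ny; apply: (ok_var n u o3).
have E k' : arr (run n (switch (Var vSum) k' (fun r =>
 Seq (Store d (dig xd (Var vB2)) (Num (odd r))) (Assign vCar (Num r./2)))) s3) c e = arr s3 c e.
 elim: k' => // k' IH; rewrite [switch _ _ _]/= run_if; case: ifP => // _ /=.
 have xs : xd != vSum by rewrite nx.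
 case: eqP => // Ec; rewrite !v3 //.
 have -> : var u xd = var s xd by rewrite /u /= /upd nx // w1.
 have -> : var u vB2 = k by rewrite /u /= /upd eqxx.
 rewrite /upd; case: eqP => [Ee|_]; last by rewrite Ec.
 by case: ne; split=> //; exists k.
by rewrite E a3.
Qed.

End Counts.

(** * Families represented by their cardinalities *)

Section CountInstance.
Variables (q n : nat) (V : finType).

Definition Yb : pred aid := fun b => b.1.1 == 2.

Definition bval s nd a (M : {set marking V q}) :=
 bits2 n s (aB a) nd /\ low n s (aB a) nd n = #|M| %[mod 2 ^ n].

Lemma bval_same s s' nd a M :
 (forall i, i < n -> arr s' (aB a) (nd * n + i) = arr s (aB a) (nd * n + i)) ->
 bval s nd a M -> bval s' nd a M.
Proof.
move=> E [b l]; split=> [i lt|]; first by rewrite E //; apply: b.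
by rewrite -l (low_ext E).
Qed.

Lemma bval_ext s s' nd a M : (forall b, Yb b -> arr s b = arr s' b) ->
 bval s nd a M -> bval s' nd a M.
Proof. by move=> E; apply: bval_same => i _; rewrite E. Qed.

Lemma bval_zero x a s : ~~ Xb x -> bval (run n (bzero (aB a) x) s) (var s x) a set0.
Proof.
move=> nx; have [h _ _] := bzeroP n (aB a) s nx.
split=> [i lt|]; first by rewrite h.
by rewrite cards0 /low big1 // => i _; rewrite h.
Qed.

Lemma bval_zeroN x a s nd b M : bval s nd b M -> ~ (nd = var s x /\ b = a) -> ~~ Xb x ->
 bval (run n (bzero (aB a) x) s) nd b M.
Proof.
move=> H ne nx; have [_ h _] := bzeroP n (aB a) s nx.
apply: bval_same H => i lt; apply: h => -[[Eb] [j lj E]].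
by apply: ne; split=> //; have [] := addr_ne lt lj E.
Qed.

Lemma bval_mark k s v : 0 < n ->
 bval (run n (bone (aB k) vMk) s) (var s vMk) k [set delta q v k].
Proof.
move=> n0; have nx : ~~ Xb vMk by [].
have [h _ h3] := bzeroP n (aB k) s nx.
rewrite /bone run_seq; set s1 := run n (bzero _ _) s in h h3 *.
have E i : i < n -> arr (run n (Store (aB k) (dig vMk (Num 0)) (Num 1)) s1) (aB k) (var s vMk * n + i) = (i == 0).
 move=> lt; rewrite /= eqxx h3 // /upd addn0; case: (posnP i) => [->|i0].
 by rewrite addn0 eqxx.
 by rewrite ifN ?h // -?lt0n // -{2}[_ * n]addn0 eqn_add2l -lt0n.
split=> [i lt|]; first by rewrite E //; case: eqP.
rewrite cards1 /low; case: n n0 E => // n' _ E.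
rewrite big_ord_recl [X in X * _]E // big1 => [|i _]; first by rewrite /= muln1.
by rewrite E ?ltn_ord.
Qed.

Lemma bval_markN k s nd b M : bval s nd b M -> ~ (nd = var s vMk /\ b = k) -> 0 < n ->
 bval (run n (bone (aB k) vMk) s) nd b M.
Proof.
move=> H ne n0; have nx : ~~ Xb vMk by [].
have [_ h h3] := bzeroP n (aB k) s nx; rewrite /bone run_seq.
have H1 := bval_zeroN H ne nx; set s1 := run n (bzero _ _) s in h h3 H1 *.
apply: bval_same H1 => i lt /=; case: eqP => // -[Eb]; rewrite h3 // /upd; case: eqP => // E.
 by case: ne; split=> //; have [] := addr_ne lt n0 E.
by rewrite Eb.
Qed.

(** On disjoint domains both factors can be read off from their superposition. *)
Lemma card_fmul (D1 D2 : {set V}) (P1 P2 : pred (marking V q)) : [disjoint D1 & D2] ->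
 #|fmul (fam D1 P1) (fam D2 P2)| = #|fam D1 P1| * #|fam D2 P2|.
Proof.
move=> dis; rewrite /fmul curry_imset2X card_in_imset ?cardsX //.
move=> [m1 m2] [p1 p2] /setXP [/famP [z1 _] /famP [z2 _]] /setXP [/famP [y1 _] /famP [y2 _]] /= E.
have dj v : v \in D1 -> v \notin D2.
 by move=> v1; apply/negP => v2; move/pred0P: dis => /(_ v) /=; rewrite v1 v2.
have Ev v := congr1 (fun m : marking V q => m v) E.
congr pair; apply/ffunP => v; have := Ev v; rewrite !ffunE.
 case: (boolP (v \in D1)) => v1; last by rewrite z1 ?y1.
 rewrite z2 ?y2 ?dj //; by do 2 case: eqP => [->|].
case: (boolP (v \in D2)) => v2; last by rewrite z2 ?y2.
have v1 : v \notin D1 by apply: contraL v2 => /dj.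
by rewrite z1 ?y1 ?eqxx.
Qed.

Lemma bval_addmul xd d xa a xb b s M0 (D1 D2 : {set V}) (P1 P2 : pred (marking V q)) :
 [disjoint D1 & D2] ->
 bval s (var s xd) d M0 -> bval s (var s xa) a (fam D1 P1) ->
 bval s (var s xb) b (fam D2 P2) -> var s xd <> var s xa -> var s xd <> var s xb ->
 [disjoint M0 & fmul (fam D1 P1) (fam D2 P2)] -> ~~ Xb xd -> ~~ Xb xa -> ~~ Xb xb ->
 bval (run n (baddmul (aB d) xd (aB a) xa (aB b) xb) s) (var s xd) d
 (M0 :|: fmul (fam D1 P1) (fam D2 P2)).
Proof.
move=> dis [b0 l0] [b1 l1] [b2 l2] na nb dj nd nxa nxb.
have [h1 h2 _] := baddmulP nd nxa nxb na nb b0 b1 b2.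
split=> //; rewrite h2 cardsU.
have -> : M0 :&: fmul (fam D1 P1) (fam D2 P2) = set0 by apply/eqP; rewrite setI_eq0.
rewrite cards0 subn0 card_fmul // -modnDm l0 -[X in (_ + X) %% _]modnMm l1 l2.
by rewrite modnMm modnDm.
Qed.

Lemma bval_addmulN xd d xa a xb b s nd e M : bval s nd e M ->
 ~ (nd = var s xd /\ e = d) -> ~~ Xb xd ->
 bval (run n (baddmul (aB d) xd (aB a) xa (aB b) xb) s) nd e M.
Proof.
move=> H ne nx; apply: bval_same H => i lt; apply: baddmulN => // -[[Ee] [j lj E]].
by apply: ne; split=> //; have [] := addr_ne lt lj E.
Qed.

End CountInstance.

(** * Queries on the current structure *)

Section Query.
Variables (c q nlab : nat) (f : fml) (Ps : seq (nat -> nat -> bool)).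

(** The algebra depends on the formula alone, so it is a constant of the program text; its choice by
    [cid] costs no running time. *)
Definition qalg : alg ((size Ps).-tuple bool) := sval (cid (fml_recog c f (size Ps))).

Lemma qalg_ex : exists acc : pred (ast qalg),
 forall (V : finType) (g : V -> V -> nat) (S : estr V) (env : (size Ps).-tuple (V -> bool)),
 (forall u v, g u v = g v u) -> (forall v, g v v = 0) -> valid c g S ->
 sat g env f <-> acc (erun c S qalg (fun v => [tuple of bits env v])).
Proof. exact: (svalP (cid (fml_recog c f (size Ps)))). Qed.

Definition qacc := sval (cid qalg_ex).

Definition qenc (a : ast qalg) : nat := enum_rank a.
Definition qdec i := nth (aunit qalg) (enum (ast qalg)) i.
Definition qletter l k : (size Ps).-tuple bool := [tuple of [seq P l k | P <- in_tuple Ps]].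

Lemma qencK a : qdec (qenc a) = a.
Proof. exact: nth_enum_rank. Qed.

Definition qengine vzero vmark vaddmul := engine q #|ast qalg| c nlab vzero vmark vaddmul
 (qenc (aunit qalg)) (fun a b => qenc (ajoin (qdec a) (qdec b)))
 (fun i j s a => qenc (aedge i j s (qdec a)))
 (fun i l k a => qenc (aforget i (qletter l k) (qdec a))) (fun a => qacc (qdec a)).

Definition find := qengine wzero (wmark q) (waddmul q).
Definition count := qengine (fun x a => bzero (aB a) x) (fun k => bone (aB k) vMk)
 (fun xd d xa a xb b => baddmul (aB d) xd (aB a) xa (aB b) xb).

Lemma ok_find : ok 1 engine_vars Yw find.
Proof.
have o : ok 1 (fun x => xpred0 x || engine_vars x) Yw find
 := @ok_engine 0 q #|ast qalg| c nlab _ _ _ xpred0 Yw _ _ _ _ _ ok_wzero (ok_wmark q) (ok_waddmul q).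
exact: (ok_sub (leqnn 1) (fun _ h => h) (fun _ h => h) o).
Qed.

Definition count_vars : pred nat := fun x => 7 <= x <= 18.

Lemma ok_count : ok 3 count_vars Yb count.
Proof.
have o1 x a : ok 2 Xb Yb (bzero (aB a) x) by exact: ok_bzero.
have o2 k : ok 2 Xb Yb (bone (aB k) vMk) by exact: ok_bone.
have o3 xd d xa a xb b : ok 2 Xb Yb (baddmul (aB d) xd (aB a) xa (aB b) xb) by exact: ok_baddmul.
have o : ok 3 (fun x => Xb x || engine_vars x) Yb count
 := @ok_engine 2 q #|ast qalg| c nlab _ _ _ Xb Yb _ _ _ _ _ o1 o2 o3.
apply: (ok_sub (leqnn 3) _ (fun _ h => h) o).
by move=> x; rewrite /Xb /engine_vars /count_vars; lia.
Qed.

Definition qenv (V : finType) (lab : V -> nat) (m : marking V q) : seq (V -> bool) :=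
 [seq (fun v => (P : nat -> nat -> bool) (lab v) (m v)) | P <- Ps].

Section Run.
Variables (n' : nat).
Let N := n'.+1.

(** [aPAR] holds node numbers of the engine: 3 for a root and [p + 4] for parent [p]. *)
Definition Sof s : estr 'I_N := EStr [seq inord (arr s aORD i) | i <- iota 0 N]
 (fun v => arr s aCOL v)
 (fun v => if arr s aPAR v == 3 then None else Some (inord (arr s aPAR v - 4)))
 (fun v j => if j < c then arr s (aADJ j) v else 0).

Definition srep s := [/\ var s vTop = N, forall i, i < N -> arr s aORD i < N
 & forall v : 'I_N, arr s aPAR v = 3 \/ 4 <= arr s aPAR v < N + 4].

Variables (g : 'I_N -> 'I_N -> nat) (s : store).
Hypotheses (gsym : forall u v, g u v = g v u) (girr : forall v, g v v = 0)
 (g3 : forall u v, g u v < 3) (sr : srep s) (vS : valid c g (Sof s))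
 (labS : forall v : 'I_N, arr s aLAB v < nlab).
Let lab (v : 'I_N) := arr s aLAB v.

Lemma Sof_adj v j : eadj (Sof s) v j < 3.
Proof.
case: vS => bag [_ _ _ [h1 h2] _]; case: (pselect (exists2 x, x \in bag v & ecol (Sof s) x = j)).
 by case=> x xb <-; rewrite h1.
by move=> no; rewrite h2 // => x xb; apply/eqP => E; apply: no; exists x.
Qed.

Lemma Sof_rep : es_rep c N (@nat_of_ord N) (Sof s) lab s.
Proof.
case: sr => t o p.
have Eo : eord (Sof s) = [seq inord (arr s aORD i) | i <- iota 0 N] by [].
split.
- by rewrite Eo size_map size_iota.
- move=> i v0; rewrite Eo size_map size_iota => lt.
 by rewrite (nth_map 0) ?size_iota // nth_iota // add0n inordK ?o.
- by move=> v; rewrite Eo size_map size_iota; split.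
- move=> v; split=> //; rewrite [epar _ _]/=; case: (p v) => [->|/andP [p1 p2]] //; rewrite gtn_eqF //= inordK.
 by rewrite subnK.
 by rewrite ltn_subLR // addnC.
- by move=> v j lt; rewrite [eadj _ _ _]/= lt.
Qed.

Lemma qsat m : sat g (qenv lab m) f <->
 qacc (qdec (qenc (erun c (Sof s) qalg (fun v => qletter (lab v) (m v))))).
Proof.
pose env := [tuple of [seq (fun v : 'I_N => (P : nat -> nat -> bool) (lab v) (m v)) | P <- in_tuple Ps]].
have E : (fun v => [tuple of bits env v]) = (fun v => qletter (lab v) (m v)).
 by apply/funext => v; apply: val_inj; rewrite /= /bits -map_comp.
by rewrite qencK -E; exact: (svalP (cid qalg_ex) _ g (Sof s) env gsym girr vS).
Qed.

Lemma find_spec : let s' := run N find s in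
 if arr s' (aF 0) 0 == 0 then forall m, ~ sat g (qenv lab m) f
 else exists2 m, sat g (qenv lab m) f & wit (@nat_of_ord N) s' 0 0 m.
Proof.
have [bag [ord [col _] _ _ _]] := vS.
pose VAL := @wval q _ (@nat_of_ord N).
have H1 x : x <= 14 -> ~~ xpred0 x by [].
have H2 := @wval_ext q _ (@nat_of_ord N) : forall t t' nd a M, _ -> VAL t nd a M -> VAL t' nd a M.
have H3 x a t : ~~ xpred0 x -> VAL (run N (wzero x a) t) (var t x) a set0 by move=> _; exact: wzeroP.
have H4 x a t nd b M : VAL t nd b M -> ~ (nd = var t x /\ b = a) -> ~~ xpred0 x ->
 VAL (run N (wzero x a) t) nd b M by move=> h1 h2 _; exact: wzeroN.
have H5 k t v := @wmarkP q N _ (@nat_of_ord N) k t v.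
have H6 k t nd b M := @wmarkN q N _ (@nat_of_ord N) k t nd b M.
have H7 xd d xa a xb b t M0 (D1 D2 : {set 'I_N}) P1 P2 :
 [disjoint D1 & D2] -> local D1 P1 -> local D2 P2 ->
 VAL t (var t xd) d M0 -> VAL t (var t xa) a (fam D1 P1) ->
 VAL t (var t xb) b (fam D2 P2) -> var t xd <> var t xa -> var t xd <> var t xb ->
 [disjoint M0 & fmul (fam D1 P1) (fam D2 P2)] -> ~~ xpred0 xd -> ~~ xpred0 xa -> ~~ xpred0 xb ->
 VAL (run N (waddmul q xd d xa a xb b) t) (var t xd) d (M0 :|: fmul (fam D1 P1) (fam D2 P2)).
 by move=> h1 h2 h3 h4 h5 h6 h7 h8 h9 _ _ _; exact: waddmulP.
have H8 xd d xa a xb b t nd e M : VAL t nd e M -> ~ (nd = var t xd /\ e = d) -> ~~ xpred0 xd ->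
 VAL (run N (waddmul q xd d xa a xb b) t) nd e M by move=> h1 h2 _; exact: waddmulN.
have H9 a : qenc a < #|ast qalg| := ltn_ord (enum_rank a).
have H10 a : Yw a -> [/\ a != aORD, a != aCOL, a != aPAR, a != aLAB & forall j, a != aADJ j].
 by move=> /eqP E; split=> [||||j]; apply/eqP => Ea; rewrite Ea in E.
have cN : 0 < #|{: 'I_N}| by rewrite card_ord.
have W : VAL (run N find s) 0 0 [set m : marking 'I_N q |
 qacc (qdec (qenc (erun c (Sof s) qalg (fun v => qletter (lab v) (m v)))))].
 exact: (@engineP 0 q #|ast qalg| c nlab wzero (wmark q) (waddmul q) xpred0 Yw _ _ _ _
 (fun a => qacc (qdec a)) ok_wzero (ok_wmark q) (ok_waddmul q) N _ (@nat_of_ord N) VAL (@ord_inj N)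
 H1 H2 H3 H4 H5 H6 H7 H8 _ qalg qletter (Sof s) lab qenc qdec H9 qencK erefl
 (fun _ _ => erefl) (fun _ _ _ _ => erefl) (fun _ _ _ _ => erefl) ord col Sof_adj labS H10 s Sof_rep cN).
move: W; rewrite /VAL /wval; case: ifP => _; last first.
 by case=> m; rewrite inE => /qsat h1 h2; exists m.
by move/setP => E m /qsat h; have := E m; rewrite !inE h.
Qed.

Lemma count_spec : let s' := run N count s in
 bits2 N s' (aB 0) 0 /\
 low N s' (aB 0) 0 N = #|[set m : marking 'I_N q | `[< sat g (qenv lab m) f >]]| %[mod 2 ^ N].
Proof.
have [bag [ord [col _] _ _ _]] := vS.
pose VAL := @bval q N 'I_N.
have H1 x : x <= 14 -> ~~ Xb x by rewrite /Xb; lia.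
have H2 := @bval_ext q N 'I_N : forall t t' nd a M, _ -> VAL t nd a M -> VAL t' nd a M.
have H3 x a t : ~~ Xb x -> VAL (run N (bzero (aB a) x) t) (var t x) a set0 by exact: bval_zero.
have H4 x a t nd b M : VAL t nd b M -> ~ (nd = var t x /\ b = a) -> ~~ Xb x ->
 VAL (run N (bzero (aB a) x) t) nd b M by exact: bval_zeroN.
have H5 k t (v : 'I_N) : k <= q -> k = 0 \/ var t vV = nat_of_ord v ->
 VAL (run N (bone (aB k) vMk) t) (var t vMk) k [set delta q v k] by move=> _ _; exact: bval_mark.
have H6 k t nd b M : VAL t nd b M -> ~ (nd = var t vMk /\ b = k) ->
 VAL (run N (bone (aB k) vMk) t) nd b M by move=> h1 h2; exact: bval_markN.
have H7 xd d xa a xb b t M0 (D1 D2 : {set 'I_N}) P1 P2 :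
 [disjoint D1 & D2] -> local D1 P1 -> local D2 P2 ->
 VAL t (var t xd) d M0 -> VAL t (var t xa) a (fam D1 P1) ->
 VAL t (var t xb) b (fam D2 P2) -> var t xd <> var t xa -> var t xd <> var t xb ->
 [disjoint M0 & fmul (fam D1 P1) (fam D2 P2)] -> ~~ Xb xd -> ~~ Xb xa -> ~~ Xb xb ->
 VAL (run N (baddmul (aB d) xd (aB a) xa (aB b) xb) t) (var t xd) d (M0 :|: fmul (fam D1 P1) (fam D2 P2)).
 by move=> h1 _ _; exact: bval_addmul.
have H8 xd d xa a xb b t nd e M : VAL t nd e M -> ~ (nd = var t xd /\ e = d) -> ~~ Xb xd ->
 VAL (run N (baddmul (aB d) xd (aB a) xa (aB b) xb) t) nd e M by exact: bval_addmulN.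
have H9 a : qenc a < #|ast qalg| := ltn_ord (enum_rank a).
have H10 a : Yb a -> [/\ a != aORD, a != aCOL, a != aPAR, a != aLAB & forall j, a != aADJ j].
 by move=> /eqP E; split=> [||||j]; apply/eqP => Ea; rewrite Ea in E.
have cN : 0 < #|{: 'I_N}| by rewrite card_ord.
have o1 x a : ok 2 Xb Yb (bzero (aB a) x) by exact: ok_bzero.
have o2 k : ok 2 Xb Yb (bone (aB k) vMk) by exact: ok_bone.
have o3 xd d xa a xb b : ok 2 Xb Yb (baddmul (aB d) xd (aB a) xa (aB b) xb) by exact: ok_baddmul.
have W : VAL (run N count s) 0 0 [set m : marking 'I_N q |
 qacc (qdec (qenc (erun c (Sof s) qalg (fun v => qletter (lab v) (m v)))))].
 exact: (@engineP 2 q #|ast qalg| c nlab (fun x a => bzero (aB a) x) (fun k => bone (aB k) vMk)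
 (fun xd d xa a xb b => baddmul (aB d) xd (aB a) xa (aB b) xb) Xb Yb _ _ _ _
 (fun a => qacc (qdec a)) o1 o2 o3 N _ (@nat_of_ord N) VAL (@ord_inj N)
 H1 H2 H3 H4 H5 H6 H7 H8 _ qalg qletter (Sof s) lab qenc qdec H9 qencK erefl
 (fun _ _ => erefl) (fun _ _ _ _ => erefl) (fun _ _ _ _ => erefl) ord col Sof_adj labS H10 s Sof_rep cN).
case: W => b l; split=> //; rewrite l; congr (#|pred_of_set _| %% _).
by apply/setP => m; rewrite !inE; apply/idP/asboolP => /qsat.
Qed.

End Run.
End Query.

(** * Marks carried by at most one vertex *)

Section UniqueMarks.
Variables (q : nat) (f : fml) (Ps : seq (nat -> nat -> bool)).

(** Every mark becomes a further set variable, so that the formula can bound its cardinality by 1;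
    [Rel] then drops these sets before [f] is evaluated. The recorded cells now determine the
    marking. *)
Definition uPs := Ps ++ [seq (fun _ k => k == i.+1) | i <- iota 0 q].
Definition UniqF :=
 foldr (fun i h => And (CardP (bit (size Ps + i)) 1) h)
 (Rel [seq bit i | i <- iota 0 (size Ps)] f) (iota 0 q).

Definition uniq_marks (V : finType) (m : marking V q) :=
 forall i, i < q -> #|[set v | m v == i.+1 :> nat]| <= 1.

Lemma sat_uniq (V : finType) (g : V -> V -> nat) lab (m : marking V q) :
 sat g (qenv uPs lab m) UniqF <-> uniq_marks m /\ sat g (qenv Ps lab m) f.
Proof.
have bitE i v P0 : i < size uPs -> bit i (bits (qenv uPs lab m) v) = nth P0 uPs i (lab v) (m v).
 by move=> lt; rewrite /bit /bits /qenv -map_comp (nth_map P0).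
have H l : {subset l <= iota 0 q} -> sat g (qenv uPs lab m) (foldr (fun i h => And (CardP (bit (size Ps + i)) 1) h)
 (Rel [seq bit i | i <- iota 0 (size Ps)] f) l) <->
 (forall i, i \in l -> #|[set v | m v == i.+1 :> nat]| <= 1) /\ sat g (qenv Ps lab m) f.
 elim: l => [|i l IH] sub.
 rewrite /= (_ : [seq _ | h <- _] = qenv Ps lab m); first by split=> // -[].
 apply: (eq_from_nth (x0 := xpred0)) => [|i]; rewrite !size_map size_iota // => lt.
 rewrite (nth_map (fun=> false)) ?size_map ?size_iota // (nth_map 0) ?size_iota // nth_iota // add0n.
 rewrite (nth_map (fun _ _ => false)) //; apply/funext => v.
 rewrite (bitE i v (fun _ _ => false)); last by rewrite size_cat; lia.
 by rewrite nth_cat lt.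
 have sub' : {subset l <= iota 0 q} by move=> j jl; apply: sub; rewrite inE jl orbT.
 have iq : i < q by have := sub i; rewrite inE eqxx mem_iota add0n; apply.
 have E : [set v | bit (size Ps + i) (bits (qenv uPs lab m) v)] = [set v | m v == i.+1 :> nat].
 apply/setP => v; rewrite !inE (bitE _ v (fun _ _ => false)); last first.
 by rewrite size_cat size_map size_iota ltn_add2l.
 by rewrite nth_cat ltnNge leq_addr /= addKn (nth_map 0) ?size_iota // nth_iota // add0n.
 rewrite [foldr _ _ _]/= [sat _ _ (And _ _)]/= E; have [I1 I2] := IH sub'; split.
 move=> [h1 /I1 [h2 h3]]; split=> // j; rewrite inE => /orP [/eqP ->|/h2] //.
 move=> [h1 h2]; split; first by apply: h1; rewrite inE eqxx.
 by apply: I2; split=> // j jl; apply: h1; rewrite inE jl orbT.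
have [h1 h2] := H (iota 0 q) (fun _ h => h); split.
 by move=> /h1 [h3 h4]; split=> // i lt; apply: h3; rewrite mem_iota.
by move=> [h3 h4]; apply: h2; split=> // i; rewrite mem_iota add0n => /h3.
Qed.

Lemma wit_cells (V : finType) (vid : V -> nat) s (m : marking V q) : injective vid ->
 uniq_marks m -> wit vid s 0 0 m -> forall v i, i < q ->
 (m v == i.+1 :> nat) = (arr s (aC 0 i) 0 == (vid v).+1).
Proof.
move=> inj um w v i lt; case: (w i lt) => [[-> no]|[u -> E]]; first exact/negbTE/no.
have /card_le1_eqP H := um i lt.
apply/eqP/eqP => [Ev|[/inj <-]] //.
by rewrite (H v u) // inE; apply/eqP.
Qed.

Variables (c nlab : nat).
Definition findq := find c q nlab UniqF uPs.

Lemma ok_findq : ok 1 engine_vars Yw findq.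
Proof. exact: ok_find. Qed.

Lemma findq_spec n' (g : 'I_n'.+1 -> 'I_n'.+1 -> nat) s s' :
 (forall u v, g u v = g v u) -> (forall v, g v v = 0) -> (forall u v, g u v < 3) ->
 srep n' s -> valid c g (Sof c n' s) -> (forall v : 'I_n'.+1, arr s aLAB v < nlab) ->
 s' = run n'.+1 findq s ->
 if arr s' (aF 0) 0 == 0
 then forall m, uniq_marks m -> ~ sat g (qenv Ps (fun v : 'I_n'.+1 => arr s aLAB v) m) f
 else exists m : marking _ q, [/\ uniq_marks m,
 sat g (qenv Ps (fun v : 'I_n'.+1 => arr s aLAB v) m) f, forall v i, i < q ->
 (m v == i.+1 :> nat) = (arr s' (aC 0 i) 0 == v.+1)
 & forall i, i < q -> arr s' (aC 0 i) 0 = 0 \/ exists v : 'I_n'.+1, arr s' (aC 0 i) 0 = v.+1].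
Proof.
move=> h1 h2 h3 h4 h5 h6 Es.
have H0 := @find_spec c q nlab UniqF uPs n' g s h1 h2 h3 h4 h5 h6.
cbv zeta in H0; change (find c q nlab UniqF uPs) with findq in H0; rewrite -Es in H0.
move: H0; case: ifP => _ H.
 by move=> m um sm; apply: (H m); apply/sat_uniq.
case: H => m /sat_uniq [um sm] w; exists m; split=> //.
 by apply: wit_cells => //; exact: ord_inj.
by move=> i /w [[-> _]|[v -> _]]; [left|right; exists v].
Qed.

End UniqueMarks.

(** The members of [A] get the marks from 1 on and those of [B] the marks above [s1], in the order
    of enumeration. *)
Lemma marks_of_sets (V : finType) s1 z1 (A B : {set V}) : [disjoint A & B] ->
 #|A| <= s1 -> #|B| <= z1 -> exists m : marking V (s1 + z1),
 [/\ uniq_marks m, forall v, (0 < m v <= s1) = (v \in A) & forall v, (s1 < m v) = (v \in B)].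
Proof.
move=> dis As Bs.
pose f v := if v \in A then (index v (enum A)).+1 else if v \in B then s1 + (index v (enum B)).+1 else 0.
have iA (C : {set V}) v : v \in C -> index v (enum C) < #|C| by move=> vC; rewrite cardE index_mem mem_enum.
have fb v : f v < (s1 + z1).+1.
 by rewrite /f; case: ifP => [/iA|_]; [|case: ifP => [/iA|_]]; lia.
have ii (C : {set V}) v v' : v \in C -> v' \in C -> index v (enum C) = index v' (enum C) -> v = v'.
 by move=> vC vC' E; rewrite -(nth_index v (_ : v \in enum C)) ?mem_enum // E nth_index ?mem_enum.
exists [ffun v => Ordinal (fb v)]; split.
- move=> i lt; apply/card_le1_eqP => v v'; rewrite !inE !ffunE /= /f => /eqP.
 case: ifP => vA; [|case: ifP => vB]; move=> E1 /eqP; (case: ifP => vA'; [|case: ifP => vB']) => E2 //.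
 + by apply: (ii A) => //; lia.
 + by have := iA _ _ vA; lia.
 + by have := iA _ _ vA'; lia.
 + by apply: (ii B) => //; lia.
- move=> v; rewrite ffunE /= /f; case: ifP => [/iA h|_]; first by lia.
 by case: ifP => _; lia.
- move=> v; rewrite ffunE /= /f; case: ifP => [vA|_]; last by case: ifP => _; lia.
 have -> : (v \in B) = false by apply/negP => vB; move/pred0P: dis => /(_ v) /=; rewrite vA vB.
 by have := iA _ _ vA; lia.
Qed.

(** * Formulas over input cells *)

(* A clause is named by its input cell, a variable by the cell of its first
 occurrence, and an edge of the incidence graph by the cell of its literal. *)
Record inst (n : nat) := Inst {
 isC : pred 'I_n; isL : pred 'I_n; icl : 'I_n -> 'I_n; ifv : 'I_n -> 'I_n;
 isg : 'I_n -> bool }.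

Section Instance.
Variables (n : nat) (I : inst n).

Definition ivars := [set x | [exists t, isL I t && (ifv I t == x)]].

Definition iok :=
 [/\ forall t, isL I t -> isC I (icl I t), forall t, isL I t -> ~~ isC I (ifv I t)
 & forall t t', isL I t -> isL I t' -> icl I t = icl I t' -> ifv I t = ifv I t' -> t = t'].

(* A partial assignment maps a variable to 0 (unassigned), 1 (false) or 2 (true). *)
Definition sats (asg : 'I_n -> nat) c :=
 [exists t, [&& isL I t, icl I t == c & asg (ifv I t) == (isg I t).+1]].

(** The cut-off [p] keeps the clauses in cells from [p] on. Lowering it by one inserts the
    occurrences of the clause in that cell, if there is one. *)
Definition alive asg p t :=
 [&& isL I t, p <= icl I t, asg (ifv I t) == 0 & ~~ sats asg (icl I t)].

Definition ends t u v := ((icl I t == u) && (ifv I t == v)) || ((icl I t == v) && (ifv I t == u)).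

(** No edge is 0, a negative occurrence 1, a positive one 2. This matches the coding of assignments,
    so a literal is true when its sign and the value of its variable are the same number. *)
Definition ig asg p u v :=
 if [pick t | alive asg p t && ends t u v] is Some t then (isg I t).+1 else 0.

Definition models (asg : 'I_n -> nat) := [set M : {set 'I_n} |
 [&& M \subset ivars, [forall x in ivars, (asg x != 0) ==> ((x \in M) == (asg x == 2))]
 & [forall c, isC I c ==> [exists t, [&& isL I t, icl I t == c & isg I t == (ifv I t \in M)]]]]].

Definition width_le w (g : rel 'I_n) :=
 exists2 r : 'I_n -> nat, injective r & forall v, #|elim_nbrs g r v| <= w.

(** A backdoor relative to a partial assignment, with elimination width in place of treewidth. The
    cut-off is 0: it refers to the whole formula and not to the part inserted so far. *)
Definition hidden w j (asg : 'I_n -> nat) (B : {set 'I_n}) :=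
 [/\ #|B| <= j, B \subset ivars, forall x, x \in B -> asg x = 0
 & forall asg', (forall x, x \notin B -> asg' x = asg x) ->
 (forall x, x \in B -> (asg' x == 1) || (asg' x == 2)) -> width_le w (gr (ig asg' 0))].

End Instance.

(** * Cells of an encoded formula *)

Fixpoint clits q p (c : seq literal) : seq (nat * nat * literal) :=
 if c is l :: c' then (q, p, l) :: clits q p.+1 c' else [::].
Fixpoint lits p (L : seq (seq literal)) :=
 if L is c :: L' then clits p p.+1 c ++ lits (p.+1 + size c) L' else [::].
Fixpoint cls p (L : seq (seq literal)) : seq nat :=
 if L is c :: L' then p :: cls (p.+1 + size c) L' else [::].

Notation ccell := (fun z : nat * nat * literal => z.1.1).
Notation lcell := (fun z : nat * nat * literal => z.1.2).

Lemma uniq_map_inj (T1 T2 : eqType) (f : T1 -> T2) s : uniq (map f s) -> {in s &, injective f}.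
Proof.
elim: s => //= a s IH /andP [na /IH inj] x y; rewrite !inE.
case/orP=> [/eqP ->|xs] /orP [/eqP ->|ys] // E; last exact: inj.
- by move: na; rewrite E map_f.
- by move: na; rewrite -E map_f.
Qed.

Lemma mem_clits q p c (z : nat * nat * literal) : z \in clits q p c ->
 [/\ z.1.1 = q, p <= z.1.2, z.1.2 < p + size c & z.2 \in c].
Proof.
elim: c p => //= l c IH p; rewrite inE => /orP [/eqP -> /=|/IH [h1 h2 h3 h4]].
 by rewrite inE eqxx leqnn; split=> //; lia.
by rewrite inE h4 orbT; split=> //; lia.
Qed.

Lemma clits_lit q p c : [seq z.2 | z <- clits q p c] = c.
Proof. by elim: c p => //= l c IH p; rewrite IH. Qed.

Definition csize (L : seq (seq literal)) := sumn [seq (size c).+1 | c <- L].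

Lemma mem_lits p L (z : nat * nat * literal) : z \in lits p L ->
 [/\ z.1.1 \in cls p L, p <= z.1.1, z.1.1 < z.1.2 & z.1.2 < p + csize L].
Proof.
elim: L p => //= c L IH p; rewrite mem_cat /csize /= -/(csize L) => /orP [/mem_clits [-> h2 h3 _]|/IH [h1 h2 h3 h4]].
 by rewrite inE eqxx; split=> //; lia.
by rewrite inE h1 orbT; split=> //; lia.
Qed.

Lemma mem_cls p L q : q \in cls p L -> p <= q < p + csize L.
Proof.
elim: L p => //= c L IH p; rewrite inE /csize /= -/(csize L) => /orP [/eqP ->|/IH]; lia.
Qed.

Lemma uniq_lcell p L : uniq (map lcell (lits p L)).
Proof.
elim: L p => //= c L IH p; rewrite map_cat cat_uniq IH andbT; apply/andP; split.
 elim: c (p.+1) => //= l c IHc q; rewrite IHc andbT.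
 by apply/mapP => -[z /mem_clits [_ h _ _] E]; rewrite /= in E; lia.
apply/hasP => -[x /mapP [z /mem_lits [_ h1 h2 _] ->]] /mapP [z' /mem_clits [_ _ h3 _]].
by move=> E; rewrite /= in E; lia.
Qed.

Lemma lcell_cls p L (z : nat * nat * literal) : z \in lits p L -> z.1.2 \notin cls p L.
Proof.
elim: L p => //= c L IH p; rewrite mem_cat inE negb_or => /orP [/mem_clits [_ h2 h3 _]|zin].
 by apply/andP; split; [apply/eqP; lia|apply/negP => /mem_cls; lia].
rewrite IH // andbT; have [_ h1 h2 _] := mem_lits zin; by apply/eqP; lia.
Qed.

Definition cq p L q := [seq z.2 | z <- lits p L & z.1.1 == q].

Lemma map_cq p L : [seq cq p L q | q <- cls p L] = L.
Proof.
elim: L p => //= c L IH p; congr cons.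
 rewrite /cq /= filter_cat map_cat (_ : [seq z <- lits _ L | _] = [::]); last first.
 apply/eqP; rewrite -[_ == _]negbK -has_filter; apply/negP => /hasP [z /mem_lits [_ h _ _] /eqP]; lia.
 rewrite cats0 (_ : [seq z <- clits p p.+1 c | _] = clits p p.+1 c) ?clits_lit //.
 by apply/all_filterP/allP => z /mem_clits [-> _ _ _].
rewrite -[RHS](IH (p.+1 + size c)); apply/eq_in_map => q /mem_cls h.
rewrite /cq /= filter_cat (_ : [seq z <- clits p p.+1 c | _] = [::]) //.
apply/eqP; rewrite -[_ == _]negbK -has_filter; apply/negP => /hasP [z /mem_clits [-> _ _ _] /eqP]; lia.
Qed.

(** * The instance of a formula *)

Section Represent.
Variables (F : formula) (L : seq (seq literal)).
Let n := size (encode L).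
Variable I : inst n.
Let LT := lits 1 L.

Definition represents :=
 [/\ forall t : 'I_n, isL I t = (val t \in map lcell LT),
 forall c : 'I_n, isC I c = (val c \in cls 1 L),
 forall z (t : 'I_n), z \in LT -> val t = z.1.2 ->
 [/\ val (icl I t) = z.1.1, isg I t = z.2.2 &
 exists2 z', z' \in LT & val (ifv I t) = z'.1.2 /\ z'.2.1 = z.2.1]
 & forall z z' (t t' : 'I_n), z \in LT -> z' \in LT -> val t = z.1.2 -> val t' = z'.1.2 ->
 z.2.1 = z'.2.1 -> ifv I t = ifv I t'].

Hypotheses (rep : represents) (cnf : is_cnf F) (lst : listing F L).

Definition lito (t : nat) := (nth (0, 0, (0, true)) LT (index t (map lcell LT))).2.

Lemma size_enc : n = 1 + csize L.
Proof.
rewrite /n /encode /= /csize; congr S; elim: (L) => //= c L' IH.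
by rewrite size_cat size_map IH.
Qed.

Lemma litcP t : isL I t -> exists2 z, z \in LT & val t = z.1.2 /\ z.2 = lito t.
Proof.
case: rep => r1 _ _ _; rewrite r1 => tin.
have lt : index (val t) (map lcell LT) < size LT by rewrite -(size_map lcell) index_mem.
exists (nth (0, 0, (0, true)) LT (index (val t) (map lcell LT))); first exact: mem_nth.
by split=> //; rewrite -[RHS](nth_map _ 0 lcell) // nth_index.
Qed.

Lemma lito_z z (t : 'I_n) : z \in LT -> val t = z.1.2 -> isL I t /\ lito t = z.2.
Proof.
case: rep => r1 _ _ _ zin E; have tin : isL I t by rewrite r1 E; exact: (map_f lcell zin).
split=> //; have [z' zin' [E' <-]] := litcP tin.
by rewrite (uniq_map_inj (uniq_lcell 1 L) zin' zin) // -E' -E.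
Qed.

Lemma cellP z : z \in LT -> exists t : 'I_n, val t = z.1.2.
Proof.
case/mem_lits=> _ _ _ h; have lt : z.1.2 < n by rewrite size_enc.
by exists (Ordinal lt).
Qed.

Lemma ifv_eq t t' : isL I t -> isL I t' -> (ifv I t == ifv I t') = ((lito t).1 == (lito t').1).
Proof.
move=> /litcP [z zin [E <-]] /litcP [z' zin' [E' <-]]; case: rep => _ _ r3 r4.
apply/eqP/eqP => [Ef|Ez]; last exact: r4 Ez.
have [_ _ [y yin [y1 y2]]] := r3 _ _ zin E; have [_ _ [y' yin' [y1' y2']]] := r3 _ _ zin' E'.
rewrite -y2 -y2' (uniq_map_inj (uniq_lcell 1 L) yin yin') //=.
by rewrite -y1 -y1' Ef.
Qed.

Lemma isg_lit t : isL I t -> isg I t = (lito t).2.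
Proof. by case/litcP=> z zin [E <-]; case: rep => _ _ /(_ _ _ zin E) []. Qed.

Lemma mem_cq (q : 'I_n) l : reflect (exists t, [/\ isL I t, icl I t = q & lito t = l]) (l \in cq 1 L q).
Proof.
apply: (iffP mapP) => [[z]|[t [tL tq <-]]].
 rewrite mem_filter => /andP [/eqP zq zin] ->; have [t Et] := cellP zin.
 have [tL tl] := lito_z zin Et; exists t; split=> //.
 by case: rep => _ _ /(_ _ _ zin Et) [h _ _] _; apply: val_inj; rewrite h.
have [z zin [E <-]] := litcP tL; exists z => //; rewrite mem_filter zin andbT.
by case: rep => _ _ /(_ _ _ zin E) [<- _ _] _; rewrite tq.
Qed.

Definition cf (c : seq literal) : clause := [fset l in c]%fset.

Lemma cf_in (C : clause) : (C \in F) = (C \in map cf L).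
Proof. by case/andP: lst => _ /perm_mem ->. Qed.

Lemma uniq_cf : uniq (map cf L).
Proof. by case/andP: lst => _ /perm_uniq ->; exact: fset_uniq. Qed.

Lemma cq_in (q : 'I_n) : isC I q -> cq 1 L q \in L.
Proof. by case: rep => _ -> _ _ qc; rewrite -[X in _ \in X](map_cq 1) map_f. Qed.

Lemma cq_ex c : c \in L -> exists2 q, isC I q & cq 1 L q = c.
Proof.
rewrite -{1}(map_cq 1 L) => /mapP [q qin ->]; case: rep => _ r2 _ _.
have /mem_cls/andP [_ lt] := qin; rewrite -size_enc in lt.
by exists (Ordinal lt); rewrite ?r2.
Qed.

Lemma cq_inj (q q' : 'I_n) : isC I q -> isC I q' -> cf (cq 1 L q) = cf (cq 1 L q') -> q = q'.
Proof.
move=> c1 c2 E; have E' := uniq_map_inj uniq_cf (cq_in c1) (cq_in c2) E.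
have u : uniq L by apply: map_uniq uniq_cf.
rewrite -(map_cq 1 L) in u; case: rep => _ r2 _ _; rewrite !r2 in c1 c2.
exact/val_inj/(uniq_map_inj u c1 c2).
Qed.

(** Two occurrences of one variable in one clause would be either one literal listed twice or a
    complementary pair; [listing] excludes the former and [is_cnf] the latter. *)
Lemma represents_ok : iok I.
Proof.
case: (rep) => r1 r2 r3 r4; split.
- by move=> t /litcP [z zin [E _]]; rewrite r2; have [-> _ _] := r3 _ _ zin E; have [] := mem_lits zin.
- move=> t /litcP [z zin [E _]]; rewrite r2; have [_ _ [z' zin' [-> _]]] := r3 _ _ zin E; exact: lcell_cls.
move=> t t' tL tL' Ec /eqP; rewrite ifv_eq // => /eqP Ev.
have [z zin [Ez lz]] := litcP tL; have [z' zin' [Ez' lz']] := litcP tL'.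
have qC : isC I (icl I t) by rewrite r2; have [-> _ _] := r3 _ _ zin Ez; have [] := mem_lits zin.
have m1 : lito t \in cq 1 L (icl I t) by apply/mem_cq; exists t.
have m2 : lito t' \in cq 1 L (icl I t) by apply/mem_cq; exists t'.
have cL := cq_in qC.
case: (eqVneq (lito t) (lito t')) => [El|nl].
 have uc : uniq (cq 1 L (icl I t)) by case/andP: lst => /allP /(_ _ cL).
 have f1 y (u : 'I_n) : y \in LT -> val u = y.1.2 -> icl I u = icl I t ->
 y \in [seq z <- lits 1 L | z.1.1 == val (icl I t)].
 by move=> yin Eu Eq; rewrite mem_filter yin andbT; have [<- _ _] := r3 _ _ yin Eu; rewrite Eq.
 apply: val_inj; rewrite Ez Ez' (uniq_map_inj uc (f1 _ _ zin Ez erefl) (f1 _ _ zin' Ez' (esym Ec))) //.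
 by rewrite lz lz'.
have cF : cf (cq 1 L (icl I t)) \in F by rewrite cf_in map_f.
case: (cnf (x := (lito t).1) cF); rewrite !inE.
move: m1 m2 nl Ev; case: (lito t) (lito t') => [x [|]] [x' [|]] /= m1 m2 nl Ev; rewrite -?Ev in m1 m2 nl *; by rewrite ?eqxx in nl *.
Qed.

Lemma fvarP x : reflect (exists2 t, isL I t & (lito t).1 = x) (x \in fvar F).
Proof.
apply: (iffP idP) => [/bigfcupP [C]|[t tL <-]].
 rewrite andbT cf_in => /mapP [c cL ->] /imfsetP [l /=]; rewrite inE => lc ->.
 have [q qC Eq] := cq_ex cL; move: lc; rewrite -Eq => /mem_cq [t [tL _ <-]]; by exists t.
have [h1 _ _] := represents_ok.
apply/bigfcupP; exists (cf (cq 1 L (icl I t))); first by rewrite andbT cf_in map_f // cq_in // h1.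
apply/imfsetP; exists (lito t) => //=; rewrite inE; apply/mem_cq; by exists t.
Qed.

Lemma satisfiedP (X : {fset nat}) (tau : {ffun X -> bool}) (q : 'I_n) : isC I q ->
 reflect (exists t, [/\ isL I t, icl I t = q & lit_val tau (lito t) = Some true])
 (satisfied tau (cf (cq 1 L q))).
Proof.
move=> qC; apply: (iffP existsP) => [[l /eqP H]|[t [tL tq H]]].
 have := valP l; rewrite inE => /mem_cq [t [tL tq tl]]; exists t; by rewrite tl.
have lin : lito t \in cf (cq 1 L q) by rewrite inE; apply/mem_cq; exists t.
by exists [` lin]%fset; apply/eqP.
Qed.

(** An assignment corresponds to the set of the cells that stand for its true variables. *)
Lemma num_models_cells : num_models F = #|models I (fun=> 0)|.
Proof.
pose tv (tau : {ffun fvar F -> bool}) x := if insub x is Some y then tau y else false.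
pose f (tau : {ffun fvar F -> bool}) : {set 'I_n} :=
 [set v | [exists t, [&& isL I t, ifv I t == v & tv tau (lito t).1]]].
have fE tau t : isL I t -> (ifv I t \in f tau) = tv tau (lito t).1.
 move=> tL; rewrite inE; apply/existsP/idP => [[t' /and3P [tL' /eqP E]]|h].
 by have := ifv_eq tL' tL; rewrite E eqxx => /esym /eqP ->.
 by exists t; rewrite tL eqxx.
have inF t : isL I t -> (lito t).1 \in fvar F by move=> tL; apply/fvarP; exists t.
have lv tau t : isL I t -> lit_val tau (lito t) = Some ((lito t).2 == tv tau (lito t).1).
 move=> tL; rewrite /lit_val /tv; case: insubP => [y _ Ey|]; last by rewrite inF.
 by rewrite /=; case: (lito t).2; case: (tau y).
rewrite /num_models -(card_in_imset (f := f)); last first.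
 move=> tau tau' _ _ E; apply/ffunP => x; have /fvarP [t tL Et] := valP x.
 have := fE tau t tL; rewrite E fE // /tv Et valK; by [].
congr #|pred_of_set _|; apply/setP => M; apply/imsetP/idP => [[tau]|].
 rewrite inE => /eqP red ->; rewrite inE; apply/and3P; split.
 - apply/subsetP => v; rewrite !inE => /existsP [t /and3P [tL tv' _]].
 by apply/existsP; exists t; rewrite tL.
 - by apply/forall_inP => x _; rewrite eqxx.
 apply/forallP => q; apply/implyP => qC.
 have /(satisfiedP tau qC) [t [tL tq H]] : satisfied tau (cf (cq 1 L q)).
 apply: contraT => ns; suff : reduce_clause tau (cf (cq 1 L q)) \in reduct F tau by rewrite red inE.
 by apply/imfsetP; exists (cf (cq 1 L q)) => //=; rewrite inE ns andbT cf_in map_f ?cq_in.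
 move: H; rewrite lv // => /(congr1 (odflt false)) /= h.
 by apply/existsP; exists t; rewrite tL tq eqxx fE // isg_lit.
rewrite inE => /and3P [sM _ /forallP mM].
pose tau : {ffun fvar F -> bool} :=
 [ffun x => [exists t, [&& isL I t, (lito t).1 == val x & ifv I t \in M]]].
have tE t : isL I t -> tv tau (lito t).1 = (ifv I t \in M).
 move=> tL; rewrite /tv; case: insubP => [y _ Ey|]; last by rewrite inF.
 rewrite ffunE; apply/existsP/idP => [[t' /and3P [tL' E tM]]|tM].
 by move: E; rewrite Ey -ifv_eq // => /eqP <-.
 by exists t; rewrite tL Ey eqxx.
have fM : f tau = M.
 apply/setP => v; rewrite inE; apply/existsP/idP => [[t /and3P [tL /eqP <-]]|vM].
 by rewrite tE.
 have := subsetP sM _ vM; rewrite inE => /existsP [t /andP [tL /eqP E]].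
 by exists t; rewrite tL E eqxx tE // E.
exists tau => //; rewrite inE -fsubset0; apply/fsubsetP => C /imfsetP [D /=].
rewrite inE cf_in => /andP [/mapP [c cL ->]] ns _.
have [q qC Eq] := cq_ex cL; case/negP: ns; rewrite -Eq; apply/(satisfiedP tau qC).
have /existsP [t /and3P [tL /eqP tq /eqP h]] := implyP (mM q) qC.
by exists t; split=> //; rewrite lv // tE // -h isg_lit // eqxx.
Qed.

Lemma ig_edge asg p u v : gr (ig I asg p) u v ->
 exists t, [/\ alive I asg p t, ends I t u v & ig I asg p u v = (isg I t).+1].
Proof. by rewrite /gr /ig; case: pickP => //= t /andP [h1 h2] _; exists t. Qed.

(** The reduct identifies clauses that differ only in falsified literals, the cells do not. A cell
    is determined by its reduced clause and the subset of [B] behind its falsified literals, so a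
    clause of the reduct stands for at most [2 ^ k] cells. A bag of [t + 1] vertices thus becomes
    one of at most [2 ^ k * t.+1] cells. *)
Lemma backdoor_hidden k t : sb t F <= k ->
 exists B, hidden I (2 ^ k * t.+1) k (fun=> 0) B.
Proof.
rewrite /sb; case: ex_minnP => m /asboolP [B [BF Bt] Bm] _ mk.
pose Br : {set 'I_n} := [set v | [exists u, [&& isL I u, ifv I u == v & (lito u).1 \in B]]].
have BrE u : isL I u -> (ifv I u \in Br) = ((lito u).1 \in B).
 move=> uL; rewrite inE; apply/existsP/idP => [[u' /and3P [uL' /eqP E h]]|h].
 by have := ifv_eq uL' uL; rewrite E eqxx => /esym /eqP <-.
 by exists u; rewrite uL eqxx.
have cB : #|Br| <= k.
 apply: leq_trans mk; rewrite -Bm cardfE.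
 pose h (b : B) := odflt (ifv I (icl I (Ordinal (ltn0Sn _ : 0 < n)))) [pick v | [exists u, [&& isL I u, ifv I u == v & (lito u).1 == val b]]].
 have -> : #|{: B}| = #|[set: B]| by rewrite cardsT.
 apply: leq_trans (leq_imset_card h _); apply/subset_leq_card/subsetP => v.
 rewrite inE => /existsP [u /and3P [uL /eqP uv uB]]; apply/imsetP; exists [` uB]%fset => //.
 rewrite /h; case: pickP => [v' /existsP [u' /and3P [uL' /eqP <- /eqP E]]|/(_ v)] /=.
 by rewrite -uv; apply/eqP; rewrite ifv_eq // E.
 by move/existsP; case; exists u; rewrite uL uv !eqxx.
exists Br; split=> //.
 apply/subsetP => v; rewrite !inE => /existsP [u /and3P [uL uv _]].
 by apply/existsP; exists u; rewrite uL.
move=> asg a0 a12.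
pose tau : {ffun B -> bool} := [ffun b => [exists u, [&& isL I u, (lito u).1 == val b & asg (ifv I u) == 2]]].
have lv u : isL I u -> lit_val tau (lito u) =
 if ifv I u \in Br then Some (asg (ifv I u) == (isg I u).+1) else None.
 move=> uL; rewrite BrE // /lit_val; case: insubP => [y yB Ey|/negbTE ->] //=.
 rewrite yB; congr Some.
 have -> : tau y = (asg (ifv I u) == 2).
 rewrite ffunE; apply/existsP/idP => [[u' /and3P [uL']]|h].
 by rewrite Ey -ifv_eq // => /eqP ->.
 by exists u; rewrite uL Ey eqxx.
 have := a12 (ifv I u); rewrite BrE // yB => /(_ isT).
 by rewrite isg_lit //; case: (lito u).2 => /orP [] /eqP ->.
have satE q : isC I q -> satisfied tau (cf (cq 1 L q)) = sats I asg q.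
 move=> qC; apply/(satisfiedP tau qC)/existsP => [[u [uL uq]]|[u /and3P [uL /eqP uq h]]].
 by rewrite lv //; case: ifP => // _ [h]; exists u; rewrite uL uq eqxx h.
 exists u; split=> //; rewrite lv //; case: ifP => [_|/negbT/a0 E]; first by rewrite h.
 by rewrite E in h.
have := Bt tau; rewrite /in_W /treewidth; case: ex_minnP => w0 /asboolP.
move=> [T [e [bag [[tt tv te tc] tw]]]] _ w0t.
pose R (y : fvar (reduct F tau) + reduct F tau) (v : 'I_n) := match y with
 | inl x => [exists u, [&& isL I u, ifv I u == v & (lito u).1 == val x]]
 | inr C => [&& isC I v, ~~ sats I asg v & reduce_clause tau (cf (cq 1 L v)) == val C] end.
have [k1 k2 _] := represents_ok.
have Rfun y y' v : R y v -> R y' v -> y = y'.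
 case: y y' => [x|C] [x'|C'] /=.
 - case/existsP=> u /and3P [uL /eqP uv /eqP ux] /existsP [u' /and3P [uL' /eqP uv' /eqP ux']].
 by congr inl; apply: val_inj; rewrite /= -ux -ux'; apply/eqP; rewrite -ifv_eq // uv uv'.
 - by case/existsP=> u /and3P [uL /eqP uv _] /and3P [vC _ _]; move: (k2 u uL); rewrite uv vC.
 - by case/and3P=> vC _ _ /existsP [u /and3P [uL /eqP uv _]]; move: (k2 u uL); rewrite uv vC.
 - by case/and3P=> _ _ /eqP E /and3P [_ _ /eqP E']; congr inr; apply: val_inj; rewrite /= -E -E'.
pose bag' i : {set 'I_n} := \bigcup_(y in bag i) [set v | R y v].
have bagP i v : reflect (exists2 y, y \in bag i & R y v) (v \in bag' i).
 by apply: (iffP bigcupP) => -[y yi]; [rewrite inE|] => h; exists y; rewrite ?inE.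
apply: (@tree_elim_order _ T _ e bag') => //.
- move=> u v /ig_edge [x [/and4P [xL _ /eqP x0 xs] xe _]].
 have qC := k1 x xL; have nB : ifv I x \notin Br.
 by apply/negP => /a12; rewrite x0.
 have red : reduce_clause tau (cf (cq 1 L (icl I x))) \in reduct F tau.
 by apply/imfsetP; exists (cf (cq 1 L (icl I x))) => //=; rewrite inE satE // xs andbT cf_in map_f ?cq_in.
 have lin : lito x \in reduce_clause tau (cf (cq 1 L (icl I x))).
 rewrite !inE lv // (negbTE nB) andbT; by apply/mem_cq; exists x.
 have xF : (lito x).1 \in cvar (reduce_clause tau (cf (cq 1 L (icl I x)))) by apply/imfsetP; exists (lito x).
 have xV : (lito x).1 \in fvar (reduct F tau) by apply/bigfcupP; exists (reduce_clause tau (cf (cq 1 L (icl I x)))); rewrite ?red.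
 have [i /andP [i1 i2]] := te (inl [` xV]%fset) (inr [` red]%fset) xF.
 exists i.
 have b1 : ifv I x \in bag' i.
 by apply/bagP; exists (inl [` xV]%fset) => //=; apply/existsP; exists x; rewrite xL !eqxx.
 have b2 : icl I x \in bag' i by apply/bagP; exists (inr [` red]%fset) => //=; rewrite qC xs eqxx.
 by case/orP: xe => /andP [/eqP <- /eqP <-]; rewrite b1 b2.
- move=> v i j /bagP [y yi yv] /bagP [y' yj yv'].
 rewrite -(Rfun _ _ _ yv yv') in yj.
 have := tc y i j yi yj; apply: connect_sub => a b /and3P [ab ya yb].
 by apply: connect1; rewrite /= ab /=; apply/andP; split; apply/bagP; exists y.
move=> i; apply: (@leq_trans (#|bag i| * 2 ^ k)).
 apply: card_bigcup_le => y _; case: y => [x|C] /=.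
 rewrite (@leq_trans 1) ?expn_gt0 //; apply/card_le1_eqP => v v'; rewrite !inE.
 move=> /existsP [u /and3P [uL /eqP <- /eqP ux]] /existsP [u' /and3P [uL' /eqP <- /eqP ux']].
 by apply/eqP; rewrite ifv_eq // ux ux'.
 (* The backdoor variables whose falsified literal lies in the clause at [v]. *)
 pose h (v : 'I_n) := [set b : B | (val b, ~~ tau b) \in cq 1 L v].
 rewrite -(card_in_imset (f := h)); last first.
 move=> v v'; rewrite !inE => /and3P [vC vs /eqP vE] /and3P [vC' vs' /eqP vE'] Eh.
 apply: cq_inj => //; apply/fsetP => l.
 have main (p p' : 'I_n) : isC I p -> ~~ sats I asg p -> h p = h p' ->
 reduce_clause tau (cf (cq 1 L p)) = reduce_clause tau (cf (cq 1 L p')) ->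
 l \in cf (cq 1 L p) -> l \in cf (cq 1 L p').
 move=> pC ps hh rr lp; case: (eqVneq (lit_val tau l) (Some false)) => [Ef|nf].
 move: Ef lp; rewrite /lit_val; case: insubP => //= y yB Ey [El].
 have El' : l = (val y, ~~ tau y).
 case: (l) El Ey => x b /= e1 e2; congr pair; first by rewrite -e2.
 by case: (b) e1 => [->|/negbFE ->].
 rewrite !inE El'; have : y \in h p -> y \in h p' by rewrite hh.
 by rewrite !inE.
 have : l \in reduce_clause tau (cf (cq 1 L p)) by rewrite !inE /= in lp *; rewrite lp nf.
 by rewrite rr !inE /= => /andP [-> _].
 by apply/idP/idP; apply: main; rewrite // vE vE'.
 apply: (@leq_trans #|powerset [set: B]|).
 by apply/subset_leq_card/subsetP => X _; rewrite powersetE subsetT.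
 by rewrite card_powerset cardsT -cardfE leq_exp2l // Bm.
apply: (@leq_trans (2 ^ k * t.+1)); last exact: leqnSn.
rewrite mulnC leq_mul2l; apply/orP; right.
have h : #|bag i| <= \max_(i : T) #|bag i| by apply: (leq_bigmax (F := fun i => #|bag i|)).
by move: tw w0t h; rewrite /td_width; lia.
Qed.

End Represent.

(** * Reading the input *)

Definition vX := 24.
Definition vRem := 25.
Definition vCur := 26.
Definition aKIND : aid := (0, 9, 0).
Definition aCL : aid := (0, 10, 0).
Definition aFV : aid := (0, 11, 0).
Definition aFIRST : aid := (0, 12, 0).
Definition aSG : aid := (0, 16, 0).

Definition nameE := Bin Div (In (Var vX)) (Num 2).
Definition parse_clause := seqs [:: Assign vCur (Var vX); Assign vRem (In (Var vX));
 Store aKIND (Var vX) (Num 1)].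
(** Cell 0 holds the number of clauses and is never a literal, so 0 in [aFIRST] means that the
    variable has not occurred before. *)
Definition parse_lit := seqs [:: Assign vRem (Bin Defs.Sub (Var vRem) (Num 1));
 Store aKIND (Var vX) (Num 2); Store aCL (Var vX) (Var vCur);
 If (Arr aFIRST nameE) Skip (Store aFIRST nameE (Var vX));
 Store aFV (Var vX) (Arr aFIRST nameE);
 If (Bin Defs.Sub (In (Var vX)) (Bin Add nameE nameE))
 (Store aSG (Var vX) (Num 2)) (Store aSG (Var vX) (Num 1))].
Definition parse_cell := If (Var vX) (If (Var vRem) parse_lit parse_clause) Skip.
Definition parse := Loop vX parse_cell.

Definition parse_arr : pred aid := fun b => b \in [:: aKIND; aCL; aFV; aFIRST; aSG].

Lemma ok_parse : ok 1 (fun x => 24 <= x <= 26) parse_arr parse.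
Proof. by []. Qed.

Lemma run_loop_foldl n x c s :
 run n (Loop x c) s = foldl (fun s i => run n c (setv s x i)) s (iota 0 n).
Proof.
have H (b : nat -> store -> store) m t : iteri m b t = foldl (fun t i => b i t) t (iota 0 m).
 by elim: m => // m IH; rewrite iota_rcons foldl_rcons -IH.
exact: (H (fun i s => run n c (setv s x i))).
Qed.

Section Parse.
Variable (n : nat) (input : nat -> nat).

Definition pinv p (Dn : seq (nat * nat * literal)) (Cn : seq nat) s :=
 [/\ (forall t, arr s aKIND t = if t \in map lcell Dn then 2 else (t \in Cn)) /\ inp s = input,
 forall z, z \in Dn -> [/\ arr s aCL z.1.2 = z.1.1, arr s aSG z.1.2 = z.2.2.+1 &
 arr s aFV z.1.2 = arr s aFIRST z.2.1],
 forall x, arr s aFIRST x != 0 -> exists2 z, z \in Dn & z.1.2 = arr s aFIRST x /\ z.2.1 = x,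
 forall z, z \in Dn -> arr s aFIRST z.2.1 != 0
 & (forall z, z \in Dn -> z.1.2 < p) /\ (forall c, c \in Cn -> c < p)].

Let body s i := run n parse_cell (setv s vX i).

Lemma parse_litP p Dn Cn s (l : literal) : pinv p Dn Cn s -> 0 < p < n -> var s vRem != 0 ->
 input p = encode_literal l ->
 let s' := body s p in
 [/\ pinv p.+1 (rcons Dn (var s vCur, p, l)) Cn s', var s' vRem = (var s vRem).-1
 & var s' vCur = var s vCur].
Proof.
move=> [[K Ei] h1 h2 h3 [h4 h5]] /andP [p0 pn] rem Ein s'.
have En : input p %/ 2 = l.1 by rewrite Ein /encode_literal divn2; case: (l) => x [] /=; lia.
have Es : (input p - (l.1 + l.1) != 0) = l.2 by rewrite Ein /encode_literal; case: (l) => x [] /=; lia.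
pose F := if arr s aFIRST l.1 != 0 then arr s aFIRST l.1 else p.
have [A0 A1 A2] : [/\ var s' vRem = (var s vRem).-1, var s' vCur = var s vCur &
 [/\ arr s' aKIND = upd (arr s aKIND) p 2, arr s' aCL = upd (arr s aCL) p (var s vCur),
 forall x, arr s' aFIRST x = (if x == l.1 then F else arr s aFIRST x),
 arr s' aFV = upd (arr s aFV) p F & arr s' aSG = upd (arr s aSG) p l.2.+1 /\ inp s' = input]].
 set u0 := setv s vX p.
 have k1 : eval n u0 (Var vX) != 0 by rewrite /= /upd eqxx -lt0n.
 have k2 : eval n u0 (Var vRem) != 0 by exact: rem.
 rewrite /s' /body -/u0 /parse_cell run_if k1 run_if k2 /parse_lit 3!run_seqs_cons.
 set u := run n (Store aCL _ _) _.
 have uX : var u vX = p by [].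
 have uI : inp u = input by exact: Ei.
 have uN t : var t vX = p -> inp t = input -> eval n t nameE = l.1 by move=> e1 e2; rewrite /= e1 e2 pn En.
 rewrite run_seqs_cons run_if; set u1 := if _ then _ else _.
 have [v1 v2 v3 v4] : [/\ var u1 = var u, inp u1 = input, forall a, a != aFIRST -> arr u1 a = arr u a &
 forall x, arr u1 aFIRST x = (if x == l.1 then F else arr s aFIRST x)].
 rewrite /u1 -[eval n u (Arr aFIRST nameE)]/(arr u aFIRST (eval n u nameE)) uN //.
 rewrite -[arr u aFIRST]/(arr s aFIRST); rewrite /F; case: ifP => e; split=> //.
 - by move=> x; case: eqP => // ->.
 - by move=> a na /=; rewrite (negbTE na).
 - have -> : run n (Store aFIRST nameE (Var vX)) u = seta u aFIRST l.1 p by rewrite -(uN u uX uI).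
 by move=> x; rewrite /= /upd.
 rewrite run_seqs_cons.
 set u2 := run n (Store aFV _ _) u1.
 have E2 : u2 = seta u1 aFV p F.
 rewrite /u2 -[run n _ u1]/(seta u1 aFV (var u1 vX) (arr u1 aFIRST (eval n u1 nameE))).
 by rewrite uN ?v1 // v4 eqxx.
 rewrite run_seqs_cons run_if.
 have -> : eval n u2 (Bin Defs.Sub (In (Var vX)) (Bin Add nameE nameE)) = input p - (l.1 + l.1).
 rewrite -[eval n u2 _]/((if var u2 vX < n then inp u2 (var u2 vX) else 0) - (eval n u2 nameE + eval n u2 nameE)).
 by rewrite uN E2 /= ?v1 // v2 pn.
 have F3 : (if l.2 then run n (Store aSG (Var vX) (Num 2)) u2 else run n (Store aSG (Var vX) (Num 1)) u2)
 = seta u2 aSG p l.2.+1 by rewrite E2; case: (l.2); rewrite /= v1.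
 rewrite Es F3 -[run n (seqs [::]) _]/(seta u2 aSG p l.2.+1) E2; split.
 - by rewrite /= v1 /u /= /upd /= subn1.
 - by rewrite /= v1.
 split; [by rewrite /= v3|by rewrite /= v3|by move=> x; rewrite /= v4|by rewrite /= v3|].
 by split; [rewrite /= v3|exact: v2].
split=> //; split.
- split; last by case: A2 => _ _ _ _ [].
 move=> t; case: A2 => -> _ _ _ _; rewrite map_rcons mem_rcons inE /upd.
 by case: eqP.
- move=> z; rewrite mem_rcons inE => /orP [/eqP ->|zD] /=.
 case: A2 => _ -> -> -> [-> _]; rewrite /upd !eqxx; by [].
 have lt := h4 z zD; have ne : (z.1.2 == p) = false by apply/eqP => E; rewrite E ltnn in lt.
 have [e1 e2 e3] := h1 z zD; case: A2 => _ -> -> -> [-> _].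
 rewrite /upd ne e1 e2 e3; split=> //; case: eqP => // E; by rewrite /F -E h3.
- move=> x nz; case: A2 => _ _ AF _ _; rewrite AF in nz.
 have [Ex|nx] := eqVneq x l.1; last first.
 rewrite (negbTE nx) in nz; have [z zD [e1 e2]] := h2 _ nz; exists z; first by rewrite mem_rcons inE zD orbT.
 by split=> //; rewrite AF (negbTE nx).
 have EF : arr s' aFIRST x = F by rewrite AF Ex eqxx.
 have [e|e] := boolP (arr s aFIRST l.1 != 0).
 have FE : F = arr s aFIRST l.1 by rewrite /F e.
 have [z zD [e1 e2]] := h2 _ e; exists z; first by rewrite mem_rcons inE zD orbT.
 by split; [rewrite EF FE|rewrite Ex].
 have FE : F = p by rewrite /F (negbTE e).
 exists (var s vCur, p, l); first by rewrite mem_rcons inE eqxx.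
 by split; [rewrite EF FE|rewrite Ex].
- have F0 : F != 0 by rewrite /F; case: ifP => // _; rewrite -lt0n.
 move=> z; case: A2 => _ _ -> _ _; rewrite mem_rcons inE => /orP [/eqP -> /=|zD]; first by rewrite eqxx.
 by case: ifP => // _; exact: h3.
- split=> [z|c cC]; last by apply: ltnW; exact: h5.
 by rewrite mem_rcons inE => /orP [/eqP -> //|/h4 /ltnW].
Qed.

Lemma parse_litsP (c : seq literal) p Dn Cn s : pinv p Dn Cn s -> 0 < p -> p + size c <= n ->
 var s vRem = size c -> (forall i, i < size c -> input (p + i) = encode_literal (nth (0, true) c i)) ->
 let s' := foldl body s (iota p (size c)) in
 pinv (p + size c) (Dn ++ clits (var s vCur) p c) Cn s' /\ var s' vRem = 0.
Proof.
elim: c p Dn s => [|l c IH] p Dn s H p0 pn rem Ein /=; first by rewrite addn0 cats0.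
have [|||H1 r1 c1] := @parse_litP p Dn Cn s l H.
- by rewrite p0; move: pn => /=; lia.
- by rewrite rem.
- by have := Ein 0 isT; rewrite addn0.
have [||||H2 r2] := IH p.+1 _ _ H1.
- by [].
- by move: pn => /=; lia.
- by rewrite r1 rem.
- by move=> i lt; have := Ein i.+1 lt; rewrite addnS.
by rewrite addnS -addSn; rewrite c1 cat_rcons in H2.
Qed.

Lemma parse_clauseP p Dn Cn s : pinv p Dn Cn s -> 0 < p < n -> var s vRem = 0 ->
 let s' := body s p in
 [/\ pinv p.+1 Dn (rcons Cn p) s', var s' vRem = input p & var s' vCur = p].
Proof.
move=> [[K Ei] h1 h2 h3 [h4 h5]] /andP [p0 pn] rem s'.
have [A0 A1 [A2 A3 A4]] : [/\ var s' vRem = input p, var s' vCur = p &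
 [/\ arr s' aKIND = upd (arr s aKIND) p 1, forall a, a != aKIND -> arr s' a = arr s a & inp s' = input]].
 rewrite /s' /body /parse_cell run_if [eval _ _ _]/= /upd eqxx -lt0n p0 run_if.
 rewrite [eval _ _ (Var vRem)]/= /upd /= rem /= pn Ei; split=> //; split=> //.
 by move=> a na; rewrite (negbTE na).
split=> //; split=> //.
- split=> // t; rewrite A2 mem_rcons inE /upd K; case: eqP => //= ->.
 case: ifP => // /mapP [z zD E]; have := h4 z zD; by rewrite -E ltnn.
- by move=> z zD; rewrite !A3 //; exact: h1.
- by move=> x; rewrite A3 //; exact: h2.
- by move=> z zD; rewrite A3 //; exact: h3.
- split=> [z /h4 /ltnW //|q]; by rewrite mem_rcons inE => /orP [/eqP -> //|/h5 /ltnW].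
Qed.

Lemma parse_clausesP (L : seq (seq literal)) p Dn Cn s : pinv p Dn Cn s -> 0 < p ->
 p + csize L <= n -> var s vRem = 0 ->
 (forall i, i < csize L -> input (p + i) =
 nth 0 (flatten [seq size c :: map encode_literal c | c <- L]) i) ->
 exists2 s', foldl body s (iota p (csize L)) = s' &
 pinv (p + csize L) (Dn ++ lits p L) (Cn ++ cls p L) s'.
Proof.
elim: L p Dn Cn s => [|c L IH] p Dn Cn s H p0 pn rem Ein.
 by rewrite /= /csize /= addn0 !cats0; exists s.
have Ec : csize (c :: L) = (size c + csize L).+1 by [].
rewrite Ec in pn Ein *.
have [|H1 r1 c1] := parse_clauseP H _ rem; first by rewrite p0; lia.
have Ep := Ein 0 isT; rewrite addn0 /= in Ep; rewrite Ep in r1.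
have [||||H2 r2] := @parse_litsP c p.+1 _ _ _ H1.
- by [].
- by lia.
- exact: r1.
- move=> i lt; have := Ein i.+1; rewrite addnS /= nth_cat size_map => -> ; last by lia.
 by rewrite lt (nth_map (0, true)).
rewrite c1 in H2.
have [||||s' Es H3] := IH (p.+1 + size c) _ _ _ H2.
- by [].
- by lia.
- exact: r2.
- move=> i lt; have := Ein ((size c).+1 + i); rewrite addnA addSnnS addnS /= nth_cat size_map => E.
 rewrite (_ : p.+1 + size c + i = (p + (size c).+1 + i)); last by lia.
 rewrite E; last by lia.
 by rewrite ltnNge leq_addr /= addKn.
exists s'; first by rewrite /= iotaD foldl_cat Es.
move: H3; rewrite -catA -cats1 -catA /= (_ : p.+1 + size c + csize L = p + (size c + csize L).+1) //; lia.
Qed.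

End Parse.

Definition irep n' s (I : inst n'.+1) :=
 [/\ forall t : 'I_n'.+1, (arr s aKIND t == 1) = isC I t,
 forall t : 'I_n'.+1, (arr s aKIND t == 2) = isL I t
 & forall t : 'I_n'.+1, isL I t -> [/\ arr s aCL t = icl I t, arr s aFV t = ifv I t
 & arr s aSG t = (isg I t).+1]].

Lemma parseP (L : seq (seq literal)) : let n' := (size (encode L)).-1 in
 exists2 I : inst n'.+1, @represents L I & irep (run n'.+1 parse (init_store (encode L))) I.
Proof.
move=> n'; have En : n'.+1 = 1 + csize L.
 by rewrite /n' /encode /= /csize; congr S; elim: (L) => //= c L' IH; rewrite size_cat size_map IH.
set s0 := init_store (encode L).
pose body s i := run n'.+1 parse_cell (setv s vX i).
have P0 : pinv (nth 0 (encode L)) 1 [::] [::] (body s0 0) by split.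
have [||||s' Es [[K Ei] h1 h2 h3 [h4 h5]]] := @parse_clausesP n'.+1 _ L 1 [::] [::] _ P0.
- by [].
- by rewrite En.
- by [].
- by [].
have Er : run n'.+1 parse s0 = s'.
 by rewrite /parse run_loop_foldl {2}En /= -/(body s0 0) -Es.
rewrite Er /= in h1 h2 h3 h4 h5 K *.
exists (Inst (fun t : 'I_n'.+1 => arr s' aKIND t == 1) (fun t => arr s' aKIND t == 2)
 (fun t => inord (arr s' aCL t)) (fun t => inord (arr s' aFV t)) (fun t => arr s' aSG t == 2)).
 split=> /=.
 - by move=> t; rewrite K; case: ifP => // _; case: (_ \in _).
 - move=> q; rewrite K; case: ifP => [/mapP [z zin E]|_]; last by case: (_ \in _).
 have -> // : (val q \in cls 1 L) = false.
 by apply/negbTE; rewrite [val q]E; exact: lcell_cls.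
 - move=> z t zin Et; have [e1 e2 e3] := h1 z zin.
 have lt := h4 z zin; rewrite -En in lt; have [_ _ l2 _] := mem_lits zin.
 rewrite !Et e1 e2 inordK; last exact: ltn_trans l2 lt.
 split=> //; first by case: (z.2.2).
 have [z' zin' [e4 e5]] := h2 _ (h3 z zin); exists z' => //; split=> //.
 by rewrite e3 inordK // -e4 En; exact: h4.
 - move=> z z' t t' zin zin' Et Et' E; have [_ _ e3] := h1 z zin; have [_ _ e3'] := h1 z' zin'.
 by rewrite Et Et' e3 e3' E.
split=> //= t; rewrite K; case: ifP => [/mapP [z zin Et] _|_]; last by case: (_ \in _).
have [e1 e2 e3] := h1 z zin; have lt := h4 z zin; rewrite -En in lt; have [_ _ l2 _] := mem_lits zin.
rewrite Et e1 e2 inordK; last exact: ltn_trans l2 lt.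
split=> //; last by case: (z.2.2).
have [z' zin' [e4 e5]] := h2 _ (h3 z zin); by rewrite e3 inordK // -e4 En; exact: h4.
Qed.

(** * Rebuilding the elimination structure *)

Definition vPv := 21.
Definition vCnt := 22.
Definition vFail := 23.
Definition vU := 20.
Definition vTg := 27.
Definition vCo := 28.
Definition vUs := 29.
Definition vPr := 30.
Definition vPp := 31.
Definition vUf := 32.
Definition aNORD : aid := (0, 3, 0).
Definition aNCOL : aid := (0, 4, 0).
Definition aNPAR : aid := (0, 5, 0).
Definition aNPOS : aid := (0, 6, 0).
Definition aZ i : aid := (4, 0, i).

Lemma setv_setv s x a b : setv (setv s x a) x b = setv s x b.
Proof.
rewrite /setv /=; congr Mk; apply/funext => y; rewrite /upd; by case: eqP.
Qed.

Lemma run_seqs_nil n s : run n (seqs [::]) s = s.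
Proof. by []. Qed.

Section Any.
Variables (n x : nat) (I : eqType) (es : I -> expr) (s : store).
Hypothesis ev : forall i v, eval n (setv s x v) (es i) = eval n s (es i).

Lemma any_loop (l : seq I) :
 run n (Seq (Assign x (Num 0)) (seqs [seq If (es i) (Assign x (Num 1)) Skip | i <- l])) s =
 setv s x (has (fun i => eval n s (es i) != 0) l).
Proof.
rewrite run_seq -[run n (Assign x (Num 0)) s]/(setv s x false).
elim/last_ind: l => [//|l i IH]; rewrite map_rcons run_seqs_rcons IH run_if ev.
rewrite has_rcons; case: (eval n s (es i) != 0) => //=.
by rewrite setv_setv.
Qed.
End Any.

(** * Placing one vertex: boundary, colour and parent *)

Section Place.
Variables (c sP : nat).

Definition cellE i := Arr (aC 0 i) (Num 0).
Definition cellV i := Bin Defs.Sub (cellE i) (Num 1).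
Definition labs := Loop vX (If (Arr aNPOS (Var vX)) (Store aLAB (Var vX) (Num 1))
 (If (EqE (Var vX) (Var vTg)) (Store aLAB (Var vX) (Num 2)) (Store aLAB (Var vX) (Num 0)))).

(** The four sets of the split formula: label 1 for placed vertices, label 2 for [u], marks up to
    [s1] for the boundary, larger marks for the new separator vertices. *)
Definition split_preds s1 : seq (nat -> nat -> bool) :=
 [:: fun l _ => l %% 3 == 1; fun l _ => l %% 3 == 2; fun _ k => 0 < k <= s1; fun _ k => s1 < k].
Definition splitq T s1 z1 := findq (s1 + z1) (SplitF T s1.+1) (split_preds s1) c 9.

Definition usedcol j := Seq (Assign vUs (Num 0)) (seqs [seq If
 (AndE (cellE i) (EqE (Arr aNCOL (cellV i)) (Num j))) (Assign vUs (Num 1)) Skip | i <- iota 0 sP]).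
Definition pickcol := seqs [seq Seq (usedcol j) (If (Var vUs) Skip (Assign vCo (Num j)))
 | j <- iota 0 sP.+1].
Definition pickpar := seqs ([:: Assign vPr (Num 3); Assign vPp (AddE Size 1)] ++
 [seq If (AndE (cellE i) (LtE (Arr aNPOS (cellV i)) (Var vPp)))
 (Seq (Assign vPr (AddE (cellE i) 3)) (Assign vPp (Arr aNPOS (cellV i)))) Skip | i <- iota 0 sP]).
(** The query is run only to list the boundary of [vTg]. The colour is one that is free on the
    boundary, and the parent is the boundary vertex with the smallest position. *)
Definition place := seqs [:: labs; splitq sP sP 1; pickcol; pickpar;
 Assign vCnt (Bin Defs.Sub (Var vCnt) (Num 1)); Store aNORD (Var vCnt) (Var vTg);
 Store aNPOS (Var vTg) (AddE (Var vCnt) 1); Store aNCOL (Var vTg) (Var vCo);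
 Store aNPAR (Var vTg) (Var vPr)].

Definition Xr : pred nat := fun x => (7 <= x <= 14) || (22 <= x <= 32).
Definition Yr : pred aid := fun a => (a.1.1 == 1) ||
 (a \in [:: aLAB; aNORD; aNCOL; aNPAR; aNPOS]).

Lemma ok_labs : ok 1 Xr Yr labs.
Proof. by []. Qed.

Lemma ok_splitq T s1 z1 : ok 1 Xr Yr (splitq T s1 z1).
Proof.
apply: (ok_sub (leqnn 1) _ _ (ok_findq _ _ _ _ _)) => [x|a]; rewrite /engine_vars /Xr /Yw /Yr => -> //.
Qed.

Lemma ok_pickcol : ok 0 (pred2 vUs vCo) xpred0 pickcol.
Proof.
apply: ok_seqs_map => j; apply: ok_seq; last by [].
by apply: ok_seq => //; apply: ok_seqs_map.
Qed.

Lemma ok_pickpar : ok 0 (pred2 vPr vPp) xpred0 pickpar.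
Proof. by rewrite /pickpar /=; do 2 apply: ok_seq => //; apply: ok_seqs_map. Qed.

Lemma ok_place : ok 1 Xr Yr place.
Proof.
apply: ok_seqs; split; [exact: ok_labs|split; [exact: ok_splitq|]].
split; first by apply: (ok_sub (leq0n 1) _ _ ok_pickcol) => // x /pred2P [] ->.
by split; first by apply: (ok_sub (leq0n 1) _ _ ok_pickpar) => // x /pred2P [] ->.
Qed.

Definition Xp : pred nat := fun x => Xr x && (x != vFail) && (x != vUf).

Lemma ok_placeX : ok 1 Xp Yr place.
Proof.
apply: ok_seqs; split; [by []|split; [|split; [|split; [|by []]]]].
- apply: (ok_sub (leqnn 1) _ _ (ok_findq _ _ _ _ _)) => [x|a]; rewrite /engine_vars /Xp /Xr /Yw /Yr.
 by rewrite /vFail /vUf; lia.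
 by move=> ->.
- by apply: (ok_sub (leq0n 1) _ _ ok_pickcol) => // x /pred2P [] ->.
- by apply: (ok_sub (leq0n 1) _ _ ok_pickpar) => // x /pred2P [] ->.
Qed.

Lemma pickcolP n s : (exists2 j, j < sP.+1 & forall i, i < sP ->
 arr s (aC 0 i) 0 != 0 -> arr s aNCOL (arr s (aC 0 i) 0 - 1) != j) ->
 let s' := run n pickcol s in
 var s' vCo < sP.+1 /\ forall i, i < sP ->
 arr s (aC 0 i) 0 != 0 -> arr s aNCOL (arr s (aC 0 i) 0 - 1) != var s' vCo.
Proof.
move=> [j0 lj0 free0].
pose free j := forall i, i < sP -> arr s (aC 0 i) 0 != 0 -> arr s aNCOL (arr s (aC 0 i) 0 - 1) != j.
have H r : r <= sP.+1 -> let s' := run n (seqs [seq Seq (usedcol j) (If (Var vUs) Skip (Assign vCo (Num j)))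
 | j <- iota 0 r]) s in arr s' = arr s /\ ((exists2 j, j < r & free j) -> var s' vCo < r /\ free (var s' vCo)).
 elim: r => [|r IH] lr; first by split=> // -[].
 rewrite iota_rcons map_rcons run_seqs_rcons; have [Ea IH'] := IH (ltnW lr).
 set s1 := run n (seqs _) s in Ea IH' *; rewrite run_seq /usedcol.
 rewrite (@any_loop n vUs _ (fun i => AndE (cellE i) (EqE (Arr aNCOL (cellV i)) (Num r)))) //.
 set b := has _ _.
 have Eb : b = false <-> free r.
 rewrite /b; split=> [/negbT /hasPn h i lt nz|fr].
 have := h i; rewrite mem_iota add0n lt => /(_ isT); rewrite eval_and eval_eq negb_and negbK /= Ea.
 by case/orP=> [/eqP E|//]; rewrite E in nz.
 apply/negbTE/hasPn => i; rewrite mem_iota add0n => lt; rewrite eval_and eval_eq negb_and negbK /= Ea.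
 case: eqP => //= /eqP nz; exact: fr.
 rewrite run_if [eval _ _ (Var vUs)]/= /upd eqxx; case: (b) Eb => /= -[h1 h2].
 split=> //= -[j]; rewrite ltnS leq_eqVlt => /orP [/eqP -> fr|lj fr]; first by have := h2 fr.
 have [|e1 e2] := IH'; first by exists j.
 by rewrite /upd /=; split=> //; exact: ltnW.
 by split=> //= _; rewrite /upd eqxx; split=> //; exact: h1.
have [_ h] := H sP.+1 (leqnn _); apply: h; by exists j0.
Qed.

Lemma pickparP n s : (forall i, i < sP -> arr s aNPOS (arr s (aC 0 i) 0 - 1) <= n) ->
 let s' := run n pickpar s in
 (var s' vPr = 3 /\ forall i, i < sP -> arr s (aC 0 i) 0 = 0) \/
 (exists i, [/\ i < sP, arr s (aC 0 i) 0 != 0, var s' vPr = arr s (aC 0 i) 0 + 3 &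
 forall j, j < sP -> arr s (aC 0 j) 0 != 0 ->
 arr s aNPOS (arr s (aC 0 i) 0 - 1) <= arr s aNPOS (arr s (aC 0 j) 0 - 1)]).
Proof.
move=> bnd; rewrite /pickpar run_seqs_cat; set s0 := run n (seqs _) s.
have H r : r <= sP -> let s' := run n (seqs [seq If (AndE (cellE i) (LtE (Arr aNPOS (cellV i)) (Var vPp)))
 (Seq (Assign vPr (AddE (cellE i) 3)) (Assign vPp (Arr aNPOS (cellV i)))) Skip | i <- iota 0 r]) s0 in
 arr s' = arr s /\ ((([/\ var s' vPr = 3, var s' vPp = n.+1 & forall i, i < r -> arr s (aC 0 i) 0 = 0])) \/
 (exists i, [/\ i < r, arr s (aC 0 i) 0 != 0, var s' vPr = arr s (aC 0 i) 0 + 3 /\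
 var s' vPp = arr s aNPOS (arr s (aC 0 i) 0 - 1) &
 forall j, j < r -> arr s (aC 0 j) 0 != 0 ->
 arr s aNPOS (arr s (aC 0 i) 0 - 1) <= arr s aNPOS (arr s (aC 0 j) 0 - 1)])).
 elim: r => [|r IH] lr.
 by split=> //; left; split=> //; rewrite /s0 /= /upd /= addn1.
 rewrite iota_rcons map_rcons run_seqs_rcons; have [Ea IH'] := IH (ltnW lr).
 set s1 := run n (seqs _) s0 in Ea IH' *.
 rewrite run_if eval_and eval_lt -[eval n s1 (cellE r)]/(arr s1 (aC 0 r) 0).
 rewrite -[eval n s1 (Arr aNPOS _)]/(arr s1 aNPOS (arr s1 (aC 0 r) 0 - 1)) Ea -[eval n s1 (Var vPp)]/(var s1 vPp).
 case: ifP => [/andP [nz lt]|no].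
 split; first by rewrite -Ea.
 right; exists r; split=> //.
 by split; rewrite /= /upd /= Ea.
 move=> j; rewrite ltnS leq_eqVlt => /orP [/eqP -> //|lj] nj.
 case: IH' => [[_ _ z]|[i [li ni [_ e2] mn]]]; first by rewrite z in nj.
 by apply: leq_trans (mn j lj nj); rewrite -e2 ltnW.
 split=> //; case: IH' => [[e1 e2 z]|[i [li ni [e1 e2] mn]]].
 left; split=> // i; rewrite ltnS leq_eqVlt => /orP [/eqP ->|]; last exact: z.
 move: no; rewrite e2 ltnS bnd // andbT => /negbFE /eqP; by [].
 right; exists i; split=> //; first exact: ltnW.
 move=> j; rewrite ltnS leq_eqVlt => /orP [/eqP ->|]; last exact: mn.
 by move=> nz; move: no; rewrite nz /= => /negbT; rewrite -leqNgt e2.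
have [_ [[e1 _ z]|[i [li ni [e1 _] mn]]]] := H sP (leqnn _); first by left.
by right; exists i.
Qed.

End Place.

(** * Rebuilding the order by splitting components *)

Section Rebuild.
Variables (T n' : nat).
Let N := n'.+1.
(** [sz] bounds the boundaries between two groups, by the arithmetic of [split_step]. While [u] and
    up to [T.+1] separator vertices are placed one after another, boundaries may rise to [sP].
    Greedy colouring then takes [sP.+1] colours, and one more is for the vertex joined to
    everything. *)
Definition sz := 2 * T + 5.
Definition sP := sz + T.+2.
Definition ncol := sP.+2.

Variables (g : 'I_N -> 'I_N -> nat).
Hypotheses (gsym : forall u v, g u v = g v u) (girr : forall v, g v v = 0)
 (g3 : forall u v, g u v < 3).
Notation G := (gr g).

Lemma labsP s : let s' := run N labs s in forall v : 'I_N,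
 arr s' aLAB v = if arr s aNPOS v != 0 then 1 else if val v == var s vTg then 2 else 0.
Proof.
have [_ _ H] : [/\ var (run N labs s) vTg = var s vTg, arr (run N labs s) aNPOS = arr s aNPOS &
 forall v, v < N -> arr (run N labs s) aLAB v =
 if arr s aNPOS v != 0 then 1 else if v == var s vTg then 2 else 0].
 apply: (@run_loop N vX _ s (fun i t => [/\ var t vTg = var s vTg, arr t aNPOS = arr s aNPOS &
 forall v, v < i -> arr t aLAB v = if arr s aNPOS v != 0 then 1 else if v == var s vTg then 2 else 0])) => //.
 move=> i t lt [h1 h2 h3].
 have -> : run N (If (Arr aNPOS (Var vX)) (Store aLAB (Var vX) (Num 1))
 (If (EqE (Var vX) (Var vTg)) (Store aLAB (Var vX) (Num 2)) (Store aLAB (Var vX) (Num 0)))) (setv t vX i)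
 = seta (setv t vX i) aLAB i (if arr s aNPOS i != 0 then 1 else if i == var s vTg then 2 else 0).
 rewrite run_if -[eval _ _ (Arr _ _)]/(arr t aNPOS i) h2; case: ifP => // _.
 rewrite run_if eval_eq -[eval _ _ (Var vX)]/i -[eval _ _ (Var vTg)]/(var t vTg) h1.
 by case: ifP.
 split=> // v; rewrite ltnS leq_eqVlt => /orP [/eqP ->|lv]; rewrite /= /upd ?eqxx //.
 by case: eqP => [->|_] //; exact: h3.
by move=> s' v; apply: H.
Qed.

Definition struct_ok s := srep n' s /\ valid ncol g (Sof ncol n' s).

Definition Ys : pred aid := fun a => (a.1.1 == 3) || (a \in [:: aORD; aCOL; aPAR]).

Lemma struct_ext s s' : var s' vTop = var s vTop -> (forall a, Ys a -> arr s' a = arr s a) ->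
 struct_ok s -> struct_ok s'.
Proof.
move=> Et Ea [[h1 h2 h3] h4].
have E : Sof ncol n' s' = Sof ncol n' s.
 rewrite /Sof !Ea //; congr EStr; apply/funext => v; apply/funext => j.
 by case: ifP => // _; rewrite Ea.
by split; [split; rewrite ?Et ?Ea|rewrite E].
Qed.

Lemma ok_struct d X Y com s : ok d X Y com -> ~~ X vTop -> (forall a, Ys a -> ~~ Y a) ->
 struct_ok s -> struct_ok (run N com s).
Proof.
move=> o nX nY; apply: struct_ext => [|a ya]; first by rewrite (ok_var _ _ o).
by rewrite (ok_arr _ _ o) // nY.
Qed.

Lemma Ys_Yr a : Ys a -> ~~ Yr a.
Proof.
rewrite /Ys /Yr => /orP [/eqP E|].
 rewrite E /=; apply/negP; rewrite !inE => /or4P [/eqP Ea|/eqP Ea|/eqP Ea|/orP [/eqP Ea|/eqP Ea]];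
 by rewrite Ea in E.
by rewrite !inE => /or3P [/eqP ->|/eqP ->|/eqP ->].
Qed.

Lemma card_marks q (m : marking 'I_N q) a b : uniq_marks m -> a + b <= q ->
 #|[set v | a < m v <= a + b]| <= b.
Proof.
move=> um ab; have -> : [set v | a < m v <= a + b] = \bigcup_(i : 'I_b) [set v | m v == (a + i).+1 :> nat].
 apply/setP => v; rewrite inE; apply/idP/bigcupP => [h|[i _]].
 have lt : m v - a.+1 < b by lia.
 by exists (Ordinal lt) => //; rewrite inE /=; apply/eqP; lia.
 by rewrite inE => /eqP ->; have := ltn_ord i; lia.
apply: leq_trans (card_bigcup_le (m := 1) _) _; last by rewrite muln1 card_ord.
by move=> i _; apply: um; have := ltn_ord i; lia.
Qed.

(** Marks name [W] and [Zn], while [Zw] is only guessed inside the formula. Sets larger than their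
    supply of marks are invisible to the query, whence the cardinality conditions in the failing
    case. *)
Lemma splitqP T' s1 z1 s s' (D : {set 'I_N}) u U W : struct_ok s -> u \notin D ->
 (forall v : 'I_N, arr s aLAB v = if v \in D then 1 else if v == u then 2 else 0) ->
 s' = run N (splitq ncol T' s1 z1) s -> U = component G (~: D) u -> W = touched G D U ->
 if arr s' (aF 0) 0 == 0 then forall Zn Zw : {set 'I_N}, #|W| <= s1 -> Zn \subset U ->
 Zw \subset W -> #|Zn| <= z1 -> #|Zn :|: Zw| <= T'.+1 ->
 ~ separates G (u |: W) (Zn :|: Zw) (U :|: W)
 else [/\ forall v, v \in W <-> exists2 i, i < s1 & arr s' (aC 0 i) 0 = v.+1,
 forall i, i < s1 + z1 -> arr s' (aC 0 i) 0 = 0 \/ exists v : 'I_N, arr s' (aC 0 i) 0 = v.+1,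
 #|W| <= s1 & exists Zn Zw : {set 'I_N}, [/\ Zn \subset U, Zw \subset W, #|Zn :|: Zw| <= T'.+1,
 separates G (u |: W) (Zn :|: Zw) (U :|: W) &
 forall v, v \in Zn <-> exists2 i, i < z1 & arr s' (aC 0 (s1 + i)) 0 = v.+1]].
Proof.
move=> [sr vS] uD labE Es EU EW0.
have lab9 (v : 'I_N) : arr s aLAB v < 9 by rewrite labE; case: ifP => // _; case: ifP.
have envE (m : marking 'I_N (s1 + z1)) : qenv (split_preds s1) (fun v : 'I_N => arr s aLAB v) m =
 [:: chi D; chi [set u]; chi [set v | 0 < m v <= s1]; chi [set v | s1 < m v]].
 rewrite /qenv /=; congr [:: _; _; _; _]; apply/funext => v; rewrite /chi ?inE ?labE //.
 by case: ifP => // _; case: ifP.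
 by case: (boolP (v \in D)) => [vD|_]; [apply/esym/negbTE; apply: contraNneq uD => <-|case: ifP].
have := @findq_spec (s1 + z1) (SplitF T' s1.+1) (split_preds s1) ncol 9 n' g s s' gsym girr g3 sr vS lab9 Es.
case: ifP => _.
 move=> no Zn Zw Ws ZU ZW Zs Zt sep.
 have dis : [disjoint W & Zn].
 rewrite -setI_eq0; apply/eqP/setP => v; rewrite [RHS]inE; apply/negP => /setIP [vW /(subsetP ZU)].
 have UD : U \subset ~: D by rewrite EU; apply: comp_sub; rewrite inE.
 move/(subsetP UD); rewrite inE => vD.
 by move: vW; rewrite EW0 => /setIdP [h _]; rewrite h in vD.
 have [m [um mW mZ]] := marks_of_sets dis Ws Zs.
 apply: (no m um); rewrite envE.
 have -> : [set v | 0 < m v <= s1] = W by apply/setP => v; rewrite inE mW.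
 have -> : [set v | s1 < m v] = Zn by apply/setP => v; rewrite inE mZ.
 apply/(sat_split gsym) => //; first by apply: leq_trans (leq_card_setU _ _) _; rewrite cards1.
 by cbv zeta; rewrite -EU; split=> //; exists Zw.
move=> [m [um]]; rewrite envE => sm cells vcells.
set Wn := [set v | 0 < m v <= s1] in sm *; set Zn := [set v | s1 < m v] in sm *.
have Wc : #|Wn| <= s1 by have := card_marks um (leq_addr z1 (0 + s1)); rewrite add0n.
have Wj : #|u |: Wn| <= s1.+1 by apply: leq_trans (leq_card_setU _ _) _; rewrite cards1.
case: ((@sat_split _ g gsym T' s1.+1 D Wn Zn u uD Wj).1 sm) => EW ZU [Zw ZW [Zs sep]].
rewrite -EU -EW0 in EW ZU sep; split; rewrite -?EW //.
 move=> v; rewrite inE; split=> [h|[i lt E]].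
 exists (m v).-1; first by lia.
 by apply/eqP; rewrite -cells; [apply/eqP; lia|lia].
 by have : m v == i.+1 :> nat; [rewrite cells ?E //; lia|move/eqP; lia].
exists Zn, Zw; split=> //.
move=> v; rewrite inE; split=> [h|[i lt E]].
 exists (m v - s1.+1); first by have := ltn_ord (m v); lia.
 by apply/eqP; rewrite -cells; [apply/eqP; lia|have := ltn_ord (m v); lia].
by have : m v == (s1 + i).+1 :> nat; [rewrite cells ?E //; lia|move/eqP; lia].
Qed.

Definition ncolf s (v : 'I_N) := arr s aNCOL v.
Definition nparf s (v : 'I_N) : option 'I_N :=
 if arr s aNPAR v == 3 then None else Some (inord (arr s aNPAR v - 4)).

(** The new order is filled from its end, [vCnt] being the first used index. Positions are shifted
    by one, as 0 in [aNPOS] marks vertices not yet placed. *)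
Definition rsrep s (P : seq 'I_N) :=
 [/\ var s vCnt + size P = N,
 forall i v0, i < size P -> arr s aNORD (var s vCnt + i) = nth v0 P i,
 forall v : 'I_N, arr s aNPOS v = if v \in P then (var s vCnt + index v P).+1 else 0,
 forall v : 'I_N, v \in P -> arr s aNPAR v = 3 \/ 4 <= arr s aNPAR v < N + 4
 & placed sP.+1 g (ncolf s) (nparf s) P].

Lemma rsrep_ext s s' P : (forall a, a \in [:: aNORD; aNCOL; aNPAR; aNPOS] -> arr s' a = arr s a) ->
 var s' vCnt = var s vCnt -> rsrep s P -> rsrep s' P.
Proof.
move=> Ea Ec [h1 h2 h3 h4 h5]; rewrite /rsrep Ec /ncolf /nparf !Ea //.
Qed.

Lemma placeP s P v : struct_ok s -> rsrep s P -> var s vTg = val v -> v \notin P ->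
 #|nbrs g [set x in P] v| <= sP -> rsrep (run N (place ncol sP) s) (v :: P).
Proof.
move=> so rs tg vP nb; set D := [set x in P] in nb.
have vD : v \notin D by rewrite inE.
rewrite /place 9!run_seqs_cons.
have L := labsP s; set s1 := run N labs s in L *.
have so1 : struct_ok s1 by apply: ok_struct ok_labs _ Ys_Yr so.
have [h1 h2 h3 h4 h5] := rs.
have L1 (x : 'I_N) : arr s1 aLAB x = if x \in D then 1 else if x == v then 2 else 0.
 by rewrite L h3 inE tg -val_eqE; case: (x \in P).
have F1 a : a \in [:: aNORD; aNCOL; aNPAR; aNPOS] -> arr s1 a = arr s a.
 have o : ok 1 xpredT (pred1 aLAB) labs by [].
 by move=> ha; rewrite (ok_arr _ _ o) //; apply: contraTneq ha => ->.
set s2 := run N (splitq _ _ _ _) s1.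
set W := nbrs g D v in nb.
have Q := @splitqP sP sP 1 s1 s2 D v _ W so1 vD L1 erefl erefl erefl.
have F2 a : ~~ Yw a -> arr s2 a = arr s1 a by move=> na; rewrite (ok_arr _ _ (ok_findq _ _ _ _ _)).
have V2 x : ~~ engine_vars x -> var s2 x = var s1 x by move=> nx; rewrite (ok_var _ _ (ok_findq _ _ _ _ _)).
have V1 x : x != vX -> var s1 x = var s x.
 have o : ok 1 (pred1 vX) xpredT labs by [].
 by move=> nx; rewrite (ok_var _ _ o).
have EW : W = nbrs g D v by [].
(* The query cannot fail here: [v] together with its boundary is a separator, and it fits the given
   size. *)
move: Q; case: ifP => _ Q.
 exfalso; apply: (Q [set v] W) => //; rewrite ?EW ?cards1 //.
 - by rewrite sub1set; exact: compxx.
 - by apply: leq_trans (leq_card_setU _ _) _; rewrite cards1 add1n ltnS.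
 - exact: split_trivial.
case: Q => cellP cellV0 _ _.
have E2 a : a \in [:: aNORD; aNCOL; aNPAR; aNPOS] -> arr s2 a = arr s a.
 by rewrite !inE => /or4P [] /eqP ->; rewrite F2 ?F1.
have cellD i : i < sP -> arr s2 (aC 0 i) 0 != 0 -> exists2 x : 'I_N, x \in W & arr s2 (aC 0 i) 0 = x.+1.
 move=> li nz; case: (cellV0 i _) => [|E|[x E]]; first by lia.
 by rewrite E in nz.
 by exists x => //; apply/cellP; exists i.
have WP x : x \in W -> x \in P by rewrite !inE => /andP [].
set s3 := run N (pickcol sP) s2.
(* At most [sP] boundary vertices leave one of the [sP.+1] colours free. *)
have [|co fr] := @pickcolP sP N s2.
 pose A := [set j : 'I_sP.+1 | [exists x in W, arr s2 aNCOL (val x) == j]].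
 have cA : #|A| <= sP.
 apply: leq_trans (leq_trans (leq_imset_card (fun x : 'I_N => inord (arr s2 aNCOL x)) W) nb).
 apply/subset_leq_card/subsetP => j; rewrite inE => /existsP [x /andP [xW /eqP E]].
 by apply/imsetP; exists x => //; rewrite E inord_val.
 case: (pickP [pred j | j \notin A]) => [j /= jA|all]; last first.
 have : A = setT by apply/setP => j; rewrite [RHS]inE; have := all j; rewrite /= => /negbFE.
 by move=> E; move: cA; rewrite E cardsT card_ord ltnn.
 exists j => // i li nz; have [x xW E] := cellD i li nz; rewrite E subn1 /=.
 apply: contra jA => h; rewrite inE; apply/existsP; exists x; by rewrite xW.
rewrite -/s3 in co fr.
have A3 : arr s3 = arr s2 by apply/funext => a; rewrite (ok_arr _ _ (ok_pickcol sP)).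
have NPb (x : 'I_N) : arr s aNPOS x <= N.
 rewrite h3; case: ifP => // xP; rewrite -index_mem in xP.
 by apply: (@leq_trans (var s vCnt + size P)); [rewrite ltn_add2l|rewrite h1].
set s4 := run N (pickpar sP) s3.
have bnd i : i < sP -> arr s3 aNPOS (arr s3 (aC 0 i) 0 - 1) <= N.
 move=> li; rewrite A3 E2 //; case: (posnP (arr s2 (aC 0 i) 0)) => [->|].
 exact: (NPb ord0).
 by rewrite lt0n => nz; have [x _ ->] := cellD i li nz; rewrite subn1; exact: NPb.
have pr := @pickparP sP N s3 bnd; cbv zeta in pr; rewrite -/s4 A3 in pr.
have A4 : arr s4 = arr s2 by rewrite -A3; apply/funext => a; rewrite (ok_arr _ _ (ok_pickpar sP)).
have V4 x : x != vPr -> x != vPp -> x != vUs -> x != vCo -> var s4 x = var s2 x.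
 move=> x1 x2 x3 x4; rewrite (ok_var _ _ (ok_pickpar sP)) ?(ok_var _ _ (ok_pickcol sP)) //=.
 by rewrite /= negb_or x3 x4.
 by rewrite /= negb_or x1 x2.
have C4 : var s4 vCo = var s3 vCo by rewrite (ok_var _ _ (ok_pickpar sP)).
have T4 : var s4 vTg = v by rewrite V4 // V2 // V1.
have K4 : var s4 vCnt = var s vCnt by rewrite V4 // V2 // V1.
set s' := run N (seqs [::]) _.
have [S1 S2 S3 S4 S5] : [/\ var s' vCnt = var s vCnt - 1,
 arr s' aNORD = upd (arr s aNORD) (var s vCnt - 1) v,
 arr s' aNPOS = upd (arr s aNPOS) v (var s vCnt - 1).+1,
 arr s' aNCOL = upd (arr s aNCOL) v (var s3 vCo) & arr s' aNPAR = upd (arr s aNPAR) v (var s4 vPr)].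
 rewrite /s' /= /upd /= T4 K4 C4 addn1 A4 !E2 //.
have uP : uniq (v :: P) by rewrite /= vP; case: h5.
have szP : size P < N.
 have le : #|v :: P| <= #|'I_N| := max_card _.
 by move: le; rewrite (card_uniqP uP) card_ord.
have cnt0 : 0 < var s vCnt by lia.
split.
- by rewrite S1 /=; lia.
- move=> [|i] v0; rewrite S1 S2 /upd; first by rewrite addn0 eqxx.
 rewrite -[size (v :: P)]/(size P).+1 ltnS -[nth v0 (v :: P) i.+1]/(nth v0 P i) => li; rewrite (_ : var s vCnt - 1 + i.+1 = var s vCnt + i); last by lia.
 by rewrite ifN ?(h2 i v0 li) //; apply/eqP; lia.
- move=> x; rewrite S1 S3 /upd inE val_eqE /=; case: (eqVneq x v) => [->|xv] /=.
 by rewrite ?eqxx ?addn0.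
 by rewrite h3; case: ifP => // _; lia.
- move=> x; rewrite S5 /upd inE val_eqE; case: (eqVneq x v) => [_ _|xv xP]; last exact: h4.
 case: pr => [[-> _]|[i [li nz -> _]]]; first by left.
 by have [y _ ->] := cellD i li nz; right; have := ltn_ord y; lia.
apply: (placed_cons h5 vP) => [x xv|].
 by rewrite /ncolf /nparf S4 S5 /upd val_eqE (negbTE xv).
have Eset : [set x in P] = D by [].
rewrite /placed_ok Eset -EW /ncolf /nparf S4 S5 /upd eqxx; split=> //.
 move=> x xW; rewrite ifN; last by rewrite val_eqE; apply: contraNneq vP => <-; exact: WP.
 have /cellP [i li E] := xW; have := fr i li; rewrite E subSS subn0 E2 //; exact.
case: pr => [[-> zz]|[i [li nz -> mn]]] /=.
 apply/setP => x; rewrite [RHS]inE; apply/negP => /cellP [i li E].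
 by have := zz i li; rewrite E.
have [y yW Ey] := cellD i li nz; rewrite Ey ifN; last by apply/eqP; lia.
rewrite (_ : y.+1 + 3 - 4 = y); last by lia.
rewrite inord_val; split=> // x xW; have /cellP [j lj Ej] := xW.
have := mn j lj; rewrite Ey Ej !subSS !subn0 !E2 // !h3 !WP // ltnS leq_add2l; exact.
Qed.

(** The queries inside [place] overwrite the cells of the witness, so the separator has to be saved
    first. *)
Definition copyZ := seqs [seq Store (aZ i) (Num 0) (cellE (sz + i)) | i <- iota 0 T.+1].
Definition placeZ i := If (Arr (aZ i) (Num 0))
 (Seq (Assign vTg (Bin Defs.Sub (Arr (aZ i) (Num 0)) (Num 1)))
 (If (Arr aNPOS (Var vTg)) Skip (place ncol sP))) Skip.
Definition placeZs := seqs [seq placeZ i | i <- iota 0 T.+1].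
Definition group := If (Var vFail) Skip (If (Arr aNPOS (Var vU)) Skip
 (seqs [:: Assign vTg (Var vU); labs; splitq ncol T sz T.+1;
 If (Arr (aF 0) (Num 0)) (seqs [:: copyZ; place ncol sP; placeZs])
 (Seq (Assign vFail (Num 1)) (Assign vUf (Var vU)))])).

Definition Yg : pred aid := fun a => Yr a || (a.1.1 == 4).

Lemma ok_placeYg : ok 1 Xr Yg (place ncol sP).
Proof. by apply: (ok_sub (leqnn 1) _ _ (ok_place ncol sP)) => [x|a] //; rewrite /Yg => ->. Qed.

Lemma ok_placeZ i : ok 1 Xr Yr (placeZ i).
Proof.
apply: ok_if; last exact: ok_skip.
by apply: ok_seq; [|apply: ok_if; [exact: ok_skip|exact: ok_place]].
Qed.

Lemma ok_group : ok 1 Xr Yg group.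
Proof.
have sub com : ok 1 Xr Yr com -> ok 1 Xr Yg com.
 by apply: (ok_sub (leqnn 1)) => [x|a] //; rewrite /Yg => ->.
apply: ok_if; first exact: ok_skip.
apply: ok_if; first exact: ok_skip.
apply: ok_seqs; split; first by [].
split; first exact: sub ok_labs.
split; first exact: sub (ok_splitq _ _ _ _).
split; last by [].
apply: ok_if; last by [].
apply: ok_seqs; split; first by apply: ok_seqs_map.
split; first exact: ok_placeYg.
by split; last by []; apply: ok_seqs_map => i; exact: sub (ok_placeZ i).
Qed.

Definition no_split (D : {set 'I_N}) u := forall Z : {set 'I_N}, #|Z| <= T.+1 ->
 ~ separates G (u |: nbrs g D u) Z setT.

(** A failure is stored with its vertex [vUf] while the placed set is [P], and later groups do
    nothing. So the failing component can still be examined after the rebuild. *)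
Definition ginv s (P : seq 'I_N) := [/\ struct_ok s, rsrep s P,
 var s vFail = 0 -> forall v, v \notin P -> #|nbrs g [set x in P] v| <= sz
 & var s vFail != 0 -> exists u : 'I_N, [/\ var s vUf = u, u \notin P,
 #|nbrs g [set x in P] u| <= sz & no_split [set x in P] u]].

(** Half-way through a separator, boundaries are bounded only by [sz] plus the number of vertices
    placed since the group began, which is at most [T.+2]. *)
Lemma placeZsP s P0 (u : 'I_N) (Zn : {set 'I_N}) (z : nat -> nat) :
 let D := [set x in P0] in
 u \notin P0 -> (forall v, v \notin P0 -> #|nbrs g D v| <= sz) ->
 #|Zn| <= T.+1 -> (forall i, i < T.+1 -> z i = 0 \/ exists2 v, v \in Zn & z i = (val v).+1) ->
 struct_ok s -> rsrep s (u :: P0) -> (forall i, arr s (aZ i) 0 = z i) ->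
 forall r, r <= T.+1 -> exists Q, let P := Q ++ u :: P0 in
 let s' := run N (seqs [seq placeZ i | i <- iota 0 r]) s in
 [/\ struct_ok s', rsrep s' P, forall i, arr s' (aZ i) 0 = z i &
 [set x in P] = D :|: (u |: [set x in Zn | [exists i : 'I_r, z i == x.+1]])].
Proof.
move=> D uP nb Zs zv so rs az; elim=> [|r IH] lr.
 exists [::]; split=> //; apply/setP => x; rewrite !inE; case: (x == u); rewrite ?orbT //=.
 rewrite (_ : [exists i : 'I_0, _] = false) ?andbF ?orbF //.
 by apply/existsP => -[[]].
have [Q0 [h1 h2 h3 h4]] := IH (ltnW lr); set P := Q0 ++ u :: P0 in h2 h4.
rewrite iota_rcons map_rcons run_seqs_rcons; set t := run N (seqs _) s in h1 h2 h3 *.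
have st : struct_ok (run N (placeZ r) t) by apply: ok_struct (ok_placeZ r) _ Ys_Yr h1.
have az' i : arr (run N (placeZ r) t) (aZ i) 0 = z i.
 by rewrite (ok_arr _ _ (ok_placeZ r)).
have exS (x : 'I_N) : [exists i : 'I_r.+1, z i == (val x).+1] = (z r == x.+1) || [exists i : 'I_r, z i == x.+1].
 apply/existsP/orP => [[i]|[h|/existsP [i h]]].
 - case: (ltngtP i r) => [lt|lt|->]; last by left.
 by right; apply/existsP; exists (Ordinal lt).
 by have := ltn_ord i; rewrite ltnS leqNgt lt.
 - by exists ord_max.
 - by exists (widen_ord (leqnSn r) i).
have same : (z r = 0 \/ exists2 x, x \in P & z r = (val x).+1) ->
 [set x in P] = D :|: (u |: [set x in Zn | [exists i : 'I_r.+1, z i == x.+1]]).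
 move=> hz; rewrite h4; apply/setP => x; rewrite !inE exS; case: (eqVneq (z r) x.+1) => //= E.
 rewrite andbT; case: hz => [hz|[y yP hy]]; first by rewrite hz in E.
 have xP : x \in P by rewrite (_ : x = y) //; apply: val_inj; rewrite hy in E; case: E.
 have : x \in [set x in P] by rewrite inE.
 rewrite h4 !inE => h; rewrite h; case/or3P: h => [->|->|/andP [-> _]] //; by rewrite ?orbT.
case: (zv r lr) => [E|[v vZ E]].
 have Ez : run N (placeZ r) t = t by rewrite /placeZ run_if -[eval _ _ (Arr _ _)]/(arr t (aZ r) 0) h3 E.
 by rewrite Ez in st az' *; exists Q0; split=> //; apply: same; left.
pose t1 := run N (Assign vTg (Bin Defs.Sub (Arr (aZ r) (Num 0)) (Num 1))) t.
have tg : var t1 vTg = v by rewrite /t1 /= h3 E subn1.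
have so1 : struct_ok t1 := h1.
have rs1 : rsrep t1 P by apply: rsrep_ext h2.
have Ec : (arr t1 aNPOS v != 0) = (v \in P) by have [_ _ -> _ _] := rs1; case: ifP.
have Ez : run N (placeZ r) t = if v \in P then t1 else run N (place ncol sP) t1.
 by rewrite -Ec -tg /placeZ run_if -[eval _ _ (Arr _ _)]/(arr t (aZ r) 0) h3 E.
move: st az'; rewrite Ez; case: ifP => [vP|/negbT vP] st az'.
 by exists Q0; split=> //; apply: same; right; exists v.
exists (v :: Q0); rewrite cat_cons -/P; split=> //.
 apply: placeP => //.
 have vD : v \notin [set x in P] by rewrite inE.
 have sD : D \subset [set x in P] by rewrite h4 subsetUl.
 apply: leq_trans (nbrs_grow g sD vD) _; apply: leq_add.
 by apply: nb; apply: contra vP => vP0; have := subsetP sD v; rewrite !inE; apply.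
 apply: (@leq_trans #|u |: Zn|); last first.
 by apply: leq_trans (leq_card_setU _ _) _; rewrite cards1 add1n ltnS.
 apply/subset_leq_card/subsetP => x; rewrite h4 !inE => /andP [/negbTE ->] /=.
 by case/orP=> [->|/andP [-> _]] //; rewrite orbT.
apply/setP => x; rewrite [LHS]inE inE; have : (x \in P) = (x \in [set x in P]) by rewrite inE.
rewrite h4 => ->; rewrite !inE exS E eqSS val_eqE [v == x]eq_sym; case: (eqVneq x v) => [->|_] //=.
by rewrite vZ !orbT.
Qed.

Lemma groupP s P (u : 'I_N) : var s vU = u -> ginv s P ->
 exists Q, let s' := run N group s in
 ginv s' (Q ++ P) /\ (var s' vFail = 0 -> u \in Q ++ P).
Proof.
move=> Eu [so rs nb fl]; rewrite /group run_if -[eval _ _ (Var vFail)]/(var s vFail).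
case: ifP => [f|/negbFE/eqP f].
 by exists [::]; split=> // E; rewrite E in f.
rewrite run_if -[eval _ _ _]/(arr s aNPOS (var s vU)) Eu.
have [_ _ np _ _] := rs.
have Ec : (arr s aNPOS u != 0) = (u \in P) by rewrite np; case: ifP.
rewrite Ec; case: ifP => [uP|/negbT uP]; first by exists [::].
rewrite 4!run_seqs_cons run_seqs_nil; set s0 := run N (Assign _ _) s.
set s1 := run N labs s0; set s2 := run N (splitq _ _ _ _) s1.
have so0 : struct_ok s0 := so.
have so1 : struct_ok s1 by apply: ok_struct ok_labs _ Ys_Yr so0.
have rs0 : rsrep s0 P by apply: rsrep_ext rs.
have rs1 : rsrep s1 P.
 have o : ok 1 (pred1 vX) (pred1 aLAB) labs by [].
 apply: rsrep_ext rs0 => [a|]; last by rewrite (ok_var _ _ o).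
 by move=> ha; rewrite (ok_arr _ _ o) //; apply: contraTneq ha => ->.
have so2 : struct_ok s2 by apply: ok_struct (ok_splitq _ _ _ _) _ Ys_Yr so1.
have rs2 : rsrep s2 P.
 apply: rsrep_ext rs1 => [a|]; last by rewrite (ok_var _ _ (ok_findq _ _ _ _ _)).
 by rewrite !inE => /or4P [] /eqP ->; rewrite (ok_arr _ _ (ok_findq _ _ _ _ _)).
pose D := [set x in P]; have uD : u \notin D by rewrite inE.
have L1 (x : 'I_N) : arr s1 aLAB x = if x \in D then 1 else if x == u then 2 else 0.
 rewrite labsP -[arr s0 _]/(arr s aNPOS) np inE -[var s0 vTg]/(var s vU) Eu -val_eqE.
 by case: (x \in P).
have Q := @splitqP T sz T.+1 s1 s2 D u _ (nbrs g D u) so1 uD L1 erefl erefl erefl.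
have Vk x : x \in [:: vFail; vU] -> var s2 x = var s x.
 have o : ok 1 (pred1 vX) (pred1 aLAB) labs by [].
 by rewrite !inE => /orP [] /eqP ->; rewrite (ok_var _ _ (ok_findq _ _ _ _ _)) // (ok_var _ _ o).
have Tg2 : var s2 vTg = u.
 have o : ok 1 (pred1 vX) (pred1 aLAB) labs by [].
 by rewrite (ok_var _ _ (ok_findq _ _ _ _ _)) // (ok_var _ _ o) //= /upd /= Eu.
have nbu := nb f u uP.
set cA := seqs [:: copyZ; place ncol sP; placeZs].
set cB := Seq (Assign vFail (Num 1)) (Assign vUf (Var vU)).
have Er0 : arr s2 (aF 0) 0 == 0 -> run N (If (Arr (aF 0) (Num 0)) cA cB) s2 = run N cB s2.
 by move=> h; rewrite run_if -[eval N s2 (Arr (aF 0) (Num 0))]/(arr s2 (aF 0) 0) (eqP h).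
have Er1 : (arr s2 (aF 0) 0 == 0) = false -> run N (If (Arr (aF 0) (Num 0)) cA cB) s2 = run N cA s2.
 by move=> h; rewrite run_if -[eval N s2 (Arr (aF 0) (Num 0))]/(arr s2 (aF 0) 0) h.
move: Q; case: ifP => [h|h] Q.
 rewrite (Er0 h).
 exists [::]; split=> //.
 split.
 - exact: so2.
 - by apply: rsrep_ext rs2.
 - by [].
 - move=> _; exists u; split=> //; first by rewrite /= /upd /= Vk.
 move=> Z Zs sep; have [Zn [Zw [z1 z2 z3 z4]]] := split_of_separator Zs sep.
 apply: (Q Zn Zw) => //; apply: leq_trans z3; apply: subset_leq_card; exact: subsetUl.
case: Q => _ vc _ [Zn [Zw [z1 z2 z3 z4 z5]]]; rewrite (Er1 h) /cA 3!run_seqs_cons run_seqs_nil.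
set s3 := run N copyZ s2.
have C3 r : let t := run N (seqs [seq Store (aZ i) (Num 0) (cellE (sz + i)) | i <- iota 0 r]) s2 in
 [/\ var t = var s2, forall a, a.1.1 != 4 -> arr t a = arr s2 a & forall i, i < r -> arr t (aZ i) 0 = arr s2 (aC 0 (sz + i)) 0].
 elim: r => [|r [e1 e2 e3]]; first by split.
 rewrite iota_rcons map_rcons run_seqs_rcons; set t := run N (seqs _) s2 in e1 e2 e3 *.
 split=> /=.
 - exact: e1.
 - by move=> a na; case: eqP => [E|_]; [rewrite E in na|exact: e2].
 - move=> i; rewrite ltnS leq_eqVlt => /orP [/eqP ->|lt]; first by rewrite eqxx /upd /= e2.
 by case: eqP => [[E]|_]; [rewrite E ltnn in lt|exact: e3].
have [c1 c2 c3] := C3 T.+1; rewrite -/copyZ -/s3 in c1 c2 c3.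
have so3 : struct_ok s3.
 apply: struct_ext so2; first by rewrite c1.
 move=> a ya; apply: c2; apply/eqP => E; move: ya; rewrite /Ys E /= !inE.
 by move=> /or3P [] /eqP Ea; rewrite Ea in E.
have rs3 : rsrep s3 P.
 apply: rsrep_ext rs2; last by rewrite c1.
 by move=> a; rewrite !inE => /or4P [] /eqP ->; exact: c2.
set s4 := run N (place _ _) s3; set s5 := run N placeZs s4.
have rs4 : rsrep s4 (u :: P).
 apply: placeP => //; first by rewrite c1.
 by apply: leq_trans nbu _; rewrite /sP leq_addr.
have so4 : struct_ok s4 by apply: ok_struct (ok_place _ _) _ Ys_Yr so3.
have Zs : #|Zn| <= T.+1 by apply: leq_trans z3; apply: subset_leq_card; exact: subsetUl.
have a4 i : arr s4 (aZ i) 0 = arr s3 (aZ i) 0 by rewrite (ok_arr _ _ (ok_place _ _)).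
have zv i : i < T.+1 -> arr s3 (aZ i) 0 = 0 \/ exists2 v, v \in Zn & arr s3 (aZ i) 0 = (val v).+1.
 move=> li; rewrite c3 //; case: (vc (sz + i)) => [|E|[v E]]; [by rewrite ltn_add2l|by left|].
 by right; exists v => //; apply/z5; exists i.
have [Q0 [p1 p2 p3 p4]] := placeZsP uP (nb f) Zs zv so4 rs4 a4 (leqnn _).
rewrite -/placeZs -/s5 in p1 p2 p3; set P' := Q0 ++ u :: P in p2 p4.
have EZ : [set x in Zn | [exists i : 'I_T.+1, arr s3 (aZ i) 0 == x.+1]] = Zn.
 apply/setP => x; rewrite inE; case: (boolP (x \in Zn)) => //= xZ; apply/existsP.
 have /z5 [i li E] := xZ; exists (Ordinal li); rewrite /= c3 // E; exact: eqxx.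
rewrite EZ in p4.
have inP x : (x \in P') = (x \in D :|: (u |: Zn)) by rewrite -p4 inE.
have op : ok 1 Xp Yr (place ncol sP) by exact: ok_placeX.
have o5 : ok 1 Xp Yr placeZs.
 apply: ok_seqs_map => i; apply: ok_if; last exact: ok_skip.
 by apply: ok_seq; [|apply: ok_if; [exact: ok_skip|exact: op]].
have F5 : var s5 vFail = 0.
 by rewrite (ok_var _ _ o5) // (ok_var _ _ op) // c1 Vk.
exists (rcons Q0 u); rewrite cat_rcons -/P'; split; last by rewrite inP !inE eqxx orbT.
split=> //; last by rewrite F5.
by move=> _ v; rewrite inP p4; apply: split_step z1 z2 z3 z4 _ v => //; move=> v; rewrite inE; exact: nb.
Qed.

(** One group of linear cost for each [vU], skipped if that vertex is already placed: quadratic time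
    in all. *)
Definition rebuild := Loop vU group.

Lemma rebuildP s P : ginv s P -> exists Q, let s' := run N rebuild s in
 ginv s' (Q ++ P) /\ (var s' vFail = 0 -> forall v, v \in Q ++ P).
Proof.
move=> gi.
have [Q [h1 h3]] : exists Q, ginv (run N rebuild s) (Q ++ P) /\
 (var (run N rebuild s) vFail = 0 -> forall v : 'I_N, v < N -> v \in Q ++ P).
 apply: (@run_loop N vU group s (fun i t => exists Q, ginv t (Q ++ P) /\
 (var t vFail = 0 -> forall v : 'I_N, v < i -> v \in Q ++ P))); first by exists [::].
 move=> i t li [Q1 [g1 f1]].
 have gt : ginv (setv t vU i) (Q1 ++ P).
 by case: g1 => a1 a2 a3 a4; split; [exact: a1|apply: rsrep_ext a2|exact: a3|exact: a4].
 have [Q2 [g2 f2]] := @groupP (setv t vU i) _ (Ordinal li) erefl gt.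
 exists (Q2 ++ Q1); rewrite -catA; split=> // F v.
 rewrite ltnS leq_eqVlt => /orP [/eqP E|lv]; first by rewrite (_ : v = Ordinal li) ?f2 //; exact: val_inj.
 rewrite mem_cat; apply/orP; right; apply: f1 => //; move: F; rewrite {1}/group run_if.
 by case: ifP => // /negbFE /eqP h _.
by exists Q; split=> // F v; apply: h3.
Qed.

End Rebuild.

(** * Inserting the literal occurrences *)

Definition vSt := 19.
Definition aPOS : aid := (0, 7, 0).
Definition aASG : aid := (0, 13, 0).
Definition aDEAD : aid := (0, 14, 0).
Definition aALV : aid := (0, 15, 0).

Lemma pointwise n c s (Ya : pred aid) (f : aid -> nat -> nat) : ok 0 xpred0 Ya c ->
 (forall t i, i < n -> var t vX = i -> (forall x, x != vX -> var t x = var s x) ->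
 (forall a, ~~ Ya a -> arr t a = arr s a) -> (forall a, Ya a -> arr t a i = arr s a i) ->
 forall a, Ya a -> arr (run n c t) a i = f a i /\
 forall j, j != i -> arr (run n c t) a j = arr t a j) ->
 let s' := run n (Loop vX c) s in
 [/\ forall a i, Ya a -> i < n -> arr s' a i = f a i,
 forall a, ~~ Ya a -> arr s' a = arr s a & forall x, x != vX -> var s' x = var s x].
Proof.
move=> oc H.
have [h1 h2 h3 _] : [/\ forall a i, Ya a -> i < n -> arr (run n (Loop vX c) s) a i = f a i,
 forall a, ~~ Ya a -> arr (run n (Loop vX c) s) a = arr s a,
 forall x, x != vX -> var (run n (Loop vX c) s) x = var s x &
 forall a i, Ya a -> n <= i -> arr (run n (Loop vX c) s) a i = arr s a i]; last by split.
apply: (@run_loop n vX c s (fun k t => [/\ forall a i, Ya a -> i < k -> arr t a i = f a i,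
 forall a, ~~ Ya a -> arr t a = arr s a, forall x, x != vX -> var t x = var s x &
 forall a i, Ya a -> k <= i -> arr t a i = arr s a i])) => // k t lk [h1 h2 h3 h4].
set u := setv t vX k.
have u1 : var u vX = k by rewrite /u /= /upd eqxx.
have u2 x : x != vX -> var u x = var s x by move=> nx; rewrite /u /= /upd (negbTE nx) h3.
have u3 a : ~~ Ya a -> arr u a = arr s a by exact: h2.
have u4 a : Ya a -> arr u a k = arr s a k by move=> ya; apply: h4.
have Hk a := H u k lk u1 u2 u3 u4 a.
split.
- move=> a i ya; rewrite ltnS leq_eqVlt => /orP [/eqP ->|li]; first by have [] := Hk a ya.
 by have [_ ->] := Hk a ya; [exact: h1|rewrite neq_ltn li].
- by move=> a na; rewrite (ok_arr _ _ oc) // u3.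
- by move=> x nx; rewrite (ok_var _ _ oc) // u2.
- by move=> a i ya ki; have [_ ->] := Hk a ya; [apply: h4 => //; exact: ltnW|rewrite gtn_eqF].
Qed.

Section Stage.
Variables (T n' : nat).
Let N := n'.+1.
Let nc := ncol T.
Let cm := (sP T).+1.

Definition XE := Var vX.
Definition clE := Arr aCL XE.
Definition fvE := Arr aFV XE.

Definition dead_code := Loop vX (If (AndE (EqE (Arr aKIND XE) (Num 2)) (EqE (Arr aASG fvE) (Arr aSG XE)))
 (Store aDEAD clE (Num 1)) Skip).
Definition alv_code := Loop vX (If (AndE (EqE (Arr aKIND XE) (Num 2))
 (AndE (EqE (Arr aASG fvE) (Num 0)) (EqE (Arr aDEAD clE) (Num 0))))
 (Store aALV XE (Num 1)) (Store aALV XE (Num 0))).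
Definition alive_code := seqs [:: Loop vX (Store aDEAD XE (Num 0)); dead_code; alv_code].

Definition adj_clear := Loop vX (seqs [seq Store (aADJ j) XE (Num 0) | j <- iota 0 nc]).
(** Each edge is stored at its earlier end, under the colour of its later end. *)
Definition adj_fill := Loop vX (If (AndE (Arr aALV XE) (LtE (Var vPv) (AddE clE 1)))
 (If (LtE (Arr aPOS clE) (Arr aPOS fvE))
 (switch (Arr aCOL fvE) nc (fun j => Store (aADJ j) clE (Arr aSG XE)))
 (switch (Arr aCOL clE) nc (fun j => Store (aADJ j) fvE (Arr aSG XE)))) Skip).
Definition adj_code := Seq adj_clear adj_fill.

Definition cone_par := Loop vX (If (EqE XE (Var vPv)) Skip
 (If (EqE (Arr aPAR XE) (Num 3)) (Store aPAR XE (AddE (Var vPv) 4)) Skip)).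
Definition copyback := Loop vX (seqs [:: Store aORD XE (Arr aNORD XE); Store aCOL XE (Arr aNCOL XE);
 Store aPAR XE (Arr aNPAR XE); Store aPOS XE (Arr aNPOS XE)]).
(** A stage lowers the cut-off to [p], the value of [vPv], and inserts all alive occurrences of the
    clause at [p] together by joining [p] to every bag. For this [p] must be last in the order; so
    each rebuild starts by placing [p - 1], the vertex of the next stage. At [p = 0] the truncated
    subtraction gives 0 again. *)
Definition stage := If (Var vFail) Skip (seqs [::
 Assign vPv (Bin Defs.Sub (Bin Defs.Sub Size (Num 1)) (Var vSt));
 Store aCOL (Var vPv) (Num cm); cone_par; adj_code;
 Loop vX (Store aNPOS XE (Num 0)); Assign vCnt Size;
 Assign vTg (Bin Defs.Sub (Var vPv) (Num 1)); place nc (sP T); rebuild T;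
 If (Var vFail) Skip copyback]).
Definition init_code := Loop vX (seqs [:: Store aORD XE XE; Store aCOL XE (Num 0);
 Store aPAR XE (Num 3); Store aPOS XE (AddE XE 1)]).
Definition build := seqs [:: alive_code; init_code; Assign vFail (Num 0); Assign vTop Size;
 Loop vSt stage; If (Var vFail) Skip (Seq (Assign vPv (Num 0)) adj_code)].

Definition Xs : pred nat := fun x => (6 <= x <= 14) || (19 <= x <= 32).
Definition Yst : pred aid := fun a => [|| Yg a, Ys a | a \in [:: aPOS; aDEAD; aALV]].

Lemma ok_rebuild : ok 2 Xs Yst (rebuild T).
Proof.
apply: ok_loop => //; apply: (ok_sub (leqnn 1) _ _ (ok_group T)) => [x|a].
 by rewrite /Xr /Xs; lia.
by rewrite /Yst => ->.
Qed.

Lemma ok_adj : ok 1 (pred1 vX) (fun a => a.1.1 == 3) adj_code.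
Proof.
apply: ok_seq; apply: ok_loop => //; first by apply: ok_seqs_map.
by apply: ok_if => //; apply: ok_if; apply: ok_switch.
Qed.

Lemma ok_stage : ok 2 Xs Yst stage.
Proof.
apply: ok_if; first exact: ok_skip.
apply: ok_seqs; split; first by []. split; first by []. split; first by [].
split.
 apply: (ok_sub (_ : 1 <= 2) _ _ ok_adj) => // [x /eqP -> //|a]; by rewrite /Yst /Ys => ->; rewrite orbT.
split; first by []. split; first by []. split; first by [].
split.
 apply: (ok_sub (_ : 1 <= 2) _ _ (ok_place _ _)) => // [x|a].
 by rewrite /Xr /Xs; lia.
 by rewrite /Yst /Yg => ->.
by split; first exact: ok_rebuild.
Qed.

Lemma ok_build : ok 3 Xs Yst build.
Proof.
apply: ok_seqs; split; first by []. split; first by []. split; first by []. split; first by [].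
split; first by apply: ok_loop => //; exact: ok_stage.
split; last by [].
apply: ok_if; first exact: ok_skip.
apply: ok_seq; first by [].
apply: (ok_sub (_ : 1 <= 3) _ _ ok_adj) => // [x /eqP -> //|a]; by rewrite /Yst /Ys => ->; rewrite orbT.
Qed.

Variables (I : inst N).
Hypothesis Iok : iok I.

Lemma ends_eq t t' u v : isL I t -> isL I t' -> ends I t u v -> ends I t' u v -> t = t'.
Proof.
case: Iok => c1 c2 inj tL tL' /orP [] /andP [/eqP e1 /eqP e2] /orP [] /andP [/eqP e3 /eqP e4];
 try (by apply: inj; rewrite // ?e1 ?e2 ?e3 ?e4).
- by have := c2 _ tL'; rewrite e4 -e1 c1.
- by have := c2 _ tL'; rewrite e4 -e1 c1.
Qed.

Lemma ig_alive asg p t u v : alive I asg p t -> ends I t u v -> ig I asg p u v = (isg I t).+1.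
Proof.
move=> at_ et; rewrite /ig; case: pickP => [t' /andP [at' et']|/(_ t)]; last by rewrite at_ et.
by case/and4P: (at_) => tL _ _ _; case/and4P: (at') => tL' _ _ _; rewrite (ends_eq tL tL' et et').
Qed.

Lemma endsC t u v : ends I t u v = ends I t v u.
Proof. by rewrite /ends orbC. Qed.

Lemma ig_sym asg p u v : ig I asg p u v = ig I asg p v u.
Proof. by rewrite /ig; under eq_pick => t do rewrite endsC. Qed.

Lemma ig_irr asg p v : ig I asg p v v = 0.
Proof.
rewrite /ig; case: pickP => // t /andP [/and4P [tL _ _ _]]; rewrite /ends orbb => /andP [/eqP e1 /eqP e2].
by case: Iok => c1 c2 _; have := c2 t tL; rewrite e2 -e1 c1.
Qed.

Lemma ig_lt3 asg p u v : ig I asg p u v < 3.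
Proof. by rewrite /ig; case: pickP => // t _; case: (isg I t). Qed.

Lemma ig_step asg (p : 'I_N) u v : u != p -> v != p -> ig I asg p u v = ig I asg p.+1 u v.
Proof.
move=> up vp; rewrite /ig; have -> // : [pick t | alive I asg p t && ends I t u v] =
 [pick t | alive I asg p.+1 t && ends I t u v].
apply: eq_pick => t /=; apply/andP/andP => -[/and4P [h1 h2 h3 h4] e]; split=> //; apply/and4P; split=> //.
 rewrite ltn_neqAle h2 andbT; apply/eqP => /val_inj E.
 by case/orP: e => /andP [/eqP e1 /eqP e2]; [rewrite -e1 -E eqxx in up|rewrite -e1 -E eqxx in vp].
exact: ltnW.
Qed.

Lemma ig_none asg u v : ig I asg N u v = 0.
Proof.
by rewrite /ig; case: pickP => // t /andP [/and4P [_ h _ _]]; have := ltn_ord (icl I t); rewrite ltnNge h.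
Qed.

Lemma ig_edgeP asg p u v : ig I asg p u v != 0 ->
 exists t, [/\ alive I asg p t, ends I t u v & ig I asg p u v = (isg I t).+1].
Proof. by rewrite /ig; case: pickP => //= t /andP [h1 h2] _; exists t. Qed.

Definition asgf s (v : 'I_N) := arr s aASG v.

Lemma alive_codeP s : irep s I -> let s' := run N alive_code s in
 [/\ forall t : 'I_N, (arr s' aALV t != 0) = alive I (asgf s) 0 t,
 forall c : 'I_N, (arr s' aDEAD c != 0) = sats I (asgf s) c
 & (forall a, a \notin [:: aDEAD; aALV] -> arr s' a = arr s a) /\
 (forall x, x != vX -> var s' x = var s x)].
Proof.
move=> [K1 K2 K3]; rewrite /alive_code 3!run_seqs_cons run_seqs_nil.
have [||z1 z2 z3] := @pointwise N (Store aDEAD XE (Num 0)) s (pred1 aDEAD) (fun _ _ => 0).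
- by [].
- move=> t i _ Ei _ _ _ a /eqP ->; rewrite /= Ei; split=> [|j nj]; rewrite /upd ?eqxx //.
 by rewrite (negbTE nj).
set s1 := run N (Loop vX (Store aDEAD XE (Num 0))) s in z1 z2 z3 *.
set s2 := run N dead_code s1.
pose sat1 k (c : 'I_N) := exists t : 'I_N, [/\ t < k, isL I t, icl I t = c & asgf s (ifv I t) = (isg I t).+1].
have [y1 y2 y3] : [/\ forall c : 'I_N, arr s2 aDEAD c != 0 <-> sat1 N c,
 forall a, a != aDEAD -> arr s2 a = arr s a & forall x, x != vX -> var s2 x = var s x].
 apply: (@run_loop N vX _ s1 (fun k t => [/\ forall c : 'I_N, arr t aDEAD c != 0 <-> sat1 k c,
 forall a, a != aDEAD -> arr t a = arr s a & forall x, x != vX -> var t x = var s x])).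
 split; [|exact: z2|exact: z3].
 by move=> c; rewrite z1 //; split=> // -[t []].
 move=> k t lk [h1 h2 h3]; pose k' := Ordinal lk.
 rewrite run_if eval_and !eval_eq -[eval _ _ (Arr aKIND XE)]/(arr t aKIND k) -[eval _ _ (Num 2)]/2.
 rewrite -[eval _ _ (Arr aASG fvE)]/(arr t aASG (arr t aFV k)) -[eval _ _ (Arr aSG XE)]/(arr t aSG k).
 rewrite !h2 // -[k]/(val k') K2.
 have fr u : (forall a, a != aDEAD -> arr u a = arr t a) -> (forall x, x != vX -> var u x = var t x) ->
 (forall c : 'I_N, arr u aDEAD c != 0 <-> arr t aDEAD c != 0 \/ (isL I k' /\ icl I k' = c /\ asgf s (ifv I k') = (isg I k').+1)) ->
 [/\ forall c : 'I_N, arr u aDEAD c != 0 <-> sat1 k.+1 c,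
 forall a, a != aDEAD -> arr u a = arr s a & forall x, x != vX -> var u x = var s x].
 move=> ua uv ud; split; [|by move=> a na; rewrite ua ?h2|by move=> x nx; rewrite uv ?h3].
 move=> c; split.
 move/ud => [/h1 [t0 [e1 e2 e3 e4]]|[e1 [e2 e3]]]; last by exists k'.
 by exists t0; split=> //; exact: ltnW.
 move=> [t0 [e1 e2 e3 e4]]; apply/ud; move: e1; rewrite ltnS leq_eqVlt => /orP [/eqP E|lt].
 by right; have <- : t0 = k' by exact: val_inj.
 by left; apply/h1; exists t0.
 case: ifP => [/andP [kL /eqP e]|no].
 have [k1 k2 k3] := K3 _ kL; rewrite k2 k3 in e.
 have Er : run N (Store aDEAD clE (Num 1)) (setv t vX k) = seta (setv t vX k) aDEAD (icl I k') 1.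
 by rewrite -[LHS]/(seta (setv t vX k) aDEAD (arr t aCL k) 1) h2 // [arr s aCL k]k1.
 rewrite Er; apply: fr.
 - by move=> a na; rewrite /= (negbTE na).
 - by move=> x nx; rewrite /= /upd (negbTE nx).
 - move=> c; rewrite /= /upd val_eqE; case: (eqVneq c (icl I k')) => [->|nE]; first by split=> // _; right.
 by split=> [h|[//|[_ [E _]]]]; [left|rewrite E eqxx in nE].
 apply: fr.
 - by [].
 - by move=> x nx; rewrite /= /upd (negbTE nx).
 - move=> c; split=> [h|[//|[kL [e1 e2]]]]; first by left.
 by have [k1 k2 k3] := K3 _ kL; move: no; rewrite kL k2 k3 [arr s aASG _]e2 eqxx.
pose fa (_ : aid) i : nat := [&& arr s2 aKIND i == 2, arr s2 aASG (arr s2 aFV i) == 0 & arr s2 aDEAD (arr s2 aCL i) == 0].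
have [||w1 w2 w3] := @pointwise N (If (AndE (EqE (Arr aKIND XE) (Num 2))
 (AndE (EqE (Arr aASG fvE) (Num 0)) (EqE (Arr aDEAD clE) (Num 0))))
 (Store aALV XE (Num 1)) (Store aALV XE (Num 0))) s2 (pred1 aALV) fa.
- by [].
- move=> t i _ Ei _ oa _ a /eqP ->; rewrite run_if !eval_and !eval_eq.
 rewrite -[eval _ _ (Arr aKIND XE)]/(arr t aKIND (var t vX)) -[eval _ _ (Num 2)]/2 -[eval _ _ (Num 0)]/0.
 rewrite -[eval _ _ (Arr aASG fvE)]/(arr t aASG (arr t aFV (var t vX))).
 rewrite -[eval _ _ (Arr aDEAD clE)]/(arr t aDEAD (arr t aCL (var t vX))) Ei (oa aKIND) // (oa aFV) // (oa aCL) // (oa aASG) // (oa aDEAD) //.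
 rewrite -[fa aALV i]/(nat_of_bool [&& arr s2 aKIND i == 2, arr s2 aASG (arr s2 aFV i) == 0 & arr s2 aDEAD (arr s2 aCL i) == 0]).
 case: ifP => _.
 rewrite -[run _ _ _]/(seta t aALV (var t vX) 1) Ei.
 by split=> [|j nj]; [rewrite /= /upd eqxx|rewrite /= /upd (negbTE nj)].
 rewrite -[run _ _ _]/(seta t aALV (var t vX) 0) Ei.
 by split=> [|j nj]; [rewrite /= /upd eqxx|rewrite /= /upd (negbTE nj)].
rewrite -/alv_code in w1 w2 w3; set s3 := run N alv_code s2 in w1 w2 w3 *.
have satE (c : 'I_N) : (arr s2 aDEAD c != 0) = sats I (asgf s) c.
 apply/idP/existsP => [/y1 [t [_ e1 e2 e3]]|[t /and3P [e1 /eqP e2 /eqP e3]]].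
 by exists t; rewrite e1 e2 e3 !eqxx.
 by apply/y1; exists t.
split.
- move=> t; rewrite w1 // /fa eqb0 negbK (y2 aKIND) // (y2 aFV) // (y2 aCL) // (y2 aASG) // K2 /alive ?leq0n; case: (boolP (isL I t)) => tL; last by [].
 have [k1 k2 _] := K3 _ tL; rewrite k1 k2 -satE negbK; by [].
- by move=> c; rewrite w2 // satE.
split=> [a|x nx]; last by rewrite w3 ?y3.
by rewrite !inE negb_or => /andP [a1 a2]; rewrite w2 ?y2.
Qed.

Definition posrep s := forall v : 'I_N, arr s aPOS v = (index v (eord (Sof nc n' s))).+1.

(** Every alive occurrence writes one entry. Later writes may overwrite earlier ones, but each
    nonzero entry comes from some edge with the right end and colour, and [prevalid_valid] shows
    that these determine the edge. *)
Lemma adj_codeP s asg (p : nat) : irep s I -> (forall t : 'I_N, (arr s aALV t != 0) = alive I asg 0 t) ->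
 var s vPv = p -> posrep s -> srep n' s -> prevalid nc (ig I asg p) (Sof nc n' s) ->
 struct_ok T (ig I asg p) (run N adj_code s).
Proof.
move=> [K1 K2 K3] al pv pos sr pre.
have [bag [ord [col _] _ _]] := pre.
rewrite /adj_code run_seq.
have [||z1 z2 z3] := @pointwise N (seqs [seq Store (aADJ j) XE (Num 0) | j <- iota 0 nc]) s
 (fun a => has (fun j => a == aADJ j) (iota 0 nc)) (fun _ _ => 0).
- elim: (iota 0 nc) => // j l IH.
 apply: (@ok_seq _ _ _ (Store (aADJ j) XE (Num 0)) (seqs [seq Store (aADJ j) XE (Num 0) | j <- l])).
 by rewrite /ok /= eqxx.
 by apply: (ok_sub (leqnn 0) _ _ IH) => // a h; rewrite /= h orbT.
- move=> t i _ Ei _ _ _ a; move: t Ei; elim: (iota 0 nc) => //= j l IH t Ei /orP h.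
 case: (boolP (has (fun j => a == aADJ j) l)) => hl.
 have [e1 e2] := IH (seta t (aADJ j) (var t vX) 0) Ei hl; split=> // k nk.
 by rewrite e2 //= Ei; case: eqP => // ->; rewrite /upd (negbTE nk).
 have Ea : a = aADJ j by case: h => [/eqP|] //; rewrite (negbTE hl).
 have fr u : arr (run N (seqs [seq Store (aADJ j) XE (Num 0) | j <- l]) u) a = arr u a.
 move: hl; elim: l u {IH h} => //= j' l IHl u; rewrite negb_or => /andP [n1 n2].
 by rewrite IHl //= (negbTE n1).
 by rewrite fr /= Ea eqxx Ei /upd eqxx; split=> // k nk; rewrite (negbTE nk).
rewrite -/adj_clear in z1 z2 z3; set s1 := run N adj_clear s in z1 z2 z3 *.
have Ez a : a.1.1 != 3 -> arr s1 a = arr s a.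
 by move=> na; apply: z2; apply/hasPn => j _; apply: contraNneq na => ->.
have al1 (t : 'I_N) : (arr s1 aALV t != 0) && (p < arr s1 aCL t + 1) = alive I asg p t.
 rewrite !Ez // al /alive; case: (boolP (isL I t)) => //= tL.
 by have [-> _ _] := K3 _ tL; rewrite addn1 ltnS andbC.
pose ps (v : 'I_N) := arr s aPOS v.
pose lo t := if ps (icl I t) < ps (ifv I t) then icl I t else ifv I t.
pose hi t := if ps (icl I t) < ps (ifv I t) then ifv I t else icl I t.
pose wr k j v := exists t : 'I_N, [/\ t < k, alive I asg p t, lo t = v & arr s aCOL (hi t) = j].
set s2 := run N adj_fill s1.
have [y1 y2 y3] : [/\ forall j (v : 'I_N), j < nc -> (arr s2 (aADJ j) v = 0 /\ ~ wr N j v) \/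
 (exists t : 'I_N, [/\ alive I asg p t, lo t = v, arr s aCOL (hi t) = j & arr s2 (aADJ j) v = (isg I t).+1]),
 forall a, a.1.1 != 3 -> arr s2 a = arr s a & forall x, x != vX -> var s2 x = var s x].
 apply: (@run_loop N vX _ s1 (fun k u => [/\ forall j (v : 'I_N), j < nc -> (arr u (aADJ j) v = 0 /\ ~ wr k j v) \/
 (exists t : 'I_N, [/\ alive I asg p t, lo t = v, arr s aCOL (hi t) = j & arr u (aADJ j) v = (isg I t).+1]),
 forall a, a.1.1 != 3 -> arr u a = arr s a & forall x, x != vX -> var u x = var s x])).
 split=> // j v lj; left; rewrite z1 //; last by apply/hasP; exists j; rewrite ?mem_iota.
 by split=> // -[t []].
 move=> k u lk [h1 h2 h3]; pose k' := Ordinal lk.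
 set u1 := setv u vX k.
 have a1 a : a.1.1 != 3 -> arr u1 a = arr s a by exact: h2.
 have c1 : eval N u1 clE = arr s aCL k by rewrite -[LHS]/(arr u1 aCL k) a1.
 have c2 : eval N u1 fvE = arr s aFV k by rewrite -[LHS]/(arr u1 aFV k) a1.
 have v1 x : x != vX -> var u1 x = var s x by move=> nx; rewrite /u1 /= /upd (negbTE nx) h3.
 have Econd : (eval N u1 (AndE (Arr aALV XE) (LtE (Var vPv) (AddE clE 1))) != 0) = alive I asg p k'.
 rewrite eval_and eval_lt -[eval _ _ (Arr aALV XE)]/(arr u1 aALV k) -[eval N u1 (AddE _ _)]/(eval N u1 clE + 1).
 by rewrite c1 -[eval N u1 (Var vPv)]/(var u1 vPv) v1 // pv a1 // -al1 !Ez.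
 have step (u2 : store) : (forall a, a.1.1 != 3 -> arr u2 a = arr u1 a) -> var u2 = var u1 ->
 (forall j (v : 'I_N), j < nc -> arr u2 (aADJ j) v =
 if [&& alive I asg p k', lo k' == v & arr s aCOL (hi k') == j] then (isg I k').+1 else arr u1 (aADJ j) v) ->
 [/\ forall j (v : 'I_N), j < nc -> (arr u2 (aADJ j) v = 0 /\ ~ wr k.+1 j v) \/
 (exists t : 'I_N, [/\ alive I asg p t, lo t = v, arr s aCOL (hi t) = j & arr u2 (aADJ j) v = (isg I t).+1]),
 forall a, a.1.1 != 3 -> arr u2 a = arr s a & forall x, x != vX -> var u2 x = var s x].
 move=> e1 e2 e3; split; [|by move=> a na; rewrite e1 ?a1|by move=> x nx; rewrite e2 v1].
 move=> j v lj; rewrite e3 //; case: ifP => [/and3P [b1 /eqP b2 /eqP b3]|no].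
 by right; exists k'.
 case: (h1 j v lj) => [[b1 b2]|]; last by right.
 left; split=> // -[t [t1 t2 t3 t4]]; move: t1; rewrite ltnS leq_eqVlt => /orP [/eqP E|lt].
 have Et : t = k' by exact: val_inj.
 by move: no; rewrite -Et t2 t3 t4 !eqxx.
 by apply: b2; exists t.
 rewrite run_if Econd; case: ifP => [ak|nk]; last first.
 by apply: step => // j v lj; rewrite nk.
 have kL : isL I k' by case/and4P: ak.
 have [k1 k2 k3] := K3 _ kL.
 rewrite run_if eval_lt -[eval N u1 (Arr aPOS clE)]/(arr u1 aPOS (eval N u1 clE)) -[eval N u1 (Arr aPOS fvE)]/(arr u1 aPOS (eval N u1 fvE)).
 rewrite c1 c2 [arr s aCL k]k1 [arr s aFV k]k2 !a1 // -/(ps (icl I k')) -/(ps (ifv I k')).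
 have C1 : eval N u1 (Arr aCOL fvE) = arr s aCOL (ifv I k').
 by rewrite -[LHS]/(arr u1 aCOL (eval N u1 fvE)) c2 [arr s aFV k]k2 a1.
 have C2 : eval N u1 (Arr aCOL clE) = arr s aCOL (icl I k').
 by rewrite -[LHS]/(arr u1 aCOL (eval N u1 clE)) c1 [arr s aCL k]k1 a1.
 have St j0 e (w : 'I_N) : eval N u1 e = w -> run N (Store (aADJ j0) e (Arr aSG XE)) u1 = seta u1 (aADJ j0) w (isg I k').+1.
 by move=> Ee; rewrite -[LHS]/(seta u1 (aADJ j0) (eval N u1 e) (arr u1 aSG k)) Ee a1 // [arr s aSG k]k3.
 have fin j0 (w : 'I_N) : lo k' = w -> arr s aCOL (hi k') = j0 ->
 forall j (v : 'I_N), j < nc -> arr (seta u1 (aADJ j0) w (isg I k').+1) (aADJ j) v =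
 if [&& alive I asg p k', lo k' == v & arr s aCOL (hi k') == j] then (isg I k').+1 else arr u1 (aADJ j) v.
 move=> -> -> j v lj; rewrite ak andTb.
 rewrite -[arr (seta _ _ _ _) (aADJ j) v]/((if aADJ j == aADJ j0 then upd (arr u1 (aADJ j0)) w (isg I k').+1 else arr u1 (aADJ j)) v).
 case: (eqVneq j j0) => [->|nj]; first by rewrite !eqxx andbT /upd val_eqE eq_sym.
 have n1 : (aADJ j == aADJ j0) = false by apply/eqP => -[E]; rewrite E eqxx in nj.
 have n2 : (j0 == j) = false by rewrite eq_sym (negbTE nj).
 by rewrite n1 ?n2 andbF.
 case: ifP => lt.
 rewrite run_switch C1; last exact: (col (ifv I k')).
 rewrite (St _ _ (icl I k')); last by rewrite c1 [arr s aCL k]k1.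
 apply: step => //; last by apply: fin; rewrite /lo /hi lt.
 by move=> a na /=; case: eqP => // Ea; rewrite Ea in na.
 rewrite run_switch C2; last exact: (col (icl I k')).
 rewrite (St _ _ (ifv I k')); last by rewrite c2 [arr s aFV k]k2.
 apply: step => //; last by apply: fin; rewrite /lo /hi lt.
 by move=> a na /=; case: eqP => // Ea; rewrite Ea in na.
have ES : Sof nc n' s2 = EStr (eord (Sof nc n' s)) (ecol (Sof nc n' s)) (epar (Sof nc n' s)) (eadj (Sof nc n' s2)).
 by rewrite /Sof !y2.
have sr2 : srep n' s2 by case: sr => r1 r2 r3; split; rewrite ?y3 ?y2.
split=> //; apply: prevalid_valid; first by rewrite ES; case: pre => b h; exists b.
have Eo : eord (Sof nc n' s2) = eord (Sof nc n' s) by rewrite ES.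
have Ep v x : (index v (eord (Sof nc n' s2)) < index x (eord (Sof nc n' s2))) = (ps v < ps x).
 by rewrite Eo /ps !pos ltnS.
have Ec x : ecol (Sof nc n' s2) x = arr s aCOL x by rewrite ES.
rewrite /adjspec; cbv zeta => v j; rewrite -[eadj _ _ _]/(if j < nc then arr s2 (aADJ j) v else 0).
case: (ltnP j nc) => lj; last first.
 by left; split=> // x _ _; rewrite Ec neq_ltn (leq_trans (col x) lj).
case: (y1 j v lj) => [[z nw]|[t [t1 t2 t3 t4]]].
 left; split=> // x; rewrite Ep Ec => lt gx; apply/eqP => cx; apply: nw.
 have [t [t1 t2 _]] := ig_edgeP gx; exists t; split=> //.
 by rewrite /lo; case/orP: t2 => /andP [/eqP -> /eqP ->]; rewrite ?lt // ltnNge ltnW.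
 by rewrite -cx /hi; case/orP: t2 => /andP [/eqP -> /eqP ->]; rewrite ?lt // ltnNge ltnW.
have tL : isL I t by case/and4P: t1.
have neq : ps (icl I t) != ps (ifv I t).
 rewrite /ps !pos eqSS; apply/eqP => /(pos_eq ord) E.
 by case: Iok => k1 k2 _; have := k2 t tL; rewrite -E k1.
have e : ends I t v (hi t) by rewrite -t2 /lo /hi /ends; case: ifP; rewrite !eqxx ?orbT.
right; exists (hi t); rewrite Ep Ec (ig_alive t1 e) t4 -t2 /lo /hi; split=> //.
by case: ifP => // /negbT; rewrite -leqNgt leq_eqVlt eq_sym (negbTE neq).
Qed.

Definition amb asg s := irep s I /\ forall t : 'I_N, (arr s aALV t != 0) = alive I asg 0 t.

Lemma amb_ext asg s s' : (forall a, a \in [:: aKIND; aCL; aFV; aSG; aALV] -> arr s' a = arr s a) ->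
 amb asg s -> amb asg s'.
Proof. by move=> E [[k1 k2 k3] h]; split; [split|]; rewrite !E. Qed.

(** Only [cm] colours are in use, which leaves one for the vertex of the next stage; the last
    conjunct says that this vertex comes last. *)
Definition stinv asg i s := [/\ srep n' s, posrep s, prevalid cm (ig I asg (N - i)) (Sof nc n' s)
 & i < N -> forall v : 'I_N, index v (eord (Sof nc n' s)) <= index (inord (N - i - 1)) (eord (Sof nc n' s))].

Definition stage_inv asg i s := [/\ amb asg s, var s vFail = 0 -> stinv asg i s
 & var s vFail != 0 -> exists p P, ginv T (ig I asg p) s P].

Lemma nbrs0 (g : 'I_N -> 'I_N -> nat) v : #|nbrs g [set x in [::]] v| = 0.
Proof. by apply/eqP; rewrite cards_eq0; apply/eqP/setP => x; rewrite !inE. Qed.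

Definition copy_src (a : aid) := if a == aORD then aNORD else if a == aCOL then aNCOL else if a == aPAR then aNPAR else aNPOS.

Lemma copy_bodyP n t k : var t vX = k -> forall a, a \in [:: aORD; aCOL; aPAR; aPOS] ->
 let t' := run n (seqs [:: Store aORD XE (Arr aNORD XE); Store aCOL XE (Arr aNCOL XE);
 Store aPAR XE (Arr aNPAR XE); Store aPOS XE (Arr aNPOS XE)]) t in
 arr t' a k = arr t (copy_src a) k /\ forall j, j != k -> arr t' a j = arr t a j.
Proof.
move=> Ek a; rewrite !inE => /or4P [] /eqP ->; rewrite /= Ek;
 by split=> [|j nj]; rewrite /upd ?eqxx // (negbTE nj).
Qed.

Lemma stageP asg i s : i < N -> var s vSt = i -> stage_inv asg i s ->
 stage_inv asg i.+1 (run N stage s).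
Proof.
move=> li Ei [am st fl]; rewrite /stage run_if -[eval _ _ (Var vFail)]/(var s vFail).
case: ifP => [f|/negbFE/eqP f]; first by split=> // E; rewrite E in f.
have [sr pos pre top] := st f.
have lp : N - i - 1 < N by lia.
pose p := Ordinal lp; have Ip : inord (N - i - 1) = p by apply: val_inj; rewrite /= inordK.
rewrite Ip in top.
rewrite 10!run_seqs_cons run_seqs_nil; set s1 := run N (Assign vPv _) s.
have p1 : var s1 vPv = p by rewrite /s1 /= /upd eqxx Ei; lia.
set s2 := run N (Store aCOL _ _) s1; set s3 := run N cone_par s2.
have E2 : arr s2 = fun b => if b == aCOL then upd (arr s aCOL) p cm else arr s b.
 by rewrite /s2 -[arr _]/(fun b => if b == aCOL then upd (arr s aCOL) (var s1 vPv) cm else arr s b) p1.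
have v2 : var s2 vPv = p by exact: p1.
have [||w1 w2 w3] := @pointwise N (If (EqE XE (Var vPv)) Skip
 (If (EqE (Arr aPAR XE) (Num 3)) (Store aPAR XE (AddE (Var vPv) 4)) Skip)) s2 (pred1 aPAR)
 (fun _ i => if i == p then arr s aPAR i else if arr s aPAR i == 3 then p + 4 else arr s aPAR i).
- by [].
- move=> t k _ Ek ov _ oa a /eqP ->; have Ea : arr t aPAR k = arr s aPAR k by rewrite oa // E2.
 rewrite run_if eval_eq -[eval _ _ XE]/(var t vX) -[eval _ _ (Var vPv)]/(var t vPv) Ek ov // v2.
 case: ifP => _; first by rewrite Ea.
 rewrite run_if eval_eq -[eval _ _ (Arr aPAR XE)]/(arr t aPAR (var t vX)) -[eval _ _ (Num 3)]/3 Ek Ea.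
 case: ifP => _; last by rewrite Ea.
 rewrite -[run _ _ _]/(seta t aPAR (var t vX) (var t vPv + 4)) Ek ov // v2 /= /upd eqxx.
 by split=> // j /negbTE ->.
rewrite -/cone_par -/s3 in w1 w2 w3.
have E3 a : a != aPAR -> a != aCOL -> arr s3 a = arr s a.
 by move=> a1 a2; rewrite w2 // E2 (negbTE a2).
have C3 : arr s3 aCOL = upd (arr s aCOL) p cm by rewrite w2 // E2.
have par0 : arr s aPAR p = 3.
 have [bag [[_ _ po] _ _ _]] := pre; have := po p; rewrite [epar _ _]/=.
 by case: eqP => // _ /(_ _ erefl); rewrite ltnNge top.
have S3 : Sof nc n' s3 = cone cm p (Sof nc n' s) (eadj (Sof nc n' s3)).
 rewrite /Sof /cone E3 //=; congr EStr; apply/funext => v.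
 by rewrite C3 /upd val_eqE.
 rewrite w1 // val_eqE; case: (eqVneq v p) => [->|vp]; first by rewrite par0.
 case E : (arr s aPAR v == 3); last by rewrite /= E.
 have -> : (p + 4 == 3) = false by apply/eqP; lia.
 by rewrite addnK inord_val.
have sr3 : srep n' s3.
 case: sr => r1 r2 r3; split; first by rewrite w3.
 by move=> k lk; rewrite E3 //; exact: r2.
 move=> v; rewrite w1 //; case: ifP => _; first exact: r3.
 by case: ifP => _; [right; have := ltn_ord p; lia|exact: r3].
have pre3 : prevalid nc (ig I asg p) (Sof nc n' s3).
 rewrite S3; apply: (@prevalid_cone _ cm (ig I asg p.+1)).
 - by rewrite (_ : p.+1 = N - i) //=; lia.
 - exact: top.
 - by move=> u v; exact: ig_step.
have am3 : amb asg s3.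
 by apply: amb_ext am => a; rewrite !inE => /or4P [|||/orP []] /eqP ->; rewrite E3.
have pos3 : posrep s3 by move=> v; rewrite E3 // pos S3.
set s4 := run N adj_code s3.
have so4 : struct_ok T (ig I asg p) s4.
 by case: am3 => a1 a2; apply: adj_codeP => //; rewrite w3.
have A4 a : a.1.1 != 3 -> arr s4 a = arr s3 a by move=> na; rewrite (ok_arr _ _ ok_adj).
have V4 x : x != vX -> var s4 x = var s3 x by move=> nx; rewrite (ok_var _ _ ok_adj).
have [||z1 z2 z3] := @pointwise N (Store aNPOS XE (Num 0)) s4 (pred1 aNPOS) (fun _ _ => 0).
- by [].
- move=> t k _ Ek _ _ _ a /eqP ->; rewrite /= Ek; split=> [|j nj]; rewrite /upd ?eqxx //.
 by rewrite (negbTE nj).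
set s5 := run N (Loop vX (Store aNPOS XE (Num 0))) s4 in z1 z2 z3 *.
set s6 := run N (Assign vCnt Size) s5; set s7 := run N (Assign vTg _) s6.
have so7 : struct_ok T (ig I asg p) s7.
 apply: struct_ext so4; first by rewrite -[var s7 vTop]/(var s5 vTop) z3.
 move=> a ya; rewrite -[arr s7 a]/(arr s5 a) z2 //=; apply: contraTneq ya => ->; by [].
have rs7 : rsrep T (ig I asg p) s7 [::].
 split=> //; first by rewrite /= addn0.
 - by move=> v; rewrite -[arr s7 _]/(arr s5 aNPOS) z1.
 - by split=> // -[|].
have ltw : p - 1 < N by have := ltn_ord p; lia.
pose w := Ordinal ltw.
have tg7 : var s7 vTg = val w.
 by rewrite -[var s7 vTg]/(var s5 vPv - 1) z3 // V4 // w3 // v2.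
set s8 := run N (place _ _) s7.
have rs8 : rsrep T (ig I asg p) s8 [:: w].
 apply: placeP => //; first exact: ig_sym.
 - exact: ig_irr.
 - exact: ig_lt3.
 by rewrite nbrs0.
have so8 : struct_ok T (ig I asg p) s8 by apply: ok_struct (ok_place _ _) _ (@Ys_Yr) so7.
have F8 : var s8 vFail = 0.
 rewrite (ok_var _ _ (ok_placeX _ _)) //.
 by rewrite -[var s7 vFail]/(var s5 vFail) z3 // V4 // w3.
(* Only [w] is placed so far, so every boundary has at most one vertex. *)
have g8 : ginv T (ig I asg p) s8 [:: w].
 split=> //; last by rewrite F8.
 move=> _ v vw; have sub : [set x in [::] : seq 'I_N] \subset [set x in [:: w]].
 by apply/subsetP => x; rewrite !inE.
 apply: leq_trans (nbrs_grow _ sub _) _; first by rewrite inE.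
 rewrite nbrs0 add0n; apply: (@leq_trans 1); last by rewrite /sz; lia.
 apply: leq_trans (subset_leq_card (subsetDl _ _)) _.
 by rewrite -(cards1 w); apply/subset_leq_card/subsetP => x; rewrite !inE.
set s9 := run N (rebuild T) s8.
have [|||Q [g9 full]] := @rebuildP T n' (ig I asg p) _ _ _ s8 [:: w] g8.
- exact: ig_sym.
- exact: ig_irr.
- exact: ig_lt3.
rewrite -/s9 in g9 full.
have am9 : amb asg s9.
 have o8 a : a \in [:: aKIND; aCL; aFV; aSG; aALV] -> arr s9 a = arr s3 a.
 move=> ha; rewrite (ok_arr _ _ (ok_loop (x := vU) (X := xpredT) isT (ok_sub (leqnn 1) (fun _ _ => isT) (fun _ h => h) (ok_group T)))).
 rewrite (ok_arr _ _ (ok_place _ _)).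
 rewrite -[arr s7 a]/(arr s5 a) z2; last by apply: contraTneq ha => ->.
 by rewrite A4 //; move: ha; rewrite !inE => /or4P [|||/orP []] /eqP ->.
 by move: ha; rewrite !inE => /or4P [|||/orP []] /eqP ->.
 by move: ha; rewrite !inE => /or4P [|||/orP []] /eqP ->.
 exact: amb_ext o8 am3.
rewrite run_if -[eval N s9 (Var vFail)]/(var s9 vFail); case: ifP => [f9|/negbFE/eqP f9].
 by split=> // [E|_]; [rewrite E in f9|exists p, (Q ++ [:: w])].
have [_ rs9 _ _] := g9; have all9 := full f9; set P := Q ++ [:: w] in rs9 all9.
have [r1 r2 r3 r4 r5] := rs9.
have uP : uniq P by case: r5.
have szP : size P = N by rewrite -(card_uniqP uP) -[RHS]card_ord; apply: eq_card => x; rewrite inE all9.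
have c9 : var s9 vCnt = 0 by lia.
pose cp := copy_src.
have [||y1 y2 y3] := @pointwise N (seqs [:: Store aORD XE (Arr aNORD XE); Store aCOL XE (Arr aNCOL XE);
 Store aPAR XE (Arr aNPAR XE); Store aPOS XE (Arr aNPOS XE)]) s9
 (fun a => a \in [:: aORD; aCOL; aPAR; aPOS]) (fun a i => arr s9 (cp a) i).
- by [].
- move=> t k _ Ek _ oa _ a ha; have [c1 c2] := copy_bodyP N Ek ha; split=> //.
 by rewrite c1 oa //; move: ha; rewrite !inE => /or4P [] /eqP ->.
rewrite -/copyback in y1 y2 y3; set s10 := run N copyback s9 in y1 y2 y3 *.
have ES : Sof nc n' s10 = EStr P (ncolf s9) (nparf s9) (eadj (Sof nc n' s10)).
 rewrite {1}/Sof; congr EStr.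
 - apply: (eq_from_nth (x0 := w)) => [|k]; rewrite size_map size_iota // => lk.
 rewrite (nth_map 0) ?size_iota // nth_iota // add0n y1 // /cp /=.
 by have := r2 k w; rewrite c9 add0n szP => -> //; rewrite inord_val.
 - by apply/funext => v; rewrite y1.
 - by apply/funext => v; rewrite y1.
split.
- apply: amb_ext am9 => a ha; apply: y2; move: ha; rewrite !inE.
 by move=> /or4P [|||/orP []] /eqP ->.
- move=> _; split.
 + case: (so8) => -[q1 _ _] _; split.
 * rewrite y3 // (ok_var _ _ (ok_loop (X := fun x => Xr x || (x == vU)) _ (ok_sub (leqnn 1) _ (fun _ h => h) (ok_group T)))) //.
 by move=> x; rewrite /= => ->.
 * by move=> k lk; rewrite y1 // /cp /=; have := r2 k w; rewrite c9 add0n szP => -> //.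
 * by move=> v; rewrite y1 //; exact: r4.
 + by move=> v; rewrite y1 // ES /cp /= r3 all9 c9 add0n.
 + rewrite (_ : N - i.+1 = p); last by rewrite /=; lia.
 by rewrite ES; apply: placed_prevalid => //; exact: ig_sym.
 + move=> _ v; rewrite ES /=.
 have -> : inord (N - i.+1 - 1) = w by apply: val_inj; rewrite /= inordK; lia.
 have iw : index w P = size Q.
 rewrite /P index_cat ifN /= ?eqxx ?addn0 //.
 by move: uP; rewrite /P cat_uniq /= orbF => /and3P [_].
 by have := all9 v; rewrite -index_mem iw -[size P]/(size (Q ++ [:: w])) size_cat addn1 ltnS.
- move=> h; have : var s10 vFail = 0 by rewrite y3.
 by move=> E; rewrite E in h.
Qed.

Lemma init_ord : [seq inord i | i <- iota 0 N] = enum 'I_N.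
Proof.
by rewrite -val_enum_ord -map_comp map_id_in // => i _; rewrite /= inord_val.
Qed.

Lemma buildP s : irep s I -> let s' := run N build s in
 [/\ var s' vFail = 0 -> struct_ok T (ig I (asgf s) 0) s',
 var s' vFail != 0 -> exists p P, ginv T (ig I (asgf s) p) s' P
 & forall c : 'I_N, (arr s' aDEAD c != 0) = sats I (asgf s) c].
Proof.
move=> ir s'; set asg := asgf s.
have [a1 a2 [a3 a4]] := alive_codeP ir; pose s1 := run N alive_code s.
rewrite -/s1 -/asg in a1 a2 a3 a4.
have ir1 : irep s1 I by case: ir => k1 k2 k3; split; rewrite !a3.
pose cp a i := if a == aORD then i else if a == aCOL then 0 else if a == aPAR then 3 else i.+1.
have [||y1 y2 y3] := @pointwise N (seqs [:: Store aORD XE XE; Store aCOL XE (Num 0);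
 Store aPAR XE (Num 3); Store aPOS XE (AddE XE 1)]) s1 (fun a => a \in [:: aORD; aCOL; aPAR; aPOS]) cp.
- by [].
- move=> t k _ Ek _ oa _ a; rewrite !inE => /or4P [] /eqP ->; rewrite /= Ek ?addn1;
 split=> [|j nj]; rewrite /upd ?eqxx //; by rewrite (negbTE nj).
rewrite -/init_code in y1 y2 y3; pose s2 := run N init_code s1; rewrite -/s2 in y1 y2 y3.
pose s3 := setv (setv s2 vFail 0) vTop N.
have Es : s' = run N (If (Var vFail) Skip (Seq (Assign vPv (Num 0)) adj_code)) (run N (Loop vSt stage) s3).
 by rewrite /s' /build 6!run_seqs_cons run_seqs_nil.
have E0 : eord (Sof nc n' s3) = enum 'I_N.
 by rewrite -init_ord; apply/eq_in_map => k; rewrite mem_iota add0n => lk; rewrite -[arr s3 _]/(arr s2 aORD) y1.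
have I0 : stage_inv asg 0 s3.
 split=> //.
 split.
 by case: ir1 => k1 k2 k3; split; rewrite -?[arr s3]/(arr s2) !y2.
 by move=> t; rewrite -[arr s3]/(arr s2) y2.
 move=> _; split.
 - split=> //; first by move=> k lk; rewrite -[arr s3]/(arr s2) y1.
 by move=> v; left; rewrite -[arr s3]/(arr s2) y1.
 - by move=> v; rewrite E0 index_enum_ord -[arr s3]/(arr s2) y1.
 - have A32 : arr s3 = arr s2 by [].
 have PN v : epar (Sof nc n' s3) v = None by rewrite -[epar _ v]/(if arr s2 aPAR v == 3 then None else Some (inord (arr s2 aPAR v - 4))) y1.
 exists (fun=> set0); split.
 + rewrite /ordered E0; split; [exact: enum_uniq|by move=> v; rewrite mem_enum|].
 by move=> v q; rewrite PN.
 + by split=> [v|v x]; [rewrite -[ecol _ v]/(arr s2 aCOL v) y1|rewrite inE].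
 + by split=> [v x y|v x]; rewrite ?inE // subn0 ig_none.
 + by move=> v; rewrite PN.
 - by move=> _ v; rewrite E0 !index_enum_ord inordK; have := ltn_ord v; lia.
have LN : stage_inv asg N (run N (Loop vSt stage) s3).
 apply: (@run_loop N vSt stage s3 (stage_inv asg)) => // i t li [b1 b2 b3].
 exact: stageP.
set s4 := run N (Loop vSt stage) s3 in LN Es.
have D4 : arr s4 aDEAD = arr s1 aDEAD.
 have o : ok 3 xpredT (fun a => Yst a && (a != aDEAD)) (Loop vSt stage).
 apply: ok_loop => //; apply: ok_if; first exact: ok_skip.
 apply: ok_seqs; split; first by []. split; first by []. split; first by [].
 split.
 apply: (ok_sub (_ : 1 <= 2) _ _ ok_adj) => // a h; rewrite /Yst /Ys h orbT /=.
 by apply: contraTneq h => ->.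
 split; first by []. split; first by []. split; first by [].
 split.
 apply: (ok_sub (_ : 1 <= 2) _ _ (ok_place _ _)) => // a h; rewrite /Yst /Yg h /=.
 by apply: contraTneq h => ->.
 split; last by [].
 apply: ok_loop => //; apply: (ok_sub (leqnn 1) _ _ (ok_group T)) => // a h.
 by rewrite /Yst h /=; apply: contraTneq h => ->.
 rewrite (ok_arr _ _ o); last by rewrite eqxx andbF.
 by rewrite -[arr s3 aDEAD]/(arr s2 aDEAD) y2.
have [l1 l2 l3] := LN; rewrite Es run_if -[eval N s4 (Var vFail)]/(var s4 vFail).
case: ifP => [f|/negbFE/eqP f].
 split=> [E||c]; [by rewrite E in f|exact: l3|by rewrite -[run N Skip s4]/s4 D4].
have [sr pos pre _] := l2 f; rewrite subnn in pre.
rewrite run_seq; set s5 := run N (Assign vPv (Num 0)) s4.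
have pre5 : prevalid nc (ig I asg 0) (Sof nc n' s5).
 case: pre => bag [b1 [b2 b3] b4 b5]; exists bag; split=> //; split=> //.
 by move=> v; apply: leq_trans (b2 v) _; rewrite /nc /cm /ncol.
split.
- by move=> _; case: l1 => ia al; apply: adj_codeP.
- by rewrite (ok_var _ _ ok_adj) //= /upd /= f.
- by move=> c; rewrite (ok_arr _ _ ok_adj) // -[arr s5 aDEAD]/(arr s4 aDEAD) D4.
Qed.

End Stage.

(** * Models and hidden backdoors of an instance *)

Section Models.
Variables (n' : nat).
Let N := n'.+1.
Variable I : inst N.
Hypothesis Iok : iok I.

Definition free (asg : 'I_N -> nat) := [set x in ivars I | asg x == 0].
Definition acls (asg : 'I_N -> nat) := [set c | isC I c && ~~ sats I asg c].

Lemma ivarsP t : isL I t -> ifv I t \in ivars I.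
Proof. by move=> tL; rewrite inE; apply/existsP; exists t; rewrite tL eqxx. Qed.

Lemma ivars_C x : x \in ivars I -> ~~ isC I x.
Proof. by rewrite inE => /existsP [t /andP [tL /eqP <-]]; case: Iok => _ h _; exact: h. Qed.

Lemma modelsP (asg : 'I_N -> nat) (M : {set 'I_N}) :
 reflect [/\ M \subset ivars I, forall x, x \in ivars I -> asg x != 0 -> (x \in M) = (asg x == 2)
 & forall c, isC I c -> exists t, [/\ isL I t, icl I t = c & isg I t = (ifv I t \in M)]]
 (M \in models I asg).
Proof.
rewrite inE; apply: (iffP and3P) => -[h1 h2 h3]; split=> //.
- by move=> x xV ax; have /forall_inP/(_ x xV)/implyP/(_ ax)/eqP := h2.
- move=> c cC; have /forallP/(_ c)/implyP/(_ cC)/existsP [t /and3P [t1 /eqP t2 /eqP t3]] := h3.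
 by exists t.
- by apply/forall_inP => x xV; apply/implyP => ax; apply/eqP; exact: h2.
- apply/forallP => c; apply/implyP => /h3 [t [t1 t2 t3]]; apply/existsP; exists t.
 by rewrite t1 t2 t3 !eqxx.
Qed.

Definition set_of (m : marking 'I_N 1) := [set v | 0 < m v].

(** A model is determined by its free variables, and only the clauses not satisfied by [asg]
    constrain them. *)
Lemma models_count (asg : 'I_N -> nat) : (forall x, asg x <= 2) ->
 #|models I asg| = #|[set m : marking 'I_N 1 |
 `[< sat (ig I asg 0) [:: chi (set_of m); chi (free asg); chi (acls asg)] ModelF >]]|.
Proof.
move=> a2; pose f (M : {set 'I_N}) : marking 'I_N 1 := [ffun v => if v \in M :&: free asg then inord 1 else ord0].
have fE M : set_of (f M) = M :&: free asg.
 by apply/setP => v; rewrite inE ffunE; case: ifP => // _; rewrite inordK.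
have mE (m : marking 'I_N 1) v : m v = if v \in set_of m then inord 1 else ord0.
 rewrite inE; apply: val_inj; case: ifP => h; rewrite /= ?inordK //; have := ltn_ord (m v); lia.
have freeV x : x \in free asg -> x \in ivars I /\ asg x = 0 by rewrite inE => /andP [-> /eqP].
have edge c t : isC I c -> ends I t c (ifv I t) -> isL I t -> icl I t = c.
 move=> cC /orP [/andP [/eqP //]|/andP [/eqP e1 /eqP e2]] tL.
 by have [_ h _] := Iok; have := h t tL; rewrite e2 cC.
rewrite -(card_in_imset (f := f)); last first.
 move=> M M' /modelsP [s1 a1 _] /modelsP [s2 a2' _] E; apply/setP => x.
 case: (boolP (x \in ivars I)) => xV; last first.
 by rewrite (contraNF (subsetP s1 x) xV) (contraNF (subsetP s2 x) xV).
 case: (eqVneq (asg x) 0) => [a0|na]; last by rewrite a1 // a2'.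
 have xF : x \in free asg by rewrite inE xV a0.
 by have := fE M; rewrite E fE => /setP /(_ x); rewrite !in_setI xF !andbT => ->.
congr #|pred_of_set _|; apply/setP => m; rewrite [in RHS]inE.
apply/imsetP/asboolP => [[M /modelsP [sM aM cM] ->]|].
 apply/sat_model; rewrite fE; split; first exact: subsetIr.
 move=> c; rewrite inE => /andP [cC ns]; have [t [tL tc tg]] := cM c cC.
 have a0 : asg (ifv I t) = 0.
 apply/eqP; apply: contraNT ns => na; apply/existsP; exists t; rewrite tL tc eqxx /= tg aM ?ivarsP //.
 by have := a2 (ifv I t); move: na; case: (asg _) => [|[|[|]]].
 have al : alive I asg 0 t by rewrite /alive tL a0 eqxx tc ns.
 have en : ends I t c (ifv I t) by rewrite /ends tc !eqxx.
 exists (ifv I t); rewrite /gr (ig_alive Iok al en); split=> //.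
 have xF : ifv I t \in free asg by rewrite inE ivarsP // a0.
 by rewrite in_setI -tg xF andbT eqSS; case: (isg I t).
move/sat_model => [sF cl]; pose M := set_of m :|: [set x in ivars I | asg x == 2].
have MF x : x \in free asg -> (x \in M) = (x \in set_of m).
 by case/freeV => _ a0; rewrite /M in_setU [in X in _ || X]inE a0 /= andbF orbF.
exists M; last first.
 apply/ffunP => v; rewrite ffunE {1}mE in_setI; case: (boolP (v \in free asg)) => vF; first by rewrite MF // andbT.
 by rewrite andbF (contraNF (subsetP sF v) vF).
apply/modelsP; split.
- rewrite subUset; apply/andP; split; apply/subsetP => x; last by rewrite inE => /andP [].
 by move/(subsetP sF)/freeV => [].
- move=> x xV na; rewrite /M in_setU [in X in _ || X]inE xV /=.
 suff -> : (x \in set_of m) = false by [].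
 by apply/negP => /(subsetP sF)/freeV [_ a0]; rewrite a0 in na.
move=> c cC; case: (boolP (sats I asg c)) => [/existsP [t /and3P [tL /eqP tc /eqP ta]]|ns].
 exists t; split=> //; rewrite /M in_setU [in X in _ || X]inE ivarsP // ta.
 have -> : (ifv I t \in set_of m) = false.
 by apply/negP => /(subsetP sF)/freeV [_ a0]; rewrite a0 in ta.
 by case: (isg I t).
have cA : c \in acls asg by rewrite inE cC.
have [x [gx ex]] := cl c cA; have [t [al en gt]] := ig_edgeP gx.
have tL : isL I t by case/and4P: al.
have [tc tx] : icl I t = c /\ ifv I t = x.
 case/orP: en => /andP [/eqP e1 /eqP e2] //.
 by have [_ h _] := Iok; have := h t tL; rewrite e2 cC.
exists t; split=> //; rewrite gt in ex; rewrite tx MF; last first.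
 by rewrite inE -tx ivarsP //; case/and4P: al.
by rewrite -ex eqSS; case: (isg I t).
Qed.

Definition setasg (asg : 'I_N -> nat) x b v := if v == x then b else asg v.

Lemma models_split (asg : 'I_N -> nat) x : x \in ivars I -> asg x = 0 ->
 #|models I asg| = #|models I (setasg asg x 1)| + #|models I (setasg asg x 2)|.
Proof.
move=> xV a0; rewrite -(cardsID [set M : {set 'I_N} | x \notin M] (models I asg)); congr (_ + _).
 congr #|pred_of_set _|; apply/setP => M; rewrite in_setI [in X in _ && X]inE; apply/andP/modelsP.
 case=> /modelsP [h1 h2 h3] nx; split=> // y yV; rewrite /setasg; case: (eqVneq y x) => [->|_] ny; last exact: h2 yV ny.
 exact: negbTE.
 case=> h1 h2 h3; split; last by rewrite h2 // /setasg eqxx.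
 apply/modelsP; split=> // y yV ny; have := h2 y yV; rewrite /setasg; case: (eqVneq y x) => [E|_] h; last exact: h ny.
 by rewrite E a0 in ny.
congr #|pred_of_set _|; apply/setP => M; rewrite in_setD [in X in ~~ X]inE negbK andbC; apply/andP/modelsP.
 case=> /modelsP [h1 h2 h3] nx; split=> // y yV; rewrite /setasg; case: (eqVneq y x) => [->|_] ny; last exact: h2 yV ny.
 exact: nx.
case=> h1 h2 h3; split; last by rewrite h2 // /setasg eqxx.
apply/modelsP; split=> // y yV ny; have := h2 y yV; rewrite /setasg; case: (eqVneq y x) => [E|_] h; last exact: h ny.
by rewrite E a0 in ny.
Qed.

(** Some cell is not a variable, so there are fewer than [N] variables. A count modulo [2 ^ N] thus
    determines the number of models. *)
Lemma card_models (asg : 'I_N -> nat) : #|models I asg| < 2 ^ N.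
Proof.
have sub : models I asg \subset powerset (ivars I).
 by apply/subsetP => M /modelsP [h _ _]; rewrite powersetE.
apply: leq_ltn_trans (subset_leq_card sub) _; rewrite card_powerset ltn_exp2l //.
have [E|[x xV]] := set_0Vmem (ivars I); first by rewrite E cards0.
have := xV; rewrite inE => /existsP [t /andP [tL _]].
have [h1 _ _] := Iok; have c1 := h1 t tL.
have : icl I t \notin ivars I by apply: contraL c1 => /ivars_C.
move=> nV; apply: (@leq_trans #|[set: 'I_N]|); last by rewrite cardsT card_ord.
by apply: proper_card; rewrite properT; apply: contraNneq nV => ->; rewrite in_setT.
Qed.

Variables (w k : nat).

Lemma hidden_step j (asg : 'I_N -> nat) B x b : hidden I w j.+1 asg B -> x \in B -> (b == 1) || (b == 2) ->
 hidden I w j (setasg asg x b) (B :\ x).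
Proof.
move=> [h1 h2 h3 h4] xB hb; split.
- by move: h1; rewrite (cardsD1 x) xB.
- exact: subset_trans (subsetDl _ _) h2.
- by move=> y; rewrite !inE => /andP [yx yB]; rewrite /setasg (negbTE yx) h3.
move=> asg' e1 e2; apply: h4 => y.
 move=> yB; rewrite e1 /setasg; last by rewrite !inE (negbTE yB) andbF.
 by case: eqP => // E; rewrite E xB in yB.
case: (eqVneq y x) => [->|yx] yB; last by apply: e2; rewrite !inE yx.
by rewrite e1 ?inE ?eqxx // /setasg eqxx.
Qed.

(** The hidden backdoor concerns the whole formula, the failing stage only the clauses inserted so
    far. An edge of the partial graph that survives an assignment of [B] also survives in the whole
    reduct, and fill-in neighbourhoods are monotone in the edges. *)
Lemma hidden_good j (asg : 'I_N -> nat) B p x0 W : hidden I w j asg B ->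
 backdoor_like (gr (ig I asg p)) (fun v => v \in free asg) (sg (ig I asg p)) w x0 W B.
Proof.
move=> [h1 h2 h3 h4]; apply: order_backdoor_like.
 by move=> u v; rewrite /gr ig_sym.
move=> tau tB; pose asg' x := if x \in B then (if x \in tau then 2 else 1) else asg x.
have [||r rinj rw] := h4 asg'.
- by move=> x /negbTE nB; rewrite /asg' nB.
- by move=> x xB; rewrite /asg' xB; case: ifP.
exists r => // v; apply: leq_trans (rw v); apply: subset_leq_card; apply: elim_nbrs_sub.
move=> a b /and3P [gab ha hb]; have [t [al en _]] := ig_edgeP gab.
have [tL pt a0 ns] := and4P al.
have [nv nc] : ifv I t \notin killed (gr (ig I asg p)) (sg (ig I asg p)) B tau /\
 icl I t \notin killed (gr (ig I asg p)) (sg (ig I asg p)) B tau.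
 rewrite !in_setC in ha hb; case/orP: en => /andP [/eqP e1 /eqP e2]; rewrite e1 e2; by split.
have nB : ifv I t \notin B by apply: contra nv => vB; rewrite inE vB.
have al' : alive I asg' 0 t.
 rewrite /alive tL /asg' (negbTE nB) a0 /=; apply/negP => /existsP [t' /and3P [tL' /eqP tc' ta']].
 case: (boolP (ifv I t' \in B)) ta' => vB; last first.
 by move=> ta'; case/negP: ns; apply/existsP; exists t'; rewrite tL' tc' eqxx.
 move=> ta'; case/negP: nc.
 have al2 : alive I asg p t' by rewrite /alive tL' tc' pt ns h3 // eqxx.
 have en2 : ends I t' (ifv I t') (icl I t) by rewrite /ends tc' !eqxx orbT.
 rewrite inE; apply/orP; right; rewrite inE; apply/existsP; exists (ifv I t'); rewrite vB /=.
 rewrite /gr /sg (ig_alive Iok al2 en2); move: ta'.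
 by case: (ifv I t' \in tau); case: (isg I t').
by rewrite /gr (ig_alive Iok al' en).
Qed.

Lemma ig_bip asg p u v : gr (ig I asg p) u v -> u \in free asg -> v \notin free asg.
Proof.
move=> /ig_edgeP [t [/and4P [tL _ _ _] en _]]; rewrite inE => /andP [/ivars_C uC _].
have [h1 _ _] := Iok; case/orP: en => /andP [/eqP e1 /eqP e2]; first by rewrite -e1 h1 in uC.
by apply/negP; rewrite inE => /andP [/ivars_C]; rewrite -e1 h1.
Qed.

End Models.

(** * The branching algorithm *)

Definition aISV : aid := (0, 17, 0).
Definition aFORB : aid := (0, 18, 0).
(** Candidates, results and flags carry the recursion level: the recursion is unfolded into the
    program text, and a call at level [j] must leave the data of level [j.+1] intact. *)
Definition aS j i : aid := (5, j, i).
Definition aR j : aid := (6, j, 0).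
Definition aOne : aid := (7, 0, 0).
Definition aFl j : aid := (8, j, 0).
Definition aTf j : aid := (9, j, 0).

Lemma boneP n a x s : ~~ Xb x -> 0 < n -> let s' := run n (bone a x) s in
 [/\ bits2 n s' a (var s x), low n s' a (var s x) n = 1, forall b, b != a -> arr s' b = arr s b
 & forall y, y != vB1 -> var s' y = var s y].
Proof.
move=> nx n0; have [h h2 h3] := bzeroP n a s nx.
rewrite /bone run_seq; set s1 := run n (bzero _ _) s in h h2 h3 *.
have xB : x != vB1 by apply: contraNneq nx => ->.
have E i : i < n -> arr (run n (Store a (dig x (Num 0)) (Num 1)) s1) a (var s x * n + i) = (i == 0).
 move=> lt; rewrite /= eqxx h3 // /upd addn0; case: (posnP i) => [->|i0].
 by rewrite addn0 eqxx.
 by rewrite ifN ?h // -?lt0n // -{2}[_ * n]addn0 eqn_add2l -lt0n.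
split.
- by move=> i lt; rewrite E //; case: eqP.
- rewrite /low (bigD1 (Ordinal n0)) // (E (Ordinal n0) n0) big1 ?addn0 // => i ni.
 by rewrite E // -[_ == 0]/(val i == val (Ordinal n0)) val_eqE (negbTE ni).
- by move=> b nb; rewrite /= (negbTE nb); apply/funext => i; apply: h2 => -[E' _]; rewrite E' eqxx in nb.
- exact: h3.
Qed.

(** * Adding counts across recursion levels *)

Section Sums.
Variable n' : nat.
Let N := n'.+1.

(** The only addition available is [baddmul], so a summand is multiplied by the number 1. Its
    destination must have another block number than its operands, even in other arrays; the result
    of level [j] therefore lies in block [j.+1]. *)
Definition zeroR j := Seq (Assign vT1 (Num j.+1)) (bzero (aR j) vT1).
Definition addR j a nd := seqs [:: Assign vT1 (Num j.+1); Assign vT2 (Num nd); Assign vMk (Num j.+2);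
 bone aOne vMk; baddmul (aR j) vT1 aOne vMk a vT2].

Definition rval s j v := bits2 N s (aR j) j.+1 /\ low N s (aR j) j.+1 N = v %[mod 2 ^ N].

Lemma zeroRP j s : rval (run N (zeroR j) s) j 0.
Proof.
rewrite /zeroR run_seq; set s1 := run N (Assign _ _) s.
have [h _ _] := @bzeroP N (aR j) vT1 s1 isT; rewrite -[var s1 vT1]/(j.+1) in h.
split=> [i lt|]; first by rewrite h.
by rewrite /low big1 // => i _; rewrite h.
Qed.

Lemma addRP j a nd s v v' : rval s j v -> bits2 N s a nd -> low N s a nd N = v' %[mod 2 ^ N] ->
 a != aOne -> nd != j.+1 -> rval (run N (addR j a nd) s) j (v + v').
Proof.
move=> [b l] ba la na nn; rewrite /addR 5!run_seqs_cons run_seqs_nil.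
set s3 := run N (Assign vMk _) _.
have [h1 h2 h3 h4] := @boneP N aOne vMk s3 isT isT; set s4 := run N (bone _ _) s3 in h1 h2 h3 h4 *.
have E1 : var s4 vT1 = j.+1 by rewrite h4.
have E2 : var s4 vT2 = nd by rewrite h4.
have E3 : var s4 vMk = j.+2 by rewrite h4.
rewrite -[var s3 vMk]/(j.+2) in h1 h2.
have same c x : c != aOne -> low N s4 c x N = low N s c x N /\ (bits2 N s c x -> bits2 N s4 c x).
 move=> nc; split; first by apply: low_ext => i _; rewrite h3.
 by move=> h i lt; rewrite h3 //; exact: h.
have [l1 b1] := same (aR j) j.+1 isT; have [l2 b2] := same a nd na.
have [||||||||g1 g2 _] := @baddmulP N (aR j) vT1 aOne vMk a vT2 s4.
- by [].
- by [].
- by [].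
- by rewrite E1 E3; lia.
- by rewrite E1 E2; apply/eqP; rewrite eq_sym.
- by rewrite E1; exact: b1.
- by rewrite E3.
- by rewrite E2; exact: b2.
rewrite E1 E2 E3 in g1 g2; split=> //.
by rewrite g2 h2 mul1n l1 l2 -modnDm l la modnDm.
Qed.

End Sums.

Definition Yres j : pred aid := fun b => (b == aR j) || (b == aOne).

Lemma ok_zeroR j : ok 2 count_vars (Yres j) (zeroR j).
Proof.
apply: ok_seq; first by [].
have o : ok 2 Xb (Yres j) (bzero (aR j) vT1) by apply: ok_bzero; rewrite /Yres eqxx.
by apply: (ok_sub (leqnn 2) _ _ o) => // x; rewrite /Xb /count_vars; lia.
Qed.

Lemma ok_addR j a nd : ok 2 count_vars (Yres j) (addR j a nd).
Proof.
have sub com : ok 2 Xb (Yres j) com -> ok 2 count_vars (Yres j) com.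
 by move=> o; apply: (ok_sub (leqnn 2) _ _ o) => // x; rewrite /Xb /count_vars; lia.
apply: ok_seqs; split; first by []. split; first by []. split; first by [].
split; first by apply: sub; apply: ok_bone; rewrite /Yres eqxx orbT.
by split; first by apply: sub; apply: ok_baddmul; rewrite /Yres eqxx.
Qed.

Section Solve.
Variables (k w : nat).
Definition nback := w.*2.+2.
(** The separator size obtained from [nback] disjoint good sets of at most [k] variables. A rebuild
    that fails with this bound rules out that many of them. *)
Definition Tb := nback * k + nback * (2 ^ k * (w.+1 + w * (nback * k))).
Let T := Tb.
Let nc := ncol T.

(** Two data in one label: modulo 3 it tells placed vertices and the failing vertex from the rest;
    divided by 3 it is 0 for no free variable, 1 for a free variable already collected, 2 for one
    still allowed. *)
Definition lab_body := seqs [:: If (Arr aNPOS XE) (Store aLAB XE (Num 1))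
 (If (EqE XE (Var vUf)) (Store aLAB XE (Num 2)) (Store aLAB XE (Num 0)));
 If (AndE (Arr aISV XE) (EqE (Arr aASG XE) (Num 0)))
 (If (Arr aFORB XE) (Store aLAB XE (AddE (Arr aLAB XE) 3)) (Store aLAB XE (AddE (Arr aLAB XE) 6))) Skip].
Definition blab := Loop vX lab_body.
Definition back_preds : seq (nat -> nat -> bool) := [:: fun _ m => 0 < m; fun l _ => l %% 3 == 1;
 fun l _ => l %% 3 == 2; fun l _ => l %/ 3 == 2; fun l _ => l %/ 3 != 0].
Definition backq := findq k (BackdoorF w (nback * k) (sz T).+1) back_preds nc 9.
Definition keep1 j r i := Seq (Store (aS j (r * k + i)) (Num 0) (cellE i))
 (If (cellE i) (Store aFORB (cellV i) (Num 1)) Skip).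
Definition keep j r := seqs [seq keep1 j r i | i <- iota 0 k].
Definition collect1 j r := seqs [:: blab; backq; If (Arr (aF 0) (Num 0)) (keep j r) Skip].
Definition clearS j := seqs [seq Store (aS j i) (Num 0) (Num 0) | i <- iota 0 (nback * k)].
Definition collect j := seqs [:: clearS j; Loop vX (Store aFORB XE (Num 0));
 seqs [seq collect1 j r | r <- iota 0 nback]].

Definition cnt_body := If (AndE (Arr aISV XE) (EqE (Arr aASG XE) (Num 0))) (Store aLAB XE (Num 1))
 (If (AndE (EqE (Arr aKIND XE) (Num 1)) (EqE (Arr aDEAD XE) (Num 0)))
 (Store aLAB XE (Num 2)) (Store aLAB XE (Num 0))).
Definition clab := Loop vX cnt_body.
Definition cnt_preds : seq (nat -> nat -> bool) :=
 [:: fun _ m => 0 < m; fun l _ => l == 1; fun l _ => l == 2].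
Definition countq := count nc 1 9 ModelF cnt_preds.
Definition succeed j := seqs [:: clab; countq; zeroR j; addR j (aB 0) 0; Store (aFl j) (Num 0) (Num 1)].

Definition slotV j i := Bin Defs.Sub (Arr (aS j i) (Num 0)) (Num 1).
(** Both values of the candidate must be solved. The flag of the first call is saved in [aTf] before
    the second call overwrites it, and further candidates are skipped once one has succeeded. *)
Definition branch c j i := If (Arr (aFl j.+1) (Num 0)) Skip (If (Arr (aS j.+1 i) (Num 0))
 (seqs [:: Store aASG (slotV j.+1 i) (Num 1); c; Store (aTf j.+1) (Num 0) (Arr (aFl j) (Num 0));
 zeroR j.+1; addR j.+1 (aR j) j.+1; Store aASG (slotV j.+1 i) (Num 2); c; addR j.+1 (aR j) j.+1;
 If (AndE (Arr (aTf j.+1) (Num 0)) (Arr (aFl j) (Num 0))) (Store (aFl j.+1) (Num 0) (Num 1)) Skip;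
 Store aASG (slotV j.+1 i) (Num 0)]) Skip).

Fixpoint solve j := seqs [:: build T; If (Var vFail)
 (if j is j'.+1 then seqs [:: collect j; Store (aFl j) (Num 0) (Num 0);
 seqs [seq branch (solve j') j' i | i <- iota 0 (nback * k)]]
 else Store (aFl 0) (Num 0) (Num 0)) (succeed j)].

Definition Xsol : pred nat := fun x => 6 <= x <= 32.
Definition Ysol j : pred aid := fun a => [|| Yst a, Yb a, a \in [:: aFORB; aASG; aOne]
 | (a.1.1 \in [:: 5; 6; 8; 9]) && (a.1.2 <= j)].

Lemma Ysol_lvl j a : a.1.1 \in [:: 5; 6; 8; 9] -> a.1.2 <= j -> Ysol j a.
Proof. by rewrite /Ysol => -> ->; rewrite !orbT. Qed.

Lemma ok_store d X (Y : pred aid) a e1 e2 : Y a -> tame e2 -> ok d X Y (Store a e1 e2).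
Proof. by move=> ya te; rewrite /ok /= te ya. Qed.

Lemma Ys_fam a : Ys a -> (a.1.1 == 3) || (a.1.1 == 0).
Proof. by rewrite /Ys => /orP [->|] //; rewrite !inE => /or3P [] /eqP ->; rewrite ?orbT. Qed.

Lemma ok_keep j r : ok 0 xpred0 (fun a => (a.1.1 == 5) && (a.1.2 == j) || (a == aFORB)) (keep j r).
Proof. by apply: ok_seqs_map => i; rewrite /ok /= !eqxx. Qed.

Lemma ok_backq : ok 1 engine_vars Yw backq.
Proof. exact: ok_findq. Qed.

Lemma ok_collect1 j r : ok 1 Xr (fun a => Yr a || ((a.1.1 == 5) && (a.1.2 == j) || (a == aFORB))) (collect1 j r).
Proof.
apply: ok_seqs; split; first by []. split.
 apply: (ok_sub (leqnn 1) _ _ ok_backq) => [x|a]; rewrite /engine_vars /Xr /Yw /Yr => -> //.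
split; last by [].
apply: ok_if; last exact: ok_skip.
by apply: (ok_sub (leq0n 1) _ _ (ok_keep j r)) => // a ->; rewrite orbT.
Qed.

Lemma ok_collect j : ok 1 Xr (fun a => Yr a || ((a.1.1 == 5) && (a.1.2 == j) || (a == aFORB))) (collect j).
Proof.
apply: ok_seqs; split; first by apply: ok_seqs_map => i; rewrite /ok /= !eqxx ?orbT.
split; first by [].
by split; last by []; apply: ok_seqs_map => r; exact: ok_collect1.
Qed.

Lemma ok_succeed j : ok 3 Xsol (Ysol j) (succeed j).
Proof.
have sR com : ok 2 count_vars (Yres j) com -> ok 3 Xsol (Ysol j) com.
 move=> o; apply: (ok_sub (_ : 2 <= 3) _ _ o) => // [x|a]; first by rewrite /count_vars /Xsol; lia.
 by rewrite /Yres /Ysol => /orP [] /eqP -> /=; rewrite ?leqnn.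
apply: ok_seqs; split; first by []. split.
 apply: (ok_sub (leqnn 3) _ _ (ok_count _ _ _ _ _)) => [x|a]; first by rewrite /count_vars /Xsol; lia.
 by rewrite /Ysol => ->; rewrite orbT.
split; first by apply: sR; exact: ok_zeroR. split; first by apply: sR; exact: ok_addR.
by split=> //; apply: ok_store => //; exact: Ysol_lvl.
Qed.

Lemma ok_branch c j i : ok 3 Xsol (Ysol j) c -> ok 3 Xsol (Ysol j.+1) (branch c j i).
Proof.
move=> oc.
have sY : subpred (Ysol j) (Ysol j.+1).
 move=> a; rewrite /Ysol => /or4P [->|->|->|/andP [-> h]]; rewrite ?orbT //= (leq_trans h) ?orbT //.
have oc' := ok_sub (leqnn 3) (fun _ h => h) sY oc.
have sR com : ok 2 count_vars (Yres j.+1) com -> ok 3 Xsol (Ysol j.+1) com.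
 move=> o; apply: (ok_sub (_ : 2 <= 3) _ _ o) => // [x|a]; first by rewrite /count_vars /Xsol; lia.
 by rewrite /Yres /Ysol => /orP [] /eqP -> /=; rewrite ?leqnn.
apply: ok_if; first exact: ok_skip. apply: ok_if; last exact: ok_skip.
apply: ok_seqs; split; first by []. split; first exact: oc'.
split; first by apply: ok_store => //; exact: Ysol_lvl.
split; first by apply: sR; exact: ok_zeroR. split; first by apply: sR; exact: ok_addR.
split; first by []. split; first exact: oc'. split; first by apply: sR; exact: ok_addR.
by split; first by apply: ok_if; [apply: ok_store => //; exact: Ysol_lvl|exact: ok_skip].
Qed.

Lemma ok_succeed0 j : ok 3 Xsol (fun a => Ysol j a && (a != aASG)) (succeed j).
Proof.
have sR com : ok 2 count_vars (Yres j) com -> ok 3 Xsol (fun a => Ysol j a && (a != aASG)) com.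
 move=> o; apply: (ok_sub (_ : 2 <= 3) _ _ o) => // [x|a]; first by rewrite /count_vars /Xsol; lia.
 by rewrite /Yres /Ysol => /orP [] /eqP -> /=; rewrite ?leqnn.
apply: ok_seqs; split; first by []. split.
 apply: (ok_sub (leqnn 3) _ _ (ok_count _ _ _ _ _)) => [x|a]; first by rewrite /count_vars /Xsol; lia.
 by rewrite /Ysol => h; rewrite h orbT /=; apply: contraTneq h => ->.
split; first by apply: sR; exact: ok_zeroR. split; first by apply: sR; exact: ok_addR.
by split=> //; apply: ok_store => //; rewrite Ysol_lvl.
Qed.

Lemma ok_branchS c j i : ok 3 Xsol (Ysol j) c ->
 ok 3 Xsol (fun a => ~~ ((a.1.1 == 5) && (a.1.2 == j.+1))) (branch c j i).
Proof.
move=> oc; set Y := fun a : aid => _.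
have sY : subpred (Ysol j) Y.
 move=> a ya; apply/negP => /andP [/eqP h1 /eqP h2]; move: ya; rewrite /Ysol h1 h2 ltnn andbF orbF.
 by rewrite /Yst /Yg /Yr /Ys /Yb h1 /= !inE; do ?case/orP; move=> /eqP E; rewrite E in h1.
have oc' := ok_sub (leqnn 3) (fun _ h => h) sY oc.
have sR com : ok 2 count_vars (Yres j.+1) com -> ok 3 Xsol Y com.
 move=> o; apply: (ok_sub (_ : 2 <= 3) _ _ o) => // [x|a]; first by rewrite /count_vars /Xsol; lia.
 by rewrite /Yres => /orP [] /eqP ->.
apply: ok_if; first exact: ok_skip. apply: ok_if; last exact: ok_skip.
apply: ok_seqs; split; first by []. split; first exact: oc'.
split; first by [].
split; first by apply: sR; exact: ok_zeroR. split; first by apply: sR; exact: ok_addR.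
split; first by []. split; first exact: oc'. split; first by apply: sR; exact: ok_addR.
by [].
Qed.

Lemma ok_solve j : ok 3 Xsol (Ysol j) (solve j).
Proof.
have oB j' : ok 3 Xsol (Ysol j') (build T).
 have o := ok_build T 0; apply: (ok_sub (leqnn 3) _ _ o) => [x|a]; first by rewrite /Xs /Xsol; lia.
 by rewrite /Ysol => ->.
elim: j => [|j IH]; apply: ok_seqs; (split; first exact: oB); split=> //.
 by apply: ok_if; [apply: ok_store => //; exact: Ysol_lvl|exact: ok_succeed].
apply: ok_if; last exact: ok_succeed.
apply: ok_seqs; split.
 apply: (ok_sub (_ : 1 <= 3) _ _ (ok_collect j.+1)) => // [x|a]; first by rewrite /Xr /Xsol; lia.
 case/orP=> [h|/orP [/andP [/eqP h1 /eqP h2]|/eqP ->]] //; rewrite /Ysol.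
 by rewrite /Yst /Yg h.
 by rewrite h1 h2 leqnn !orbT.
split; first by apply: ok_store => //; exact: Ysol_lvl.
by split; last by []; apply: ok_seqs_map => i; exact: ok_branch.
Qed.

(** * Correctness of collecting and branching *)

Section Correct.
Variable n' : nat.
Let N := n'.+1.
Variable I : inst N.
Hypothesis Iok : iok I.

Definition env_ok s := [/\ irep s I, forall v : 'I_N, (arr s aISV v != 0) = (v \in ivars I)
 & forall v : 'I_N, arr s aASG v <= 2].

Lemma env_ext s s' : (forall a, a \in [:: aKIND; aCL; aFV; aSG; aISV; aASG] -> arr s' a = arr s a) ->
 env_ok s -> env_ok s'.
Proof. by move=> E [[k1 k2 k3] h1 h2]; split; [split| |]; rewrite !E. Qed.

Lemma succeedP j s asg : env_ok s -> asg = asgf s -> struct_ok T (ig I asg 0) s ->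
 (forall c : 'I_N, (arr s aDEAD c != 0) = sats I asg c) ->
 let s' := run N (succeed j) s in
 arr s' (aFl j) 0 = 1 /\ rval n' s' j #|models I asg|.
Proof.
move=> [[K1 K2 K3] isv a2] Ea so de; rewrite /succeed 5!run_seqs_cons run_seqs_nil.
pose f (_ : aid) i := if (arr s aISV i != 0) && (arr s aASG i == 0) then 1 else
 if (arr s aKIND i == 1) && (arr s aDEAD i == 0) then 2 else 0.
have [||w1 w2 w3] := @pointwise N cnt_body s (pred1 aLAB) f.
- by [].
- move=> t i _ Ei _ oa _ a /eqP ->; rewrite /cnt_body run_if eval_and eval_eq.
 rewrite -[eval _ _ (Arr aISV XE)]/(arr t aISV (var t vX)) -[eval _ _ (Arr aASG XE)]/(arr t aASG (var t vX)).
 rewrite -[eval _ _ (Num 0)]/0 Ei (oa aISV) // (oa aASG) //.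
 rewrite -[f aLAB i]/(if (arr s aISV i != 0) && (arr s aASG i == 0) then 1 else
 if (arr s aKIND i == 1) && (arr s aDEAD i == 0) then 2 else 0).
 case: ((arr s aISV i != 0) && (arr s aASG i == 0)).
 rewrite -[run _ _ _]/(seta t aLAB (var t vX) 1) Ei.
 by split=> [|j0 nj]; [rewrite /= /upd eqxx|rewrite /= /upd (negbTE nj)].
 rewrite run_if eval_and !eval_eq.
 rewrite -[eval _ _ (Arr aKIND XE)]/(arr t aKIND (var t vX)) -[eval _ _ (Arr aDEAD XE)]/(arr t aDEAD (var t vX)).
 rewrite -[eval _ _ (Num 0)]/0 -[eval _ _ (Num 1)]/1 Ei (oa aKIND) // (oa aDEAD) //; case: ((arr s aKIND i == 1) && (arr s aDEAD i == 0)).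
 rewrite -[run _ _ _]/(seta t aLAB (var t vX) 2) Ei.
 by split=> [|j0 nj]; [rewrite /= /upd eqxx|rewrite /= /upd (negbTE nj)].
 rewrite -[run _ _ _]/(seta t aLAB (var t vX) 0) Ei.
 by split=> [|j0 nj]; [rewrite /= /upd eqxx|rewrite /= /upd (negbTE nj)].
rewrite -/clab in w1 w2 w3; set s1 := run N clab s in w1 w2 w3 *.
have so1 : struct_ok T (ig I asg 0) s1.
 apply: struct_ext so; first by rewrite w3.
 by move=> a ya; apply: w2; apply: contraTneq ya => ->.
have LE (v : 'I_N) : arr s1 aLAB v = if v \in free I asg then 1 else if v \in acls I asg then 2 else 0.
 have E0 : arr s aASG v = asg v by rewrite Ea.
 have dE : (arr s aDEAD v == 0) = ~~ sats I asg v by rewrite -de negbK.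
 by rewrite w1 // /f isv E0 K1 dE [v \in free _ _]inE [v \in acls _ _]inE.
set s2 := run N countq s1.
case: (so1) => sr1 v1.
have lab9 (v : 'I_N) : arr s1 aLAB v < 9 by rewrite LE; case: ifP => // _; case: ifP.
have [b2 l2] := @count_spec nc 1 9 ModelF cnt_preds n' (ig I asg 0) s1 (ig_sym I asg 0) (ig_irr Iok asg 0) (ig_lt3 I asg 0) sr1 v1 lab9.
rewrite -/countq -/s2 in b2 l2.
have Em : low N s2 (aB 0) 0 N = #|models I asg| %[mod 2 ^ N].
 rewrite l2 models_count //; last by move=> v; rewrite Ea; exact: a2.
 congr (#|pred_of_set _| %% _); apply/setP => m; rewrite !inE; congr (`[< sat _ _ _ >]).
 rewrite /qenv /=; congr [:: _; _; _]; apply/funext => v; rewrite /chi.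
 - by rewrite inE.
 - by rewrite LE; case: ifP => // _; case: ifP.
 - rewrite LE; case: (boolP (v \in free I asg)) => vF; last by case: ifP.
 apply/esym/negbTE; apply: contraL vF => vC; apply/negP; rewrite inE => /andP [/(ivars_C Iok)].
 by move: vC; rewrite inE => /andP [->].
set s3 := run N (zeroR j) s2; have z3 := @zeroRP n' j s2; rewrite -/s3 in z3.
have A3 : arr s3 (aB 0) = arr s2 (aB 0) by rewrite (ok_arr _ _ (ok_zeroR j)).
have l3 : low N s3 (aB 0) 0 N = #|models I asg| %[mod 2 ^ N] by rewrite -Em /low A3.
have b3 : bits2 N s3 (aB 0) 0 by move=> i li; rewrite A3; exact: b2.
have [r1 r2] := addRP z3 b3 l3 isT isT.
set s4 := run N (addR j (aB 0) 0) s3 in r1 r2 *.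
rewrite -[run N (Store (aFl j) (Num 0) (Num 1)) s4]/(seta s4 (aFl j) 0 1); move: s4 r1 r2 => s4 r1 r2.
split; last by split=> [i li|]; [exact: (r1 i li)|exact: r2].
by rewrite -[LHS]/((if aFl j == aFl j then upd (arr s4 (aFl j)) 0 1 else arr s4 (aFl j)) 0) eqxx.
Qed.

Lemma backqP s s' (D S Fr : {set 'I_N}) u (g : 'I_N -> 'I_N -> nat) W :
 (forall u v, g u v = g v u) -> (forall v, g v v = 0) -> (forall u v, g u v < 3) ->
 struct_ok T g s -> u \notin D -> W = u |: nbrs g D u -> #|nbrs g D u| <= sz T ->
 (forall v : 'I_N, arr s aLAB v = (if v \in D then 1 else if v == u then 2 else 0) +
 (if v \in Fr then if v \in S then 3 else 6 else 0)) ->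
 s' = run N backq s ->
 if arr s' (aF 0) 0 == 0 then forall B : {set 'I_N}, B \subset Fr -> [disjoint B & S] -> #|B| <= k ->
 ~ backdoor_like (gr g) (fun v => v \in Fr) (sg g) w (nback * k) W B
 else exists B : {set 'I_N}, [/\ B \subset Fr, [disjoint B & S], #|B| <= k,
 backdoor_like (gr g) (fun v => v \in Fr) (sg g) w (nback * k) W B &
 (forall v, v \in B <-> exists2 i, i < k & arr s' (aC 0 i) 0 = v.+1) /\
 (forall i, i < k -> arr s' (aC 0 i) 0 = 0 \/ exists v : 'I_N, arr s' (aC 0 i) 0 = v.+1)].
Proof.
move=> gsym girr g3 [sr vS] uD EW nb labE Es.
have lab9 (v : 'I_N) : arr s aLAB v < 9.
 by rewrite labE; case: ifP => _; [|case: ifP => _]; (case: ifP => // _; case: ifP).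
have Wj : #|u |: touched (gr g) D (component (gr g) (~: D) u)| <= (sz T).+1.
 by apply: leq_trans (leq_card_setU _ _) _; rewrite cards1 add1n ltnS.
have envE (m : marking 'I_N k) : qenv back_preds (fun v : 'I_N => arr s aLAB v) m =
 [:: chi [set v | 0 < m v]; chi D; chi [set u]; chi (Fr :\: S); chi Fr].
 rewrite /qenv /=; congr [:: _; _; _; _; _]; apply/funext => v; rewrite /chi ?inE ?labE //.
 - by case: (v \in D); case: (v == u); case: (v \in Fr); case: (v \in S).
 - case: (boolP (v \in D)) => vD; last by case: (v == u); case: (v \in Fr); case: (v \in S).
 have -> : (v == u) = false by apply: contraNF uD => /eqP <-.
 by case: (v \in Fr); case: (v \in S).
 - by case: (v \in D); case: (v == u); case: (v \in Fr); case: (v \in S).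
 - by case: (v \in D); case: (v == u); case: (v \in Fr); case: (v \in S).
have SB (B : {set 'I_N}) := @sat_backdoor _ g gsym w (nback * k) (sz T).+1 B D (Fr :\: S) Fr u uD Wj.
rewrite -[touched _ _ _]/(nbrs g D u) -EW in SB.
have dj (B : {set 'I_N}) : (B \subset Fr :\: S) = (B \subset Fr) && [disjoint B & S] by rewrite subsetD.
have := @findq_spec k (BackdoorF w (nback * k) (sz T).+1) back_preds nc 9 n' g s s' gsym girr g3 sr vS lab9 Es.
case: ifP => _.
 move=> no B BF BS Bk bl.
 have d0 : [disjoint B & (set0 : {set 'I_N})] by rewrite -setI_eq0 setI0.
 have z0 : #|(set0 : {set 'I_N})| <= 0 by rewrite cards0.
 have [m0] := marks_of_sets d0 Bk z0; rewrite addn0 in m0 *; move=> [um mB _].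
 apply: (no m0 um); rewrite envE.
 have -> : [set v | 0 < m0 v] = B.
 by apply/setP => v; rewrite inE -mB; have := ltn_ord (m0 v); rewrite ltnS => ->; rewrite andbT.
 by apply/SB; rewrite dj BF BS.
move=> [m [um]]; rewrite envE => /SB []; rewrite dj => /andP [BF BS] bl cells vc.
exists [set v | 0 < m v]; split=> //.
 have := @card_marks n' k m 0 k um (leqnn _); rewrite add0n => h; apply: leq_trans h.
 by apply/subset_leq_card/subsetP => v; rewrite !inE => ->; rewrite -ltnS ltn_ord.
split=> // v; rewrite inE; split=> [h|[i li E]].
 exists (m v).-1; first by have := ltn_ord (m v); lia.
 by apply/eqP; rewrite -cells; [apply/eqP; lia|have := ltn_ord (m v); lia].
by have : m v == i.+1 :> nat; [rewrite cells // E|move/eqP => ->].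
Qed.

Lemma blabP s : let s' := run N blab s in
 [/\ forall v : 'I_N, arr s' aLAB v = (if arr s aNPOS v != 0 then 1 else if val v == var s vUf then 2 else 0) +
 (if (arr s aISV v != 0) && (arr s aASG v == 0) then if arr s aFORB v != 0 then 3 else 6 else 0),
 forall a, a != aLAB -> arr s' a = arr s a & forall x, x != vX -> var s' x = var s x].
Proof.
pose b1 i := if arr s aNPOS i != 0 then 1 else if i == var s vUf then 2 else 0.
pose f (_ : aid) i := b1 i + (if (arr s aISV i != 0) && (arr s aASG i == 0) then if arr s aFORB i != 0 then 3 else 6 else 0).
have [||w1 w2 w3] := @pointwise N lab_body s (pred1 aLAB) f.
- by [].
- move=> t i _ Ei ov oa _ a /eqP ->; rewrite /lab_body 2!run_seqs_cons run_seqs_nil.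
 set t1 := run N (If (Arr aNPOS XE) _ _) t.
 have E1 : t1 = seta t aLAB i (b1 i).
 rewrite /t1 run_if -[eval _ _ (Arr _ _)]/(arr t aNPOS (var t vX)) Ei oa // /b1; case: ifP => _; first by rewrite /= Ei.
 rewrite run_if eval_eq -[eval _ _ XE]/(var t vX) -[eval _ _ (Var vUf)]/(var t vUf) Ei ov //.
 by case: ifP => _; rewrite /= Ei.
 rewrite E1; set t2 := seta t aLAB i (b1 i).
 have C1 b : b != aLAB -> arr t2 b i = arr s b i by move=> nb; rewrite /t2 /= (negbTE nb) oa.
 have L2 : arr t2 aLAB i = b1 i by rewrite /t2 /= /upd eqxx.
 rewrite run_if eval_and eval_eq -[eval _ _ (Arr aISV XE)]/(arr t2 aISV (var t vX)) -[eval _ _ (Arr aASG XE)]/(arr t2 aASG (var t vX)).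
 rewrite -[eval _ _ (Num 0)]/0 Ei !C1 // /f; case: ifP => _; last first.
 by rewrite addn0 L2; split=> // j0 nj; rewrite /t2 /= /upd (negbTE nj).
 rewrite run_if -[eval _ _ (Arr aFORB XE)]/(arr t2 aFORB (var t vX)) Ei C1 //; case: ifP => _.
 rewrite -[run _ _ _]/(seta t2 aLAB (var t vX) (arr t2 aLAB (var t vX) + 3)) Ei L2.
 by split=> [|j0 nj]; [rewrite /= /upd eqxx|rewrite /= /upd (negbTE nj)].
 rewrite -[run _ _ _]/(seta t2 aLAB (var t vX) (arr t2 aLAB (var t vX) + 6)) Ei L2.
 by split=> [|j0 nj]; [rewrite /= /upd eqxx|rewrite /= /upd (negbTE nj)].
by split=> // v; rewrite w1.
Qed.

Lemma keepP j r s : let c i := arr s (aC 0 i) 0 in let s' := run N (keep j r) s in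
 [/\ forall i, i < k -> arr s' (aS j (r * k + i)) 0 = c i,
 forall i, (forall i', i' < k -> i <> r * k + i') -> arr s' (aS j i) 0 = arr s (aS j i) 0
 & forall x, arr s' aFORB x != 0 <-> arr s aFORB x != 0 \/ exists2 i, i < k & c i = x.+1].
Proof.
move=> c.
have H q : let t := run N (seqs [seq keep1 j r i | i <- iota 0 q]) s in
 [/\ forall i, arr t (aC 0 i) = arr s (aC 0 i), forall i, i < q -> arr t (aS j (r * k + i)) 0 = c i,
 forall i, (forall i', i' < q -> i <> r * k + i') -> arr t (aS j i) 0 = arr s (aS j i) 0
 & forall x, arr t aFORB x != 0 <-> arr s aFORB x != 0 \/ exists2 i, i < q & c i = x.+1].
 elim: q => [|q [h0 h1 h2 h3]].
 by split=> // x; split=> [h|[//|[i]]] //; left.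
 rewrite iota_rcons map_rcons run_seqs_rcons; set t := run N (seqs _) s in h0 h1 h2 h3 *.
 pose t1 := seta t (aS j (r * k + q)) 0 (c q).
 have E1 : run N (keep1 j r q) t = if c q != 0 then seta t1 aFORB (c q - 1) 1 else t1.
 rewrite /keep1 run_seq -[run N (Store _ _ _) t]/(seta t (aS j (r * k + q)) 0 (arr t (aC 0 q) 0)) h0 -/(c q) -/t1.
 rewrite run_if -[eval N t1 (cellE q)]/(arr t (aC 0 q) 0) h0 -/(c q); case: ifP => // _.
 by rewrite -[run N _ _]/(seta t1 aFORB (arr t (aC 0 q) 0 - 1) 1) h0.
 rewrite E1; have [g0 g1 g2 g3] : [/\ forall i, arr t1 (aC 0 i) = arr s (aC 0 i),
 forall i, i < q.+1 -> arr t1 (aS j (r * k + i)) 0 = c i,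
 forall i, (forall i', i' < q.+1 -> i <> r * k + i') -> arr t1 (aS j i) 0 = arr s (aS j i) 0 &
 arr t1 aFORB = arr t aFORB].
 split=> //.
 - move=> i; rewrite ltnS leq_eqVlt => /orP [/eqP ->|li]; first by rewrite /t1 /= eqxx.
 rewrite /t1 /=; case: eqP => [[E]|_]; first by move: li; lia.
 exact: h1.
 - move=> i ne; rewrite /t1 /=; case: eqP => [[E]|_]; first by case: (ne q).
 by apply: h2 => i' li; apply: ne; exact: ltnW.
 have FB x : (arr s aFORB x != 0 \/ exists2 i, i < q.+1 & c i = x.+1) <-> (arr t aFORB x != 0 \/ c q = x.+1).
 split=> [[h|[i]]|[/h3 [h|[i li h]]|h]].
 - by left; apply/h3; left.
 - rewrite ltnS leq_eqVlt => /orP [/eqP -> h|li h]; first by right.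
 by left; apply/h3; right; exists i.
 - by left.
 - by right; exists i => //; exact: ltnW.
 - by right; exists q.
 case: ifP => cq; split=> //.
 - move=> x; rewrite FB -[arr (seta _ _ _ _) aFORB x]/(upd (arr t1 aFORB) (c q - 1) 1 x) g3 /upd; case: (eqVneq x (c q - 1)) => [->|ne].
 by split=> // _; right; move: cq; case: (c q) => // m _; rewrite subn1.
 by split=> [h|[//|h]]; [left|case/eqP: ne; rewrite h subn1].
 - move=> x; rewrite FB g3; split=> [h|[//|h]]; first by left.
 by rewrite h in cq.
by have [_ h1 h2 h3] := H k.
Qed.

Definition slots_in j (Fr : {set 'I_N}) t :=
 (forall i, i < nback * k -> arr t (aS j i) 0 = 0 \/ exists2 x : 'I_N, x \in Fr & arr t (aS j i) 0 = x.+1) /\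
 (forall x : 'I_N, arr t aFORB x != 0 -> exists2 i, i < nback * k & arr t (aS j i) 0 = x.+1).

(** The variables flagged in [aFORB] form the set of [collected]: each round asks for a good set
    disjoint from it. After [nback] rounds, [collected_all] and the recorded failure show that it
    meets every good set, in particular every hidden backdoor. *)
Lemma collectP j s asg p P : env_ok s -> asg = asgf s -> ginv T (ig I asg p) s P -> var s vFail != 0 ->
 let s' := run N (collect j) s in
 slots_in j (free I asg) s' /\
 forall B i, hidden I w i asg B -> i <= k -> exists2 x, x \in B & arr s' aFORB x != 0.
Proof.
move=> en Ea [so rs _ fl] f; have [u [Eu uP nu ns]] := fl f.
set D := [set x in P] in nu ns; have uD : u \notin D by rewrite inE.
pose g := ig I asg p; pose Fr := free I asg; pose W := u |: nbrs g D u.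
have gsym := ig_sym I asg p; have girr := ig_irr Iok asg p; have g3 := ig_lt3 I asg p.
rewrite /collect 3!run_seqs_cons run_seqs_nil.
set s1 := run N (clearS j) s.
have C1 q : let t := run N (seqs [seq Store (aS j i) (Num 0) (Num 0) | i <- iota 0 q]) s in
 [/\ var t = var s, forall a, a.1.1 != 5 -> arr t a = arr s a & forall i, i < q -> arr t (aS j i) 0 = 0].
 elim: q => [|q [e1 e2 e3]]; first by split.
 rewrite iota_rcons map_rcons run_seqs_rcons; set t := run N (seqs _) s in e1 e2 e3 *.
 split=> //=.
 by move=> a na; case: eqP => [E|_]; [rewrite E in na|exact: e2].
 move=> i; rewrite ltnS leq_eqVlt => /orP [/eqP ->|lt]; first by rewrite eqxx.
 by case: eqP => [[E]|_] //; exact: e3.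
have [c1 c2 c3] := C1 (nback * k); rewrite -/(clearS j) -/s1 in c1 c2 c3.
have [||z1 z2 z3] := @pointwise N (Store aFORB XE (Num 0)) s1 (pred1 aFORB) (fun _ _ => 0).
- by [].
- move=> t i _ Ei _ _ _ a /eqP ->; rewrite /= Ei; split=> [|j0 nj]; rewrite /upd ?eqxx //.
 by rewrite (negbTE nj).
set s2 := run N (Loop vX (Store aFORB XE (Num 0))) s1 in z1 z2 z3 *.
pose Sf t := [set x : 'I_N | arr t aFORB x != 0].
pose inv r t := [/\ struct_ok T g t, var t vUf = u /\ (forall a, a \in [:: aNPOS; aASG; aISV] -> arr t a = arr s a),
 slots_in j Fr t, forall i, r * k <= i -> i < nback * k -> arr t (aS j i) 0 = 0 &
 collected (gr g) (fun v => v \in Fr) (sg g) w k W r (Sf t)].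
have sS a : a.1.1 != 5 -> a != aFORB -> arr s2 a = arr s a by move=> n1 n2; rewrite z2 ?c2.
have I0 : inv 0 s2.
 split.
 - apply: struct_ext so => [|a ya]; first by rewrite z3 // c1.
 apply: sS; first by apply: contraTneq (Ys_fam ya) => ->.
 by apply: contraTneq ya => ->.
 - split; first by rewrite z3 // c1.
 by move=> a; rewrite !inE => /or3P [] /eqP ->; rewrite sS.
 - split=> [i li|x]; last by rewrite z1.
 by left; rewrite z2 // c3.
 - by move=> i _ li; rewrite z2 // c3.
 - rewrite (_ : Sf s2 = set0); first exact: collected0.
 by apply/setP => x; rewrite !inE z1.
have step r t : r < nback -> inv r t -> inv r.+1 (run N (collect1 j r) t).
 move=> lr [so1 [uf fr] [sl1 sl2] sz0 co].
 rewrite /collect1 3!run_seqs_cons run_seqs_nil.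
 have [l1 l2 l3] := blabP t; set t1 := run N blab t in l1 l2 l3 *.
 have so2 : struct_ok T g t1.
 apply: struct_ext so1 => [|a ya]; first by rewrite l3.
 by apply: l2; apply: contraTneq ya => ->.
 have [_ _ np _ _] := rs; have [_ isv _] := en.
 have LE (v : 'I_N) : arr t1 aLAB v = (if v \in D then 1 else if v == u then 2 else 0) +
 (if v \in Fr then if v \in Sf t then 3 else 6 else 0).
 rewrite l1 uf (fr aNPOS) // (fr aISV) // (fr aASG) // np isv [v \in D]inE [v \in Sf t]inE [v \in Fr]inE Ea.
 by case: (v \in P).
 set t2 := run N backq t1.
 have Q := @backqP t1 t2 D (Sf t) Fr u g W gsym girr g3 so2 uD erefl nu LE erefl.
 have A2 a : ~~ Yw a -> a != aLAB -> arr t2 a = arr t a by move=> n1 n2; rewrite (ok_arr _ _ ok_backq) // l2.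
 have V2 x : ~~ engine_vars x -> x != vX -> var t2 x = var t x by move=> n1 n2; rewrite (ok_var _ _ ok_backq) // l3.
 have so3 : struct_ok T g t2.
 apply: struct_ext so2 => [|a ya]; first by rewrite (ok_var _ _ ok_backq).
 by rewrite (ok_arr _ _ ok_backq) //; apply: contraTneq (Ys_fam ya) => ->.
 have Er0 : arr t2 (aF 0) 0 == 0 -> run N (If (Arr (aF 0) (Num 0)) (keep j r) Skip) t2 = t2.
 by move=> h; rewrite run_if -[eval N t2 (Arr (aF 0) (Num 0))]/(arr t2 (aF 0) 0) (eqP h).
 have Er1 : (arr t2 (aF 0) 0 == 0) = false -> run N (If (Arr (aF 0) (Num 0)) (keep j r) Skip) t2 = run N (keep j r) t2.
 by move=> h; rewrite run_if -[eval N t2 (Arr (aF 0) (Num 0))]/(arr t2 (aF 0) 0) h.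
 have ES : Sf t2 = Sf t by apply/setP => x; rewrite !inE A2.
 move: Q; case: ifP => [h|h] Q.
 rewrite (Er0 h); split=> //.
 - by split; [rewrite V2|move=> a ha; rewrite -fr // A2 //; move: ha; rewrite !inE => /or3P [] /eqP ->].
 - split=> [i li|x]; first by rewrite A2 //; exact: sl1.
 by rewrite A2 // => /sl2 [i li E]; exists i => //; rewrite A2.
 - by move=> i li lk; rewrite A2 //; apply: sz0 => //; move: li; rewrite mulSn; lia.
 - rewrite ES; apply: collected_none => B [BF Bk bl]; apply/negP => dB; exact: (Q B BF dB Bk bl).
 case: Q => B [BF BS Bk bl [cB vc]]; rewrite (Er1 h).
 have [k1 k2 k3] := keepP j r t2; set t3 := run N (keep j r) t2 in k1 k2 k3 *.
 have ok3 := ok_keep j r.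
 have A3 a : (a.1.1 != 5) && (a != aFORB) -> arr t3 a = arr t2 a.
 by case/andP=> n1 n2; rewrite (ok_arr _ _ ok3) // (negbTE n1) (negbTE n2).
 have rk i : i < k -> r * k + i < nback * k.
 by move=> li; apply: (@leq_trans (r.+1 * k)); [rewrite mulSn; lia|rewrite leq_mul2r lr orbT].
 have ES3 : Sf t3 = Sf t :|: B.
 apply/setP => x; rewrite -ES in_setU ![_ \in Sf _]inE; apply/idP/orP.
 by move/k3 => [->|[i li E]]; [left|right; apply/cB; exists i].
 by move=> [h'|/cB [i li E]]; apply/k3; [left|right; exists i].
 split.
 - apply: struct_ext so3 => [|a ya]; first by rewrite (ok_var _ _ ok3).
 apply: A3; apply/andP; split; first by apply: contraTneq (Ys_fam ya) => ->.
 by apply: contraTneq ya => ->.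
 - split; first by rewrite (ok_var _ _ ok3) // V2.
 by move=> a ha; rewrite -fr // A3 ?A2 //; move: ha; rewrite !inE => /or3P [] /eqP ->.
 - have old i : i < nback * k -> (forall i', i' < k -> i <> r * k + i') -> arr t3 (aS j i) 0 = arr t (aS j i) 0.
 by move=> li ne; rewrite k2 // A2.
 have dec i : (exists2 i', i' < k & i = r * k + i') \/ (forall i', i' < k -> i <> r * k + i').
 case: (boolP ((r * k <= i) && (i - r * k < k))) => [/andP [a1 a2]|no].
 by left; exists (i - r * k) => //; rewrite subnKC.
 by right=> i' li' E; case/negP: no; rewrite E leq_addr addKn.
 split=> [i li|x].
 case: (dec i) => [[i' li' ->]|ne]; last by rewrite old //; exact: sl1.
 rewrite k1 //; case: (vc i' li') => [->|[v E]]; [by left|right; exists v => //].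
 by apply: (subsetP BF); apply/cB; exists i'.
 move/k3 => [h'|[i li E]]; last by exists (r * k + i); [exact: rk|rewrite k1].
 rewrite A2 // in h'; have [i li E] := sl2 x h'; exists i => //; rewrite old // => i' li' Ei.
 have := sz0 i; rewrite E Ei leq_addr => /(_ isT); rewrite -Ei => /(_ li); by [].
 - move=> i li lk; rewrite k2 ?A2 //; first by apply: sz0 => //; move: li; rewrite mulSn; lia.
 by move=> i' li' E; move: li; rewrite E mulSn; lia.
 - by rewrite ES3; apply: collected_found.
have main q : q <= nback -> inv q (run N (seqs [seq collect1 j r | r <- iota 0 q]) s2).
 elim: q => [|q IH] lq; first exact: I0.
 by rewrite iota_rcons map_rcons run_seqs_rcons; apply: step => //; apply: IH; exact: ltnW.
have [_ _ sl _ co] := main nback (leqnn _); split=> // B i hB ik.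
set s3 := run N (seqs _) s2 in sl co *.
have gd := @hidden_good n' I Iok w i asg B p (nback * k) W hB.
have [hb1 hb2 hb3 _] := hB.
have BF : B \subset Fr by apply/subsetP => x xB; rewrite inE (subsetP hb2) // hb3.
have gb : forall u v, gr g u v -> u \in Fr -> v \notin Fr by move=> u0 v0; exact: ig_bip.
have gs : symmetric (gr g) by exact: gr_sym.
have := collected_all (T := Tb.+1) gs gb co (leqnSn _) ns (And3 BF (leq_trans hb1 ik) gd).
rewrite -setI_eq0 => /set0Pn [x /setIP [xB]]; rewrite inE => xS; by exists x.
Qed.

Lemma rval_ext s s' j v : arr s' (aR j) = arr s (aR j) -> rval n' s j v -> rval n' s' j v.
Proof.
move=> E [b l]; split=> [i li|]; first by rewrite E; exact: b.
by rewrite -l /low E.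
Qed.

Lemma asg_frame s (x : 'I_N) b : (forall v : 'I_N, arr s aASG v <= 2) -> b <= 2 -> env_ok s ->
 env_ok (seta s aASG (val x) b) /\ asgf (n' := n') (seta s aASG (val x) b) = setasg (asgf s) x b.
Proof.
move=> _ b2 [[k1 k2 k3] h1 h2]; split; last by apply/funext => v; rewrite /asgf /setasg /= /upd val_eqE.
by split=> // v; rewrite /= /upd; case: ifP.
Qed.

Lemma branchP c j i s x : env_ok s -> x \in free I (asgf s) -> arr s (aFl j.+1) 0 = 0 ->
 arr s (aS j.+1 i) 0 = (val x).+1 -> ok 3 Xsol (Ysol j) c ->
 (forall t, env_ok t -> let t' := run N c t in
 [/\ arr t' aASG = arr t aASG, arr t' (aFl j) 0 != 0 -> rval n' t' j #|models I (asgf t)|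
 & (exists B, hidden I w j (asgf t) B) -> arr t' (aFl j) 0 != 0]) ->
 let s' := run N (branch c j i) s in
 [/\ arr s' aASG = arr s aASG, arr s' (aFl j.+1) 0 != 0 -> rval n' s' j.+1 #|models I (asgf s)|
 & forall B, hidden I w j.+1 (asgf s) B -> x \in B -> arr s' (aFl j.+1) 0 != 0].
Proof.
move=> en xF fl0 sx oc H; set asg := asgf s.
have [xV a0] : x \in ivars I /\ asg x = 0 by move: xF; rewrite inE => /andP [-> /eqP].
have [_ _ a2] := en.
have Es : run N (branch c j i) s = run N (seqs [:: Store aASG (slotV j.+1 i) (Num 1); c;
 Store (aTf j.+1) (Num 0) (Arr (aFl j) (Num 0));
 zeroR j.+1; addR j.+1 (aR j) j.+1; Store aASG (slotV j.+1 i) (Num 2); c; addR j.+1 (aR j) j.+1;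
 If (AndE (Arr (aTf j.+1) (Num 0)) (Arr (aFl j) (Num 0))) (Store (aFl j.+1) (Num 0) (Num 1)) Skip;
 Store aASG (slotV j.+1 i) (Num 0)]) s.
 rewrite /branch run_if -[eval N s _]/(arr s (aFl j.+1) 0) fl0 run_if.
 by rewrite -[eval N s (Arr (aS _ _) _)]/(arr s (aS j.+1 i) 0) sx.
rewrite Es 10!run_seqs_cons run_seqs_nil.
have St t b : arr t (aS j.+1 i) 0 = (val x).+1 -> run N (Store aASG (slotV j.+1 i) (Num b)) t = seta t aASG (val x) b.
 by move=> h; rewrite -[LHS]/(seta t aASG (arr t (aS j.+1 i) 0 - 1) b) h subn1.
have nY a : (a.1.1 \in [:: 5; 6; 8; 9]) && (a.1.2 == j.+1) || (a \in [:: aKIND; aCL; aFV; aSG; aISV]) -> ~~ Ysol j a.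
 case/orP=> [/andP [h1 /eqP h2]|]; last by rewrite !inE => /or4P [/eqP ->|/eqP ->|/eqP ->|/orP [] /eqP ->].
 rewrite /Ysol h2 ltnn andbF orbF; apply/negP.
 move: h1; rewrite !inE => h1 /or3P [h|h|h].
 - move: h; rewrite /Yst /Yg /Yr /Ys !inE => h; move: h1; case/or4P: h => h;
 repeat (case/orP: h => h); move: h => /eqP E; rewrite ?E //; by move: E => ->.
 - by move: h h1; rewrite /Yb => /eqP ->.
 - by move: h1; case/or3P: h => /eqP ->.
have oA t a : a \notin [:: aR j.+1; aOne] -> arr (run N (addR j.+1 (aR j) j.+1) t) a = arr t a.
 by rewrite !inE => na; rewrite (ok_arr _ _ (ok_addR _ _ _)).
have oZ t a : a \notin [:: aR j.+1; aOne] -> arr (run N (zeroR j.+1) t) a = arr t a.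
 by rewrite !inE => na; rewrite (ok_arr _ _ (ok_zeroR _)).
have oC t a : (a.1.1 \in [:: 5; 6; 8; 9]) && (a.1.2 == j.+1) || (a \in [:: aKIND; aCL; aFV; aSG; aISV]) ->
 arr (run N c t) a = arr t a by move=> ha; rewrite (ok_arr _ _ oc) // nY.
rewrite (St s) //; have [e1 A1] := asg_frame x a2 (isT : 1 <= 2) en.
set t1 := seta s aASG x 1 in e1 A1 *; have [c1 r1 h1] := H t1 e1; set t2 := run N c t1 in c1 r1 h1 *.
set t3 := run N (Store (aTf _) _ _) t2.
set t4 := run N (zeroR _) t3; set t5 := run N (addR _ _ _) t4.
have S5 : arr t5 (aS j.+1 i) 0 = (val x).+1.
 rewrite oA // oZ // -[arr t3 _]/(arr t2 (aS j.+1 i)) oC ?inE ?eqxx //.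
rewrite (St t5) //; set t6 := seta t5 aASG x 2.
have F5 a : a \notin [:: aR j.+1; aOne; aTf j.+1] -> arr t5 a = arr t2 a.
 rewrite !inE !negb_or => /and3P [n1 n2 n3]; rewrite oA ?oZ ?inE ?negb_or ?n1 ?n2 //.
 by rewrite /t3 /= (negbTE n3).
have e5 : env_ok t5.
 apply: env_ext e1 => a; rewrite !inE => /or4P [/eqP ->|/eqP ->|/eqP ->|/or3P [] /eqP ->]; rewrite F5 //;
 by [rewrite oC|exact: c1].
have A5 : asgf t5 = setasg asg x 1 by rewrite -A1; apply/funext => v; rewrite /asgf F5 // c1.
have [e6 A6] := asg_frame x (let: And3 _ _ h := e5 in h) (isT : 2 <= 2) e5.
rewrite -/t6 in e6 A6.
have A6' : asgf t6 = setasg asg x 2 by rewrite A6 A5; apply/funext => v; rewrite /setasg; case: eqP.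
have [c7 r7 h7] := H t6 e6; set t7 := run N c t6 in c7 r7 h7 *.
set t8 := run N (addR _ _ _) t7.
have F8 a : a \notin [:: aR j.+1; aOne] -> arr t8 a = arr t7 a by exact: oA.
have T8 : arr t8 (aTf j.+1) 0 = arr t2 (aFl j) 0.
 rewrite F8 // oC ?inE ?eqxx ?orbT // -[arr t6 _]/(arr t5 (aTf j.+1)) oA // oZ //.
 by rewrite /t3 /= eqxx.
have G8 : arr t8 (aFl j) 0 = arr t7 (aFl j) 0 by rewrite F8.
have L8 : arr t8 (aFl j.+1) 0 = 0.
 rewrite F8 // oC ?inE ?eqxx ?orbT // -[arr t6 _]/(arr t5 (aFl j.+1)) F5 // oC ?inE ?eqxx ?orbT //.
set t9 := run N (If _ _ _) t8.
have E9 : t9 = if (arr t2 (aFl j) 0 != 0) && (arr t7 (aFl j) 0 != 0) then seta t8 (aFl j.+1) 0 1 else t8.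
 rewrite /t9 run_if eval_and -[eval N t8 (Arr (aTf _) _)]/(arr t8 (aTf j.+1) 0) T8.
 by rewrite -[eval N t8 (Arr (aFl _) _)]/(arr t8 (aFl j) 0) G8.
have F9 a : a != aFl j.+1 -> arr t9 a = arr t8 a by move=> na; rewrite E9; case: ifP => //= _; rewrite (negbTE na).
have S9 : arr t9 (aS j.+1 i) 0 = (val x).+1.
 by rewrite F9 // F8 // oC ?inE ?eqxx // -[arr t6 _]/(arr t5 (aS j.+1 i)).
rewrite (St t9) //; set t10 := seta t9 aASG x 0.
have Fl : arr t10 (aFl j.+1) 0 = if (arr t2 (aFl j) 0 != 0) && (arr t7 (aFl j) 0 != 0) then 1 else 0.
 by rewrite -[LHS]/(arr t9 (aFl j.+1) 0) E9; case: ifP => //= _; rewrite eqxx.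
split.
- apply/funext => v; rewrite -[arr t10 aASG v]/(upd (arr t9 aASG) x 0 v) /upd F9 // F8 // c7.
 rewrite -[arr t6 aASG v]/(upd (arr t5 aASG) x 2 v) /upd F5 // c1.
 rewrite -[arr t1 aASG v]/(upd (arr s aASG) x 1 v) /upd; case: eqP => // ->; exact: esym a0.
- rewrite Fl; case: ifP => // /andP [f1 f2] _.
 have R5 : rval n' t5 j.+1 (0 + #|models I (setasg asg x 1)|).
 have [rb rl] := r1 f1; rewrite A1 in rl.
 have E4 : arr t4 (aR j) = arr t2 (aR j).
 by rewrite oZ //; rewrite !inE negb_or /= andbT; apply/eqP => -[]; lia.
 apply: addRP; first exact: zeroRP.
 + by move=> q lq; rewrite E4; exact: rb.
 + by rewrite /low E4.
 + by [].
 + by apply/eqP; lia.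
 have R7 : rval n' t7 j.+1 (0 + #|models I (setasg asg x 1)|).
 by apply: rval_ext R5; rewrite oC ?inE ?eqxx ?orbT.
 have [rb rl] := r7 f2; rewrite A6' in rl.
 have ne : j.+1 != j.+2 by apply/eqP; lia.
 have R8 := addRP R7 rb rl isT ne; rewrite add0n -models_split // in R8.
 by apply: rval_ext R8; rewrite -[arr t10 _]/(arr t9 (aR j.+1)) F9.
- move=> B hB xB; rewrite Fl.
 have H1 : arr t2 (aFl j) 0 != 0 by apply: h1; exists (B :\ x); rewrite A1; exact: hidden_step.
 have H2 : arr t7 (aFl j) 0 != 0 by apply: h7; exists (B :\ x); rewrite A6'; exact: hidden_step.
 by rewrite H1 H2.
Qed.

(** A raised flag comes with the right count whether or not a backdoor exists. If a hidden one of
    size at most [j] exists, a failed build yields a candidate inside it, and fixing either value of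
    that candidate leaves a hidden backdoor with one variable less. *)
Lemma solveP j s : j <= k -> env_ok s -> let s' := run N (solve j) s in
 [/\ arr s' aASG = arr s aASG, arr s' (aFl j) 0 != 0 -> rval n' s' j #|models I (asgf s)|
 & (exists B, hidden I w j (asgf s) B) -> arr s' (aFl j) 0 != 0].
Proof.
elim: j s => [|j IH] s jk en s'; set asg := asgf s; pose s1 := run N (build T) s.
all: have [ir isv a2] := en; have [b1 b2 b3] := buildP T Iok ir; rewrite -/s1 -/asg in b1 b2 b3.
all: have F1 a : a \in [:: aKIND; aCL; aFV; aSG; aISV; aASG] -> arr s1 a = arr s a
 by rewrite !inE => /or4P [/eqP ->|/eqP ->|/eqP ->|/or3P [] /eqP ->]; rewrite (ok_arr _ _ (ok_build T 0)).
all: have e1 := env_ext F1 en.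
all: have A1 : asg = asgf s1 by apply/funext => v; rewrite /asgf F1.
all: case: (eqVneq (var s1 vFail) 0) => f.
- have Es : s' = run N (succeed 0) s1.
 by rewrite /s' -[run N _ s]/(run N (If (Var vFail) (Store (aFl 0) (Num 0) (Num 0)) (succeed 0)) s1) run_if -[eval _ _ _]/(var s1 vFail) f.
 have [g1 g2] := @succeedP 0 s1 asg e1 A1 (b1 f) b3; rewrite -Es in g1 g2.
 split=> //; last by rewrite g1.
 by rewrite Es (ok_arr _ _ (ok_succeed0 0)) // F1.
- have Es : s' = seta s1 (aFl 0) 0 0.
 by rewrite /s' -[run N _ s]/(run N (If (Var vFail) (Store (aFl 0) (Num 0) (Num 0)) (succeed 0)) s1) run_if -[eval _ _ _]/(var s1 vFail) f.
 rewrite Es; split=> //; first by rewrite /= F1.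
 (* At level 0 a hidden backdoor is empty. Repeated [nback] times it counts as pairwise disjoint
    good sets, which would meet the empty set; so the build cannot have failed. *)
 case=> B hB; exfalso; have [p [P gi]] := b2 f; have [so rs _ fl] := gi; have [u [Eu uP nu ns]] := fl f.
 have [hb1 hb2 hb3 _] := hB; have B0 : B = set0 by apply/eqP; rewrite -cards_eq0 -leqn0.
 pose g := ig I asg p; pose W := u |: nbrs g [set x in P] u.
 have gd := @hidden_good n' I Iok w 0 asg B p (nback * k) W hB; rewrite B0 in gd.
 have gb : forall u v, gr g u v -> u \in free I asg -> v \notin free I asg by move=> u0 v0; exact: ig_bip.
 have gs : symmetric (gr g) by apply: gr_sym => u0 v0; exact: ig_sym.
 have good0 : [/\ (set0 : {set 'I_N}) \subset (fun v => v \in free I asg), #|(set0 : {set 'I_N})| <= k &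
 backdoor_like (gr g) (fun v => v \in free I asg) (sg g) w (nback * k) W set0].
 by split=> //; rewrite ?sub0set ?cards0.
 have co : collected (gr g) (fun v => v \in free I asg) (sg g) w k W nback set0.
 left; exists (nseq nback set0); split; first by rewrite size_nseq.
 elim: (nback) => //= m ->; rewrite andbT; apply/allP => A /nseqP [-> _].
 by rewrite -setI_eq0 set0I.
 by move=> A /nseqP [-> _]; split; [exact: good0|exact: sub0set].
 have := collected_all (T := Tb.+1) gs gb co (leqnSn _) ns good0.
 by rewrite -setI_eq0 set0I eqxx.
- have Es : s' = run N (succeed j.+1) s1.
 by rewrite /s' -[run N _ s]/(run N (If (Var vFail) (seqs [:: collect j.+1; Store (aFl j.+1) (Num 0) (Num 0);
 seqs [seq branch (solve j) j i | i <- iota 0 (nback * k)]]) (succeed j.+1)) s1) run_if -[eval _ _ _]/(var s1 vFail) f.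
 have [g1 g2] := @succeedP j.+1 s1 asg e1 A1 (b1 f) b3; rewrite -Es in g1 g2.
 split=> //; last by rewrite g1.
 by rewrite Es (ok_arr _ _ (ok_succeed0 j.+1)) // F1.
have [p [P gi]] := b2 f.
have Es : s' = run N (seqs [seq branch (solve j) j i | i <- iota 0 (nback * k)])
 (run N (Store (aFl j.+1) (Num 0) (Num 0)) (run N (collect j.+1) s1)).
 rewrite /s' -[run N _ s]/(run N (If (Var vFail) (seqs [:: collect j.+1; Store (aFl j.+1) (Num 0) (Num 0);
 seqs [seq branch (solve j) j i | i <- iota 0 (nback * k)]]) (succeed j.+1)) s1) run_if -[eval _ _ _]/(var s1 vFail).
 by rewrite f 3!run_seqs_cons run_seqs_nil.
have [[sl1 sl2] hit] := @collectP j.+1 s1 asg p P e1 A1 gi f.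
set s2 := run N (collect j.+1) s1 in sl1 sl2 hit Es; set s3 := run N (Store _ _ _) s2 in Es.
have F3 a : a \in [:: aKIND; aCL; aFV; aSG; aISV; aASG] -> arr s3 a = arr s a.
 move=> ha; rewrite -F1 //; transitivity (arr s2 a).
 by move: ha; rewrite !inE => /or4P [/eqP ->|/eqP ->|/eqP ->|/or3P [] /eqP ->].
 by move: ha; rewrite !inE => /or4P [/eqP ->|/eqP ->|/eqP ->|/or3P [] /eqP ->]; rewrite (ok_arr _ _ (ok_collect j.+1)).
pose inv q t := [/\ env_ok t /\ arr t aASG = arr s aASG,
 forall i, arr t (aS j.+1 i) 0 = arr s2 (aS j.+1 i) 0,
 arr t (aFl j.+1) 0 != 0 -> rval n' t j.+1 #|models I asg|
 & forall (x : 'I_N) i B, i < q -> arr s2 (aS j.+1 i) 0 = x.+1 -> hidden I w j.+1 asg B -> x \in B ->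
 arr t (aFl j.+1) 0 != 0].
have I3 : inv 0 s3.
 split=> //; last by rewrite /s3 /= eqxx.
 by split; [exact: env_ext F3 en|exact: F3].
have step q t : q < nback * k -> inv q t -> inv q.+1 (run N (branch (solve j) j q) t).
 move=> lq [[et at_] st rt ht].
 have At : asgf t = asg by apply/funext => v; rewrite /asgf at_.
 case: (eqVneq (arr t (aFl j.+1) 0) 0) => fl; last first.
 have -> : run N (branch (solve j) j q) t = t by rewrite /branch run_if -[eval N t _]/(arr t (aFl j.+1) 0) fl.
 by split.
 case: (sl1 q lq) => [z|[x xF z]].
 have -> : run N (branch (solve j) j q) t = t.
 rewrite /branch run_if -[eval N t _]/(arr t (aFl j.+1) 0) fl run_if.
 by rewrite -[eval N t (Arr (aS _ _) _)]/(arr t (aS j.+1 q) 0) st z.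
 split=> // x i B; rewrite ltnS leq_eqVlt => /orP [/eqP ->|li]; first by rewrite z.
 exact: ht.
 have zt : arr t (aS j.+1 q) 0 = (val x).+1 by rewrite st.
 have xt : x \in free I (asgf t) by rewrite At.
 have [g1 g2 g3] := @branchP (solve j) j q t x et xt fl zt (ok_solve j) (fun t0 e0 => IH t0 (ltnW jk) e0).
 set t' := run N (branch _ _ _) t in g1 g2 g3 *; rewrite At in g2 g3.
 have oB := ok_branch q (ok_solve j).
 have F' a : a \in [:: aKIND; aCL; aFV; aSG; aISV; aASG] -> arr t' a = arr t a.
 by rewrite !inE => /or4P [/eqP ->|/eqP ->|/eqP ->|/or3P [/eqP ->|/eqP ->|/eqP ->]] //; rewrite (ok_arr _ _ oB).
 split.
 - by split; [exact: env_ext F' et|rewrite g1].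
 - move=> i; rewrite -st; rewrite (ok_arr _ _ (ok_branchS q (ok_solve j))) //.
 by rewrite /= eqxx.
 - exact: g2.
 move=> x' i B; rewrite ltnS leq_eqVlt => /orP [/eqP ->|li].
 by rewrite z => -[/val_inj <-] hB xB; exact: g3 hB xB.
 by move=> h1 h2 h3; have := ht x' i B li h1 h2 h3; rewrite fl.
have main q : q <= nback * k -> inv q (run N (seqs [seq branch (solve j) j i | i <- iota 0 q]) s3).
 elim: q => [|q IHq] lq; first exact: I3.
 by rewrite iota_rcons map_rcons run_seqs_rcons; apply: step => //; apply: IHq; exact: ltnW.
have [[_ m1] _ m2 m3] := main (nback * k) (leqnn _); rewrite -Es in m1 m2 m3.
split=> // -[B hB]; have [x xB fx] := hit B j.+1 hB jk; have [i li zi] := sl2 x fx.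
exact: m3 li zi hB xB.
Qed.

End Correct.
End Solve.

(** * The theorem *)

Definition isv_code := Loop vX (If (EqE (Arr aKIND XE) (Num 2)) (Store aISV fvE (Num 1)) Skip).
(** The count has [N] digits, as many as the input has cells, so the digits exactly overwrite the
    input region as required for the output. *)
Definition out_code k := If (Arr (aFl k) (Num 0)) (seqs [:: Assign 0 (Num 1); Assign 1 Size;
 Loop vX (Out XE (Arr (aR k) (Bin Add (Bin Mul (Num k.+1) Size) XE)))])
 (Assign 0 (Num 0)).
Definition main k w := seqs [:: parse; isv_code; solve k w k; out_code k].

Lemma wf_main k w : wf (main k w) /\ depth (main k w) <= 3.
Proof.
have /and3P [w1 d1 _] := ok_solve k w k.
by rewrite /main /=; split; rewrite ?w1 // !geq_max d1.
Qed.

Lemma isv_codeP n' (I : inst n'.+1) s : irep s I -> (forall i, arr s aISV i = 0) ->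
 let s' := run n'.+1 isv_code s in
 (forall v : 'I_n'.+1, (arr s' aISV v != 0) = (v \in ivars I)) /\
 (forall a, a != aISV -> arr s' a = arr s a).
Proof.
move=> [K1 K2 K3] z.
pose iv k (v : 'I_n'.+1) := exists t : 'I_n'.+1, [/\ t < k, isL I t & ifv I t = v].
have [h1 h2] : (forall v : 'I_n'.+1, arr (run n'.+1 isv_code s) aISV v != 0 <-> iv n'.+1 v) /\
 (forall a, a != aISV -> arr (run n'.+1 isv_code s) a = arr s a).
 apply: (@run_loop n'.+1 vX _ s (fun k t => (forall v : 'I_n'.+1, arr t aISV v != 0 <-> iv k v) /\
 (forall a, a != aISV -> arr t a = arr s a))).
 by split=> // v; rewrite z; split=> // -[t []].
 move=> k t lk [e1 e2]; pose k' := Ordinal lk.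
 rewrite run_if eval_eq -[eval _ _ (Arr aKIND XE)]/(arr t aKIND k) -[eval _ _ (Num 2)]/2 e2 // [_ == 2](K2 k').
 have iS v : iv k.+1 v <-> iv k v \/ (isL I k' /\ ifv I k' = v).
 split=> [[u [u1 u2 u3]]|[[u [u1 u2 u3]]|[u2 u3]]].
 - move: u1; rewrite ltnS leq_eqVlt => /orP [/eqP E|lt]; last by left; exists u.
 by right; have <- : u = k' by exact: val_inj.
 - by exists u; split=> //; exact: ltnW.
 - by exists k'.
 case: ifP => kL; last first.
 by split=> // v; rewrite iS e1; split=> [h|[//|[]]]; [left|rewrite kL].
 have [_ k2 _] := K3 _ kL.
 rewrite -[run _ _ _]/(seta (setv t vX k) aISV (arr t aFV k) 1) e2 // [arr s aFV k]k2.
 split=> [v|a na]; last by rewrite /= (negbTE na); exact: e2.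
 rewrite iS -e1 -[arr _ aISV v]/(upd (arr t aISV) (ifv I k') 1 v) /upd val_eqE.
 case: (eqVneq v (ifv I k')) => [->|ne]; first by split=> // _; right.
 by split=> [h|[//|[_ E]]]; [left|rewrite E eqxx in ne].
split=> // v; rewrite inE; apply/idP/existsP => [/h1 [t [_ t1 t2]]|[t /andP [t1 /eqP t2]]].
 by exists t; rewrite t1 t2 eqxx.
by apply/h1; exists t.
Qed.

Lemma out_codeP k n' s m : (arr s (aFl k) 0 != 0 -> rval n' s k m) -> m < 2 ^ n'.+1 ->
 loop_output n'.+1 (run n'.+1 (out_code k) s) (if arr s (aFl k) 0 != 0 then Some m else None).
Proof.
move=> H lm; pose N := n'.+1.
rewrite /out_code run_if -[eval _ _ _]/(arr s (aFl k) 0); case: ifP => f; last by [].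
have [rb rl] := H f.
rewrite 3!run_seqs_cons run_seqs_nil; set s2 := run _ (Assign 1 Size) _.
set s3 := run _ (Loop _ _) s2.
have [h1 h2 h3] : [/\ var s3 0 = 1, var s3 1 = N & forall i, i < N -> inp s3 i = arr s (aR k) (k.+1 * N + i)].
 have [e1 [e2 e3] e4] : [/\ arr s3 = arr s, var s3 0 = 1 /\ var s3 1 = N & forall i, i < N -> inp s3 i = arr s (aR k) (k.+1 * N + i)].
 apply: (@run_loop N vX _ s2 (fun q t => [/\ arr t = arr s, var t 0 = 1 /\ var t 1 = N &
 forall i, i < q -> inp t i = arr s (aR k) (k.+1 * N + i)])) => // q t lq [e1 [e2 e3] e4].
 rewrite -[run _ _ _]/(if q < N then seti (setv t vX q) q (arr t (aR k) (k.+1 * N + q)) else setv t vX q) lq e1.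
 split=> // i; rewrite ltnS leq_eqVlt => /orP [/eqP ->|li]; rewrite /= /upd ?eqxx //.
 by case: eqP => [->|_] //; exact: e4.
 by split.
split=> //; rewrite ?h2 //.
 by move=> i li; rewrite h3 //; exact: rb.
have E : \sum_(i < N) inp s3 i * 2 ^ i = low N s (aR k) k.+1 N by apply: eq_bigr => i _; rewrite h3.
rewrite E; have lt : low N s (aR k) k.+1 N < 2 ^ N.
 have B q : q <= N -> low N s (aR k) k.+1 q < 2 ^ q.
 elim: q => [|q IH] lq; first by rewrite /low big_ord0.
 rewrite lowS expnS mul2n -addnn -addSn; apply: leq_add; first by apply: IH; exact: ltnW.
 by have := rb q lq; case: (arr _ _ _) => [|[|]] // _; rewrite mul1n.
 exact: B.
by rewrite -(modn_small lm) -(modn_small lt).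
Qed.

Lemma computes_mono P W W' n n' input a : W <= W' -> n <= n' ->
 computes P W n input a -> computes P W' n' input a.
Proof.
move=> WW nn [m [s [mn it h o]]]; exists m, s; split=> //; first exact: leq_trans nn.
elim: m s it {mn h o} => //= m IH s; case E : (iter m _ _) => [u|] //= st.
rewrite (IH u E) /=; move: st; rewrite /step; case: u {E} => p R M; case: (current _ _) => //.
- by move=> r v; case: ifP => // lt; rewrite (leq_trans lt WW).
- by move=> o r a0 b; case: ifP => // lt; rewrite (leq_trans lt WW).
- by move=> r a0; case: ifP => // lt; rewrite (leq_trans lt WW).
Qed.

(** * Size of the encoded input in terms of the formula *)

Section Bounds.
Variables (F : formula) (L : seq (seq literal)).
Hypothesis lst : listing F L.

Lemma listing_size : \sum_(c <- L) (1 + size c) <= fsize F.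
Proof.
case/andP: lst => /allP uL pL; rewrite /fsize; apply: leq_trans (leq_addl _ _).
have -> : \sum_(c <- F) (1 + #|` c|) = \sum_(c <- L) (1 + #|` ([fset l in c]%fset : clause)|).
 by rewrite -(perm_big _ pL) /= big_map.
rewrite !big_seq; apply: leq_sum => c cL; rewrite leq_add2l card_fseq undup_id //; exact: uL.
Qed.

Lemma encode_bound v : v \in encode L -> v <= 2 * (fsize F + \max_(x <- fvar F) x + 1).
Proof.
have fs := listing_size; rewrite inE => /orP [/eqP ->|/flattenP [e /mapP [c cL ->]]].
 have h : size L <= \sum_(c <- L) (1 + size c).
 by rewrite -sum1_size; apply: leq_sum => c _; rewrite leq_addr.
 by lia.
have cs : 1 + size c <= \sum_(c <- L) (1 + size c) by rewrite (big_rem c) //= leq_addr.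
rewrite inE => /orP [/eqP ->|/mapP [l lc ->]]; first by apply: leq_trans (leq_trans (leqnSn _) (leq_trans cs fs)) _; lia.
have xF : l.1 \in fvar F.
 case/andP: lst => _ pL; apply/bigfcupP; exists ([fset l in c]%fset : clause).
 by rewrite andbT -(perm_mem pL) map_f.
 by apply/imfsetP; exists l => //=; rewrite inE.
have h : l.1 <= \max_(x <- fvar F) x by rewrite (big_rem l.1) //= leq_maxl.
apply: (@leq_trans (l.1.*2 + 1)); first by rewrite leq_add2l leq_b1.
apply: (@leq_trans (2 * (\max_(x <- fvar F) x + 1))); last by rewrite leq_mul2l leq_add2r leq_addl orbT.
by rewrite -mul2n mulnDr; apply: leq_add => //; rewrite leq_mul2l h orbT.
Qed.

End Bounds.

Theorem theorem2 (k t : nat) :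
  exists (P : program) (C : nat),
    forall (F : formula) (L : seq (seq literal)),
      is_cnf F -> listing F L ->
      exists a : option nat,
        computes P (word_bound C F) (cubic_bound C F) (encode L) a /\
        (a = Some (num_models F) \/ (a = None /\ k < sb t F)).
Proof.
(* The width that [backdoor_hidden] guarantees after every assignment of the backdoor. *)
pose w := 2 ^ k * t.+1; have [wm dm] := wf_main k w.
have [P [C H]] := loop_computes wm dm.
(* The factor [3 ^ C] absorbs the step from [(2 * m).+1] to [3 * m] in the word bound, and the 8
   comes from [(fsize F + 1) ^ 3 <= 8 * (fsize F ^ 3 + 1)] in the time bound. *)
exists P, (C * 3 ^ C + 8 * C) => F L cnf lst.
pose n' := (size (encode L)).-1; have En : size (encode L) = n'.+1 by [].
have [I rp ir] := parseP L; rewrite -/n' in ir.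
pose s0 := run n'.+1 parse (init_store (encode L)).
have Iok := represents_ok rp cnf lst.
have z0 i : arr s0 aISV i = 0 by rewrite (ok_arr _ _ ok_parse).
have [iv fr] := isv_codeP ir z0; pose s1 := run n'.+1 isv_code s0; rewrite -/s1 in iv fr.
have as0 v : arr s1 aASG v = 0 by rewrite fr // (ok_arr _ _ ok_parse).
have en : env_ok I s1.
 split=> //; last by move=> v; rewrite as0.
 by case: ir => k1 k2 k3; split; rewrite !fr.
have [_ rv hd] := @solveP k w n' I Iok k s1 (leqnn k) en.
pose s2 := run n'.+1 (solve k w k) s1; rewrite -/s2 in rv hd.
have Ea : asgf (n' := n') s1 = (fun=> 0) by apply/funext => v; rewrite /asgf as0.
rewrite Ea in rv hd.
have out := out_codeP rv (card_models Iok _).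
have Er : run n'.+1 (main k w) (init_store (encode L)) = run n'.+1 (out_code k) s2.
 by rewrite /main 4!run_seqs_cons run_seqs_nil.
set a := if _ then _ else _ in out.
pose m := fsize F + \max_(x <- fvar F) x + 1.
have ls := listing_size lst; have se := size_encode L.
exists a; split.
 have X2 : size (encode L) <= 2 * m by rewrite se /m; lia.
 apply: computes_mono (H L (2 * m) (encode_bound lst) X2 a _); last by rewrite En Er.
 rewrite /word_bound -/m; apply: (@leq_trans (C * (3 * m) ^ C)).
 case: (posnP C) => [->|C0]; first by rewrite mul0n.
 have m0 : 0 < m by rewrite /m addn1.
 rewrite leq_mul2l leq_exp2r //; apply/orP; right; move: (m) m0 => q; lia.
 rewrite expnMn mulnA; apply: leq_mul; first exact: leq_addr.
 apply: leq_pexp2l; first by rewrite /m addn1.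
 apply: leq_trans (leq_addl _ _); lia.
 rewrite /cubic_bound; apply: (@leq_trans (8 * C * (fsize F ^ 3 + 1))); last first.
 by rewrite leq_mul2r leq_addl orbT.
 rewrite [8 * C]mulnC -[C * 8 * _]mulnA leq_mul2l; apply/orP; right.
 apply: (@leq_trans ((fsize F + 1) ^ 3)); first by rewrite leq_exp2r // se; lia.
 case: (posnP (fsize F)) => [->|f0]; first by [].
 apply: (@leq_trans ((2 * fsize F) ^ 3)); first by rewrite leq_exp2r //; lia.
 by rewrite expnMn (_ : 2 ^ 3 = 8) // leq_mul2l leq_addr orbT.
rewrite /a; case: ifP => f; first by left; rewrite (num_models_cells rp cnf lst).
right; split=> //; rewrite ltnNge; apply/negP => le.
by move: (hd (backdoor_hidden rp cnf lst le)); rewrite f.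
Qed.
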